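(* The fundamental group of a hyperbolic closed surface of even Euler characteristic at most $-2$ embeds into a diagram group but is not a diagram group itself.
   Context: A semigroup presentation $\mathcal{P}=\langle\Sigma\mid\mathcal{R}\rangle$ consists of an alphabet $\Sigma$ and a set $\mathcal{R}$ of relations $u=v$ with $u,v\in\Sigma^+$, where $\Sigma^+$ is the free semigroup of non-empty words and $\Sigma^*=\Sigma^+\cup\{1\}$ also contains the empty word. Convention: if $u=v\in\mathcal{R}$ then $v=u\notin\mathcal{R}$ (in particular $u=u\notin\mathcal{R}$). The Squier complex $S(\mathcal{P})$ is the cube complex whose vertices are the words over $\Sigma$; whose oriented edges are $(a,u\to v,b)$ with $a,b\in\Sigma^*$ and $u=v$ or $v=u$ in $\mathcal{R}$, going from $aub$ to $avb$ (and $(a,v\to u,b)$ is the same edge with opposite orientation); and whose $n$-cubes are similarly $(a_1,u_1\to v_1,\dots,a_n,u_n\to v_n,a_{n+1})$, spanned by the vertices $a_1w_1\cdots a_nw_na_{n+1}$ with $w_i\in\{u_i,v_i\}$. For $w\in\Sigma^+$, $S(\mathcal{P},w)$ is the connected component containing $w$, and the diagram group $D(\mathcal{P},w)$ is $\pi_1(S(\mathcal{P},w),w)$. A group is a diagram group if it is isomorphic to $D(\mathcal{P},w)$ for some semigroup presentation $\mathcal{P}$ and some $w\in\Sigma^+$. Surfaces are connected. *)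

(* Defs.v *)
From HB Require Import structures.
From Stdlib Require Import Relations.
From mathcomp Require Import all_boot all_order all_algebra generic_quotient.
From mathcomp Require Import all_classical all_reals all_analysis homotopy.
From mathcomp Require Import ring lra.

Set Implicit Arguments.
Unset Strict Implicit.
Unset Printing Implicit Defensive.

Import Order.TTheory GRing.Theory Num.Theory.
Import numFieldNormedType.Exports.

Local Open Scope classical_set_scope.
Local Open Scope ring_scope.

(* A group given by representatives and an equivalence relation on them: both
   kinds of fundamental groups below consist of loops up to homotopy. *)
Record setoid_group := SetoidGroup {
  sg_sort : Type;
  sg_eq : sg_sort -> sg_sort -> Prop;
  sg_mul : sg_sort -> sg_sort -> sg_sort;
  sg_one : sg_sort;
  sg_inv : sg_sort -> sg_sort;
  sg_refl : forall a, sg_eq a a;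
  sg_sym : forall a b, sg_eq a b -> sg_eq b a;
  sg_trans : forall a b c, sg_eq a b -> sg_eq b c -> sg_eq a c;
  sg_mul_eq : forall a a' b b',
    sg_eq a a' -> sg_eq b b' -> sg_eq (sg_mul a b) (sg_mul a' b');
  sg_mulA : forall a b c,
    sg_eq (sg_mul a (sg_mul b c)) (sg_mul (sg_mul a b) c);
  sg_mul1 : forall a, sg_eq (sg_mul sg_one a) a;
  sg_mulr1 : forall a, sg_eq (sg_mul a sg_one) a;
  sg_mulV : forall a, sg_eq (sg_mul (sg_inv a) a) sg_one;
  sg_mulrV : forall a, sg_eq (sg_mul a (sg_inv a)) sg_one }.

Section class_group.
Variable L : setoid_group.

Definition sg_elt : Type := sg_sort L.
HB.instance Definition _ := gen_eqMixin sg_elt.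
HB.instance Definition _ := gen_choiceMixin sg_elt.

Definition sg_rel (a b : sg_elt) : bool := `[< sg_eq a b >].

Lemma sg_rel_refl : reflexive sg_rel.
Proof. by move=> a; apply/asboolP; exact: sg_refl. Qed.

Lemma sg_rel_sym : symmetric sg_rel.
Proof. by move=> a b; apply/asboolP/asboolP; exact: sg_sym. Qed.

Lemma sg_rel_trans : transitive sg_rel.
Proof.
by move=> b a c /asboolP ab /asboolP bc; apply/asboolP; exact: sg_trans ab bc.
Qed.

Definition sg_equiv := EquivRel sg_rel sg_rel_refl sg_rel_sym sg_rel_trans.

Definition class_group : Type := {eq_quot sg_equiv}%qT.
HB.instance Definition _ := Choice.on class_group.
HB.instance Definition _ := Quotient.on class_group.

Definition class_of (a : sg_elt) : class_group := (\pi_class_group a)%qT.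

Lemma class_ofP a b : class_of a = class_of b <-> sg_eq a b.
Proof.
split=> [/eqP|ab]; last by apply/eqP; rewrite eqmodE; apply/asboolP.
by rewrite eqmodE => /asboolP.
Qed.

Lemma class_of_repr (A : class_group) : class_of (repr A) = A.
Proof. exact: reprK. Qed.

Lemma sg_eq_repr a : sg_eq (repr (class_of a)) a.
Proof. by apply/class_ofP; rewrite class_of_repr. Qed.

Definition class_mul (A B : class_group) : class_group :=
  class_of (sg_mul (repr A) (repr B)).
Definition class_one : class_group := class_of (sg_one L).
Definition class_inv (A : class_group) : class_group :=
  class_of (sg_inv (repr A)).

Lemma class_mulE a b :
  class_mul (class_of a) (class_of b) = class_of (sg_mul a b).
Proof. by apply/class_ofP; apply: sg_mul_eq; exact: sg_eq_repr. Qed.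

Lemma class_mulA : associative class_mul.
Proof.
move=> A B C; rewrite -(class_of_repr A) -(class_of_repr B) -(class_of_repr C).
by rewrite !class_mulE; apply/class_ofP; exact: sg_mulA.
Qed.

Lemma class_mul1 : left_id class_one class_mul.
Proof.
move=> A; rewrite -(class_of_repr A) /class_one class_mulE.
by apply/class_ofP; exact: sg_mul1.
Qed.

Lemma class_mulr1 : right_id class_one class_mul.
Proof.
move=> A; rewrite -(class_of_repr A) /class_one class_mulE.
by apply/class_ofP; exact: sg_mulr1.
Qed.

Lemma class_mulV : left_inverse class_one class_inv class_mul.
Proof.
move=> A; rewrite -{2}(class_of_repr A) /class_inv class_mulE.
by apply/class_ofP; exact: sg_mulV.
Qed.

Lemma class_mulrV : right_inverse class_one class_inv class_mul.
Proof.
move=> A; rewrite -{1}(class_of_repr A) /class_inv class_mulE.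
by apply/class_ofP; exact: sg_mulrV.
Qed.

HB.instance Definition _ := isGroup.Build class_group
  class_mulA class_mul1 class_mulr1 class_mulV class_mulrV.

End class_group.

Definition group_isomorphic (G H : groupType) : Prop :=
  exists f : G -> H, monoid.monoid_morphism f /\ bijective f.

Definition group_embeds (G H : groupType) : Prop :=
  exists f : G -> H, monoid.monoid_morphism f /\ injective f.

Record semigroup_presentation := SemigroupPresentation {
  letter :> Type;
  relation_of : seq letter -> seq letter -> Prop;
  relation_lhs : forall u v, relation_of u v -> u <> [::];
  relation_rhs : forall u v, relation_of u v -> v <> [::];
  relation_asym : forall u v, relation_of u v -> ~ relation_of v u }.

Section squier.
Variable P : semigroup_presentation.
Local Notation word := (seq P).

(* [SquierEdge a u v b] stands for (a, u -> v, b); it is an oriented edge of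
   the Squier complex when [is_squier_edge] holds. *)
Record squier_edge := SquierEdge {
  edge_left : word; edge_src : word; edge_tgt : word; edge_right : word }.

Definition is_squier_edge (e : squier_edge) : Prop :=
  relation_of (edge_src e) (edge_tgt e) \/ relation_of (edge_tgt e) (edge_src e).

Definition edge_start (e : squier_edge) : word :=
  edge_left e ++ edge_src e ++ edge_right e.
Definition edge_end (e : squier_edge) : word :=
  edge_left e ++ edge_tgt e ++ edge_right e.
Definition edge_inv (e : squier_edge) : squier_edge :=
  SquierEdge (edge_left e) (edge_tgt e) (edge_src e) (edge_right e).

Fixpoint is_edge_path (w : word) (p : seq squier_edge) (w' : word) : Prop :=
  if p is e :: p' then
    [/\ is_squier_edge e, w = edge_start e & is_edge_path (edge_end e) p' w']
  else w = w'.

(* The fundamental group of a cube complex only depends on its 2-skeleton: it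
   is the group of closed edge paths modulo the removal of backtracks and the
   replacement of one half of the boundary of a square by the other half. Here
   the square is (a, u -> v, b, s -> t, c), all orientations being allowed. *)
Inductive elementary_homotopy : seq squier_edge -> seq squier_edge -> Prop :=
| Backtrack p e q : elementary_homotopy (p ++ [:: e; edge_inv e] ++ q) (p ++ q)
| Square p a u v b s t c q : elementary_homotopy
    (p ++ [:: SquierEdge a u v (b ++ s ++ c);
              SquierEdge (a ++ v ++ b) s t c] ++ q)
    (p ++ [:: SquierEdge (a ++ u ++ b) s t c;
              SquierEdge a u v (b ++ t ++ c)] ++ q).

Definition edge_homotopic (w w' : word) : relation (seq squier_edge) :=
  clos_refl_sym_trans _ (fun p q =>
    [/\ is_edge_path w p w', is_edge_path w q w' & elementary_homotopy p q]).

Lemma is_edge_path_cat w p q w' : is_edge_path w (p ++ q) w' <->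
  exists2 z, is_edge_path w p z & is_edge_path z q w'.
Proof.
elim: p w => [|e p IH] w /=; first by split=> [?|[z -> //]]; exists w.
split=> [[e1 -> /IH[z pz zq]]|[z [e1 -> pz] zq]]; first by exists z.
by split=> //; apply/IH; exists z.
Qed.

Lemma is_squier_edge_inv e : is_squier_edge e -> is_squier_edge (edge_inv e).
Proof. by case=> ?; [right|left]. Qed.

Definition path_inv (p : seq squier_edge) := rev (map edge_inv p).

Lemma is_edge_path_inv w p w' :
  is_edge_path w p w' -> is_edge_path w' (path_inv p) w.
Proof.
elim: p w => [|e p IH] w /=; first by move->.
move=> [e1 -> /IH pw]; rewrite /path_inv /= rev_cons -cats1.
apply/is_edge_path_cat; exists (edge_end e) => //=.
by split=> //; exact: is_squier_edge_inv.
Qed.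

Lemma elementary_homotopy_ctx l r p q :
  elementary_homotopy p q -> elementary_homotopy (l ++ p ++ r) (l ++ q ++ r).
Proof.
case=> [p' e q'|p' a u v b s t c q'].
  by have := Backtrack (l ++ p') e (q' ++ r); rewrite -!catA.
by have := Square (l ++ p') a u v b s t c (q' ++ r); rewrite -!catA.
Qed.

Lemma edge_homotopic_ctx x w w' y l p q r :
  is_edge_path x l w -> is_edge_path w' r y ->
  edge_homotopic w w' p q -> edge_homotopic x y (l ++ p ++ r) (l ++ q ++ r).
Proof.
move=> xl ry; elim=> {p q} [p q [wp wq pq]|p|p q _ IH|p q s _ IH _ IH'].
- apply: rst_step; split; last exact: elementary_homotopy_ctx.
  + by apply/is_edge_path_cat; exists w => //; apply/is_edge_path_cat; exists w'.
  + by apply/is_edge_path_cat; exists w => //; apply/is_edge_path_cat; exists w'.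
- exact: rst_refl.
- exact: rst_sym.
- exact: rst_trans IH IH'.
Qed.

Lemma edge_homotopic_backtrack w e p w' :
  is_squier_edge e -> w = edge_start e -> is_edge_path w p w' ->
  edge_homotopic w w' ([:: e; edge_inv e] ++ p) p.
Proof.
move=> e1 we wp; apply: rst_step; split=> //; last exact: (Backtrack [::]).
by split=> //=; split=> //; [exact: is_squier_edge_inv|rewrite {1}/edge_end /= -/(edge_start e) -we].
Qed.

Lemma edge_homotopic_mulrV w p w' :
  is_edge_path w p w' -> edge_homotopic w w (p ++ path_inv p) [::].
Proof.
elim: p w => [|e p IH] w /=; first by move=> _; exact: rst_refl.
move=> [e1 we pw]; rewrite /path_inv /= rev_cons -cats1 catA.
apply: (@rst_trans _ _ _ ([:: e] ++ [::] ++ [:: edge_inv e])).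
  apply: (@edge_homotopic_ctx w (edge_end e) (edge_end e) w [:: e] _ _
    [:: edge_inv e]) => //=; last exact: IH.
  by split=> //; exact: is_squier_edge_inv.
exact: (@edge_homotopic_backtrack w e [::] w).
Qed.

Lemma edge_invK : involutive edge_inv. Proof. by case. Qed.

Lemma path_invK : involutive path_inv.
Proof. by move=> p; rewrite /path_inv map_rev revK mapK//; exact: edge_invK. Qed.

Definition edge_loop (w : word) :=
  {p : seq squier_edge | is_edge_path w p w}.

Section based.
Variable w : word.

Definition edge_loop_eq (p q : edge_loop w) : Prop :=
  edge_homotopic w w (projT1 p) (projT1 q).

Program Definition edge_loop_mul (p q : edge_loop w) : edge_loop w :=
  exist _ (projT1 p ++ projT1 q) _.
Next Obligation. by move=> [p wp] [q wq]; apply/is_edge_path_cat; exists w. Qed.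

Program Definition edge_loop_one : edge_loop w := exist _ [::] _.
Next Obligation. by []. Qed.

Program Definition edge_loop_inv (p : edge_loop w) : edge_loop w :=
  exist _ (path_inv (projT1 p)) _.
Next Obligation. by move=> [p wp]; exact: is_edge_path_inv. Qed.

Lemma edge_loop_mul_eq a a' b b' : edge_loop_eq a a' -> edge_loop_eq b b' ->
  edge_loop_eq (edge_loop_mul a b) (edge_loop_mul a' b').
Proof.
move: a a' b b' => [a wa] [a' wa'] [b wb] [b' wb']; rewrite /edge_loop_eq /=.
move=> aa' bb'; apply: (@rst_trans _ _ _ (a' ++ b)).
  exact: (@edge_homotopic_ctx w w w w [::]).
by have := edge_homotopic_ctx wa' (erefl : is_edge_path w [::] w) bb'; rewrite !cats0.
Qed.

Lemma edge_loop_mulA a b c : edge_loop_eq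
  (edge_loop_mul a (edge_loop_mul b c)) (edge_loop_mul (edge_loop_mul a b) c).
Proof. by rewrite /edge_loop_eq /= catA; exact: rst_refl. Qed.

Lemma edge_loop_mul1 a : edge_loop_eq (edge_loop_mul edge_loop_one a) a.
Proof. exact: rst_refl. Qed.

Lemma edge_loop_mulr1 a : edge_loop_eq (edge_loop_mul a edge_loop_one) a.
Proof. by rewrite /edge_loop_eq /= cats0; exact: rst_refl. Qed.

Lemma edge_loop_mulrV a :
  edge_loop_eq (edge_loop_mul a (edge_loop_inv a)) edge_loop_one.
Proof. by case: a => a wa; exact: edge_homotopic_mulrV wa. Qed.

Lemma edge_loop_mulV a :
  edge_loop_eq (edge_loop_mul (edge_loop_inv a) a) edge_loop_one.
Proof.
case: a => a wa; rewrite /edge_loop_eq /=.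
by have := edge_homotopic_mulrV (is_edge_path_inv wa); rewrite path_invK.
Qed.

Definition edge_loop_group := SetoidGroup
  (fun a => rst_refl _ _ _) (fun a b => @rst_sym _ _ _ _)
  (fun a b c => @rst_trans _ _ _ _ _)
  edge_loop_mul_eq edge_loop_mulA edge_loop_mul1 edge_loop_mulr1
  edge_loop_mulV edge_loop_mulrV.

End based.
End squier.

(* D(P, w) = pi_1(S(P, w), w): a closed edge path based at w stays in the
   connected component S(P, w) of the Squier complex. *)
Definition diagram_group_of (P : semigroup_presentation) (w : seq P)
  : groupType := class_group (edge_loop_group w).

Definition is_diagram_group (G : groupType) : Prop :=
  exists (P : semigroup_presentation) (w : seq P),
    w <> [::] /\ group_isomorphic G (diagram_group_of w).

Section unit_interval.
Variable R : realType.

Definition unit_interval : Type := set_type `[0 : R, 1]%classic.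
HB.instance Definition _ := Topological.on unit_interval.

Lemma unit_interval0 : (0 : R) \in `[0 : R, 1]%classic.
Proof. by rewrite inE /= in_itv /= lexx ler01. Qed.

Lemma unit_interval1 : (1 : R) \in `[0 : R, 1]%classic.
Proof. by rewrite inE /= in_itv /= lexx ler01. Qed.

Definition ui0 : unit_interval := SigSub unit_interval0.
Definition ui1 : unit_interval := SigSub unit_interval1.

Lemma ui0_neq1 : ui0 != ui1.
Proof. by apply/eqP => /(congr1 (@sval _ _))/eqP; rewrite /= eq_sym oner_eq0. Qed.

HB.instance Definition _ := isBiPointed.Build unit_interval ui0_neq1.

Definition uival (t : unit_interval) : R := set_val t.

Lemma uival_itv t : 0 <= uival t <= 1.
Proof. by case: t => t tI; have := tI; rewrite inE /= in_itv. Qed.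

Lemma uival_inj : injective uival. Proof. exact: val_inj. Qed.

Lemma uival_continuous : continuous uival.
Proof. exact: initial_continuous. Qed.

Lemma clamp_subproof (r : R) :
  Num.max 0 (Num.min r 1) \in `[0 : R, 1]%classic.
Proof.
by rewrite inE /= in_itv /= le_max lexx ge_max ler01 ge_min lexx orbT.
Qed.

Definition clamp (r : R) : unit_interval := SigSub (clamp_subproof r).

Lemma clampE r : uival (clamp r) = Num.max 0 (Num.min r 1).
Proof. by []. Qed.

Lemma uivalK : cancel uival clamp.
Proof.
move=> t; apply: uival_inj; rewrite clampE.
by have /andP[t0 t1] := uival_itv t; rewrite (min_idPl t1) (max_idPr t0).
Qed.

Lemma clamp_le0 r : r <= 0 -> clamp r = zero.
Proof.
move=> r0; apply: uival_inj; rewrite clampE; apply/max_idPl.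
by rewrite ge_min r0.
Qed.

Lemma clamp_ge1 r : 1 <= r -> clamp r = one.
Proof.
move=> r1; apply: uival_inj; rewrite clampE (min_idPr r1).
exact/max_idPr.
Qed.

Lemma clamp_continuous : continuous clamp.
Proof.
apply: continuous_comp_initial.
suff : continuous ((cst 0 : R -> R^o) \max ((id : R -> R^o) \min cst 1)) by [].
move=> r; apply: continuous_max; first exact: cvg_cst.
by apply: continuous_min; [exact: cvg_id|exact: cvg_cst].
Qed.

End unit_interval.

Section paste.
Variables (R : realType) (Z S : topologicalType).

Lemma paste_continuous (h : Z -> R) (f g : Z -> S) :
  continuous h -> continuous f -> continuous g ->
  (forall z, h z = 2^-1 -> f z = g z) ->
  continuous (fun z => if h z <= 2^-1 then f z else g z).
Proof.
move=> ch cf cg fg; apply/continuous_subspace_setT.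
have -> : [set: Z] = [set z | h z <= 2^-1] `|` [set z | 2^-1 <= h z].
  by apply/seteqP; split=> z //= _; apply/orP; exact: le_total.
have cl (D : set R) : closed D -> closed (h @^-1` D).
  by apply: preimage_closed => y _; exact: ch.
apply: withinU_continuous.
- by apply: (cl [set y | y <= 2^-1]); exact: closed_le.
- by apply: (cl [set y | 2^-1 <= y]); exact: closed_ge.
- apply: (@subspace_eq_continuous _ _ _ f); last exact: continuous_subspaceT.
  by move=> z; rewrite inE => hz; rewrite /from_subspace ifT.
- apply: (@subspace_eq_continuous _ _ _ g); last exact: continuous_subspaceT.
  move=> z; rewrite inE => zh; rewrite /from_subspace; case: ifPn => // hz.
  by apply/esym/fg/eqP; rewrite eq_le hz zh.
Qed.

End paste.

Lemma clampK (R : realType) (r : R) : 0 <= r <= 1 -> uival (clamp r) = r.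
Proof.
by case/andP=> r0 r1; rewrite clampE (min_idPl r1) (max_idPr r0).
Qed.

Lemma uival0 (R : realType) : uival (zero : unit_interval R) = 0.
Proof. by []. Qed.

Lemma uival1 (R : realType) : uival (one : unit_interval R) = 1.
Proof. by []. Qed.

Lemma comp_continuous (X Y Z : topologicalType) (f : Y -> Z) (g : X -> Y) :
  continuous f -> continuous g -> continuous (fun z => f (g z)).
Proof. by move=> cf cg z; apply: continuous_comp; [exact: cg|exact: cf]. Qed.

Lemma pair_continuous (X Y Z : topologicalType) (f : X -> Y) (g : X -> Z) :
  continuous f -> continuous g -> continuous (fun z => (f z, g z)).
Proof. by move=> cf cg z; apply: cvg_pair; [exact: cf|exact: cg]. Qed.

Lemma fst_continuous (X Y : topologicalType) : continuous (@fst X Y).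
Proof. by move=> z; exact: cvg_fst. Qed.

Lemma snd_continuous (X Y : topologicalType) : continuous (@snd X Y).
Proof. by move=> z; exact: cvg_snd. Qed.

Section fundamental_group.
Variables (R : realType) (S : topologicalType) (x : S).
Local Notation I := (unit_interval R).
Local Notation loop := {path I from x to x in S}.

Definition loop_homotopic (p q : loop) : Prop :=
  exists H : I * I -> S,
    [/\ continuous H,
        forall t, H (zero, t) = p t,
        forall t, H (one, t) = q t,
        forall s, H (s, zero) = x &
        forall s, H (s, one) = x].

Definition loop_mul_fun (p q : loop) (t : I) : S :=
  if uival t <= 2^-1 then p (clamp (2 * uival t))
  else q (clamp (2 * uival t - 1)).

Lemma loop_continuous (p : loop) : continuous (fun r : R => p (clamp r)).
Proof.
by apply: comp_continuous; [exact: cts_fun|exact: clamp_continuous].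
Qed.

Lemma double_continuous (Z : topologicalType) (h : Z -> R) :
  continuous h -> continuous (fun z => 2 * h z).
Proof. by move=> ch z; apply: cvgMr; exact: ch. Qed.

Lemma subr1_continuous (Z : topologicalType) (h : Z -> R) :
  continuous h -> continuous (fun z => h z - 1).
Proof. by move=> ch z; apply: cvgB; [exact: ch|exact: cvg_cst]. Qed.

Lemma onem_continuous (Z : topologicalType) (h : Z -> R) :
  continuous h -> continuous (fun z => 1 - h z).
Proof. by move=> ch z; apply: cvgB; [exact: cvg_cst|exact: ch]. Qed.

Lemma loop_mul_continuous p q : continuous (loop_mul_fun p q).
Proof.
apply: paste_continuous; first exact: uival_continuous.
- apply: (comp_continuous (@loop_continuous p)).
  exact/double_continuous/uival_continuous.
- apply: (comp_continuous (@loop_continuous q)).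
  exact/subr1_continuous/double_continuous/uival_continuous.
- move=> t ->; rewrite clamp_ge1 ?path_one; last by lra.
  by rewrite clamp_le0 ?path_zero//; lra.
Qed.

Lemma loop_mul0 p q : loop_mul_fun p q zero = x.
Proof.
by rewrite /loop_mul_fun uival0 ifT ?clamp_le0 ?path_zero//; lra.
Qed.

Lemma loop_mul1 p q : loop_mul_fun p q one = x.
Proof.
by rewrite /loop_mul_fun uival1 ifF ?clamp_ge1 ?path_one//; lra.
Qed.

Definition loop_mul (p q : loop) : loop :=
  mk_path (@loop_mul_continuous p q) (loop_mul0 p q) (loop_mul1 p q).

Lemma loop_mulE p q t : loop_mul p q t =
  if uival t <= 2^-1 then p (clamp (2 * uival t))
  else q (clamp (2 * uival t - 1)).
Proof. by []. Qed.

Definition loop_one : loop := cst x.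

Definition loop_inv_fun (p : loop) (t : I) : S := p (clamp (1 - uival t)).

Lemma loop_inv_continuous p : continuous (loop_inv_fun p).
Proof.
apply: (comp_continuous (@loop_continuous p)).
exact/onem_continuous/uival_continuous.
Qed.

Lemma loop_inv0 p : loop_inv_fun p zero = x.
Proof. by rewrite /loop_inv_fun uival0 clamp_ge1 ?path_one//; lra. Qed.

Lemma loop_inv1 p : loop_inv_fun p one = x.
Proof. by rewrite /loop_inv_fun uival1 clamp_le0 ?path_zero//; lra. Qed.

Definition loop_inv (p : loop) : loop :=
  mk_path (@loop_inv_continuous p) (loop_inv0 p) (loop_inv1 p).

Lemma loop_invE p t : loop_inv p t = p (clamp (1 - uival t)).
Proof. by []. Qed.

Lemma loop_homotopic_refl p : loop_homotopic p p.
Proof.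
exists (fun z => p z.2); split=> //= [|_|_]; last 2 first.
- exact: path_zero.
- exact: path_one.
by apply: (comp_continuous (@cts_fun _ _ p)); exact: snd_continuous.
Qed.

Lemma loop_homotopic_sym p q : loop_homotopic p q -> loop_homotopic q p.
Proof.
case=> H [cH H0 H1 Hx Hy]; exists (fun z => H (clamp (1 - uival z.1), z.2)).
split=> /= [|t|t|//|//].
- apply: (comp_continuous cH); apply: pair_continuous; last exact: snd_continuous.
  apply: (comp_continuous (@clamp_continuous R)); apply: onem_continuous.
  by apply: (comp_continuous (@uival_continuous R)); exact: fst_continuous.
- by rewrite uival0 clamp_ge1//; lra.
- by rewrite uival1 clamp_le0//; lra.
Qed.

Lemma loop_homotopic_trans p q r :
  loop_homotopic p q -> loop_homotopic q r -> loop_homotopic p r.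
Proof.
case=> H [cH H0 H1 Hx Hy] [K [cK K0 K1 Kx Ky]].
have c1 : continuous (fun z : I * I => uival z.1).
  by apply: (comp_continuous (@uival_continuous R)); exact: fst_continuous.
exists (fun z => if uival z.1 <= 2^-1 then H (clamp (2 * uival z.1), z.2)
  else K (clamp (2 * uival z.1 - 1), z.2)); split=> /= [|t|t|s|s].
- apply: paste_continuous => //.
  + apply: (comp_continuous cH); apply: pair_continuous; last exact: snd_continuous.
    by apply: (comp_continuous (@clamp_continuous R)); exact: double_continuous.
  + apply: (comp_continuous cK); apply: pair_continuous; last exact: snd_continuous.
    apply: (comp_continuous (@clamp_continuous R)).
    exact/subr1_continuous/double_continuous.
  + move=> [s t] /= ->; rewrite clamp_ge1 ?H1; last by lra.
    by rewrite clamp_le0 ?K0//; lra.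
- by rewrite uival0 ifT ?clamp_le0//; lra.
- by rewrite uival1 ifF ?clamp_ge1//; lra.
- by case: ifP.
- by case: ifP.
Qed.

Lemma loop_mul_homotopic p p' q q' : loop_homotopic p p' ->
  loop_homotopic q q' -> loop_homotopic (loop_mul p q) (loop_mul p' q').
Proof.
case=> H [cH H0 H1 Hx Hy] [K [cK K0 K1 Kx Ky]].
have c2 : continuous (fun z : I * I => uival z.2).
  by apply: (comp_continuous (@uival_continuous R)); exact: snd_continuous.
exists (fun z => if uival z.2 <= 2^-1 then H (z.1, clamp (2 * uival z.2))
  else K (z.1, clamp (2 * uival z.2 - 1))); split=> /= [|t|t|s|s].
- apply: paste_continuous => //.
  + apply: (comp_continuous cH); apply: pair_continuous; first exact: fst_continuous.
    by apply: (comp_continuous (@clamp_continuous R)); exact: double_continuous.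
  + apply: (comp_continuous cK); apply: pair_continuous; first exact: fst_continuous.
    apply: (comp_continuous (@clamp_continuous R)).
    exact/subr1_continuous/double_continuous.
  + move=> [s t] /= ->; rewrite clamp_ge1 ?Hy; last by lra.
    by rewrite clamp_le0 ?Kx//; lra.
- by rewrite H0 K0.
- by rewrite H1 K1.
- by rewrite uival0 ifT ?clamp_le0//; lra.
- by rewrite uival1 ifF ?clamp_ge1//; lra.
Qed.

Lemma reparam_homotopic (f : R -> S) (a b : R -> R) (p q : loop) :
  continuous f -> continuous a -> continuous b ->
  (forall t, p t = f (a (uival t))) -> (forall t, q t = f (b (uival t))) ->
  (forall s, 0 <= s <= 1 -> f ((1 - s) * a 0 + s * b 0) = x) ->
  (forall s, 0 <= s <= 1 -> f ((1 - s) * a 1 + s * b 1) = x) ->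
  loop_homotopic p q.
Proof.
move=> cf ca cb pE qE f0 f1.
have c1 : continuous (fun z : I * I => uival z.1).
  by apply: (comp_continuous (@uival_continuous R)); exact: fst_continuous.
have c2 : continuous (fun z : I * I => uival z.2).
  by apply: (comp_continuous (@uival_continuous R)); exact: snd_continuous.
exists (fun z => f ((1 - uival z.1) * a (uival z.2) + uival z.1 * b (uival z.2))).
split=> /= [|t|t|s|s].
- apply: (comp_continuous cf) => z; apply: cvgD; apply: cvgM.
  + exact: (onem_continuous c1).
  + exact: (comp_continuous ca c2).
  + exact: c1.
  + exact: (comp_continuous cb c2).
- by rewrite uival0 pE subr0 mul1r mul0r addr0.
- by rewrite uival1 qE subrr mul1r mul0r add0r.
- by rewrite uival0 f0// uival_itv.
- by rewrite uival1 f1// uival_itv.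
Qed.

Lemma min_cont (f g : R -> R) : continuous f -> continuous g ->
  continuous (fun r => Num.min (f r) (g r)).
Proof. by move=> cf cg r; apply: (@continuous_min R R f g); [exact: cf|exact: cg]. Qed.

Lemma affine_continuous (a b : R) : continuous (fun r : R => a * r + b).
Proof.
by move=> r; apply: cvgD; [apply: cvgMr; exact: cvg_id|exact: cvg_cst].
Qed.

Lemma loop_mulA p q r : loop_homotopic
  (loop_mul p (loop_mul q r)) (loop_mul (loop_mul p q) r).
Proof.
pose phi u : R := Num.min (2 * u + 0)
  (Num.min (1 * u + 4^-1) (2^-1 * u + 2^-1)).
apply: (@reparam_homotopic
  (fun u => loop_mul p (loop_mul q r) (clamp u)) (fun u => 1 * u + 0) phi).
- exact: loop_continuous.
- exact: affine_continuous.
- by apply: min_cont; [|apply: min_cont]; exact: affine_continuous.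
- by move=> t; rewrite mul1r addr0 uivalK.
- move=> t; rewrite !loop_mulE.
  have := uival_itv t; move: (uival t) => u u01.
  rewrite /phi; have [u1|u1] := leP u 2^-1; last first.
    rewrite (@min_idPr _ _ (1 * u + 4^-1) _ _); last by lra.
    rewrite (min_idPr _); last by lra.
    rewrite clampK; last by lra.
    rewrite ifF; last by lra.
    rewrite [uival (clamp (2 * (2^-1 * u + 2^-1) - 1))]clampK; last by lra.
    by rewrite ifF; [congr (r (clamp _)); lra|lra].
  rewrite clampK; last by lra.
  rewrite (@min_idPl _ _ (1 * u + 4^-1) _ _); last by lra.
  have [u2|u2] := leP (2 * u) 2^-1.
    rewrite (min_idPl _); last by lra.
    rewrite clampK; last by lra.
    by rewrite ifT; [congr (p (clamp _)); lra|lra].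
  rewrite (min_idPr _); last by lra.
  rewrite clampK; last by lra.
  rewrite ifF; last by lra.
  rewrite [uival (clamp (2 * (1 * u + 4^-1) - 1))]clampK; last by lra.
  by rewrite ifT; [congr (q (clamp _)); lra|lra].
- move=> s s01; rewrite (_ : _ + _ = 0) ?clamp_le0 ?path_zero//.
  by rewrite /phi (min_idPl _) ?(mulr0, addr0)// le_min; lra.
- move=> s s01; rewrite (_ : _ + _ = 1) ?clamp_ge1 ?path_one//.
  rewrite /phi (@min_idPr _ _ (1 * 1 + 4^-1) _ _); last by lra.
  by rewrite (min_idPr _); lra.
Qed.

Lemma loop_mul1l p : loop_homotopic (loop_mul loop_one p) p.
Proof.
apply: (@reparam_homotopic (fun u => p (clamp u)) (fun u => 2 * u - 1)
  (fun u => 1 * u + 0)); try exact: affine_continuous.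
- exact: loop_continuous.
- move=> t; rewrite !loop_mulE; case: ifP => // t1.
  by rewrite -[LHS]/x clamp_le0 ?path_zero//; lra.
- by move=> t; rewrite mul1r addr0 uivalK.
- by move=> s s01; rewrite clamp_le0 ?path_zero//; lra.
- by move=> s s01; rewrite clamp_ge1 ?path_one//; lra.
Qed.

Lemma loop_mulr1 p : loop_homotopic (loop_mul p loop_one) p.
Proof.
apply: (@reparam_homotopic (fun u => p (clamp u)) (fun u => 2 * u + 0)
  (fun u => 1 * u + 0)); try exact: affine_continuous.
- exact: loop_continuous.
- move=> t; rewrite !loop_mulE addr0; case: ifP => // t1.
  by rewrite -[LHS]/x clamp_ge1 ?path_one//; lra.
- by move=> t; rewrite mul1r addr0 uivalK.
- by move=> s s01; rewrite clamp_le0 ?path_zero//; lra.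
- by move=> s s01; rewrite clamp_ge1 ?path_one//; lra.
Qed.

Lemma loop_mulrV p : loop_homotopic (loop_mul p (loop_inv p)) loop_one.
Proof.
apply: (@reparam_homotopic (fun u => p (clamp u))
  (fun u => Num.min (2 * u + 0) (-2 * u + 2)) (fun u => 0 * u + 0)).
- exact: loop_continuous.
- by apply: min_cont; exact: affine_continuous.
- exact: affine_continuous.
- move=> t; rewrite !loop_mulE.
  have := uival_itv t; move: (uival t) => u u01; have [u1|u1] := leP u 2^-1.
    by rewrite (min_idPl _) ?addr0//; lra.
  rewrite (min_idPr _); last by lra.
  rewrite !loop_invE clampK; last by lra.
  by congr (p (clamp _)); lra.
- by move=> t; rewrite mul0r addr0 clamp_le0 ?path_zero.
- move=> s s01; rewrite (min_idPl _); last by lra.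
  by rewrite clamp_le0 ?path_zero//; lra.
- move=> s s01; rewrite (min_idPr _); last by lra.
  by rewrite clamp_le0 ?path_zero//; lra.
Qed.

Lemma loop_invK p : loop_inv (loop_inv p) = p.
Proof.
apply/path_eqP => t; rewrite !loop_invE.
have := uival_itv t => t01; rewrite clampK; last by lra.
by rewrite -[in RHS](uivalK t); congr (p (clamp _)); lra.
Qed.

Lemma loop_mulV p : loop_homotopic (loop_mul (loop_inv p) p) loop_one.
Proof. by have := loop_mulrV (loop_inv p); rewrite loop_invK. Qed.

Definition loop_group := SetoidGroup loop_homotopic_refl loop_homotopic_sym
  loop_homotopic_trans loop_mul_homotopic loop_mulA loop_mul1l loop_mulr1
  loop_mulV loop_mulrV.

Definition fundamental_group : groupType := class_group loop_group.

End fundamental_group.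

Definition homeomorphic (X Y : topologicalType) : Prop :=
  exists (f : X -> Y) (g : Y -> X),
    [/\ continuous f, continuous g, cancel f g & cancel g f].

Section surfaces.
Variable R : realType.

Definition locally_euclidean2 (S : topologicalType) : Prop :=
  forall x : S, exists U : set S,
    [/\ open U, U x & homeomorphic (set_type U) (R * R)%type].

Definition closed_surface (S : topologicalType) : Prop :=
  [/\ hausdorff_space S, compact [set: S], connected [set: S] &
      locally_euclidean2 S].

(* An abstract simplicial complex on the vertices 0, ..., n - 1 (not all of
   which need to be used), given by its set of non-empty simplices. *)
Definition simplicial_complex (n : nat) (K : {set {set 'I_n}}) : Prop :=
  finset.set0 \notin K /\
  forall A B : {set 'I_n}, A \in K -> B \subset A -> B != finset.set0 -> B \in K.

(* The points are given by their barycentric coordinates. *)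
Definition geometric_realization (n : nat) (K : {set {set 'I_n}})
    : set 'rV[R]_n :=
  [set t | [/\ forall i, 0 <= t 0 i, \sum_i t 0 i = 1 &
               [set i | t 0 i != 0]%SET \in K]].

Definition triangulates (S : topologicalType) (n : nat) (K : {set {set 'I_n}})
    : Prop :=
  simplicial_complex K /\
  homeomorphic S (set_type (geometric_realization K)).

Definition simplicial_euler_characteristic (n : nat) (K : {set {set 'I_n}})
    : int :=
  \sum_(A in K) (-1) ^+ (#|A|).-1.

(* By Rado's theorem every closed surface has a triangulation, and the
   alternating sum does not depend on it. *)
Definition has_euler_characteristic (S : topologicalType) (chi : int) : Prop :=
  exists (n : nat) (K : {set {set 'I_n}}),
    triangulates S K /\ simplicial_euler_characteristic K = chi.

Definition upper_half_plane : set (R * R) := [set p | 0 < p.2].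

(* cosh d(p, q) in the upper half-plane model of the hyperbolic plane. *)
Definition cosh_hyperbolic_dist (p q : R * R) : R :=
  1 + ((p.1 - q.1) ^+ 2 + (p.2 - q.2) ^+ 2) / (2 * p.2 * q.2).

Definition cosh (r : R) : R := (expR r + expR (- r)) / 2.

(* Distances are compared through cosh, which is injective on [0, +oo[; the
   last clause makes phi onto the ball of radius r around phi x. *)
Definition locally_hyperbolic (M : metricType R) : Prop :=
  forall x : M, exists (r : R) (phi : M -> R * R),
    [/\ 0 < r,
        forall y, ball x r y -> upper_half_plane (phi y),
        forall y z, ball x r y -> ball x r z ->
          cosh (mdist y z) = cosh_hyperbolic_dist (phi y) (phi z) &
        forall p, upper_half_plane p ->
          cosh_hyperbolic_dist (phi x) p < cosh r ->
          exists2 y, ball x r y & phi y = p].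

(* For a closed surface this is equivalent to the Euler characteristic being
   negative. *)
Definition hyperbolic (S : topologicalType) : Prop :=
  exists M : metricType R, homeomorphic S M /\ locally_hyperbolic M.

End surfaces.

(* Main.v *)
(** A triangulation presents the fundamental group pi of S by its edges and
    triangles, and invariance of domain in the plane makes the triangles fit
    together as in a combinatorial closed surface. Cutting and pasting brings the
    presentation to the form [a, b] kappa(u_1, v_1) ... kappa(u_d, v_d) = 1, where
    the Euler characteristic is -2d and kappa(u, v) is [u, v] or u^2 v^2.

    Embedding: a cyclic covering of degree d embeds pi into the group with d = 1.
    The latter is a double of a free group of rank two along cyclic subgroups, and
    embeds into the diagram group generated by x_0, ..., x_6 in which x_i and x_j
    commute for i + 1 < j; injectivity is read off an action on reduced words.

    Suppose that pi = D(P, w). If w is connected to a word ab with D(P, a) and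
    D(P, b) nontrivial, then pi contains the product of two nontrivial groups:
    D(P, a) x D(P, b) embeds into D(P, ab), because a diagram without dipoles acts
    nontrivially on wires running through its cells. But if A is an abelian
    subgroup of a surface group, it has infinite index, so the corresponding
    covering is an open surface and homomorphisms from A to an abelian group H lift
    through central extensions of H with finite kernel. Applied to Z/n^2 -> Z/n
    this excludes torsion, and applied to the Heisenberg group over F_2 and its
    abelian quotient F_2^2 it excludes two independent commuting elements. In the
    other case every word connected to w has a critical letter, only the cells
    meeting the critical letters matter, and homomorphisms from D(P, w) to an
    abelian group lift through every surjection. But a |-> (1, 0), b |-> (0, 1),
    u_i, v_i |-> 0 does not lift from F_2^2 to the Heisenberg group, since [a, b]
    would go to the nontrivial central element and the other factors to 1. *)
Require Import Defs.
From HB Require Import structures.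
From Stdlib Require Import Relations.
From mathcomp Require Import all_boot all_order all_algebra.
From mathcomp Require Import all_classical all_reals all_analysis homotopy.
From mathcomp Require Import zify ring lra.

Set Implicit Arguments.
Unset Strict Implicit.
Unset Printing Implicit Defensive.

Import Order.TTheory GRing.Theory Num.Theory.
Import numFieldNormedType.Exports.

(** * Groups given by generators and relations *)

Local Open Scope group_scope.

(** About the surface group only a universal property is kept ([surface_presented]): a relation
    between generators, maps out of them, generation. No word problem is solved; injectivity is
    always tested on an explicit action. An even Euler characteristic makes the number of squares
    even in the non-orientable case, so that after trading three squares for a commutator and one
    square the squares can be paired into [d] blocks, as for handles. The cyclic covering then
    reduces all questions about subgroups to $d = 1$. The lifting over an infinite coset graph is
    the vanishing of $H^2$ of an open surface in elementary form: one equation per face, a free edge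
    on the boundary of every finite set of faces, and a finite kernel, so that compactness passes
    from finite sets to all faces. On the diagram side the presentation is arbitrary, and neither
    confluence nor finiteness is available; shortest paths replace diagrams without dipoles, and the
    level of a wire detects non-triviality in a product. Lifting from $D(P,w)$ is possible because
    two disjoint edges are never both critical, so no commutation between critical edges has to be
    respected. *)

Definition is_hom (G H : groupType) (f : G -> H) := forall x y, f (x * y) = f x * f y.

Lemma hom1 (G H : groupType) (f : G -> H) : is_hom f -> f 1 = 1.
Proof. by move=> fM; apply: (mulgI (f 1)); rewrite -fM !mulg1. Qed.

Lemma homV (G H : groupType) (f : G -> H) : is_hom f -> forall x, f x^-1 = (f x)^-1.
Proof. by move=> fM x; apply/esym/mulg1_eq; rewrite -fM mulgV hom1. Qed.

Lemma hom_comp (G H K : groupType) (f : G -> H) (g : H -> K) :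
  is_hom f -> is_hom g -> is_hom (g \o f).
Proof. by move=> fM gM x y /=; rewrite fM gM. Qed.

Lemma hom_inj (G H : groupType) (f : G -> H) :
  is_hom f -> (forall x, f x = 1 -> x = 1) -> injective f.
Proof.
move=> fM f1 x y fxy; apply: divg1_eq; apply: f1.
by rewrite fM homV// fxy mulgV.
Qed.

Lemma homX (G H : groupType) (f : G -> H) : is_hom f ->
  forall x n, f (x ^+ n) = f x ^+ n.
Proof.
by move=> fM x; elim=> [|n IH]; rewrite ?expg0 ?hom1// !expgS fM IH.
Qed.

(** * Permutation groups, words and one-relator groups *)

Record bij (T : Type) := Bij {
  bfun :> T -> T; bifun : T -> T;
  bfunK : cancel bfun bifun; bifunK : cancel bifun bfun }.

Section sym.
Variable T : Type.
Implicit Types x y z : bij T.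

Lemma bij_eq x y : (forall t, x t = y t) -> x = y.
Proof.
case: x y => [f g fg gf] [f' g' fg' gf'] /= E.
have Ef : f = f' by apply/funext.
have Eg : g = g' by apply/funext => t; rewrite -[t in LHS]gf' -E fg.
by subst; congr Bij; apply: Prop_irrelevance.
Qed.

Definition bij_one := @Bij T id id (fun=> erefl) (fun=> erefl).
Definition bij_mul x y := Bij (can_comp (bfunK x) (bfunK y)) (can_comp (bifunK y) (bifunK x)).
Definition bij_inv x := Bij (bifunK x) (bfunK x).

HB.instance Definition _ := gen_eqMixin (bij T).
HB.instance Definition _ := gen_choiceMixin (bij T).

Lemma bij_mulA : associative bij_mul. Proof. by move=> x y z; apply: bij_eq. Qed.
Lemma bij_mul1 : left_id bij_one bij_mul. Proof. by move=> x; apply: bij_eq. Qed.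
Lemma bij_mulr1 : right_id bij_one bij_mul. Proof. by move=> x; apply: bij_eq. Qed.
Lemma bij_mulV : left_inverse bij_one bij_inv bij_mul.
Proof. by move=> x; apply: bij_eq => t /=; rewrite bfunK. Qed.
Lemma bij_mulrV : right_inverse bij_one bij_inv bij_mul.
Proof. by move=> x; apply: bij_eq => t /=; rewrite bifunK. Qed.

HB.instance Definition _ := isGroup.Build (bij T)
  bij_mulA bij_mul1 bij_mulr1 bij_mulV bij_mulrV.

Lemma bijM x y t : (x * y) t = x (y t). Proof. by []. Qed.
Lemma bij1 t : (1 : bij T) t = t. Proof. by []. Qed.
Lemma bijKV x t : x (x^-1 t) = t. Proof. exact: bifunK. Qed.
Lemma bijVK x t : x^-1 (x t) = t. Proof. exact: bfunK. Qed.

End sym.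

Section darts.
Variable L : Type.

Definition dart : Type := (L * bool)%type.
Definition dinv (d : dart) : dart := (d.1, ~~ d.2).
Definition winv (w : seq dart) := rev (map dinv w).

Lemma dinvK : involutive dinv. Proof. by case=> l b; rewrite /dinv /= negbK. Qed.

Lemma winvK : involutive winv.
Proof. by move=> w; rewrite /winv map_rev revK mapK//; exact: dinvK. Qed.

Lemma winv_cat u v : winv (u ++ v) = winv v ++ winv u.
Proof. by rewrite /winv map_cat rev_cat. Qed.

Lemma winv_cons d w : winv (d :: w) = winv w ++ [:: dinv d].
Proof. by rewrite /winv /= rev_cons -cats1. Qed.

Section eval.
Variables (G : groupType) (h : L -> G).

Definition evd (d : dart) := if d.2 then (h d.1)^-1 else h d.1.
Fixpoint ev (w : seq dart) : G := if w is d :: w' then evd d * ev w' else 1.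

Lemma ev_cons d w : ev (d :: w) = evd d * ev w. Proof. by []. Qed.
Lemma ev1 d : ev [:: d] = evd d. Proof. exact: mulg1. Qed.

Lemma ev_cat u v : ev (u ++ v) = ev u * ev v.
Proof. by elim: u => [|d u IH] /=; rewrite ?mul1g// IH mulgA. Qed.

Lemma evd_inv d : evd (dinv d) = (evd d)^-1.
Proof. by case: d => l [] /=; rewrite /evd /= ?invgK. Qed.

Lemma ev_winv w : ev (winv w) = (ev w)^-1.
Proof.
elim: w => [|d w IH]; first by rewrite invg1.
by rewrite winv_cons ev_cat IH ev1 evd_inv /= invgM.
Qed.

End eval.

Lemma eq_ev (G : groupType) (h k : L -> G) : h =1 k -> ev h =1 ev k.
Proof. by move=> hk; elim=> //= d w ->; rewrite /evd hk. Qed.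

Lemma ev_hom (G H : groupType) (f : G -> H) (h : L -> G) w :
  is_hom f -> f (ev h w) = ev (f \o h) w.
Proof.
move=> fM; elim: w => [|d w IH] /=; first exact: hom1.
by rewrite fM IH /evd; case: d.2 => /=; rewrite ?homV.
Qed.

End darts.

(* The group of words over [L] whose only relation is [W = 1]; equality is
   tested in all groups in which [W] holds, which makes the universal property
   immediate. *)
Section presented.
Variables (L : Type) (W : seq (dart L)).

Definition pres_eq (u v : seq (dart L)) : Prop :=
  forall (G : groupType) (h : L -> G), ev h W = 1 -> ev h u = ev h v.

Lemma pres_refl u : pres_eq u u. Proof. by []. Qed.
Lemma pres_sym u v : pres_eq u v -> pres_eq v u.
Proof. by move=> uv G h /uv. Qed.
Lemma pres_trans u v w : pres_eq u v -> pres_eq v w -> pres_eq u w.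
Proof. by move=> uv vw G h hW; rewrite uv// vw. Qed.
Lemma pres_cat u u' v v' : pres_eq u u' -> pres_eq v v' -> pres_eq (u ++ v) (u' ++ v').
Proof. by move=> uu vv G h hW; rewrite !ev_cat uu// vv. Qed.
Lemma pres_catA u v w : pres_eq (u ++ (v ++ w)) ((u ++ v) ++ w).
Proof. by rewrite catA. Qed.
Lemma pres_cat0 u : pres_eq ([::] ++ u) u. Proof. by []. Qed.
Lemma pres_catr0 u : pres_eq (u ++ [::]) u. Proof. by rewrite cats0. Qed.
Lemma pres_catV u : pres_eq (winv u ++ u) [::].
Proof. by move=> G h _; rewrite ev_cat ev_winv mulVg. Qed.
Lemma pres_catrV u : pres_eq (u ++ winv u) [::].
Proof. by move=> G h _; rewrite ev_cat ev_winv mulgV. Qed.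

Definition pres_setoid := SetoidGroup pres_refl pres_sym pres_trans pres_cat
  pres_catA pres_cat0 pres_catr0 pres_catV pres_catrV.

Definition pres : groupType := class_group pres_setoid.

Definition pword (w : seq (dart L)) : pres := class_of (w : sg_elt pres_setoid).
Definition pgen (l : L) : pres := pword [:: (l, false)].

Lemma pwordM u v : pword u * pword v = pword (u ++ v).
Proof. exact: class_mulE. Qed.

Lemma pwordP u v : pword u = pword v <-> pres_eq u v.
Proof. exact: class_ofP. Qed.

Lemma pword_ev w : pword w = ev pgen w.
Proof.
have p1 : pword [::] = 1 by [].
elim: w => [|[l b] w IH] //=; rewrite -IH -cat1s -pwordM; congr (_ * _).
case: b; rewrite /evd //=; apply/esym/mulg1_eq; rewrite pwordM -p1.
by apply/pwordP => G h _ /=; rewrite /evd /= mulg1 mulgV.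
Qed.

Lemma pword_surj (g : pres) : exists w, g = ev pgen w.
Proof. by exists (repr g); rewrite -pword_ev; apply/esym/class_of_repr. Qed.

Lemma pgen_rel : ev pgen W = 1.
Proof. by rewrite -pword_ev; apply/pwordP => G h ->. Qed.

Section universal.
Variables (G : groupType) (h : L -> G).

Definition pres_map (g : pres) : G := ev h (repr g).

Hypothesis hW : ev h W = 1.

Lemma pres_mapE w : pres_map (pword w) = ev h w.
Proof. by have /(_ G h hW) := sg_eq_repr (w : sg_elt pres_setoid). Qed.

Lemma pres_map_hom : is_hom pres_map.
Proof.
move=> x y; have [u ->] := pword_surj x; have [v ->] := pword_surj y.
by rewrite -!pword_ev pwordM !pres_mapE ev_cat.
Qed.

Lemma pres_map_gen l : pres_map (pgen l) = h l.
Proof. by rewrite pres_mapE /= /evd /= mulg1. Qed.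

End universal.
End presented.

(** The homomorphism in the second clause is unique because of the third, so this determines the
    group up to isomorphism, whichever way it was constructed. *)
Definition presents (L : Type) (W : seq (dart L)) (G : groupType) (gen : L -> G) :=
  [/\ ev gen W = 1,
      forall (H : groupType) (h : L -> H), ev h W = 1 ->
        exists f : G -> H, is_hom f /\ f \o gen =1 h &
      forall g, exists w, g = ev gen w].

Lemma pres_presents (L : Type) (W : seq (dart L)) : presents W (@pgen L W).
Proof.
split; [exact: pgen_rel| |exact: pword_surj].
move=> H h hW; exists (pres_map h); split; first exact: pres_map_hom.
by move=> l; exact: pres_map_gen.
Qed.

(** * The fundamental group of a triangulated space *)

Local Close Scope group_scope.
Local Open Scope classical_set_scope.
Local Open Scope ring_scope.

Section real_continuity.
Variables (R : realType) (Z : topologicalType).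
Implicit Types f g : Z -> R.

Lemma contD f g : continuous f -> continuous g -> continuous (fun z => f z + g z).
Proof. by move=> cf cg z; apply: cvgD; [exact: cf|exact: cg]. Qed.
Lemma contB f g : continuous f -> continuous g -> continuous (fun z => f z - g z).
Proof. by move=> cf cg z; apply: cvgB; [exact: cf|exact: cg]. Qed.
Lemma contM f g : continuous f -> continuous g -> continuous (fun z => f z * g z).
Proof. by move=> cf cg z; apply: cvgM; [exact: cf|exact: cg]. Qed.
Lemma contN f : continuous f -> continuous (fun z => - f z).
Proof. by move=> cf z; apply: cvgN; exact: cf. Qed.
Lemma cont_cst (W : topologicalType) (c : W) : continuous (fun _ : Z => c).
Proof. by move=> z; exact: cvg_cst. Qed.
Lemma cont_min f g : continuous f -> continuous g ->
  continuous (fun z => Num.min (f z) (g z)).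
Proof. by move=> cf cg z; apply: (@continuous_min R Z f g); [exact: cf|exact: cg]. Qed.
Lemma cont_max f g : continuous f -> continuous g ->
  continuous (fun z => Num.max (f z) (g z)).
Proof. by move=> cf cg z; apply: (@continuous_max R Z f g); [exact: cf|exact: cg]. Qed.
Lemma cont_norm f : continuous f -> continuous (fun z => `|f z|).
Proof. by move=> cf z; apply: cvg_norm; exact: cf. Qed.

Lemma paste_at (S : topologicalType) (c : R) (h : Z -> R) (f g : Z -> S) :
  continuous h -> continuous f -> continuous g ->
  (forall z, h z = c -> f z = g z) ->
  continuous (fun z => if h z <= c then f z else g z).
Proof.
move=> ch cf cg fg.
have -> : (fun z => if h z <= c then f z else g z) =
          (fun z => if h z - c + 2^-1 <= 2^-1 then f z else g z).
  by apply/funext => z; rewrite -subr_ge0 -[in RHS]subr_ge0 opprD opprB addrA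
    [2^-1 + _]addrC addrK.
apply: paste_continuous => //.
  apply: contD; last exact: cont_cst.
  by apply: contB => //; exact: cont_cst.
by move=> z hz; apply: fg; apply/eqP; rewrite -subr_eq0; lra.
Qed.

End real_continuity.

(** * Homotopies of paths relative to their ends *)

Section homot.
Variables (R : realType) (S : topologicalType).
Implicit Types p q r : R -> S.

(* Paths are continuous functions on the whole line, of which only the
   restriction to [0, 1] matters. *)
Definition homot p q := exists H : R * R -> S,
  [/\ continuous H,
      forall t, 0 <= t <= 1 -> H (0, t) = p t,
      forall t, 0 <= t <= 1 -> H (1, t) = q t,
      forall s, 0 <= s <= 1 -> H (s, 0) = p 0 &
      forall s, 0 <= s <= 1 -> H (s, 1) = p 1].

(** The homotopy is the straight line from [a] to [b] in the convex parameter plane, pushed forward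
    by [f]. Associativity, units, inverses and the square relation of path composition are all
    instances. *)
Lemma homot_plane (f : R * R -> S) (a b : R -> R * R) :
  continuous f -> continuous a -> continuous b -> a 0 = b 0 -> a 1 = b 1 ->
  homot (f \o a) (f \o b).
Proof.
move=> cf ca cb ab0 ab1.
exists (fun z => f ((1 - z.1) * (a z.2).1 + z.1 * (b z.2).1,
                    (1 - z.1) * (a z.2).2 + z.1 * (b z.2).2)).
have E (u v : R) : (1 - u) * v + u * v = v by ring.
have E0 (u v : R) : (1 - 0) * u + 0 * v = u by ring.
have E1 (u v : R) : (1 - 1) * u + 1 * v = v by ring.
split=> [|t _|t _|s _|s _] /=.
- apply: (comp_continuous cf).
  have c1 : continuous (fun z : R * R => z.1) by exact: fst_continuous.
  have ca' : continuous (fun z : R * R => a z.2).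
    by apply: (comp_continuous ca); exact: snd_continuous.
  have cb' : continuous (fun z : R * R => b z.2).
    by apply: (comp_continuous cb); exact: snd_continuous.
  by apply: pair_continuous; apply: contD; apply: contM => //;
    try (by apply: contB => //; exact: cont_cst);
    try (by apply: (comp_continuous (@fst_continuous _ _)));
    try (by apply: (comp_continuous (@snd_continuous _ _))).
- by rewrite !E0 -surjective_pairing.
- by rewrite !E1 -surjective_pairing.
- by rewrite -ab0 !E -surjective_pairing.
- by rewrite -ab1 !E -surjective_pairing.
Qed.

Lemma homot_line p (a b : R -> R) : continuous p -> continuous a -> continuous b ->
  a 0 = b 0 -> a 1 = b 1 -> homot (p \o a) (p \o b).
Proof.
move=> cp ca cb ab0 ab1.
apply: (@homot_plane (fun z => p z.1) (fun t => (a t, 0)) (fun t => (b t, 0))).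
- by apply: (comp_continuous cp); exact: fst_continuous.
- by apply: pair_continuous => //; exact: cont_cst.
- by apply: pair_continuous => //; exact: cont_cst.
- by rewrite ab0.
- by rewrite ab1.
Qed.

Lemma homot_eq p q q' : (forall t, 0 <= t <= 1 -> q t = q' t) -> homot p q -> homot p q'.
Proof. by move=> E [H [c h0 h1 h2 h3]]; exists H; split=> // t t01; rewrite h1// E. Qed.

Lemma homot_eql p p' q : (forall t, 0 <= t <= 1 -> p t = p' t) -> homot p q -> homot p' q.
Proof.
move=> E [H [c h0 h1 h2 h3]]; exists H; split=> // t t01; rewrite ?h0 ?h2 ?h3 ?E//;
  by rewrite ?ler01 ?lexx.
Qed.

Lemma homot_refl p : continuous p -> homot p p.
Proof.
have cid : continuous (fun t : R => t) by move=> z; exact: cvg_id.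
by move=> cp; exact: (@homot_line p (fun t => t) (fun t => t)).
Qed.

Lemma homot_ends p q : homot p q -> p 0 = q 0 /\ p 1 = q 1.
Proof.
move=> [H [_ _ h1 h2 h3]].
have z01 : 0 <= (0 : R) <= 1 by rewrite lexx ler01.
have o01 : 0 <= (1 : R) <= 1 by rewrite lexx ler01.
by rewrite -(h1 _ z01) -(h1 _ o01) h2// h3.
Qed.

Lemma homot_sym p q : homot p q -> homot q p.
Proof.
move=> pq; have [E0 E1] := homot_ends pq; case: pq => H [c h0 h1 h2 h3].
exists (fun z => H (1 - z.1, z.2)); split=> [|t t01|t t01|s s01|s s01] /=.
- apply: (comp_continuous c); apply: pair_continuous; last exact: snd_continuous.
  by apply: contB; [exact: cont_cst|exact: fst_continuous].
- by rewrite subr0 h1.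
- by rewrite subrr h0.
- by rewrite h2 ?E0//; lra.
- by rewrite h3 ?E1//; lra.
Qed.

Lemma homot_trans p q r : homot p q -> homot q r -> homot p r.
Proof.
move=> pq; have [E0 E1] := homot_ends pq; case: pq => H [c h0 h1 h2 h3].
move=> [K [d k0 k1 k2 k3]].
(* The two homotopies agree on their common side only for times in $[0,1]$; clamping the time makes
   the pasted map continuous on the whole plane. *)
pose u (z : R * R) : R := Num.max 0 (Num.min 1 z.2).
exists (fun z => if z.1 <= 2^-1 then H (2 * z.1, u z) else K (2 * z.1 - 1, u z)).
have cu : continuous u.
  apply: cont_max; first exact: cont_cst.
  by apply: cont_min; [exact: cont_cst|exact: snd_continuous].
have u01 z : 0 <= u z <= 1 by rewrite /u le_max lexx/= ge_max ler01 ge_min lexx.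
have uE s t : 0 <= t <= 1 -> u (s, t) = t.
  by move=> /andP[t0 t1]; rewrite /u /= (min_idPr t1) (max_idPr t0).
have c1 : continuous (fun z : R * R => 2 * z.1).
  by apply: contM; [exact: cont_cst|exact: fst_continuous].
split=> [|t t01|t t01|s s01|s s01] /=.
- apply: paste_at.
  + exact: fst_continuous.
  + by apply: (comp_continuous c); apply: pair_continuous.
  + apply: (comp_continuous d); apply: pair_continuous => //.
    by apply: contB => //; exact: cont_cst.
  + move=> z zE; rewrite zE divff ?subrr ?pnatr_eq0//.
    by rewrite h1// k0.
- by rewrite ifT ?invr_ge0// mulr0 uE// h0.
- rewrite ifF; last by lra.
  by rewrite uE// (_ : 2 * 1 - 1 = 1) ?k1//; lra.
- rewrite uE ?lexx ?ler01//; case: ifP => s2; first by rewrite h2//; lra.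
  by rewrite k2 ?E0//; lra.
- rewrite uE ?lexx ?ler01//; case: ifP => s2; first by rewrite h3//; lra.
  by rewrite k3 ?E1//; lra.
Qed.

Definition concat p q (t : R) : S := if t <= 2^-1 then p (2 * t) else q (2 * t - 1).
Definition prev p (t : R) : S := p (1 - t).

Lemma concat_continuous p q : continuous p -> continuous q -> p 1 = q 0 ->
  continuous (concat p q).
Proof.
move=> cp cq pq.
have c2 : continuous (fun t : R => 2 * t).
  by apply: contM; [exact: cont_cst|move=> z; exact: cvg_id].
apply: paste_at.
- by move=> z; exact: cvg_id.
- exact: (comp_continuous cp).
- by apply: (comp_continuous cq); apply: contB => //; exact: cont_cst.
- by move=> t ->; rewrite divff ?pnatr_eq0// subrr.
Qed.

Lemma concat0 p q : concat p q 0 = p 0.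
Proof. by rewrite /concat ifT ?invr_ge0// mulr0. Qed.
Lemma concat1 p q : concat p q 1 = q 1.
Proof. by rewrite /concat ifF; [congr q|]; lra. Qed.

Lemma prev_continuous p : continuous p -> continuous (prev p).
Proof.
move=> cp; apply: (comp_continuous cp).
by apply: contB; [exact: cont_cst|move=> z; exact: cvg_id].
Qed.

Lemma prev0 p : prev p 0 = p 1. Proof. by rewrite /prev subr0. Qed.
Lemma prev1 p : prev p 1 = p 0. Proof. by rewrite /prev subrr. Qed.

Lemma homot_concat p p' q q' : p 1 = q 0 ->
  homot p p' -> homot q q' -> homot (concat p q) (concat p' q').
Proof.
move=> pq [H [c h0 h1 h2 h3]] [K [d k0 k1 k2 k3]].
pose u (z : R * R) : R := Num.max 0 (Num.min 1 z.1).
have cu : continuous u.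
  apply: cont_max; first exact: cont_cst.
  by apply: cont_min; [exact: cont_cst|exact: fst_continuous].
have u01 z : 0 <= u z <= 1 by rewrite /u le_max lexx/= ge_max ler01 ge_min lexx.
have uE s t : 0 <= s <= 1 -> u (s, t) = s.
  by move=> /andP[t0 t1]; rewrite /u /= (min_idPr t1) (max_idPr t0).
have c2 : continuous (fun z : R * R => 2 * z.2).
  by apply: contM; [exact: cont_cst|exact: snd_continuous].
exists (fun z => if z.2 <= 2^-1 then H (u z, 2 * z.2) else K (u z, 2 * z.2 - 1)).
split=> [|t t01|t t01|s s01|s s01] /=.
- apply: paste_at.
  + exact: snd_continuous.
  + by apply: (comp_continuous c); apply: pair_continuous.
  + apply: (comp_continuous d); apply: pair_continuous => //.
    by apply: contB => //; exact: cont_cst.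
  + by move=> z ->; rewrite divff ?pnatr_eq0// subrr h3// k2.
- rewrite uE ?lexx ?ler01// /concat; case: ifP => ht.
    by rewrite h0//; lra.
  by rewrite k0//; lra.
- rewrite uE ?lexx ?ler01// /concat; case: ifP => ht.
    by rewrite h1//; lra.
  by rewrite k1//; lra.
- by rewrite ifT ?invr_ge0// mulr0 uE// h2// concat0.
- rewrite ifF; last by lra.
  rewrite uE// concat1 (_ : 2 * 1 - 1 = 1) ?k3//; lra.
Qed.

Lemma cont_affine (a b : R) : continuous (fun t : R => a * t + b).
Proof.
apply: contD; last exact: cont_cst.
by apply: contM; [exact: cont_cst|move=> z; exact: cvg_id].
Qed.

Lemma homot_concatA p q r : continuous p -> continuous q -> continuous r ->
  p 1 = q 0 -> q 1 = r 0 ->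
  homot (concat p (concat q r)) (concat (concat p q) r).
Proof.
move=> cp cq cr pq qr.
(* [f] runs through [p], [q], [r] on three successive unit intervals; the two bracketings are its
   reparametrisations by piecewise linear maps from $[0,1]$ onto $[0,3]$. *)
pose f (t : R) := if t <= 1 then p t else if t <= 2 then q (1 * t - 1) else r (1 * t - 2).
have cid : continuous (fun t : R => t) by move=> z; exact: cvg_id.
have cf : continuous f.
  apply: paste_at => //.
    apply: paste_at => //.
    - by apply: (comp_continuous cq); exact: cont_affine.
    - by apply: (comp_continuous cr); exact: cont_affine.
    - by move=> z ->; rewrite !mul1r subrr -qr; congr q; lra.
  by move=> z ->; rewrite ifT ?ler1n// mul1r subrr.
have h : homot (f \o (fun t => Num.max (2 * t + 0) (4 * t - 1)))
               (f \o (fun t => Num.min (4 * t + 0) (2 * t + 1))).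
  apply: homot_line => //.
  - by apply: cont_max; exact: cont_affine.
  - by apply: cont_min; exact: cont_affine.
  - by rewrite (max_idPl _) ?(min_idPl _); lra.
  - by rewrite (max_idPr _) ?(min_idPr _); lra.
apply: homot_eql (homot_eq _ h).
- move=> t t01 /=; rewrite /f /concat.
  have [t1|t1] := leP t 2^-1.
    by rewrite (max_idPl _); [rewrite ifT ?addr0//; lra|lra].
  rewrite (max_idPr _); last by lra.
  rewrite ifF; last by lra.
  have [t2|t2] := leP (2 * t - 1) 2^-1.
    by rewrite ifT; [congr q|]; lra.
  by rewrite ifF; [congr r|]; lra.
- move=> t t01 /=; rewrite /f /concat.
  have [t1|t1] := leP t 2^-1.
    rewrite (min_idPl _); last by lra.
    have [t2|t2] := leP (2 * t) 2^-1.
      by rewrite ifT; [congr p|]; lra.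
    rewrite ifF; last by lra.
    by rewrite ifT; [congr q|]; lra.
  rewrite (min_idPr _); last by lra.
  rewrite ifF; last by lra.
  by rewrite ifF; [congr r|]; lra.
Qed.

Lemma homot_concat1 p : continuous p -> homot (concat p (cst (p 1))) p.
Proof.
move=> cp; have cid : continuous (fun t : R => t) by move=> z; exact: cvg_id.
have := @homot_line p (fun t => Num.min (2 * t + 0) 1) (fun t => t) cp.
move=> h; apply: homot_eql (h _ cid _ _).
- move=> t t01 /=; rewrite /concat; have [t1|t1] := leP t 2^-1.
    by rewrite (min_idPl _) ?addr0//; lra.
  by rewrite (min_idPr _)//; lra.
- by apply: cont_min; [exact: cont_affine|exact: cont_cst].
- by rewrite mulr0 addr0 (min_idPl _).
- by rewrite (min_idPr _)//; lra.
Qed.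

Lemma homot_concatV p : continuous p -> homot (concat p (prev p)) (cst (p 0)).
Proof.
move=> cp.
have := @homot_line p (fun t => 1 - `|2 * t - 1|) (fun=> 0) cp.
move=> h; apply: homot_eql (h _ _ _ _).
- move=> t t01 /=; rewrite /concat /prev; have [t1|t1] := leP t 2^-1.
    by congr p; rewrite ler0_norm; lra.
  by congr p; rewrite ger0_norm; lra.
- apply: contB; first exact: cont_cst.
  by apply: cont_norm; exact: cont_affine.
- exact: cont_cst.
- by rewrite mulr0 sub0r normrN normr1 subrr.
- by rewrite mulr1 (_ : 2 - 1 = 1) ?normr1 ?subrr//; lra.
Qed.

(** The two halves of the boundary of the square are paths from $(0,0)$ to $(1,1)$ in the plane,
    hence homotopic along straight lines. *)
Lemma homot_square (H : R * R -> S) : continuous H ->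
  homot (concat (fun t => H (0, t)) (fun s => H (s, 1)))
        (concat (fun s => H (s, 0)) (fun t => H (1, t))).
Proof.
move=> cH; have cid : continuous (fun t : R => t) by move=> z; exact: cvg_id.
pose lo (t : R) := Num.min (2 * t + 0) 1; pose hi (t : R) := Num.max 0 (2 * t - 1).
have clo : continuous lo by apply: cont_min; [exact: cont_affine|exact: cont_cst].
have chi : continuous hi by apply: cont_max; [exact: cont_cst|exact: cont_affine].
have lo0 : lo 0 = 0 by rewrite /lo mulr0 addr0 (min_idPl _).
have lo1 : lo 1 = 1 by rewrite /lo (min_idPr _)//; lra.
have hi0 : hi 0 = 0 by rewrite /hi mulr0 (max_idPl _)//; lra.
have hi1 : hi 1 = 1 by rewrite /hi (max_idPr _)//; lra.
have h := @homot_plane H (fun t => (hi t, lo t)) (fun t => (lo t, hi t)) cH.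
have {h} := h (pair_continuous chi clo) (pair_continuous clo chi).
rewrite lo0 hi0 lo1 hi1 => /(_ erefl erefl) h.
have E (t : R) : (t <= 2^-1 -> lo t = 2 * t /\ hi t = 0) /\
                 (2^-1 < t -> lo t = 1 /\ hi t = 2 * t - 1).
  split=> ht.
    by rewrite /lo /hi (min_idPl _) ?addr0 ?(max_idPl _)//; lra.
  by rewrite /lo /hi (min_idPr _) ?(max_idPr _)//; lra.
apply: homot_eql (homot_eq _ h) => t t01 /=; rewrite /concat; case: (E t) => E1 E2.
  by case: leP => [/E1[-> ->]|/E2[-> ->]].
by case: leP => [/E1[-> ->]|/E2[-> ->]].
Qed.

End homot.

(** * Paths as elements of the fundamental group *)

Section path_classes.
Variables (R : realType) (S : topologicalType) (x : S).
Implicit Types p q : R -> S.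
Local Notation G := (fundamental_group R x).
Local Notation I := (unit_interval R).
Local Notation loop := {path I from x to x in S}.

Definition is_loop p := [/\ continuous p, p 0 = x & p 1 = x].

Section mkloop.
Variable p : R -> S.
Hypothesis hp : is_loop p.
Lemma mkloop_cont : continuous (fun t : unit_interval R => p (uival t)).
Proof. by case: hp => cp _ _; apply: (comp_continuous cp); exact: uival_continuous. Qed.
Lemma mkloop0 : p (uival (zero : unit_interval R)) = x.
Proof. by case: hp; rewrite uival0. Qed.
Lemma mkloop1 : p (uival (one : unit_interval R)) = x.
Proof. by case: hp; rewrite uival1. Qed.
Definition mkloop : loop := mk_path mkloop_cont mkloop0 mkloop1.
End mkloop.

Definition toloop p : loop :=
  if pselect (is_loop p) is left hp then mkloop hp else loop_one R x.

Lemma toloopE p t : is_loop p -> toloop p t = p (uival t).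
Proof. by rewrite /toloop; case: pselect. Qed.

Definition cl p : G := class_of (toloop p : sg_elt (loop_group R x)).

Lemma cl_homot p q : is_loop p -> is_loop q -> homot p q -> cl p = cl q.
Proof.
move=> lp lq [H [cH h0 h1 h2 h3]]; apply/class_ofP => /=.
exists (fun z => H (uival z.1, uival z.2)); split=> [|t|t|s|s].
- apply: (comp_continuous cH); apply: pair_continuous.
    by apply: (comp_continuous (@uival_continuous R)); exact: fst_continuous.
  by apply: (comp_continuous (@uival_continuous R)); exact: snd_continuous.
- by rewrite /= uival0 h0 ?uival_itv// toloopE.
- by rewrite /= uival1 h1 ?uival_itv// toloopE.
- by rewrite /= uival0 h2 ?uival_itv//; case: lp.
- by rewrite /= uival1 h3 ?uival_itv//; case: lp.
Qed.

Lemma cl_inj p q : is_loop p -> is_loop q -> cl p = cl q -> homot p q.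
Proof.
move=> lp lq /class_ofP[H [cH h0 h1 h2 h3]].
exists (fun z => H (clamp z.1, clamp z.2)).
have c0 : clamp (0 : R) = zero by rewrite clamp_le0.
have c1 : clamp (1 : R) = one by rewrite clamp_ge1.
split=> [|t t01|t t01|s s01|s s01] /=.
- apply: (comp_continuous cH); apply: pair_continuous.
    by apply: (comp_continuous (@clamp_continuous R)); exact: fst_continuous.
  by apply: (comp_continuous (@clamp_continuous R)); exact: snd_continuous.
- by rewrite c0 h0 toloopE// clampK.
- by rewrite c1 h1 toloopE// clampK.
- by rewrite c0 h2; case: lp.
- by rewrite c1 h3; case: lp.
Qed.

Lemma is_loop_concat p q : is_loop p -> is_loop q -> is_loop (concat p q).
Proof.
move=> [cp p0 p1] [cq q0 q1]; split; rewrite ?concat0 ?concat1//.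
by apply: concat_continuous => //; rewrite p1.
Qed.

Lemma clM p q : is_loop p -> is_loop q -> cl (concat p q) = (cl p * cl q)%g.
Proof.
move=> lp lq; rewrite /cl [RHS]class_mulE; congr class_of.
apply/path_eqP => t; rewrite toloopE; last exact: is_loop_concat.
rewrite loop_mulE /concat; have := uival_itv t => t01.
by case: ifP => t2; rewrite toloopE// clampK//; lra.
Qed.

Lemma cl1 : cl (cst x) = 1%g.
Proof.
rewrite /cl; congr class_of; apply/path_eqP => t; rewrite toloopE//.
by split => //; exact: cont_cst.
Qed.

Lemma cl_surj (g : G) : exists2 p, is_loop p & g = cl p.
Proof.
pose l := repr g : loop; pose p (t : R) := l (clamp t).
have lp : is_loop p.
  split; first exact: loop_continuous.
    by rewrite /p clamp_le0 ?path_zero.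
  by rewrite /p clamp_ge1 ?path_one.
exists p => //; rewrite -(class_of_repr g) /cl; congr class_of.
by apply/path_eqP => t; rewrite toloopE// /p uivalK.
Qed.

Hypothesis pathS : forall y : S, exists p : R -> S, [/\ continuous p, p 0 = x & p 1 = y].

Definition gauge (y : S) : R -> S := sval (cid (pathS y)).
Lemma gaugeP y : [/\ continuous (gauge y), gauge y 0 = x & gauge y 1 = y].
Proof. by rewrite /gauge; case: cid. Qed.

Definition gloop p : R -> S := concat (concat (gauge (p 0)) p) (prev (gauge (p 1))).

Lemma gloop_loop p : continuous p -> is_loop (gloop p).
Proof.
move=> cp; have [c0 a0 b0] := gaugeP (p 0); have [c1 a1 b1] := gaugeP (p 1).
split; rewrite /gloop ?concat0 ?concat1 ?prev1//.
apply: concat_continuous; last by rewrite concat1 prev0.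
  by apply: concat_continuous.
exact: prev_continuous.
Qed.

(** The chosen paths [gauge] close up an arbitrary path. This maps the fundamental groupoid to the
    group: the class is multiplicative on composable paths ([gcM]), wherever they start and end. *)
Definition based_class p : G := cl (gloop p).

Lemma gc_homot p q : continuous p -> continuous q -> homot p q -> based_class p = based_class q.
Proof.
move=> cp cq pq; have [E0 E1] := homot_ends pq.
apply: cl_homot; [exact: gloop_loop|exact: gloop_loop|].
have [c0 a0 b0] := gaugeP (p 0); have [c1 a1 b1] := gaugeP (p 1).
rewrite /gloop -E0 -E1; apply: homot_concat.
- by rewrite concat1 prev0.
- by apply: homot_concat => //; exact: homot_refl.
- by apply: homot_refl; exact: prev_continuous.
Qed.

Lemma gcM p q : continuous p -> continuous q -> p 1 = q 0 ->
  based_class (concat p q) = (based_class p * based_class q)%g.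
Proof.
move=> cp cq pq; rewrite /based_class -clM; try exact: gloop_loop.
have cpq := concat_continuous cp cq pq.
have [c0 a0 b0] := gaugeP (p 0); have [c1 a1 b1] := gaugeP (q 0).
have [c2 a2 b2] := gaugeP (q 1).
have cV := prev_continuous c1; have cV2 := prev_continuous c2.
set A := gauge (p 0) in c0 a0 b0 *; set B := gauge (q 0) in c1 a1 b1 cV *.
set C := gauge (q 1) in c2 a2 b2 cV2 *.
have Ap : A 1 = p 0 by [].
have cAp : continuous (concat A p) by exact: concat_continuous.
have cBq : continuous (concat B q) by exact: concat_continuous.
have eAp : (concat A p) 1 = p 1 by rewrite concat1.
have eBq0 : (concat B q) 0 = x by rewrite concat0.
have eBq1 : (concat B q) 1 = q 1 by rewrite concat1.
have V0 : prev B 0 = p 1 by rewrite prev0 pq.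
have V1 : prev B 1 = x by rewrite prev1.
have W0 : prev C 0 = q 1 by rewrite prev0.
have cBV : continuous (concat (prev B) B) by apply: concat_continuous; rewrite ?V1.
have cAV : continuous (concat (concat A p) (prev B)).
  by apply: concat_continuous; rewrite ?eAp ?V0.
have lA : is_loop (gloop p) by exact: gloop_loop.
have lB : is_loop (gloop q) by exact: gloop_loop.
apply: cl_homot; [exact: gloop_loop|exact: is_loop_concat|].
rewrite /gloop concat0 concat1 -/A -/C -/B pq -/B.
set P := concat (concat A p) (prev B); set Q := concat B q.
have cP : continuous P by [].
have eP : P 1 = Q 0 by rewrite /P /Q concat1 concat0 V1.
apply: (@homot_trans _ _ _ (concat (concat P Q) (prev C))); last first.
  by apply: homot_sym; apply: homot_concatA => //; rewrite /Q concat1 W0.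
apply: homot_concat; rewrite ?concat1 ?W0//; last exact: homot_refl.
apply: (@homot_trans _ _ _ (concat (concat A p) q)); first exact: homot_concatA.
apply: homot_sym.
apply: (@homot_trans _ _ _ (concat (concat P B) q)).
  by apply: homot_concatA => //; rewrite eP /Q concat0.
apply: homot_concat; rewrite ?concat1//; last exact: homot_refl.
apply: (@homot_trans _ _ _ (concat (concat A p) (concat (prev B) B))).
  by apply: homot_sym; apply: homot_concatA => //; rewrite ?eAp ?V0 ?V1.
apply: (@homot_trans _ _ _ (concat (concat A p) (cst (p 1)))).
  apply: homot_concat; rewrite ?concat0 ?eAp ?V0//; first exact: homot_refl.
  have := homot_concatV cV; rewrite V0 => h.
  apply: homot_eql h => t t01; rewrite /concat; case: ifP => // _.
  by rewrite /prev; congr B; ring.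
by have := homot_concat1 cAp; rewrite concat1.
Qed.

Lemma gc_cst y : based_class (cst y) = 1%g.
Proof.
have c : continuous (cst y : R -> S) by exact: cont_cst.
apply: (mulgI (based_class (cst y))); rewrite -gcM// mulg1.
apply: gc_homot => //; first exact: concat_continuous.
exact: (homot_concat1 c).
Qed.

Lemma gc_square (H : R * R -> S) : continuous H ->
  (based_class (fun t => H (0%R, t)) * based_class (fun s => H (s, 1%R)) =
   based_class (fun s => H (s, 0%R)) * based_class (fun t => H (1%R, t)))%g.
Proof.
move=> cH; have cid : continuous (fun t : R => t) by move=> z; exact: cvg_id.
have c a : continuous (fun t => H (a, t)).
  by apply: (comp_continuous cH); apply: pair_continuous => //; exact: cont_cst.
have d a : continuous (fun t => H (t, a)).
  by apply: (comp_continuous cH); apply: pair_continuous => //; exact: cont_cst.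
rewrite -!gcM//; apply: gc_homot; try exact: concat_continuous.
exact: homot_square.
Qed.

Definition seg p (a b : R) : R -> S := fun t => p ((b - a) * t + a).

Lemma seg_continuous p a b : continuous p -> continuous (seg p a b).
Proof. by move=> cp; apply: (comp_continuous cp); exact: cont_affine. Qed.
Lemma seg0 p a b : seg p a b 0 = p a.
Proof. by rewrite /seg mulr0 add0r. Qed.
Lemma seg1 p a b : seg p a b 1 = p b.
Proof. by rewrite /seg mulr1 subrK. Qed.

Lemma gc_seg p a b c : continuous p ->
  (based_class (seg p a b) * based_class (seg p b c) = based_class (seg p a c))%g.
Proof.
move=> cp; rewrite -gcM ?seg0 ?seg1//; try exact: seg_continuous.
apply: gc_homot; [|exact: seg_continuous|].
  by apply: concat_continuous; rewrite ?seg0 ?seg1//; exact: seg_continuous.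
pose th (t : R) := if t <= 2^-1 then (b - a) * (2 * t) + a else (c - b) * (2 * t - 1) + b.
have cth : continuous th.
  apply: paste_at.
  - by move=> z; exact: cvg_id.
  - apply: contD; last exact: cont_cst.
    apply: contM; first exact: cont_cst.
    by apply: contM; [exact: cont_cst|move=> z; exact: cvg_id].
  - apply: contD; last exact: cont_cst.
    apply: contM; first exact: cont_cst.
    exact: cont_affine.
  - by move=> z ->; rewrite divff ?pnatr_eq0// subrr; ring.
have := @homot_line _ _ p th (fun t => (c - a) * t + a) cp cth (@cont_affine _ _ _).
move=> h; apply: homot_eql (h _ _).
- by move=> t _; rewrite /= /th /concat /seg; case: ifP.
- by rewrite /th ifT ?invr_ge0//; ring.
- by rewrite /th ifF; [ring|lra].
Qed.

Lemma gc_segE p : based_class (seg p 0 1) = based_class p.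
Proof. by congr based_class; apply/funext => t; rewrite /seg subr0 mul1r addr0. Qed.

(** The path chosen from the base point to itself need not be constant, hence the conjugation. *)
Lemma gc_loop p : is_loop p -> based_class p = (cl (gauge x) * cl p * (cl (gauge x))^-1)%g.
Proof.
move=> lp; have [cp p0 p1] := lp; have [c0 a0 b0] := gaugeP x.
have lg : is_loop (gauge x) by [].
have lgv : is_loop (prev (gauge x)).
  by split; rewrite ?prev0 ?prev1//; exact: prev_continuous.
have -> : ((cl (gauge x))^-1 = cl (prev (gauge x)))%g.
  apply: mulg1_eq; rewrite -clM// -cl1; apply: cl_homot.
  - exact: is_loop_concat.
  - by split=> //; exact: cont_cst.
  - by have := homot_concatV c0; rewrite a0.
rewrite -!clM//; last exact: is_loop_concat.
by rewrite /based_class /gloop p0 p1.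
Qed.

End path_classes.

Section plane.
Variable R : realType.

Lemma nbhs_real (t : R) (A : set R) :
  nbhs t A <-> exists2 e : R, 0 < e & forall s, `|s - t| < e -> A s.
Proof.
split=> [/nbhs_ballP[e e0 eA]|[e e0 eA]].
  by exists e => // s st; apply: eA; rewrite -ball_normE /= distrC.
apply/nbhs_ballP; exists e => // s; rewrite -ball_normE /= distrC => st.
exact: eA.
Qed.

Lemma nbhs_plane (z : R * R) (A : set (R * R)) :
  nbhs z A <-> exists2 e : R, 0 < e &
    forall w, `|w.1 - z.1| < e -> `|w.2 - z.2| < e -> A w.
Proof.
split=> [/nbhs_ballP[e e0 eA]|[e e0 eA]].
  by exists e => // w w1 w2; apply: eA; split; rewrite -ball_normE /= distrC.
apply/nbhs_ballP; exists e => // w [w1 w2]; apply: eA.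
  by move: w1; rewrite -ball_normE /= distrC.
by move: w2; rewrite -ball_normE /= distrC.
Qed.

(** Connectedness of the line: the local condition is symmetric in [a] and [b], so both [P] and its
    complement are open. *)
Lemma locally_constant (P : R -> Prop) :
  (forall t, exists2 e : R, 0 < e & forall a b,
     `|a - t| < e -> `|b - t| < e -> P a -> P b) ->
  forall a b, P a -> P b.
Proof.
move=> locP.
have oP (Q : R -> Prop) : (forall t, exists2 e : R, 0 < e & forall a b,
     `|a - t| < e -> `|b - t| < e -> Q a -> Q b) -> open [set t | Q t].
  move=> locQ; rewrite openE => t /= Qt; have [e e0 He] := locQ t.
  apply/nbhs_real; exists e => // s st; apply: (He t s) => //.
  by rewrite subrr normr0.
have oC : open [set t | ~ P t].
  apply: (oP (fun t => ~ P t)) => t; have [e e0 He] := locP t.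
  by exists e => // a b at_ bt nPa Pb; apply: nPa; exact: (He b a).
have cP : closed [set t | P t].
  by rewrite -openC (_ : ~` _ = [set t | ~ P t]).
have main a b : a <= b -> (P a -> P b) /\ (P b -> P a).
  move=> ab; have sc := @segment_connected R a b.
  have ca : `[a, b]%classic a by rewrite /= in_itv /= lexx.
  have cb : `[a, b]%classic b by rewrite /= in_itv /= lexx andbT.
  split=> Pab.
    have E : `[a, b]%classic `&` [set t | P t] = `[a, b]%classic.
      apply: sc; first by exists a.
        by exists [set t | P t] => //; exact: oP.
      by exists [set t | P t].
    by have : (`[a, b]%classic `&` [set t | P t]) b; [rewrite E|case].
  have E : `[a, b]%classic `&` [set t | P t] = `[a, b]%classic.
    apply: sc; first by exists b.
      by exists [set t | P t] => //; exact: oP.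
    by exists [set t | P t].
  by have : (`[a, b]%classic `&` [set t | P t]) a; [rewrite E|case].
move=> a b Pa; have [/main[h _]|/ltW/main[_ h]] := leP a b; exact: h.
Qed.

End plane.

(** * Holonomy of a cocycle on an open cover *)

Section transport.
Variables (R : realType) (S : topologicalType) (V : Type) (U : V -> set S).
Hypothesis openU : forall v, open (U v).
Hypothesis coverU : forall y, exists v, U v y.

(** A Lebesgue number for the cover pulled back to the unit square, obtained from the near-covering
    form of compactness: one radius $1/(n+1)$ serves all centres, and a cell of the grid lies in the
    box around its lower left corner. *)
Lemma square_subdivision (H : R * R -> S) : continuous H ->
  exists2 M : nat, (0 < M)%N & forall i j, (i < M)%N -> (j < M)%N ->
    exists v, forall s t, i%:R / M%:R <= s <= i.+1%:R / M%:R ->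
      j%:R / M%:R <= t <= j.+1%:R / M%:R -> U v (H (s, t)).
Proof.
move=> cH.
pose I := [set` `[0 : R, 1]]; pose K := I `*` I.
have cK : compact K by apply: compact_setX; exact: segment_compact.
pose P (n : nat) (z : R * R) := exists v, forall z' : R * R,
  `|z'.1 - z.1| <= n.+1%:R^-1 -> `|z'.2 - z.2| <= n.+1%:R^-1 -> U v (H z').
have [N _ HN] : \forall n \near \oo, K `<=` P n.
  apply: (proj1 (compact_near_coveringP K) cK) => z Kz.
  have [v Uv] := coverU (H z).
  have : nbhs z (H @^-1` U v) by apply: cH; apply: open_nbhs_nbhs.
  move=> /nbhs_plane[e e0 He].
  have e20 : 0 < e / 2 by rewrite divr_gt0.
  have nz : nbhs z [set z' : R * R | `|z'.1 - z.1| < e / 2 /\ `|z'.2 - z.2| < e / 2].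
    by apply/nbhs_plane; exists (e / 2).
  exists ([set z' : R * R | `|z'.1 - z.1| < e / 2 /\ `|z'.2 - z.2| < e / 2],
          [set n | n.+1%:R^-1 < e / 2]).
    by split=> //; exact: (near_infty_natSinv_lt (PosNum e20)).
  move=> [z' n] /= [[h1 h2] n_e]; exists v => z'' z1 z2.
  have {}z1 := le_lt_trans z1 n_e; have {}z2 := le_lt_trans z2 n_e.
  apply: He.
    rewrite -(subrKA z'.1); apply: (le_lt_trans (ler_normD _ _)); lra.
  rewrite -(subrKA z'.2); apply: (le_lt_trans (ler_normD _ _)); lra.
have {}HN := HN N (leqnn N).
exists N.+1 => // i j iN jN.
have M0 : 0 < N.+1%:R :> R by rewrite ltr0n.
have Kij : K (i%:R / N.+1%:R, j%:R / N.+1%:R).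
  split; rewrite /I /= in_itv /= divr_ge0 ?ler0n//= ler_pdivrMr// mul1r ler_nat ltnW//.
have [v Hv] := HN _ Kij; exists v => s t s1 t1; apply: Hv => /=.
  have E : i.+1%:R / N.+1%:R = i%:R / N.+1%:R + N.+1%:R^-1 :> R.
    by rewrite -natr1 mulrDl mul1r.
  rewrite E in s1; move: s1; set a := (i%:R / _); set d := (_^-1).
  by move=> s1; rewrite ger0_norm; lra.
have E : j.+1%:R / N.+1%:R = j%:R / N.+1%:R + N.+1%:R^-1 :> R.
  by rewrite -natr1 mulrDl mul1r.
rewrite E in t1; move: t1; set a := (j%:R / _); set d := (_^-1).
by move=> t1; rewrite ger0_norm; lra.
Qed.

Definition chain (N : nat) (w : nat -> V) (p : R -> S) :=
  forall j, (j < N)%N -> forall t, j%:R / N%:R <= t <= j.+1%:R / N%:R -> U (w j) (p t).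

Lemma chain_ex p : continuous p -> exists N w, (0 < N)%N /\ chain N w p.
Proof.
move=> cp; pose H (z : R * R) := p z.2.
have cH : continuous H by apply: (comp_continuous cp); exact: snd_continuous.
have [M M0 HM] := square_subdivision cH.
have [v0 _] := coverU (p 0).
have /choice[w Hw] : forall j, exists v, (j < M)%N ->
    forall t, j%:R / M%:R <= t <= j.+1%:R / M%:R -> U v (p t).
  move=> j; have [jM|_] := boolP (j < M)%N; last by exists v0.
  have [v Hv] := HM 0%N j M0 jM; exists v => _ t tj; apply: (Hv 0 t) => //.
  by rewrite mul0r lexx divr_ge0.
by exists M, w; split=> // j /Hw.
Qed.

Lemma chain_eq N w p q : (forall t, 0 <= t <= 1 -> p t = q t) ->
  chain N w p -> chain N w q.
Proof.
move=> pq cw j jN t tj; rewrite -pq; first exact: cw.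
have N0 : 0 < N%:R :> R by rewrite ltr0n (leq_trans _ jN).
case/andP: tj => tj tj'; apply/andP; split.
  by apply: le_trans tj; rewrite divr_ge0.
by apply: (le_trans tj'); rewrite ler_pdivrMr// mul1r ler_nat.
Qed.

Section values.
Variables (G : groupType) (lam : V -> V -> G).
Local Open Scope group_scope.
Hypothesis lamM : forall y u v w, U u y -> U v y -> U w y ->
  lam u v * lam v w = lam u w.

Lemma lam1 y u : U u y -> lam u u = 1.
Proof. by move=> Uy; apply: (mulgI (lam u u)); rewrite (lamM Uy Uy Uy) mulg1. Qed.

Definition lprod (w : nat -> V) (n : nat) := \prod_(0 <= i < n) lam (w i) (w i.+1).

Lemma lprod0 w : lprod w 0 = 1. Proof. by rewrite /lprod big_nil. Qed.
Lemma lprodS w n : lprod w n.+1 = lprod w n * lam (w n) (w n.+1).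
Proof. by rewrite /lprod big_nat_recr. Qed.

Definition cval u (w : nat -> V) N v := lam u (w 0%N) * lprod w N.-1 * lam (w N.-1) v.

Lemma chain_pt N w p j : chain N w p -> (j < N)%N ->
  U (w j) (p (j%:R / N%:R)%R) /\ U (w j) (p (j.+1%:R / N%:R)%R).
Proof.
move=> cw jN; have N0 : (0 < N%:R :> R)%R by rewrite ltr0n (leq_trans _ jN).
have h : (j%:R / N%:R <= (j.+1%:R / N%:R : R))%R by rewrite ler_pM2r ?invr_gt0// ler_nat.
by split; apply: cw => //; rewrite h lexx.
Qed.

(** With the same subdivision the two chains form a ladder with rungs [lam (w k) (w' k)]; the
    cocycle identity at the division points pushes the rung from one end to the other. *)
Lemma chain_ladder N w w' p u v : (0 < N)%N -> chain N w p -> chain N w' p ->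
  U u (p 0) -> U v (p 1%R) -> cval u w N v = cval u w' N v.
Proof.
move=> N0 cw cw' Uu Uv.
have E k : (k < N)%N ->
    lam u (w 0%N) * lprod w k * lam (w k) (w' k) = lam u (w' 0%N) * lprod w' k.
  elim: k => [|k IH] kN.
    rewrite !lprod0 !mulg1.
    have [h _] := chain_pt cw kN; have [h' _] := chain_pt cw' kN.
    by rewrite mul0r in h h'; rewrite (lamM Uu h h').
  have kN' := ltnW kN.
  have [_ h1] := chain_pt cw kN'; have [_ h1'] := chain_pt cw' kN'.
  have [h2 _] := chain_pt cw kN; have [h2' _] := chain_pt cw' kN.
  rewrite !lprodS -!mulgA (lamM h1 h2 h2') -(lamM h1 h1' h2') !mulgA.
  by rewrite -[_ * _ * lam (w k) _]/(_ * _) IH.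
have N1 : (N.-1 < N)%N by rewrite prednK.
have [_ h1] := chain_pt cw N1; have [_ h1'] := chain_pt cw' N1.
rewrite prednK// divff ?pnatr_eq0 -?lt0n// in h1 h1'.
by rewrite /cval -(lamM h1 h1' Uv) mulgA E.
Qed.

Lemma chain_refine N w p k : (0 < k)%N -> chain N w p ->
  chain (N * k) (fun j => w (j %/ k)%N) p.
Proof.
move=> k0 cw j jNk t tj; apply: cw; first by rewrite ltn_divLR.
have N0 : (0 < N)%N by case: (N) jNk => //; rewrite mul0n.
have N0' : (0 < N%:R :> R)%R by rewrite ltr0n.
have k0' : (0 < k%:R :> R)%R by rewrite ltr0n.
have NkE a b : ((a%:R / N%:R <= b%:R / (N * k)%:R :> R) = (a * k <= b)%N)%R.
  rewrite natrM invfM mulrA mulrAC ler_pM2r ?invr_gt0//.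
  by rewrite ler_pdivlMr// -natrM ler_nat.
have NkE' a b : ((b%:R / (N * k)%:R <= a%:R / N%:R :> R) = (b <= a * k)%N)%R.
  rewrite natrM invfM mulrA mulrAC ler_pM2r ?invr_gt0//.
  by rewrite ler_pdivrMr// -natrM ler_nat.
case/andP: tj => t1 t2; apply/andP; split.
  by apply: le_trans t1; rewrite NkE leq_divM.
by apply: le_trans t2 _; rewrite NkE' ltn_ceil.
Qed.

Lemma cval_refine N w p k u v : (0 < k)%N -> (0 < N)%N -> chain N w p ->
  cval u (fun j => w (j %/ k)%N) (N * k) v = cval u w N v.
Proof.
move=> k0 N0 cw.
have E n : (n < N * k)%N -> lprod (fun j => w (j %/ k)%N) n = lprod w (n %/ k).
  elim: n => [|n IH] nNk; first by rewrite div0n !lprod0.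
  rewrite lprodS IH; last exact: ltnW.
  have nN : (n %/ k < N)%N by rewrite ltn_divLR// ltnW.
  rewrite divnS//; case: (k %| n.+1)%N; first by rewrite add1n lprodS.
  by rewrite add0n; have [_ h] := chain_pt cw nN; rewrite (lam1 h) mulg1.
have lt1 : ((N * k).-1 < N * k)%N by rewrite prednK// muln_gt0 N0.
have E1 : ((N * k).-1 %/ k = N.-1)%N.
  have -> : ((N * k).-1 = N.-1 * k + k.-1)%N.
    by nia.
  by rewrite divnMDl// divn_small ?addn0// prednK.
by rewrite /cval E// E1 div0n.
Qed.

Lemma chain_uniq N w N' w' p u v : (0 < N)%N -> (0 < N')%N ->
  chain N w p -> chain N' w' p -> U u (p 0) -> U v (p 1%R) ->
  cval u w N v = cval u w' N' v.
Proof.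
move=> N0 N0' cw cw' Uu Uv.
(* Repeating charts brings both chains to the common length [N * N']. *)
rewrite -(cval_refine u v N0' N0 cw) -(cval_refine u v N0 N0' cw').
have c1 := chain_refine N0' cw; have c2 := chain_refine N0 cw'.
rewrite [(N' * N)%N]mulnC in c2 *.
by apply: (chain_ladder _ c1 c2) => //; rewrite muln_gt0 N0.
Qed.

(** The homotopy square is cut into a grid of cells, each inside one chart. Two neighbouring rows of
    cells share a line of the grid, and both give chains for the path along it, so [chain_ladder]
    compares them. *)
Lemma chain_homot N w N' w' p q u v : (0 < N)%N -> (0 < N')%N ->
  chain N w p -> chain N' w' q -> homot p q -> U u (p 0) -> U v (p 1%R) ->
  cval u w N v = cval u w' N' v.
Proof.
move=> N0 N0' cw cw' [H [cH h0 h1 h2 h3]] Uu Uv.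
have [M M0 HM] := square_subdivision cH.
have [v0 _] := coverU (p 0).
have /choice[a Ha] : forall i, exists a : nat -> V, (i < M)%N -> forall j, (j < M)%N ->
    forall s t, (i%:R / M%:R <= s <= i.+1%:R / M%:R)%R ->
      (j%:R / M%:R <= t <= j.+1%:R / M%:R)%R -> U (a j) (H (s, t)).
  move=> i; have [iM|_] := boolP (i < M)%N; last by exists (fun=> v0).
  have /choice[b Hb] : forall j, exists b : V, (j < M)%N ->
      forall s t, (i%:R / M%:R <= s <= i.+1%:R / M%:R)%R ->
      (j%:R / M%:R <= t <= j.+1%:R / M%:R)%R -> U b (H (s, t)).
    move=> j; have [jM|_] := boolP (j < M)%N; last by exists v0.
    by have [b Hb] := HM i j iM jM; exists b.
  by exists b => _ j /Hb.
have M0' : (0 < M%:R :> R)%R by rewrite ltr0n.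
have ra i s : (i < M)%N -> (i%:R / M%:R <= s <= i.+1%:R / M%:R)%R ->
    chain M (a i) (fun t => H (s, t)).
  by move=> iM si j jM t tj; exact: (Ha i iM j jM).
have lei i : (i%:R / M%:R <= (i.+1%:R / M%:R : R))%R.
  by rewrite ler_pM2r ?invr_gt0// ler_nat.
have i01 i : (i <= M)%N -> (0 <= (i%:R / M%:R : R) <= 1)%R.
  by move=> iM; rewrite divr_ge0//= ler_pdivrMr// mul1r ler_nat.
have rows i : (i < M)%N -> cval u (a 0%N) M v = cval u (a i) M v.
  elim: i => // i IH iM; rewrite IH ?(ltnW iM)//.
  have c1 := ra i (i.+1%:R / M%:R)%R (ltnW iM).
  have c2 := ra i.+1 (i.+1%:R / M%:R)%R iM.
  apply: (chain_ladder (p := fun t => H ((i.+1%:R / M%:R)%R, t)) M0).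
  - by apply: c1; rewrite lei lexx.
  - by apply: c2; rewrite lei lexx.
  - by rewrite h2// i01// ltnW.
  - by rewrite h3// i01// ltnW.
have M1 : (M.-1 < M)%N by rewrite prednK.
have cp : chain M (a 0%N) p.
  apply: chain_eq (ra 0%N 0%R M0 _) => [t t01|]; first exact: h0.
  by rewrite mul0r lexx divr_ge0.
have cq : chain M (a M.-1) q.
  apply: chain_eq (ra M.-1 1%R M1 _) => [t t01|]; first exact: h1.
  by rewrite prednK// divff ?pnatr_eq0 -?lt0n// lexx ler_pdivrMr// mul1r ler_nat leq_pred.
have z01 : (0 <= (0 : R) <= 1)%R by rewrite lexx ler01.
have o01 : (0 <= (1 : R) <= 1)%R by rewrite lexx ler01.
rewrite (chain_uniq N0 M0 cw cp Uu Uv) (rows _ M1).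
apply: (chain_uniq M0 N0' cq cw').
  by rewrite -h1// h2.
by rewrite -h1// h3.
Qed.

(* The holonomy of [lam] along [p], read in the charts [u] and [v]. *)
Definition pval (p : R -> S) u v : G :=
  if pselect (exists Nw : nat * (nat -> V), (0 < Nw.1)%N /\ chain Nw.1 Nw.2 p)
  is left H then cval u (sval (cid H)).2 (sval (cid H)).1 v else 1.

Lemma pvalE p N w u v : (0 < N)%N -> chain N w p -> U u (p 0) -> U v (p 1%R) ->
  pval p u v = cval u w N v.
Proof.
move=> N0 cw Uu Uv; rewrite /pval; case: pselect => [H|]; last by case; exists (N, w).
by case: cid => -[N' w'] /= [N0' cw']; exact: (chain_uniq (p := p)).
Qed.

Lemma pval_homot (p q : R -> S) u v : continuous p -> continuous q -> homot p q ->
  U u (p 0) -> U v (p 1%R) -> pval p u v = pval q u v.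
Proof.
move=> cp cq pq Uu Uv; have [E0 E1] := homot_ends pq.
have [N [w [N0 cw]]] := chain_ex cp; have [N' [w' [N0' cw']]] := chain_ex cq.
rewrite (pvalE N0 cw Uu Uv) (pvalE N0' cw') -?E0 -?E1//.
exact: (chain_homot N0 N0' cw cw').
Qed.

Lemma pval_in p u v w : (forall t, 0 <= t <= 1 -> U v (p t))%R -> U u (p 0) -> U w (p 1%R) ->
  pval p u w = lam u v * lam v w.
Proof.
move=> pv Uu Uw; rewrite (@pvalE p 1 (fun=> v))//; first by rewrite /cval lprod0 mulg1.
move=> [|//] _ t; rewrite !divr1 => t01; exact: pv.
Qed.

Lemma chain_concat N w w' p q : (0 < N)%N -> p 1%R = q 0%R -> chain N w p -> chain N w' q ->
  chain (N + N) (fun j => if (j < N)%N then w j else w' (j - N)%N) (concat p q).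
Proof.
move=> N0 pq cw cw' j jN t tj; rewrite /concat.
have N0' : (0 < N%:R :> R)%R by rewrite ltr0n.
have N0n : (N%:R != 0 :> R)%R by rewrite gt_eqF.
have E k : (k%:R / (N + N)%:R = 2^-1 * (k%:R / N%:R) :> R)%R.
  by rewrite natrD -mulr2n -[_ *+ 2]mulr_natl invfM mulrCA.
rewrite !E in tj; case: ltnP => jN'.
  have h : (j.+1%:R / N%:R <= (1 : R))%R by rewrite ler_pdivrMr// mul1r ler_nat.
  by rewrite ifT; [apply: cw => //|]; lra.
have E2 k : (N <= k)%N -> ((k - N)%:R / N%:R = k%:R / N%:R - 1 :> R)%R.
  by move=> Nk; rewrite natrB// mulrBl divff.
have jN2 : (j - N < N)%N by lia.
have h2 : ((1 : R) <= j%:R / N%:R)%R by rewrite ler_pdivlMr// mul1r ler_nat.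
have e1 := E2 _ jN'; have e2 := E2 j.+1 (leqW jN'); rewrite subSn// in e2.
case: ifP => t2; last by apply: cw' => //; lra.
have tE : (t = 2^-1)%R by lra.
rewrite tE divff ?pnatr_eq0// pq (_ : 0%R = (2 * 2^-1 - 1)%R); last by lra.
by apply: cw' => //; lra.
Qed.

(** Both chains are first refined to the same length, because the midpoint of the concatenation has
    to be a division point with equally many pieces on either side. *)
Lemma pval_concat (p q : R -> S) u v w : continuous p -> continuous q -> p 1%R = q 0%R ->
  U u (p 0%R) -> U v (p 1%R) -> U w (q 1%R) ->
  pval (concat p q) u w = pval p u v * pval q v w.
Proof.
move=> cp cq pq Uu Uv Uw.
have [N [a [N0 ca]]] := chain_ex cp; have [N' [b [N0' cb]]] := chain_ex cq.
have c1 := chain_refine N0' ca; have c2 := chain_refine N0 cb.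
rewrite [(N' * N)%N]mulnC in c2.
set M := (N * N')%N in c1 c2.
set a' := fun j => a (j %/ N')%N in c1; set b' := fun j => b (j %/ N)%N in c2.
have M0 : (0 < M)%N by rewrite muln_gt0 N0.
have Uv' : U v (q 0%R) by rewrite -pq.
rewrite (pvalE M0 c1 Uu Uv) (pvalE M0 c2 Uv' Uw).
have cc := chain_concat M0 pq c1 c2.
rewrite (pvalE _ cc) ?concat0 ?concat1 ?addn_gt0 ?M0//.
set d := fun j => _; rewrite /cval.
have E1 n : (n < M)%N -> lprod d n = lprod a' n.
  move=> nM; apply: eq_big_nat => i /andP[_ iN]; rewrite /d.
  by rewrite (ltn_trans iN nM) (leq_ltn_trans iN nM).
have dM k : d (M + k)%N = b' k by rewrite /d ltnNge leq_addr /= addKn.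
have E2 n : lprod d (M + n) = lprod d M * lprod b' n.
  elim: n => [|n IH]; first by rewrite addn0 lprod0 mulg1.
  by rewrite addnS !lprodS IH -!mulgA -addnS !dM.
have M1 : (M.-1 < M)%N by rewrite prednK.
have -> : ((M + M).-1 = M + M.-1)%N by move: M0; lia.
have -> : lprod d (M + M.-1) = lprod a' M.-1 * lam (d M.-1) (d M) * lprod b' M.-1.
  by have := lprodS d M.-1; rewrite (prednK M0) => E3; rewrite E2 E3 E1.
have -> : d 0%N = a' 0%N by rewrite /d M0.
have -> : d M.-1 = a' M.-1 by rewrite /d M1.
have -> : d M = b' 0%N by rewrite -(dM 0%N) addn0.
rewrite dM.
have [_ h1] := chain_pt c1 M1; have [h2 _] := chain_pt c2 M0.
have Mn0 : (M%:R != 0 :> R)%R by rewrite pnatr_eq0 -lt0n.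
rewrite (prednK M0) divff// in h1; rewrite mul0r -pq in h2.
by rewrite -(lamM h1 Uv h2) !mulgA.
Qed.

Lemma pval_end (p : R -> S) u v w : continuous p -> U u (p 0%R) -> U v (p 1%R) -> U w (p 1%R) ->
  pval p u w = pval p u v * lam v w.
Proof.
move=> cp Uu Uv Uw; have [N [a [N0 ca]]] := chain_ex cp.
rewrite (pvalE N0 ca Uu Uv) (pvalE N0 ca Uu Uw) /cval.
have N1 : (N.-1 < N)%N by rewrite prednK.
have [_ h1] := chain_pt ca N1; rewrite prednK// divff ?pnatr_eq0 -?lt0n// in h1.
by rewrite -(lamM h1 Uv Uw) !mulgA.
Qed.

End values.
End transport.

Local Close Scope group_scope.
Local Close Scope ring_scope.
Local Close Scope classical_set_scope.
Local Open Scope classical_set_scope.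
Local Open Scope ring_scope.

(** * The fundamental group of a space covered by contractible charts *)

Section nerve.
Variables (R : realType) (S : topologicalType) (x : S).
Variables (V : Type) (U : V -> set S) (c : V -> S) (rho : V -> S -> R -> S).
Hypothesis openU : forall v, open (U v).
Hypothesis coverU : forall y, exists v, U v y.
Hypothesis rho_cont : forall v y, U v y -> continuous (rho v y).
Hypothesis rho0 : forall v y, U v y -> rho v y 0 = y.
Hypothesis rho1 : forall v y, U v y -> rho v y 1 = c v.
Hypothesis rhoU : forall v y t, U v y -> 0 <= t <= 1 -> U v (rho v y t).
Hypothesis contract : forall v (p : R -> S), continuous p ->
  (forall t, 0 <= t <= 1 -> U v (p t)) ->
  exists H : R * R -> S,
  [/\ continuous H,
      forall t, 0 <= t <= 1 -> H (0, t) = p t,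
      forall t, 0 <= t <= 1 -> H (1, t) = c v,
      forall s, 0 <= s <= 1 -> H (s, 0) = rho v (p 0) s &
      forall s, 0 <= s <= 1 -> H (s, 1) = rho v (p 1) s].
Hypothesis joinU : forall u v y z, U u y -> U v y -> U u z -> U v z ->
  exists p : R -> S, [/\ continuous p, p 0 = y, p 1 = z &
    forall t, 0 <= t <= 1 -> U u (p t) /\ U v (p t)].
Hypothesis connS : connected [set: S].

Lemma nerve_path_connected y :
  exists p : R -> S, [/\ continuous p, p 0 = x & p 1 = y].
Proof.
pose A := [set y | exists p : R -> S, [/\ continuous p, p 0 = x & p 1 = y]].
have AU v z z' : A z -> U v z -> U v z' -> A z'.
  move=> [p [cp p0 p1]] Uz Uz'.
  have cr := rho_cont Uz; have cr' := prev_continuous (rho_cont Uz').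
  have crr : continuous (concat (rho v z) (prev (rho v z'))).
    by apply: concat_continuous => //; rewrite prev0 !rho1.
  exists (concat p (concat (rho v z) (prev (rho v z')))).
  rewrite concat0 !concat1 prev1 rho0//; split=> //.
  by apply: concat_continuous => //; rewrite concat0 rho0.
have oA : open A.
  rewrite openE => z Az; have [v Uv] := coverU z.
  apply: (filterS _ (open_nbhs_nbhs (conj (openU v) Uv))) => z' Uz'.
  exact: AU Az Uv Uz'.
have cA : closed A.
  rewrite -openC openE => z nAz; have [v Uv] := coverU z.
  apply: (filterS _ (open_nbhs_nbhs (conj (openU v) Uv))) => z' Uz' Az'.
  by apply: nAz; exact: AU Az' Uz' Uv.
have AT : A = [set: S].
  apply: connS; [by exists x, (cst x); split=> //; exact: cont_cst| |];
    by exists A; rewrite ?setTI.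
suff : A y by []; by rewrite AT.
Qed.

Local Notation G := (fundamental_group R x).
Local Notation gc := (based_class (x := x) nerve_path_connected).

Lemma gc_ext (p q : R -> S) : continuous p -> continuous q ->
  (forall t, 0 <= t <= 1 -> p t = q t) -> gc p = gc q.
Proof.
by move=> cp cq pq; apply: gc_homot => //; apply: (homot_eq pq); exact: homot_refl.
Qed.

Definition nr v y : G := gc (rho v y).

Local Open Scope group_scope.

(** The homotopy [contract] is a square whose sides are [p], the two rays and a constant path at the
    centre; [gc_square] turns it into this identity. *)
Lemma gc_nr v (p : R -> S) : continuous p -> (forall t, 0 <= t <= 1 -> U v (p t))%R ->
  gc p = nr v (p 0%R) * (nr v (p 1%R))^-1.
Proof.
move=> cp pU; have [H [cH h0 h1 h2 h3]] := contract cp pU.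
have cid : continuous (fun t : R => t) by move=> z; exact: cvg_id.
have Hc a : continuous (fun t => H (a, t)).
  by apply: (comp_continuous cH); apply: pair_continuous => //; exact: cont_cst.
have Hd a : continuous (fun t => H (t, a)).
  by apply: (comp_continuous cH); apply: pair_continuous => //; exact: cont_cst.
have := gc_square nerve_path_connected cH.
have U0 : U v (p 0%R) by apply: pU; rewrite lexx ler01.
have U1 : U v (p 1%R) by apply: pU; rewrite lexx ler01.
rewrite (gc_ext (Hc _) cp h0) (gc_ext (Hd _) (rho_cont U1) h3).
rewrite (gc_ext (Hd _) (rho_cont U0) h2).
have -> : gc (fun t => H (1%R, t)) = gc (cst (c v)) by apply: gc_ext => //; exact: cont_cst.
by rewrite gc_cst mulg1 /nr => <-; rewrite mulgK.
Qed.

(** An edge of the nerve: from the centre of [u] back along a ray to a common point, then along a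
    ray to the centre of [v]. The common point does not matter ([ngE]) because two charts meet in a
    path connected set; disjoint charts get the value 1. *)
Definition ng u v : G :=
  if pselect (exists m, U u m /\ U v m) is left H
  then (nr u (sval (cid H)))^-1 * nr v (sval (cid H)) else 1.

Lemma ngE u v m : U u m -> U v m -> ng u v = (nr u m)^-1 * nr v m.
Proof.
move=> Uu Uv; rewrite /ng; case: pselect => [H|]; last by case; exists m.
case: cid => z /= [Zu Zv]; have [p [cp p0 p1 pU]] := joinU Uu Uv Zu Zv.
have E1 := gc_nr cp (fun t t01 => (pU t t01).1).
have E2 := gc_nr cp (fun t t01 => (pU t t01).2).
rewrite p0 p1 in E1 E2; rewrite E1 in E2.
apply: (mulgI (nr u m)); rewrite mulVKg; apply: (mulIg (nr v z)^-1).
by rewrite -E2 !mulgA mulgK.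
Qed.

Lemma ngM u v w m : U u m -> U v m -> U w m -> ng u v * ng v w = ng u w.
Proof. by move=> Uu Uv Uw; rewrite !(@ngE _ _ m)// mulgA mulgK. Qed.

Definition is_subgroup (H : groupType) (Q : H -> Prop) :=
  [/\ Q 1, forall a b, Q a -> Q b -> Q (a * b) & forall a, Q a -> Q a^-1].

(** The generation half of van Kampen's theorem. For an initial segment of a path, the condition
    that its class, corrected by [sg] at both ends, lies in [Q] is locally constant in the end of
    the segment. The gauge [s] is left free so that a spanning tree can be used for it. *)
Lemma nerve_generates (Q : G -> Prop) (s : V -> G) : is_subgroup Q ->
  (forall u v m, U u m -> U v m -> Q (s u * ng u v * (s v)^-1)) -> forall g, Q g.
Proof.
move=> [Q1 QM QV] Qs.
have /choice[ch chP] := coverU.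
pose sg y := nr (ch y) y * (s (ch y))^-1.
have Qsg v y : U v y -> Q ((sg y)^-1 * (nr v y * (s v)^-1)).
  move=> Uv; have := Qs (ch y) v y (chP y) Uv; rewrite (ngE (chP y) Uv).
  by rewrite /sg invgM invgK !mulgA.
have Qp (p : R -> S) : continuous p -> Q ((sg (p 0%R))^-1 * gc p * sg (p 1%R)).
  move=> cp; rewrite -(gc_segE _ p).
  pose P b := Q ((sg (p 0%R))^-1 * gc (seg p 0%R b) * sg (p b)).
  apply: (@locally_constant R P _ 0%R 1%R); last first.
    rewrite /P (_ : seg p 0%R 0%R = cst (p 0%R)) ?gc_cst ?mulg1 ?mulVg//.
    by apply/funext => t; rewrite /seg subr0 mul0r add0r.
  move=> t; have [v Uv] := coverU (p t).
  have : nbhs t (p @^-1` U v) by apply: cp; exact: open_nbhs_nbhs.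
  move=> /nbhs_real[e e0 He]; exists e => // a b ae be; rewrite /P => Pa.
  rewrite -(gc_seg _ 0%R a b cp).
  have cs : continuous (seg p a b) by exact: seg_continuous.
  have -> : gc (seg p a b) = nr v (p a) * (nr v (p b))^-1.
    rewrite (gc_nr (v := v) cs) ?seg0 ?seg1// => r r01; rewrite /seg; apply: He.
    have -> : ((b - a) * r + a - t = r * (b - t) + (1 - r) * (a - t))%R by ring.
    apply: (le_lt_trans (ler_normD _ _)); rewrite !normrM.
    rewrite (ger0_norm (_ : 0 <= r)%R) ?(ger0_norm (_ : 0 <= 1 - r)%R); try by lra.
    have [->|r0] := eqVneq r 0%R; first by rewrite mul0r add0r subr0 mul1r.
    have r0' : (0 < r)%R by rewrite lt_neqAle eq_sym r0; lra.
    have h1 : (r * `|b - t| < r * e)%R by rewrite ltr_pM2l.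
    have h2 : ((1 - r) * `|a - t| <= (1 - r) * e)%R by rewrite ler_wpM2l//; lra.
    by apply: lt_le_trans (ltr_leD h1 h2) _; rewrite -mulrDl addrC subrK mul1r.
  have Ua : U v (p a) by exact: He.
  have Ub : U v (p b) by exact: He.
  have := QM _ _ (QM _ _ Pa (Qsg _ _ Ua)) (QV _ (Qsg _ _ Ub)).
  by rewrite !invgM !invgK !mulgA !(mulgK, mulgVK).
move=> g.
(* The based class of a loop is only conjugate to its class; conjugating [g] by [k'] beforehand
   cancels this and the correction [sg x] at once. *)
pose k : G := cl x (gauge nerve_path_connected x).
pose k' := (sg x)^-1 * k.
have [p lp Ep] := cl_surj (k'^-1 * g * k').
have [cp p0 p1] := lp.
have := Qp _ cp; rewrite gc_loop// -Ep p0 p1 -/k.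
suff -> : (sg x)^-1 * (k * (k'^-1 * g * k') * k^-1) * sg x = g by [].
by rewrite /k' !gnorm.
Qed.

Section hom.
Variables (H : groupType) (lam : V -> V -> H).
Hypothesis lamM : forall y u v w, U u y -> U v y -> U w y ->
  lam u v * lam v w = lam u w.
Local Notation pval := (pval U lam).

(** The other half of van Kampen's theorem: holonomy is invariant under homotopy, so it defines a
    homomorphism. On [ng] it agrees with [lam] up to the coboundary of [t], the holonomy of the path
    chosen from the base point to each centre. *)
Lemma nerve_hom : exists (f : G -> H) (t : V -> H), is_hom f /\
  forall u v m, U u m -> U v m -> f (ng u v) = t u * lam u v * (t v)^-1.
Proof.
have [b Ub] := coverU x.
pose f (g : G) : H := pval (s2val (cid2 (cl_surj g))) b b.
have fE p : is_loop x p -> f (cl x p) = pval p b b.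
  move=> lp; rewrite /f; case: cid2 => q /= lq E.
  have [cp p0 p1] := lp; have [cq q0 q1] := lq.
  by apply: (pval_homot openU coverU lamM) => //; rewrite ?q0 ?q1//; exact: cl_inj (esym E).
have fM : is_hom f.
  move=> g g'; have [p lp ->] := cl_surj g; have [q lq ->] := cl_surj g'.
  have [cp p0 p1] := lp; have [cq q0 q1] := lq.
  rewrite -clM// !fE//; last exact: is_loop_concat.
  by apply: (pval_concat openU coverU lamM); rewrite ?p0 ?p1 ?q0 ?q1.
pose ga := gauge nerve_path_connected.
have gaP y : [/\ continuous (ga y), ga y 0%R = x & ga y 1%R = y] by exact: gaugeP.
have pvV y v : U v y -> pval (prev (ga y)) v b = (pval (ga y) b v)^-1.
  move=> Uv; have [cg g0 g1] := gaP y; have cV := prev_continuous cg.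
  apply/esym/mulg1_eq.
  rewrite -(pval_concat openU coverU lamM) ?prev0 ?prev1 ?g0 ?g1//.
  have cc : continuous (cst x : R -> S) by exact: cont_cst.
  have cgV : continuous (concat (ga y) (prev (ga y))).
    by apply: concat_continuous; rewrite ?prev0.
  have h := homot_concatV cg; rewrite g0 in h.
  rewrite (pval_homot openU coverU lamM cgV cc h) ?concat0 ?concat1 ?prev1 ?g0//.
  by rewrite (pval_in lamM (v := b))// !(lam1 lamM Ub) mulg1.
have fgc (p : R -> S) u v : continuous p -> U u (p 0%R) -> U v (p 1%R) ->
    f (gc p) = pval (ga (p 0%R)) b u * pval p u v * (pval (ga (p 1%R)) b v)^-1.
  move=> cp Uu Uv; have [c0 a0 b0] := gaP (p 0%R); have [c1 a1 b1] := gaP (p 1%R).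
  rewrite /based_class fE; last exact: gloop_loop.
  have cV := prev_continuous c1.
  have ce : concat (ga (p 0%R)) p 1%R = prev (ga (p 1%R)) 0%R.
    by rewrite concat1 prev0 b1.
  have cc : continuous (concat (ga (p 0%R)) p) by exact: concat_continuous.
  have U0 : U b (concat (ga (p 0%R)) p 0%R) by rewrite concat0 a0.
  have U1 : U v (concat (ga (p 0%R)) p 1%R) by rewrite concat1.
  have U2 : U b (prev (ga (p 1%R)) 1%R) by rewrite prev1 a1.
  rewrite /gloop (pval_concat openU coverU lamM cc cV ce U0 U1 U2) pvV//.
  by rewrite (pval_concat openU coverU lamM (v := u)) ?a0 ?b0.
pose t v := pval (ga (c v)) b v.
have fnr v y : U v y -> f (nr v y) = pval (ga y) b v * (t v)^-1.
  move=> Uv; have cr := rho_cont Uv.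
  have U0 : U v (rho v y 0%R) by rewrite rho0.
  have U1 : U v (rho v y 1%R) by apply: rhoU => //; rewrite lexx ler01.
  have Ur r : (0 <= r <= 1)%R -> U v (rho v y r) by move=> r01; exact: rhoU.
  have E := pval_in lamM Ur U0 U1.
  by rewrite /nr (fgc _ v v)// E rho0// rho1// !(lam1 lamM Uv) !mulg1.
exists f, t; split=> // u v m Uu Uv.
rewrite (ngE Uu Uv) fM homV// !fnr// invgM invgK.
have [cg g0 g1] := gaP m.
rewrite (pval_end openU coverU lamM (v := u) (w := v)) ?g0 ?g1//.
by rewrite !mulgA mulgVK.
Qed.

End hom.
End nerve.

Local Close Scope group_scope.
Local Close Scope ring_scope.
Local Close Scope classical_set_scope.
Local Open Scope classical_set_scope.
Local Open Scope ring_scope.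

Lemma rV_continuous (R : realType) (Z : topologicalType) n (f : Z -> 'rV[R]_n) :
  (forall i, continuous (fun z => f z 0 i)) -> continuous f.
Proof.
move=> cf z A /nbhs_ballP[e e0 eA].
have : \forall z' \near z, forall i, ball (f z 0 i) e (f z' 0 i).
  apply: filter_forall => i; apply: (cf i z).
  exact: nbhsx_ballx.
apply: filterS => z' h; apply: eA; split=> // i j.
by rewrite ord1; exact: h.
Qed.

(** * Triangulated spaces and their open stars *)

Section realization.
Variables (R : realType) (n : nat) (K : {set {set 'I_n}}).
Hypothesis complexK : simplicial_complex K.
Implicit Types (t m : 'rV[R]_n) (v : 'I_n).

Definition supp t : {set 'I_n} := [set i | t 0 i != 0]%SET.

Lemma face_closed (A B : {set 'I_n}) : A \in K -> B \subset A -> B != finset.set0 -> B \in K.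
Proof. by case: complexK => _; exact. Qed.

Lemma supp_neq0 t : \sum_i t 0 i = 1 -> supp t != finset.set0.
Proof.
move=> t1; apply/eqP => E.
have : \sum_i t 0 i = 0.
  rewrite big1// => i _; apply/eqP/negPn/negP => ti.
  have : i \in supp t by rewrite inE.
  by rewrite E inE.
by move/eqP; rewrite t1 oner_eq0.
Qed.

Definition bary (A : {set 'I_n}) : 'rV[R]_n :=
  \row_i (if i \in A then #|A|%:R^-1 else 0).

Lemma baryE A i : bary A 0 i = if i \in A then #|A|%:R^-1 else 0.
Proof. by rewrite mxE. Qed.

Lemma supp_bary A : supp (bary A) = A.
Proof.
apply/setP => i; rewrite inE baryE; case: ifP => iA; last by rewrite eqxx.
by rewrite invr_eq0 pnatr_eq0 cards_eq0; apply/set0Pn; exists i.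
Qed.

Lemma bary_ge0 A i : 0 <= bary A 0 i.
Proof. by rewrite baryE; case: ifP => // _; rewrite invr_ge0. Qed.

Lemma bary_sum A : A != finset.set0 -> \sum_i bary A 0 i = 1.
Proof.
move=> A0; under eq_bigr do rewrite baryE; rewrite -big_mkcond /= sumr_const.
by rewrite -[_ *+ _]mulr_natl mulfV// pnatr_eq0 cards_eq0.
Qed.

Lemma K_neq0 A : A \in K -> A != finset.set0.
Proof. by case: complexK => K0 _ AK; apply: contraNneq K0 => <-. Qed.

Lemma bary_real A : A \in K -> geometric_realization K (bary A).
Proof.
move=> AK; split; [exact: bary_ge0|exact/bary_sum/K_neq0|].
by rewrite -/(supp _) supp_bary.
Qed.

Definition cl01 (r : R) : R := Num.max 0 (Num.min r 1).
Lemma cl01_itv r : 0 <= cl01 r <= 1.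
Proof. by rewrite /cl01 le_max lexx ge_max ler01 ge_min lexx orbT. Qed.
Lemma cl01E r : 0 <= r <= 1 -> cl01 r = r.
Proof. by case/andP => r0 r1; rewrite /cl01 (min_idPl r1) (max_idPr r0). Qed.
Lemma cl01_cont : continuous cl01.
Proof.
apply: cont_max; first exact: cont_cst.
by apply: cont_min; [move=> z; exact: cvg_id|exact: cont_cst].
Qed.

(** The parameter is clamped so that the segment stays inside the realization for every real
    parameter, as paths are defined on the whole line. *)
Definition mix t m (r : R) : 'rV[R]_n := (1 - cl01 r) *: t + cl01 r *: m.
Lemma mixE t m r i : mix t m r 0 i = (1 - cl01 r) * t 0 i + cl01 r * m 0 i.
Proof. by rewrite !mxE. Qed.
Lemma mix0 t m : mix t m 0 = t.
Proof. by rewrite /mix cl01E ?lexx ?ler01// subr0 scale1r scale0r addr0. Qed.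
Lemma mix1 t m : mix t m 1 = m.
Proof. by rewrite /mix cl01E ?lexx ?ler01// subrr scale1r scale0r add0r. Qed.

Lemma mix_pos t m r v : (forall i, 0 <= t 0 i) -> (forall i, 0 <= m 0 i) ->
  0 < t 0 v -> 0 < m 0 v -> 0 < mix t m r 0 v.
Proof.
move=> t0 m0 tv mv; rewrite mixE; have := cl01_itv r; set c := cl01 r => c01.
have [->|c0] := eqVneq c 0; first by rewrite subr0 mul1r mul0r addr0.
have cp : 0 < c by rewrite lt_neqAle eq_sym c0; lra.
have : 0 < c * m 0 v by rewrite mulr_gt0.
have : 0 <= (1 - c) * t 0 v by apply: mulr_ge0 (ltW tv); lra.
by lra.
Qed.

Lemma mix_real t m r : geometric_realization K t -> geometric_realization K m ->
  supp m \subset supp t -> geometric_realization K (mix t m r).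
Proof.
move=> [t0 t1 tK] [m0 m1 mK] mt; have := cl01_itv r => c01.
have s1 : \sum_i mix t m r 0 i = 1.
  under eq_bigr do rewrite mixE.
  by rewrite big_split /= -!mulr_sumr t1 m1; ring.
split=> //.
- by move=> i; rewrite mixE addr_ge0// mulr_ge0//; lra.
- apply: (face_closed tK); last exact: supp_neq0.
  apply/fintype.subsetP => i ti; have [mi|] := boolP (i \in supp m).
    exact: (fintype.subsetP mt).
  rewrite inE negbK => /eqP mi; move: ti; rewrite !inE mixE mi mulr0 addr0.
  by apply: contraNneq => ->; rewrite mulr0.
Qed.

Lemma mix_cont (Z : topologicalType) (f g : Z -> 'rV[R]_n) (r : Z -> R) :
  (forall i, continuous (fun z => f z 0 i)) ->
  (forall i, continuous (fun z => g z 0 i)) -> continuous r ->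
  forall i, continuous (fun z => mix (f z) (g z) (r z) 0 i).
Proof.
move=> cf cg cr i.
have -> : (fun z => mix (f z) (g z) (r z) 0 i) =
    (fun z => (1 - cl01 (r z)) * f z 0 i + cl01 (r z) * g z 0 i).
  by apply/funext => z; rewrite mixE.
have cc := comp_continuous cl01_cont cr.
apply: contD; apply: contM => //; apply: contB => //; exact: cont_cst.
Qed.

End realization.

Section triangulated.
Variables (R : realType) (S : topologicalType) (n : nat) (K : {set {set 'I_n}}).
Hypothesis complexK : simplicial_complex K.
Local Notation X := (set_type (@geometric_realization R n K)).
Variables (h : S -> X) (k : X -> S).
Hypotheses (ch : continuous h) (ck : continuous k) (hk : cancel h k) (kh : cancel k h).
Variable x : S.

Definition co (y : S) : 'rV[R]_n := set_val (h y).

Lemma co_real y : geometric_realization K (co y).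
Proof. exact: set_mem (valP (h y)). Qed.

Lemma co_ge0 y i : 0 <= co y 0 i. Proof. by case: (co_real y). Qed.

Lemma co_cont i : continuous (fun y => co y 0 i).
Proof.
apply: (comp_continuous (@coord_continuous R 1 n 0 i)).
by apply: (comp_continuous _ ch); exact: initial_continuous.
Qed.

(* Points outside the realization are sent to the basepoint. *)
Definition pt (t : 'rV[R]_n) : S :=
  if pselect (geometric_realization K t) is left H then k (SigSub (mem_set H)) else x.

Lemma co_pt t : geometric_realization K t -> co (pt t) = t.
Proof. by move=> tK; rewrite /pt; case: pselect => // H; rewrite /co kh. Qed.

Lemma pt_co y : pt (co y) = y.
Proof.
rewrite /pt; case: pselect => [H|]; last by case; exact: co_real.
by rewrite -[RHS]hk; congr k; apply: val_inj.
Qed.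

Lemma pt_cont (Z : topologicalType) (f : Z -> 'rV[R]_n) :
  (forall z, geometric_realization K (f z)) ->
  (forall i, continuous (fun z => f z 0 i)) -> continuous (fun z => pt (f z)).
Proof.
move=> fK cf.
pose F z : X := SigSub (mem_set (fK z)).
have cF : continuous F.
  by apply: continuous_comp_initial; exact: rV_continuous.
have -> : (fun z => pt (f z)) = (fun z => k (F z)).
  apply/funext => z; rewrite /pt; case: pselect => [H|]; last by case.
  by congr k; apply: val_inj.
exact: (comp_continuous ck).
Qed.

Definition star (v : 'I_n) : set S := [set y | 0 < co y 0 v].

Lemma star_supp v y : star v y -> v \in supp (co y).
Proof. by rewrite /star /= inE => /gt_eqF->. Qed.

Lemma supp_star v y : v \in supp (co y) -> star v y.
Proof. by rewrite /star /= inE lt_neqAle eq_sym co_ge0 andbT. Qed.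

Lemma star_open v : open (star v).
Proof.
have : open [set r : R | 0 < r] by exact: open_gt.
by apply: open_comp => y _; exact: co_cont.
Qed.

Lemma star_cover y : exists v, star v y.
Proof.
have [_ t1 _] := co_real y; have /set0Pn[v vy] := supp_neq0 t1.
by exists v; exact: supp_star.
Qed.

Definition vert v : S := pt (bary R [set v]%SET).

Definition ray v (y : S) (r : R) : S := pt (mix (co y) (bary R [set v]%SET) r).

Lemma vert_real v y : star v y -> geometric_realization K (bary R [set v]%SET).
Proof.
move=> vy; apply: (bary_real R complexK); have [_ _ yK] := co_real y.
apply: (face_closed complexK yK); first by rewrite finset.sub1set; exact: star_supp.
by apply/set0Pn; exists v; rewrite inE.
Qed.

Lemma ray_real v y r : star v y -> geometric_realization K (mix (co y) (bary R [set v]%SET) r).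
Proof.
move=> vy; apply: (mix_real complexK); [exact: co_real|exact: vert_real vy|].
by rewrite supp_bary finset.sub1set star_supp.
Qed.

Lemma co_coord_cont (Z : topologicalType) (p : Z -> S) : continuous p ->
  forall i, continuous (fun z => co (p z) 0 i).
Proof. by move=> cp i; exact: (comp_continuous (@co_cont i)). Qed.

Lemma ray_star v y r : star v y -> star v (ray v y r).
Proof.
move=> vy; rewrite /star /= co_pt; last exact: ray_real.
apply: mix_pos => //; [exact: co_ge0|exact: bary_ge0|].
by rewrite baryE inE eqxx cards1 invr1.
Qed.

Lemma star_contract v (p : R -> S) : continuous p ->
  (forall t, 0 <= t <= 1 -> star v (p t)) ->
  exists H : R * R -> S,
  [/\ continuous H,
      forall t, 0 <= t <= 1 -> H (0, t) = p t,
      forall t, 0 <= t <= 1 -> H (1, t) = vert v,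
      forall s, 0 <= s <= 1 -> H (s, 0) = ray v (p 0) s &
      forall s, 0 <= s <= 1 -> H (s, 1) = ray v (p 1) s].
Proof.
move=> cp pv; exists (fun z => ray v (p (cl01 z.2)) z.1).
have pv' s : star v (p (cl01 s)) by apply: pv; exact: cl01_itv.
have c0 : cl01 (0 : R) = 0 by rewrite cl01E// lexx ler01.
have c1 : cl01 (1 : R) = 1 by rewrite cl01E// lexx ler01.
split=> [|t t01|t t01|s s01|s s01] /=.
- apply: pt_cont => [z|]; first exact: ray_real.
  apply: mix_cont; last exact: fst_continuous.
    apply: co_coord_cont; apply: (comp_continuous cp).
    by apply: (comp_continuous (@cl01_cont R)); exact: snd_continuous.
  by move=> i; exact: cont_cst.
- by rewrite /ray mix0 pt_co cl01E.
- by rewrite /ray mix1.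
- by rewrite c0.
- by rewrite c1.
Qed.

(** Both points are joined by segments to the barycentre of the edge spanned by [u] and [v]. *)
Lemma star_join u v y z : star u y -> star v y -> star u z -> star v z ->
  exists p : R -> S, [/\ continuous p, p 0 = y, p 1 = z &
    forall t, 0 <= t <= 1 -> star u (p t) /\ star v (p t)].
Proof.
move=> uy vy uz vz; pose m := bary R [set u; v]%SET.
have mK : geometric_realization K m.
  apply: (bary_real R complexK); have [_ _ yK] := co_real y.
  apply: (face_closed complexK yK); last by apply/set0Pn; exists u; rewrite !inE eqxx.
  by apply/fintype.subsetP => i; rewrite !inE => /orP[]/eqP->; [have := star_supp uy|have := star_supp vy];
    rewrite inE.
have um : 0 < m 0 u by rewrite baryE !inE eqxx invr_gt0 ltr0n; apply/card_gt0P; exists u; rewrite !inE eqxx.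
have vm : 0 < m 0 v by rewrite baryE !inE eqxx orbT invr_gt0 ltr0n; apply/card_gt0P; exists u; rewrite !inE eqxx.
pose q y (r : R) := pt (mix (co y) m r).
have qK y' r : star u y' -> star v y' -> geometric_realization K (mix (co y') m r).
  move=> uy' vy'; apply: (mix_real complexK); [exact: co_real|exact: mK|].
  rewrite supp_bary; apply/fintype.subsetP => i; rewrite !inE => /orP[]/eqP->.
    by have := star_supp uy'; rewrite inE.
  by have := star_supp vy'; rewrite inE.
have cq y' : star u y' -> star v y' -> continuous (q y').
  move=> uy' vy'; apply: pt_cont => [r|]; first exact: qK.
  by apply: mix_cont => [i|i|]; [exact: cont_cst|exact: cont_cst|move=> r; exact: cvg_id].
have qs y' r : star u y' -> star v y' -> star u (q y' r) /\ star v (q y' r).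
  move=> uy' vy'; rewrite /star /= co_pt; last exact: qK.
  by split; apply: mix_pos => //; try exact: co_ge0; exact: bary_ge0.
have q0 y' : q y' 0 = y' by rewrite /q mix0 pt_co.
have q1 y' : q y' 1 = pt m by rewrite /q mix1.
exists (concat (q y) (prev (q z))).
rewrite concat0 concat1 prev1 !q0; split=> //.
  apply: concat_continuous; [exact: cq|exact/prev_continuous/cq|].
  by rewrite prev0 !q1.
by move=> t _; rewrite /concat /prev; case: ifP => _; exact: qs.
Qed.

Hypothesis connS : connected [set: S].
Local Notation G := (fundamental_group R x).

(** The cover consists of the open stars, and stars have a common point exactly when their vertices
    span a simplex; so the cocycle condition is one relation per triangle. Degenerate triangles are
    included: they give [g v v = 1] and make [g v u] inverse to [g u v]. The coboundary terms [t]
    and [s] are absorbed later by a spanning tree. *)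
Theorem triangulated_group : exists g : 'I_n -> 'I_n -> G,
  [/\ forall u v w, [set u; v; w]%SET \in K -> (g u v * g v w = g u w)%g,
      forall (H : groupType) (lam : 'I_n -> 'I_n -> H),
        (forall u v w, [set u; v; w]%SET \in K -> (lam u v * lam v w = lam u w)%g) ->
        exists (f : G -> H) (t : 'I_n -> H), is_hom f /\
          forall u v, [set u; v]%SET \in K -> (f (g u v) = t u * lam u v * (t v)^-1)%g &
      forall (Q : G -> Prop) (s : 'I_n -> G), is_subgroup Q ->
        (forall u v, [set u; v]%SET \in K -> Q (s u * g u v * (s v)^-1)%g) ->
        forall a, Q a].
Proof.
have rc v y : star v y -> continuous (ray v y).
  move=> vy; apply: pt_cont => [r|]; first exact: ray_real.
  by apply: mix_cont => [i|i|]; [exact: cont_cst|exact: cont_cst|move=> r; exact: cvg_id].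
have r0 v y : star v y -> ray v y 0 = y by move=> _; rewrite /ray mix0 pt_co.
have r1 v y : star v y -> ray v y 1 = vert v by move=> _; rewrite /ray mix1.
have rs v y t : star v y -> 0 <= t <= 1 -> star v (ray v y t).
  by move=> vy _; exact: ray_star.
have inK (A : {set 'I_n}) : A \in K -> exists y, forall v, v \in A -> star v y.
  move=> AK; exists (pt (bary R A)) => v vA; apply: supp_star.
  by rewrite co_pt ?supp_bary//; apply: (bary_real R complexK).
have Kin (A : {set 'I_n}) y : A != finset.set0 -> (forall v, v \in A -> star v y) -> A \in K.
  move=> A0 Ay; have [_ _ yK] := co_real y; apply: (face_closed complexK yK) => //.
  by apply/fintype.subsetP => v /Ay/star_supp.
have set3 u v w y : star u y -> star v y -> star w y -> [set u; v; w]%SET \in K.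
  move=> uy vy wy; apply: (Kin _ y); first by apply/set0Pn; exists u; rewrite !inE eqxx.
  by move=> i; rewrite !inE => /orP[/orP[]|]/eqP->.
exists (ng x star_open star_cover rc r0 r1 connS).
split=> [u v w|H lam lamM|Q s Qs Qg].
- move=> /inK[y yA]; apply: (@ngM R S x _ star vert ray star_open star_cover rc r0 r1 star_contract star_join connS u v w y); apply: yA;
    by rewrite !inE eqxx ?orbT.
- have lamM' y u v w : star u y -> star v y -> star w y -> (lam u v * lam v w = lam u w)%g.
    by move=> uy vy wy; apply: lamM; exact: set3 uy vy wy.
  have [f [t [fM ft]]] := nerve_hom x star_open star_cover rc r0 r1 rs star_contract
    star_join connS lamM'.
  exists f, t; split=> // u v /inK[y yA].
  by apply: (ft u v y); apply: yA; rewrite !inE eqxx ?orbT.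
- apply: (@nerve_generates R S x _ star vert ray star_open star_cover rc r0 r1
    star_contract star_join connS Q s Qs) => u v y uy vy.
  apply: Qg; have := set3 _ _ _ _ uy uy vy.
  by rewrite finset.setUid.
Qed.

End triangulated.

(** * Closed surfaces and invariance of domain in the plane *)

Definition Z2 : Type := bool.
HB.instance Definition _ := Choice.on Z2.
HB.instance Definition _ := isGroup.Build Z2 addbA addFb addbF addbb addbb.

Lemma Z2C (x y : Z2) : (x * y = y * x)%g. Proof. exact: addbC. Qed.

(** * Winding numbers modulo two *)

Section winding.
Variable R : realType.
Local Notation plane := (R * R)%type.

(* [(false, s)] and [(true, s)] are the open half planes bounded by the axes
   [x = 0] and [y = 0]; [s] is the sign of the coordinate. The transport of
   [cross] around a loop is its winding number mod 2. *)
Definition half (v : bool * bool) : set plane := [set z |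
  let c := if v.1 then z.2 else z.1 in if v.2 then c < 0 else 0 < c].

Definition cross (u v : bool * bool) : Z2 :=
  ((u == (false, false)) && (v == (true, true))) ||
  ((u == (true, true)) && (v == (false, false))).

Lemma half_open v : open (half v).
Proof.
case: v => [[] []]; rewrite /half /=.
- by apply: (@open_comp _ _ snd [set r : R | r < 0]) => [z _|]; [exact: cvg_snd|exact: open_lt].
- by apply: (@open_comp _ _ snd [set r : R | 0 < r]) => [z _|]; [exact: cvg_snd|exact: open_gt].
- by apply: (@open_comp _ _ fst [set r : R | r < 0]) => [z _|]; [exact: cvg_fst|exact: open_lt].
- by apply: (@open_comp _ _ fst [set r : R | 0 < r]) => [z _|]; [exact: cvg_fst|exact: open_gt].
Qed.

Lemma half_cover (z : plane) : z != (0, 0) -> exists v, half v z.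
Proof.
case: z => a b; rewrite xpair_eqE negb_and => ab.
have [a0|a0|a0] := ltgtP a 0; [by exists (false, true)|by exists (false, false)|].
have [b0|b0|b0] := ltgtP b 0; [by exists (true, true)|by exists (true, false)|].
by move: ab; rewrite a0 b0 eqxx.
Qed.

Lemma crossM (z : plane) u v w : half u z -> half v z -> half w z ->
  (cross u v * cross v w = cross u w)%g.
Proof.
case: z => a b; case: u => [[] []]; case: v => [[] []]; case: w => [[] []];
  rewrite /half /cross //= => h1 h2 h3; exfalso; lra.
Qed.

Section space.
Variables (S : topologicalType) (m : S -> plane).
Hypotheses (cm : continuous m) (m0 : forall y, m y != (0, 0)).
Definition mhalf v : set S := m @^-1` half v.
Lemma mhalf_open v : open (mhalf v).
Proof. by apply: open_comp => [z _|]; [exact: cm|exact: half_open]. Qed.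
Lemma mhalf_cover y : exists v, mhalf v y.
Proof. exact: half_cover. Qed.
Lemma mhalfM (y : S) u v w : mhalf u y -> mhalf v y -> mhalf w y ->
  (cross u v * cross v w = cross u w)%g.
Proof. exact: crossM. Qed.
End space.

Definition wind (q : R -> plane) u v : Z2 := pval (mhalf q) cross (fun t : R => t) u v.

Lemma cont_id : continuous (fun t : R => t). Proof. by move=> z; exact: cvg_id. Qed.

Lemma wind_pull (S : topologicalType) (m : S -> plane) (p : R -> S) u v :
  continuous m -> (forall y, m y != (0, 0)) -> continuous p ->
  mhalf m u (p 0) -> mhalf m v (p 1) ->
  pval (mhalf m) cross p u v = wind (m \o p) u v.
Proof.
move=> cm m0 cp Uu Uv.
have [N [w [N0 cw]]] := chain_ex (mhalf_open cm) (mhalf_cover m0) cp.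
rewrite (pvalE (@mhalfM _ m) N0 cw Uu Uv) /wind.
by rewrite (@pvalE R R _ (mhalf (m \o p)) _ _ (@mhalfM _ (m \o p)) (fun t => t) N w).
Qed.

(** The homotopy is free. The tracks of the two ends are the same path, and their contributions
    cancel because the values lie in a commutative group. *)
Lemma wind_homotopy (H : plane -> plane) u v : continuous H ->
  (forall z, H z != (0, 0)) -> (forall s, 0 <= s <= 1 -> H (s, 0) = H (s, 1)) ->
  half u (H (0, 0)) -> half v (H (1, 0)) ->
  wind (fun t => H (0, t)) u u = wind (fun t => H (1, t)) v v.
Proof.
move=> cH H0 Hp Uu Uv.
have cx a : continuous (fun t : R => (a, t) : plane).
  by apply: pair_continuous; [exact: cont_cst|exact: cont_id].
have cy a : continuous (fun t : R => (t, a) : plane).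
  by apply: pair_continuous; [exact: cont_id|exact: cont_cst].
have oU := mhalf_open cH; have cU := mhalf_cover H0.
have UM := @mhalfM _ H.
have Uu1 : mhalf H u (0, 1) by rewrite /mhalf /= -Hp// lexx ler01.
have Uv1 : mhalf H v (1, 1) by rewrite /mhalf /= -Hp// lexx ler01.
have cidp : continuous (fun z : plane => z) by move=> z; exact: cvg_id.
have sq := homot_square cidp.
have E := pval_homot oU cU UM _ _ sq (u := u) (v := v).
have := E _ _ _ _; rewrite concat0 concat1 => {}E.
have {E} := E (concat_continuous (cx 0) (cy 1) erefl)
  (concat_continuous (cy 0) (cx 1) erefl) Uu Uv1.
rewrite (pval_concat oU cU UM (v := u))// (pval_concat oU cU UM (v := v))//.
rewrite !(wind_pull cH H0)//.
have -> : wind (H \o (fun t : R => (t, 1))) u v = wind (H \o (fun t : R => (t, 0))) u v.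
  have [N [w [N0 cw]]] := chain_ex oU cU (cy 0).
  have cw1 : chain (mhalf (H \o (fun t : R => (t, 0)))) N w (fun t : R => t) by [].
  have cw2 : chain (mhalf (H \o (fun t : R => (t, 1)))) N w (fun t : R => t).
    move=> j jN t tj; rewrite /mhalf /= -Hp; first exact: (cw j jN t tj).
    have N0' : (0 < N%:R :> R) by rewrite ltr0n.
    case/andP: tj => tj tj'; apply/andP; split.
      by apply: le_trans tj; rewrite divr_ge0.
    by apply: (le_trans tj'); rewrite ler_pdivrMr// mul1r ler_nat.
  by rewrite /wind (pvalE (@mhalfM _ _) N0 cw1)// (pvalE (@mhalfM _ _) N0 cw2).
by rewrite [RHS]Z2C => /mulIg.
Qed.

Lemma wind_cst c u : half u c -> wind (fun=> c) u u = 1%g.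
Proof.
move=> Uc; rewrite /wind (pval_in (@mhalfM _ _) (v := u))//.
by rewrite !(lam1 (@mhalfM _ (fun _ : R => c)) (y := 0)) ?mulg1.
Qed.

Definition anti (v : bool * bool) := (v.1, ~~ v.2).

Lemma anti_half v (z : plane) : half v z -> half (anti v) (- z.1, - z.2).
Proof. by case: z => a b; case: v => [[] []]; rewrite /half /=; rewrite ?oppr_lt0 ?oppr_gt0. Qed.

(** What remains after adding the antipodal crossing is a coboundary; this is the term that
    telescopes in [wind_odd]. *)
Lemma cross_anti (z : plane) u v : half u z -> half v z ->
  (cross u v * cross (anti u) (anti v) = (u.2 : Z2) * (v.2 : Z2))%g.
Proof.
case: z => a b; case: u => [[] []]; case: v => [[] []];
  rewrite /half /cross //= => h1 h2; exfalso; lra.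
Qed.

(** The charts along the second half of the loop are taken antipodal to those along the first half.
    By [cross_anti] the total telescopes to the signs of [u] and [anti u], which differ. *)
Lemma wind_odd (q : R -> plane) u : continuous q -> (forall t, q t != (0, 0)) ->
  (forall t, 0 <= t <= 2^-1 -> q (t + 2^-1) = (- (q t).1, - (q t).2)) ->
  half u (q 0) -> wind q u u = true.
Proof.
move=> cq q0 odd Uu.
have oU := mhalf_open cq; have cU := mhalf_cover q0; have UM := @mhalfM _ q.
pose h1 (t : R) := 2^-1 * t + 0; pose h2 (t : R) := 2^-1 * t + 2^-1.
have ch1 : continuous h1 by exact: cont_affine.
have ch2 : continuous h2 by exact: cont_affine.
have h12 : h1 1 = h2 0 by rewrite /h1 /h2; lra.
have E0 : concat h1 h2 = fun t => t.
  by apply/funext => t; rewrite /concat /h1 /h2; case: ifP => _; lra.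
have Ua : mhalf q (anti u) (h1 1).
  rewrite /mhalf /= (_ : h1 1 = 0 + 2^-1); last by rewrite /h1; lra.
  have z0 : 0 <= (0 : R) <= 2^-1 by lra.
  by rewrite (odd _ z0); exact: anti_half.
have h10 : h1 0 = 0 by rewrite /h1; lra.
have h21 : h2 1 = 2^-1 + 2^-1 by rewrite /h2; lra.
have Uu1 : mhalf q u (h2 1).
  have z0 : 0 <= (2^-1 : R) <= 2^-1 by lra.
  rewrite /mhalf /= h21 (odd _ z0).
  have := anti_half Ua; rewrite /mhalf /= (_ : h1 1 = 2^-1); last by rewrite /h1; lra.
  by rewrite /anti /= negbK -surjective_pairing.
rewrite /wind -E0 (pval_concat oU cU UM (v := anti u))//; last by rewrite h10.
have [N [w [N0 cw]]] := chain_ex oU cU ch1.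
have cw2 : chain (mhalf q) N (fun j => anti (w j)) h2.
  move=> j jN t tj; have N0' : (0 < N%:R :> R) by rewrite ltr0n.
  have t01 : 0 <= t <= 1.
    case/andP: tj => tj tj'; apply/andP; split.
      by apply: le_trans tj; rewrite divr_ge0.
    by apply: (le_trans tj'); rewrite ler_pdivrMr// mul1r ler_nat.
  have := cw j jN t tj; rewrite /mhalf /= /h1 /h2 addr0 => hw.
  have t0 : 0 <= 2^-1 * t <= 2^-1 by lra.
  by rewrite (odd _ t0); exact: anti_half.
have Uu0 : mhalf q u (h1 0) by rewrite h10.
have Ua0 : mhalf q (anti u) (h2 0) by rewrite -h12.
rewrite (pvalE UM N0 cw Uu0 Ua) (pvalE UM N0 cw2 Ua0 Uu1) /cval.
have tele n : (n < N)%N -> (lprod cross w n * lprod cross (fun j => anti (w j)) n =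
    ((w 0%N).2 : Z2) * ((w n).2 : Z2))%g.
  elim: n => [|n IH] nN; first by rewrite !lprod0 mulg1; exact/esym/addbb.
  have nN' := ltnW nN; have := IH nN'.
  have [_ a1] := chain_pt cw nN'; have [a2 _] := chain_pt cw nN.
  have := cross_anti a1 a2.
  rewrite !lprodS; move: (lprod _ _ _) (lprod _ _ _) (cross _ _) (cross _ _).
  by move: (w 0%N).2 (w n).2 (w n.+1).2; do 7 case=> //.
have N1 : (N.-1 < N)%N by rewrite prednK.
have := tele _ N1.
have [a0 _] := chain_pt cw N0; have [_ a1] := chain_pt cw N1.
rewrite mul0r in a0; rewrite prednK// divff ?pnatr_eq0 -?lt0n// in a1.
have := cross_anti Uu0 a0; have := cross_anti a1 Ua.
move: (lprod _ _ _) (lprod _ _ _) (cross u _) (cross _ (anti u)) (cross _ (anti (w 0%N))).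
have -> : anti (anti u) = u by case: (u) => ? []; rewrite /anti /= ?negbK.
move: (cross _ u) => x1 x2 x3 x4 x5 x6.
rewrite /anti /=; move: (w 0%N).2 (w N.-1).2 u.2 x1 x2 x3 x4 x5 x6.
by do 9 case=> //.
Qed.

Definition circ : R -> plane := locked (fun t => (cos (t * (2 * pi)), sin (t * (2 * pi)))).

Lemma circE : circ = fun t => (cos (t * (2 * pi)), sin (t * (2 * pi))).
Proof. by rewrite /circ -lock. Qed.

Lemma circ_cont : continuous circ.
Proof.
have c : continuous (fun t : R => t * (2 * pi)).
  by apply: contM; [exact: cont_id|exact: cont_cst].
by rewrite circE; apply: pair_continuous; apply: (comp_continuous _ c); [exact: continuous_cos|exact: continuous_sin].
Qed.

Lemma circ_norm t : (circ t).1 ^+ 2 + (circ t).2 ^+ 2 = 1.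
Proof. by rewrite circE; exact: cos2Dsin2. Qed.

Lemma circ_half t : circ (t + 2^-1) = (- (circ t).1, - (circ t).2).
Proof.
rewrite circE (_ : (t + 2^-1) * (2 * pi) = t * (2 * pi) + pi); last by field.
by rewrite cosDpi sinDpi.
Qed.

Lemma circ_period t : circ (t + 2^-1 + 2^-1) = circ t.
Proof. by rewrite !circ_half; case: (circ t) => a b /=; rewrite !opprK. Qed.

Lemma circ1 : circ 1 = circ 0.
Proof. by rewrite -(circ_period 0); congr circ; lra. Qed.

Definition disc : set plane := [set z | z.1 ^+ 2 + z.2 ^+ 2 <= 1].

Lemma circ_disc (a : R) t : -1 <= a <= 1 -> disc (a * (circ t).1, a * (circ t).2).
Proof.
move=> a1; rewrite /disc /= !exprMn -mulrDr circ_norm mulr1.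
by rewrite expr2; nra.
Qed.

(* Invariance of domain in the plane: if [y] were close to [f 0] but outside
   [f disc], then [t |-> f (circ t) - y] would be contractible in the punctured
   plane, although it is homotopic to an odd loop. *)
Theorem invariance_of_domain (f : plane -> plane) : continuous f ->
  (forall z w, disc z -> disc w -> f z = f w -> z = w) ->
  exists2 e : R, 0 < e & forall y : plane,
    `|y.1 - (f (0, 0)).1| < e -> `|y.2 - (f (0, 0)).2| < e ->
    exists2 z, disc z & f z = y.
Proof.
move=> cf injf; set f0 := f (0, 0).
have scal_cont (a : plane -> R) : continuous a ->
    continuous (fun z : plane => (a z * (circ z.2).1, a z * (circ z.2).2)).
  move=> ca; have cc : continuous (fun z : plane => circ z.2).
    by apply: (comp_continuous circ_cont); exact: snd_continuous.
  apply: pair_continuous; apply: contM => //.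
    by apply: (comp_continuous (@fst_continuous _ _)).
  by apply: (comp_continuous (@snd_continuous _ _)).
have cs : continuous (fun z : plane => cl01 z.1).
  by apply: (comp_continuous (@cl01_cont R)); exact: fst_continuous.
have c0 : cl01 (0 : R) = 0 by rewrite cl01E// lexx ler01.
have c1 : cl01 (1 : R) = 1 by rewrite cl01E// lexx ler01.
have circN0 t : ((circ t).1 != 0) || ((circ t).2 != 0).
  rewrite -negb_and; apply/negP => /andP[/eqP a /eqP b].
  by have := circ_norm t; rewrite a b expr0n addr0 => /eqP; rewrite eq_sym oner_eq0.
have f01 t : f (circ t) != f0.
  have d1 : disc (circ t) by rewrite /disc /= circ_norm.
  have d2 : disc (0, 0) by rewrite /disc /= expr0n addr0 ler01.
  apply/eqP => /(injf _ _ d1 d2) E; have := circN0 t.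
  by rewrite E /= eqxx.
(* The distance of the boundary curve from [f0] in the maximum norm; its minimum is positive by
   injectivity and serves as the radius [e]. *)
pose d (t : R) : R := Num.max `|(f (circ t)).1 - f0.1| `|(f (circ t)).2 - f0.2|.
have cfc : continuous (fun t => f (circ t)) by exact: (comp_continuous cf circ_cont).
have cd : continuous d.
  apply: cont_max; apply: cont_norm; apply: contB; try exact: cont_cst.
    by apply: (comp_continuous (@fst_continuous _ _)).
  by apply: (comp_continuous (@snd_continuous _ _)).
have [t0 _ dmin] : exists2 c, c \in `[0 : R, 1] & forall t, t \in `[0 : R, 1] -> d c <= d t.
  apply: EVT_min; first exact: ler01.
  by apply: continuous_subspaceT => t; exact: cd.
have d0 : 0 < d t0.
  rewrite lt_max !normr_gt0 !subr_eq0 -negb_and; apply: contra (f01 t0).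
  move=> /andP[/eqP E1 /eqP E2].
  by rewrite [f (circ t0)]surjective_pairing E1 E2 -surjective_pairing.
exists (d t0) => // y y1 y2; apply: contrapT => ny.
have {}ny z : disc z -> f z != y by move=> dz; apply/eqP => fz; apply: ny; exists z.
pose sub (a b : plane) : plane := (a.1 - b.1, a.2 - b.2).
have sub_cont (Z : topologicalType) (a b : Z -> plane) : continuous a -> continuous b ->
    continuous (fun z => sub (a z) (b z)).
  move=> ca cb; apply: pair_continuous; apply: contB.
  - by apply: (comp_continuous (@fst_continuous _ _)).
  - by apply: (comp_continuous (@fst_continuous _ _)).
  - by apply: (comp_continuous (@snd_continuous _ _)).
  - by apply: (comp_continuous (@snd_continuous _ _)).
have sub_neq0 a b : a != b -> sub a b != (0, 0).
  apply: contra; case: a b => [a1 a2] [b1 b2] /eqP[/= /eqP + /eqP].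
  by rewrite !subr_eq0 => /eqP-> /eqP->.
have [u Uu] : exists u, half u (sub (f (circ 0)) f0) by apply/half_cover/sub_neq0.
(* first homotopy: to an odd loop *)
pose H3 (z : plane) : plane :=
  sub (f ((1 + cl01 z.1)^-1 * (circ z.2).1, (1 + cl01 z.1)^-1 * (circ z.2).2))
      (f (- (cl01 z.1 / (1 + cl01 z.1)) * (circ z.2).1,
          - (cl01 z.1 / (1 + cl01 z.1)) * (circ z.2).2)).
have s1 (s : R) : 0 < 1 + cl01 s by have := cl01_itv s; lra.
have ci : continuous (fun z : plane => (1 + cl01 z.1)^-1).
  have c1s : continuous (fun z : plane => 1 + cl01 z.1).
    by apply: contD => //; exact: cont_cst.
  by move=> z; apply: cvgV; [rewrite gt_eqF|exact: c1s].
have cH3 : continuous H3.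
  apply: sub_cont; apply: (comp_continuous cf); apply: scal_cont => //.
  by apply: contN; apply: contM.
have inv1 (s : R) : 0 <= (1 + cl01 s)^-1 <= 1.
  by rewrite invr_ge0 ltW//= invf_le1//; have := cl01_itv s; lra.
have inv2 (s : R) : 0 <= cl01 s / (1 + cl01 s) <= 1.
  have := cl01_itv s => cs01; apply/andP; split; last by rewrite ler_pdivrMr//; lra.
  by apply: divr_ge0; lra.
have H30 z : H3 z != (0, 0).
  apply/sub_neq0/eqP.
  have d1 : disc ((1 + cl01 z.1)^-1 * (circ z.2).1, (1 + cl01 z.1)^-1 * (circ z.2).2).
    by apply: circ_disc; have := inv1 z.1; lra.
  have d2 : disc (- (cl01 z.1 / (1 + cl01 z.1)) * (circ z.2).1,
                  - (cl01 z.1 / (1 + cl01 z.1)) * (circ z.2).2).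
    by apply: circ_disc; have := inv2 z.1; lra.
  (* The two arguments of [f] in [H3] differ by exactly the unit vector [circ z.2], so injectivity
     keeps [H3] away from the origin; at parameter 1 they are antipodal, which makes that loop
     odd. *)
  have ij : (1 + cl01 z.1)^-1 - - (cl01 z.1 / (1 + cl01 z.1)) = 1.
    by rewrite opprK -[X in X + _]mul1r -mulrDl divff// gt_eqF.
  have k (a : R) : (1 + cl01 z.1)^-1 * a = - (cl01 z.1 / (1 + cl01 z.1)) * a -> a = 0.
    by move=> E; rewrite -[a]mul1r -ij mulrBl E subrr.
  move=> /(injf _ _ d1 d2) E; have := circN0 z.2.
  by rewrite (k _ (congr1 fst E)) (k _ (congr1 snd E)) eqxx.
have E3 : wind (fun t => H3 (0, t)) u u = true.
  have [v Uv] := half_cover (H30 (1, 0)).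
  rewrite (wind_homotopy cH3 H30 _ _ Uv)//; last 2 first.
  - by move=> s _; rewrite /H3 /= circ1.
  - rewrite /H3 /= c0 addr0 invr1 !mul0r oppr0 !mul0r !mul1r.
    by rewrite -surjective_pairing.
  apply: wind_odd => //.
    apply: (comp_continuous cH3); apply: pair_continuous; [exact: cont_cst|exact: cont_id].
  move=> t _; rewrite /H3 /= circ_half /= c1 /sub /=.
  by rewrite !(mulrN, mulNr, opprK, mul1r, opprB).
(* second homotopy: translation from [f 0] to [y] *)
pose H1 (z : plane) : plane :=
  sub (f (circ z.2)) (f0.1 + cl01 z.1 * (y.1 - f0.1), f0.2 + cl01 z.1 * (y.2 - f0.2)).
have cH1 : continuous H1.
  apply: sub_cont; first by apply: (comp_continuous cfc); exact: snd_continuous.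
  apply: pair_continuous; apply: contD; try exact: cont_cst;
    by apply: contM => //; exact: cont_cst.
(* The minimum was taken over $[0,1]$ only; periodicity of [circ] extends the bound to the whole
   line. *)
have frac (t : R) : exists2 r, 0 <= r <= 1 & circ t = circ r.
  exists (t - (Num.floor t)%:~R).
    have := floor_le_tmp t; have := floorD1_gt t; rewrite intrD; lra.
  have zper (n : nat) (r : R) : circ (r + n%:R) = circ r.
    elim: n => [|n IH]; first by rewrite addr0.
    rewrite (_ : r + n.+1%:R = r + n%:R + 2^-1 + 2^-1); last by rewrite -natr1; lra.
    by rewrite circ_period.
  case: (Num.floor t) => n.
    by rewrite -[in LHS](subrK n%:R t) zper.
  by rewrite NegzE mulrNz opprK zper.
have dt t : d t0 <= d t.
  have [r r01 E] := frac t; have -> : d t = d r by rewrite /d E.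
  by apply: dmin; rewrite in_itv.
have H10 z : H1 z != (0, 0).
  apply: sub_neq0; apply/eqP => E; have := dt z.2.
  rewrite /d E /= !(addrC _ (cl01 _ * _)) !addrK !normrM.
  have c01 := cl01_itv z.1; rewrite ger0_norm ?(andP c01).1//.
  rewrite le_max => /orP[] h; rewrite -/(d t0) in h.
    have : cl01 z.1 * `|y.1 - f0.1| <= 1 * `|y.1 - f0.1| by rewrite ler_wpM2r// (andP c01).2.
    by rewrite mul1r; lra.
  have : cl01 z.1 * `|y.2 - f0.2| <= 1 * `|y.2 - f0.2| by rewrite ler_wpM2r// (andP c01).2.
  by rewrite mul1r; lra.
have ny0 t : f (circ t) != y by apply: ny; rewrite /disc /= circ_norm.
have [v Uv] : exists v, half v (sub (f (circ 0)) y) by apply/half_cover/sub_neq0.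
have E1 : wind (fun t => H1 (0, t)) u u = wind (fun t => H1 (1, t)) v v.
  apply: (wind_homotopy cH1 H10).
  - by move=> s _; rewrite /H1 /= circ1.
  - by rewrite /H1 /= c0 !mul0r !addr0 -surjective_pairing.
  - by rewrite /H1 /= c1 !mul1r !(addrC f0.1) !(addrC f0.2) !subrK -surjective_pairing.
(* third homotopy: contraction inside the disc *)
pose H2 (z : plane) : plane :=
  sub (f ((1 - cl01 z.1) * (circ z.2).1, (1 - cl01 z.1) * (circ z.2).2)) y.
have cH2 : continuous H2.
  apply: sub_cont; last exact: cont_cst.
  apply: (comp_continuous cf); apply: scal_cont.
  by apply: contB => //; exact: cont_cst.
have H20 z : H2 z != (0, 0).
  by apply/sub_neq0/ny; apply: circ_disc; have := cl01_itv z.1; lra.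
have [w Uw] : exists w, half w (sub f0 y).
  by apply/half_cover/sub_neq0/ny; rewrite /disc /= expr0n addr0 ler01.
have E2 : wind (fun t => H2 (0, t)) v v = wind (fun t => H2 (1, t)) w w.
  apply: (wind_homotopy cH2 H20).
  - by move=> s _; rewrite /H2 /= circ1.
  - by rewrite /H2 /= c0 subr0 !mul1r -surjective_pairing.
  - by rewrite /H2 /= c1 subrr !mul0r.
have e1 : (fun t => H3 (0, t)) = (fun t => H1 (0, t)).
  apply/funext => t; rewrite /H3 /H1 /= c0 addr0 invr1 !mul0r oppr0 !mul0r !mul1r !addr0.
  by rewrite -!surjective_pairing.
have e2 : (fun t => H1 (1, t)) = (fun t => H2 (0, t)).
  apply/funext => t; rewrite /H1 /H2 /= c0 c1 subr0 !mul1r.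
  by rewrite !(addrC f0.1) !(addrC f0.2) !subrK -!surjective_pairing.
have e3 : (fun t => H2 (1, t)) = (fun=> sub f0 y).
  by apply/funext => t; rewrite /H2 /= c1 subrr !mul0r.
by move: E3; rewrite e1 E1 e2 E2 e3 wind_cst.
Qed.

End winding.

(** * Charts of a surface *)

Section charts.
Variables (R : realType) (S : topologicalType).
Local Notation plane := (R * R)%type.
Hypothesis eucl : locally_euclidean2 R S.

Definition clsq (r : R) : R := 2 * cl01 ((r + 1) / 2) - 1.

Lemma clsq_itv r : -1 <= clsq r <= 1.
Proof. by rewrite /clsq; have := cl01_itv ((r + 1) / 2); lra. Qed.

Lemma clsqE r : -1 <= r <= 1 -> clsq r = r.
Proof. by move=> r1; rewrite /clsq cl01E; lra. Qed.

Lemma clsq0 : clsq 0 = 0. Proof. by rewrite clsqE//; lra. Qed.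

Lemma clsq_cont : continuous clsq.
Proof.
apply: contB; last exact: cont_cst.
apply: contM; first exact: cont_cst.
apply: (comp_continuous (@cl01_cont R)).
apply: contM; last exact: cont_cst.
by apply: contD; [move=> z; exact: cvg_id|exact: cont_cst].
Qed.

Lemma disc_itv (z : plane) : disc z -> -1 <= z.1 <= 1 /\ -1 <= z.2 <= 1.
Proof.
rewrite /disc /=; case: z => a b /= ab.
have ha := sqr_ge0 a; have hb := sqr_ge0 b.
by split; nra.
Qed.

(** The clamp keeps the values within [r] of [c] on the whole plane, while on the disc the map is an
    affine embedding. *)
Definition sq (c : plane) (r : R) (z : plane) : plane := (c.1 + r * clsq z.1, c.2 + r * clsq z.2).

Lemma sq_cont c r : continuous (sq c r).
Proof.
by apply: pair_continuous; apply: contD; try exact: cont_cst;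
  (apply: contM; first exact: cont_cst); apply: (comp_continuous clsq_cont);
  [exact: fst_continuous|exact: snd_continuous].
Qed.

Lemma sq_inj c r z w : 0 < r -> disc z -> disc w -> sq c r z = sq c r w -> z = w.
Proof.
move=> r0 /disc_itv[z1 z2] /disc_itv[w1 w2]; rewrite /sq !clsqE//.
case: z z1 z2 => [a b] /= _ _; case: w w1 w2 => [a' b'] /= _ _ [] e1 e2.
by congr pair; nra.
Qed.

Lemma sq0 c r : sq c r (0, 0) = c.
Proof. by rewrite /sq /= clsqE ?mulr0 ?addr0 -?surjective_pairing//; lra. Qed.

Lemma sq_near c r e z : 0 < r -> r < e -> `|(sq c r z).1 - c.1| < e /\ `|(sq c r z).2 - c.2| < e.
Proof.
move=> r0 re; rewrite /sq /=; have := clsq_itv z.1; have := clsq_itv z.2 => h1 h2.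
by split; rewrite ltr_norml; nra.
Qed.

Lemma chart (y : S) : exists (p : plane -> S) (z0 : plane),
  [/\ continuous p, injective p, p z0 = y &
   forall e : R, 0 < e -> \forall y' \near y, exists z : plane,
     [/\ `|z.1 - z0.1| < e, `|z.2 - z0.2| < e & p z = y']].
Proof.
have [U [oU Uy [f [g [cf cg fg gf]]]]] := eucl y.
pose u0 : set_type U := SigSub (mem_set Uy).
exists (fun z => set_val (g z)), (f u0); split.
- by apply: (comp_continuous _ cg); exact: initial_continuous.
- by move=> z w /val_inj/(can_inj gf).
- by rewrite fg.
move=> e e0.
have : nbhs u0 (f @^-1` [set z | `|z.1 - (f u0).1| < e /\ `|z.2 - (f u0).2| < e]).
  by apply: cf; apply/nbhs_plane; exists e.
rewrite nbhsE => -[V [[B oB BV] Vu] VA].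
have By : B y by move: Vu; rewrite -BV.
have nB : nbhs y (B `&` U) by apply: open_nbhs_nbhs; split; [exact: openI|].
apply: filterS nB => y' [By' Uy'].
pose u' : set_type U := SigSub (mem_set Uy').
have /VA[h1 h2] : V u' by rewrite -BV.
by exists (f u'); rewrite fg.
Qed.

(** Invariance of domain, read in a chart at [j (0, 0)] after shrinking the disc so that its image
    lies in the domain of the chart; $r \le 1$ keeps the smaller square of parameters within the
    reach of the injectivity of [j]. *)
Lemma open_disc_image (j : plane -> S) : continuous j ->
  (forall z w, disc z -> disc w -> j z = j w -> z = w) ->
  \forall y \near j (0, 0), exists2 z, disc z & j z = y.
Proof.
move=> cj ij; have [U [oU Uy [f [g [cf cg fg gf]]]]] := eucl (j (0, 0)).
have /nbhs_plane[e e0 eU] : nbhs ((0, 0) : plane) (j @^-1` U).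
  by apply: cj; apply: open_nbhs_nbhs.
pose r := Num.min (e / 2) 1.
have r0 : 0 < r by rewrite /r lt_min; lra.
have re : r < e by rewrite /r gt_min; lra.
have r1 : r <= 1 by rewrite /r ge_min lexx orbT.
have jU z : U (j (sq (0, 0) r z)).
  by apply: eU; have [h1 h2] := sq_near (0, 0) z r0 re.
pose F z : set_type U := SigSub (mem_set (jU z)).
have cF : continuous F.
  by apply: continuous_comp_initial; apply: (comp_continuous cj); exact: sq_cont.
have [||d d0 dF] := @invariance_of_domain R (f \o F).
- by apply: comp_continuous.
- move=> z w dz dw /= /(can_inj fg)/(congr1 (@set_val _ _)) /= E.
  apply: (@sq_inj (0, 0) r _ _ r0 dz dw); apply: ij => //.
    have [z1 z2] := disc_itv dz; rewrite /sq !clsqE// /disc /= !add0r.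
    by move: dz; rewrite /disc /=; nra.
  have [z1 z2] := disc_itv dw; rewrite /sq !clsqE// /disc /= !add0r.
  by move: dw; rewrite /disc /=; nra.
pose u0 : set_type U := F (0, 0).
have : nbhs u0 (f @^-1` [set z | `|z.1 - (f u0).1| < d /\ `|z.2 - (f u0).2| < d]).
  by apply: cf; apply/nbhs_plane; exists d.
rewrite nbhsE => -[V [[B oB BV] Vu] VA].
have By : B (j (0, 0)) by move: Vu; rewrite -BV /= /set_val /= sq0.
have nB : nbhs (j (0, 0)) (B `&` U) by apply: open_nbhs_nbhs; split; [exact: openI|].
apply: filterS nB => y' [By' Uy'].
pose u' : set_type U := SigSub (mem_set Uy').
have /VA[h1 h2] : V u' by rewrite -BV.
have [z dz /= /(can_inj fg)/(congr1 (@set_val _ _)) E] := dF (f u') h1 h2.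
exists (sq (0, 0) r z) => //.
have [z1 z2] := disc_itv dz; rewrite /sq !clsqE// /disc /= !add0r.
by move: dz; rewrite /disc /=; nra.
Qed.

(** Invariance of domain for [th] composed with a parametrisation of a neighbourhood of [y]. It is
    the tool for excluding local models in which too few coordinates determine a point. *)
Lemma open_map_plane (th : S -> plane) (y : S) (N : set S) : continuous th ->
  nbhs y N -> (forall a b, N a -> N b -> th a = th b -> a = b) ->
  exists2 e : R, 0 < e & forall p : plane,
    `|p.1 - (th y).1| < e -> `|p.2 - (th y).2| < e -> exists2 a, N a & th a = p.
Proof.
move=> cth Ny ith; have [p [z0 [cp ip pz0 _]]] := chart y.
have /nbhs_plane[e e0 eN] : nbhs z0 (p @^-1` N) by apply: cp; rewrite pz0.
have r0 : 0 < e / 2 by lra.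
have re : e / 2 < e by lra.
have pN z : N (p (sq z0 (e / 2) z)).
  by apply: eN; have [h1 h2] := sq_near z0 z r0 re.
have [||d d0 dF] := @invariance_of_domain R (fun z => th (p (sq z0 (e / 2) z))).
- by do 2?apply: comp_continuous => //; exact: sq_cont.
- move=> z w dz dw /ith E; apply: (sq_inj r0 dz dw); apply: ip; exact: E.
exists d => //; rewrite sq0 pz0 in dF => q q1 q2.
by have [z dz E] := dF q q1 q2; exists (p (sq z0 (e / 2) z)).
Qed.

End charts.

Section combinations.
Variables (R : realType) (n : nat) (K : {set {set 'I_n}}).
Hypothesis complexK : simplicial_complex K.
Variable Z : topologicalType.

(** A point is described by a list of vertices with coefficient functions. Vertices whose
    coefficient vanishes may lie outside the simplex ([comb_real]), which allows one formula to
    cross several triangles. *)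
Definition comb (s : seq ('I_n * (Z -> R))) (z : Z) : 'rV[R]_n :=
  \row_i \sum_(p <- s) p.2 z * (p.1 == i)%:R.

Lemma comb_nil z i : comb [::] z 0 i = 0.
Proof. by rewrite mxE big_nil. Qed.

Lemma comb_cons p s z i : comb (p :: s) z 0 i = p.2 z * (p.1 == i)%:R + comb s z 0 i.
Proof. by rewrite !mxE big_cons. Qed.

Lemma comb_cont s i : {in s, forall p, continuous p.2} -> continuous (fun z => comb s z 0 i).
Proof.
elim: s => [|p s IH] cs.
  by rewrite (_ : (fun z => _) = fun=> 0); [exact: cont_cst|apply/funext => z; exact: comb_nil].
rewrite (_ : (fun z => _) = fun z => p.2 z * (p.1 == i)%:R + comb s z 0 i); last first.
  by apply/funext => z; exact: comb_cons.
apply: contD; last by apply: IH => q qs; apply: cs; rewrite in_cons qs orbT.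
by apply: contM; [apply: cs; rewrite mem_head|exact: cont_cst].
Qed.

Lemma comb_sum s z : \sum_i comb s z 0 i = \sum_(p <- s) p.2 z.
Proof.
under eq_bigr do rewrite mxE.
rewrite exchange_big /=; apply: eq_bigr => p _; rewrite -mulr_sumr (bigD1 p.1)//= eqxx.
by rewrite big1 ?addr0 ?mulr1// => i; rewrite eq_sym => /negPf->.
Qed.

Lemma comb_real s z (A : {set 'I_n}) : A \in K ->
  all (fun p => (0 <= p.2 z) && ((p.2 z != 0) ==> (p.1 \in A))) s ->
  \sum_(p <- s) p.2 z = 1 -> geometric_realization K (comb s z).
Proof.
move=> AK /allP As s1.
have c1 : \sum_i comb s z 0 i = 1 by rewrite comb_sum.
have c0 i : 0 <= comb s z 0 i.
  rewrite mxE big_seq; apply: sumr_ge0 => p /As/andP[p0 _].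
  by rewrite mulr_ge0// ler0n.
split=> //; apply: (face_closed complexK AK); last exact: (supp_neq0 c1).
apply/fintype.subsetP => i; rewrite inE; apply: contraNT => iA.
rewrite mxE big_seq big1// => p /As/andP[_ /implyP pA].
have [pi|] := eqVneq p.1 i; last by rewrite mulr0.
have [->|/pA] := eqVneq (p.2 z) 0; first by rewrite mul0r.
by rewrite pi (negPf iA).
Qed.

End combinations.

(** * Local structure of a triangulated surface *)

Section surface.
Variables (R : realType) (S : topologicalType) (n : nat) (K : {set {set 'I_n}}).
Hypothesis complexK : simplicial_complex K.
Local Notation X := (set_type (@geometric_realization R n K)).
Variables (h : S -> X) (k : X -> S).
Hypotheses (ch : continuous h) (ck : continuous k) (hk : cancel h k) (kh : cancel k h).
Variable x : S.
Hypothesis eucl : locally_euclidean2 R S.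
Local Notation plane := (R * R)%type.
Local Notation co := (co h).
Local Notation pt := (pt k x).

Let pcont (Z : topologicalType) := @pt_cont R S n K k ck x Z.
Let pco := co_pt kh x.
Let cpt := pt_co hk x.
Let ccont := co_cont ch.

Lemma co_inj y y' : (forall i, co y 0 i = co y' 0 i) -> y = y'.
Proof.
move=> E; rewrite -(cpt y) -(cpt y'); congr pt; apply/rowP => i; exact: E.
Qed.

Lemma near_pos (y : S) (s : seq 'I_n) : {in s, forall i, 0 < co y 0 i} ->
  \forall y' \near y, {in s, forall i, 0 < co y' 0 i}.
Proof.
elim: s => [|i s IH] s0; first by apply: nearW => y' i.
have h1 : nbhs y [set y' | 0 < co y' 0 i].
  by apply: open_nbhs_nbhs; split; [exact: (star_open ch)|apply: s0; rewrite mem_head].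
have h2 := IH (fun j js => s0 j (eqbRL (in_cons _ _ _) (introT orP (or_intror js)))).
apply: filterS2 h1 h2 => y' h1 h2 j; rewrite in_cons => /orP[/eqP->//|]; exact: h2.
Qed.

Lemma co_supp_in y (s : seq 'I_n) : (0 < size s)%N -> {in s, forall i, 0 < co y 0 i} ->
  [set i in s] \in K.
Proof.
move=> s0 sy; have [_ _ yK] := co_real h y.
apply: (face_closed complexK yK).
  by apply/fintype.subsetP => i; rewrite !inE => /sy/gt_eqF->.
by case: s s0 {sy} => // i s _; apply/set0Pn; exists i; rewrite !inE eqxx.
Qed.

Let cz1 : continuous (fun z : plane => z.1). Proof. exact: fst_continuous. Qed.
Let cz2 : continuous (fun z : plane => z.2). Proof. exact: snd_continuous. Qed.

(* A path leaving the image of an injective disc contradicts invariance of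
   domain. *)
Lemma disc_path (j : plane -> S) (q : R -> S) : continuous j ->
  (forall z w, disc z -> disc w -> j z = j w -> z = w) ->
  continuous q -> q 0 = j (0, 0) ->
  exists2 r : R, 0 < r <= 1 & exists2 z, disc z & j z = q r.
Proof.
move=> cj ij cq q0; have := open_disc_image eucl cj ij; rewrite -q0 => /cq.
move=> /nbhs_real[e e0 eq]; exists (Num.min (e / 2) 1).
  by rewrite lt_min ge_min lexx orbT andbT; lra.
apply: eq; rewrite subr0 ger0_norm; first by rewrite gt_min; lra.
by rewrite le_min; lra.
Qed.

Lemma neqE (T : eqType) (a b : T) : a != b -> ((a == b) = false) * ((b == a) = false).
Proof. by move=> ab; rewrite (eq_sym b) (negPf ab). Qed.

Lemma mem2 (T : eqType) (a b : T) (P : T -> Prop) : P a -> P b -> {in [:: a; b], forall i, P i}.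
Proof. by move=> Pa Pb i; rewrite !inE => /orP[]/eqP->. Qed.

(** Inside a tetrahedron, the disc through the barycentre with directions $a-b$ and $c-d$ stays
    where the coordinates of [a] and [b] add up to $1/2$. The path in direction $a-c$ leaves this
    plane at once, contradicting [disc_path]. The factor $1/8$ keeps the weights $1/4 \pm 1/8$
    positive. *)
Lemma dim_le2 (A : {set 'I_n}) : A \in K -> (#|A| <= 3)%N.
Proof.
move=> AK; rewrite leqNgt; apply/negP => A4.
have [s [us sA s4]] : exists s : seq 'I_n, [/\ uniq s, {subset s <= A} & size s = 4%N].
  exists (take 4 (enum A)); split.
  - by apply: take_uniq; exact: enum_uniq.
  - by move=> i /mem_take; rewrite mem_enum.
  - by rewrite size_takel// -cardE.
case: s us sA s4 => [|a [|b [|c [|d []]]]]//= us sA _.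
have [aA bA cA dA] : [/\ a \in A, b \in A, c \in A & d \in A].
  by split; apply: sA; rewrite !inE eqxx ?orbT.
move: us; rewrite !inE !negb_or -!andbA => /and5P[ab ac ad bc /andP[bd] /andP[cd _]].
pose w1 (z : plane) : R := clsq z.1 / 8; pose w2 (z : plane) : R := clsq z.2 / 8.
have cw1 : continuous w1.
  apply: contM; last exact: cont_cst.
  by apply: (comp_continuous (@clsq_cont R)).
have cw2 : continuous w2.
  apply: contM; last exact: cont_cst.
  by apply: (comp_continuous (@clsq_cont R)).
pose s := [:: (a, fun z => 4^-1 + w1 z); (b, fun z => 4^-1 - w1 z);
             (c, fun z => 4^-1 + w2 z); (d, fun z => 4^-1 - w2 z)].
pose j z := pt (comb s z).
have sK z : geometric_realization K (comb s z).
  apply: (comb_real complexK AK); last by rewrite !big_cons big_nil /=; lra.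
  have := clsq_itv z.1; have := clsq_itv z.2; rewrite -/(clsq _) => h1 h2.
  by rewrite /= aA bA cA dA !implybT /w1 /w2 !andbT; apply/and4P; split; lra.
have cs (i : 'I_n) : continuous (fun z => comb s z 0 i).
  apply: comb_cont => p; rewrite !inE => /or4P[] /eqP-> /=.
  - by apply: contD => //; exact: cont_cst.
  - by apply: contB => //; exact: cont_cst.
  - by apply: contD => //; exact: cont_cst.
  - by apply: contB => //; exact: cont_cst.
have cj : continuous j by exact: pcont.
have jE z i : co (j z) 0 i = comb s z 0 i by rewrite pco.
have ij z w : disc z -> disc w -> j z = j w -> z = w.
  move=> /disc_itv[z1 z2] /disc_itv[y1 y2] E.
  have := jE z a; have := jE z c; rewrite E !jE !comb_cons !comb_nil /= !eqxx.
  rewrite !(neqE ab) !(neqE ac) !(neqE ad) !(neqE bc) !(neqE cd) /w1 /w2 !clsqE//=.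
  case: z {z1 z2 E} => [z1 z2]; case: w {y1 y2} => [y1 y2] /= e2 e1; congr pair; lra.
pose u (r : R) := cl01 r / 8.
have cu : continuous u by apply: contM; [exact: cl01_cont|exact: cont_cst].
pose s' := [:: (a, fun r => 4^-1 + u r); (b, fun=> 4^-1);
             (c, fun r => 4^-1 - u r); (d, fun=> 4^-1)].
have sK' r : geometric_realization K (comb s' r).
  apply: (comb_real complexK AK); last by rewrite !big_cons big_nil /=; lra.
  have := cl01_itv r => h1.
  by rewrite /= aA bA cA dA !implybT /u !andbT; apply/and4P; split; lra.
have cs' (i : 'I_n) : continuous (fun r => comb s' r 0 i).
  apply: comb_cont => p; rewrite !inE => /or4P[] /eqP-> /=.
  - by apply: contD => //; exact: cont_cst.
  - exact: cont_cst.
  - by apply: contB => //; exact: cont_cst.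
  - exact: cont_cst.
have u0 : u 0 = 0 by rewrite /u cl01E ?mul0r// lexx ler01.
have [||r r01 [z _ E]] := @disc_path j (fun r => pt (comb s' r)) cj ij.
- exact: pcont.
- by congr pt; apply/rowP => i; rewrite !comb_cons !comb_nil /w1 /w2 /= clsq0 u0 mul0r !addr0 !subr0.
have := jE z a; have := jE z b; rewrite E !pco// !comb_cons !comb_nil /= !eqxx.
rewrite !(neqE ab) !(neqE ac) !(neqE ad) !(neqE bc) !(neqE bd) /u cl01E /=; last by lra.
by lra.
Qed.

(** Near the barycentre of a maximal simplex with at most two vertices, one barycentric coordinate
    determines the point. Paired with zero it would be an injective, hence open, map to the plane,
    although its image lies on a line. *)
Lemma triangle_above (A : {set 'I_n}) : A \in K ->
  exists2 T : {set 'I_n}, T \in K & (A \subset T) && (#|T| == 3)%N.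
Proof.
move=> AK.
have [T /maxsetP[TK Tmax] AT] := @maxset_exists _ (fun T => T \in K) A AK.
exists T => //; rewrite AT /=; apply/negPn/negP => T3.
have T2 : (#|T| <= 2)%N by have := dim_le2 TK; rewrite leq_eqVlt (negPf T3).
have /set0Pn[a aT] := K_neq0 complexK TK.
have yE i : co (pt (bary R T)) 0 i = bary R T 0 i by rewrite pco//; exact: bary_real.
have suppT y : (forall i, i \in T -> 0 < co y 0 i) -> forall i, i \notin T -> co y 0 i = 0.
  move=> yT i; apply: contraNeq => yi; have [_ _ yK] := co_real h y.
  by rewrite -(Tmax _ yK) ?inE//; apply/fintype.subsetP => l /yT; rewrite inE => /gt_eqF->.
pose N : set S := [set y | forall i, i \in T -> 0 < co y 0 i].
have nN : nbhs (pt (bary R T)) N.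
  have /near_pos : {in enum T, forall i, 0 < co (pt (bary R T)) 0 i}.
    move=> i; rewrite mem_enum yE baryE => -> //; rewrite invr_gt0 ltr0n.
    by apply/card_gt0P; exists a.
  by apply: filterS => y yT i iT; apply: yT; rewrite mem_enum.
have [||e e0 eN] := open_map_plane eucl (th := fun y => (co y 0 a, 0 : R)) _ nN.
- by apply: pair_continuous; [exact: ccont|exact: cont_cst].
- move=> y y' yN yN' [] E; apply: co_inj.
  have rest z : N z -> \sum_(i in T :\ a) co z 0 i = 1 - co z 0 a.
    move=> zN; have [_ <- _] := co_real h z.
    rewrite [in RHS](bigID (fun i => i \in T)) /= [X in _ + X - _]big1 ?addr0; last exact: suppT.
    by rewrite [in RHS](big_setD1 a)//= [X in X - _]addrC addrK.
  have [b Tb] : exists b, T :\ a \subset [set b]%SET.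
    have [->|/set0Pn[b bT]] := eqVneq (T :\ a) finset.set0; first by exists a; rewrite finset.sub0set.
    exists b; suff -> : T :\ a = [set b]%SET by [].
    apply/eqP; rewrite eq_sym eqEcard finset.sub1set bT cards1.
    by move: T2; rewrite (cardsD1 a) aT.
  move=> i; have [->|ia] := eqVneq i a; first exact: E.
  have [iT|iT] := boolP (i \in T); last by rewrite !suppT.
  have Ti : T :\ a = [set i]%SET.
    have iTa : i \in T :\ a by rewrite !inE ia.
    have := fintype.subsetP Tb i iTa; rewrite inE => /eqP ib.
    by apply/eqP; rewrite finset.eqEsubset finset.sub1set iTa andbT ib.
  by have := rest y yN; have := rest y' yN'; rewrite Ti !big_set1 E => -> ->.
have [||y _ []] := eN (co (pt (bary R T)) 0 a, e / 2).
- by rewrite /= subrr normr0.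
- by rewrite /= subr0 ger0_norm; lra.
by lra.
Qed.

Lemma edge_third (a b : 'I_n) : a != b -> [set a; b]%SET \in K ->
  exists c, [/\ c != a, c != b & [set a; b; c]%SET \in K].
Proof.
move=> ab /triangle_above[T TK /andP[abT /eqP T3]].
have /set0Pn[c] : T :\: [set a; b] != finset.set0.
  by rewrite -cards_eq0 cardsD (finset.setIidPr abT) T3 cards2 ab.
rewrite !inE negb_or => /andP[/andP[ca cb] cT]; exists c; split=> //.
apply: (face_closed complexK TK); last by apply/set0Pn; exists c; rewrite !inE eqxx orbT.
by rewrite finset.subUset abT finset.sub1set.
Qed.

Lemma co_edge (a b c : 'I_n) y : a != b -> c != a -> c != b ->
  (forall c', c' != a -> c' != b -> [set a; b; c']%SET \in K -> c' = c) ->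
  0 < co y 0 a -> 0 < co y 0 b ->
  (forall i, i != a -> i != b -> i != c -> co y 0 i = 0) /\ co y 0 b = 1 - co y 0 a - co y 0 c.
Proof.
move=> ab ca cb uc ya yb.
have z i : i != a -> i != b -> i != c -> co y 0 i = 0.
  move=> ia ib; apply: contraNeq => yi; apply/eqP/uc => //.
  have -> : [set a; b; i]%SET = [set l in [:: a; b; i]].
    by apply/setP => l; rewrite !inE orbA.
  apply: (@co_supp_in y) => // l; rewrite !inE => /or3P[]/eqP->//.
  by rewrite lt_neqAle eq_sym yi co_ge0.
split=> //; have [_ <- _] := co_real h y.
rewrite (bigD1 a)//= (bigD1 b) 1?eq_sym//= (bigD1 c) ?ca//= big1 ?addr0.
  by rewrite (addrC (co y 0 a)) addrK addrK.
by move=> i /andP[/andP[ia ib] ic]; exact: z.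
Qed.

(** With a single triangle on the edge, the coordinates of [a] and [c] determine the points near the
    midpoint. They would form an open map to the plane, although the coordinate of [c] is never
    negative and vanishes at the midpoint. *)
Lemma edge_two (a b c : 'I_n) : a != b -> c != a -> c != b -> [set a; b; c]%SET \in K ->
  exists c', [/\ c' != a, c' != b, c' != c & [set a; b; c']%SET \in K].
Proof.
move=> ab ca cb abc; apply: contrapT => noc.
have uc c' : c' != a -> c' != b -> [set a; b; c']%SET \in K -> c' = c.
  by move=> c'a c'b c'K; apply/eqP/negPn/negP => c'c; apply: noc; exists c'.
have abK : [set a; b]%SET \in K.
  apply: (face_closed complexK abc); last by apply/set0Pn; exists a; rewrite !inE eqxx.
  exact: finset.subsetUl.
pose y := pt (bary R [set a; b]%SET).
have yE i : co y 0 i = bary R [set a; b]%SET 0 i by rewrite pco//; exact: bary_real.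
have y2 i : i \in [set a; b]%SET -> co y 0 i = 2^-1 by rewrite yE baryE => ->; rewrite cards2 ab.
pose N : set S := [set y | {in [:: a; b], forall i, 0 < co y 0 i}].
have nN : nbhs y N.
  apply: near_pos => i iab; rewrite y2; first by rewrite invr_gt0 ltr0n.
  by move: iab; rewrite !inE.
have [||e e0 eN] := open_map_plane eucl (th := fun y => (co y 0 a, co y 0 c)) _ nN.
- by apply: pair_continuous; exact: ccont.
- move=> z z' zN zN' [] Ea Ec; apply: co_inj => i.
  have [za zb] : 0 < co z 0 a /\ 0 < co z 0 b by split; apply: zN; rewrite !inE eqxx ?orbT.
  have [za' zb'] : 0 < co z' 0 a /\ 0 < co z' 0 b by split; apply: zN'; rewrite !inE eqxx ?orbT.
  have [z0 z1] := co_edge ab ca cb uc za zb; have [z0' z1'] := co_edge ab ca cb uc za' zb'.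
  have [->//|ia] := eqVneq i a.
  have [->|ib] := eqVneq i b; first by rewrite z1 z1' Ea Ec.
  have [->//|ic] := eqVneq i c.
  by rewrite z0// z0'.
have yc : co y 0 c = 0 by rewrite yE baryE !inE (negPf ca) (negPf cb).
have [||z _ []] := eN (co y 0 a, - (e / 2)).
- by rewrite /= subrr normr0.
- by rewrite /= yc subr0 normrN ger0_norm; lra.
by have := co_ge0 h z c; lra.
Qed.

(** Two of the triangles together contain a disc around the midpoint of the edge; a path into the
    third one leaves this disc, contradicting [disc_path]. *)
Lemma edge_not_three (a b c1 c2 c3 : 'I_n) : uniq [:: a; b; c1; c2; c3] ->
  [set a; b; c1]%SET \in K -> [set a; b; c2]%SET \in K -> [set a; b; c3]%SET \in K -> False.
Proof.
rewrite /= !inE !negb_or -!andbA => /and5P[ab a1 a2 a3 /and5P[b1 b2 b3 c12 /and3P[c13 c23 _]]].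
move=> K1 K2 K3.
pose w1 (z : plane) : R := clsq z.1 / 4.
pose w2 (z : plane) : R := clsq z.2 / 8.
(* Positive and negative parts of the height [w2]: the disc bends across the edge, with [c1] on one
   side and [c2] on the other. *)
pose m1 z := Num.max (w2 z) 0; pose m2 z := Num.max (- w2 z) 0.
have cw1 : continuous w1.
  apply: contM; last exact: cont_cst.
  by apply: (comp_continuous (@clsq_cont R)).
have cw2 : continuous w2.
  apply: contM; last exact: cont_cst.
  by apply: (comp_continuous (@clsq_cont R)).
have cm1 : continuous m1 by apply: cont_max => //; exact: cont_cst.
have cm2 : continuous m2 by apply: cont_max; [exact: contN|exact: cont_cst].
have m12 z : m1 z = 0 /\ m2 z = - w2 z /\ w2 z <= 0 \/ m1 z = w2 z /\ m2 z = 0 /\ 0 <= w2 z.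
  rewrite /m1 /m2; case: (lerP (w2 z) 0) => w0; [left|right].
    by split=> //; split=> //; apply/max_idPl; rewrite oppr_ge0.
  by split=> //; split; [apply/max_idPr; rewrite oppr_le0 ltW|exact: ltW].
pose s := [:: (a, fun z => 2^-1 + w1 z - (m1 z + m2 z) / 2);
              (b, fun z => 2^-1 - w1 z - (m1 z + m2 z) / 2);
              (c1, m1); (c2, m2)].
pose j z := pt (comb s z).
have sK z : geometric_realization K (comb s z).
  have := clsq_itv z.1; have := clsq_itv z.2 => h1 h2.
  case: (m12 z) => -[E1 [E2 E3]].
    apply: (comb_real complexK K2); last by rewrite !big_cons big_nil /=; lra.
    rewrite /= E1 E2 eqxx lexx !inE !eqxx !orbT !implybT /w1 /w2 in E3 * => /=.
    by rewrite !andbT; apply/and3P; split; lra.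
  apply: (comb_real complexK K1); last by rewrite !big_cons big_nil /=; lra.
  rewrite /= E1 E2 eqxx lexx !inE !eqxx !orbT !implybT /w1 /w2 in E3 * => /=.
  by rewrite !andbT; apply/and3P; split; lra.
have cm : continuous (fun z => (m1 z + m2 z) / 2).
  by apply: contM; [exact: contD|exact: cont_cst].
have cs (i : 'I_n) : continuous (fun z => comb s z 0 i).
  apply: comb_cont => p; rewrite !inE => /or4P[] /eqP-> //=.
  - by apply: contB => //; apply: contD => //; exact: cont_cst.
  - by apply: contB => //; apply: contB => //; exact: cont_cst.
have cj : continuous j by exact: pcont.
have jE z i : co (j z) 0 i = comb s z 0 i by rewrite pco.
have ev z : [/\ co (j z) 0 a = 2^-1 + w1 z - (m1 z + m2 z) / 2, co (j z) 0 c1 = m1 z,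
    co (j z) 0 c2 = m2 z & co (j z) 0 c3 = 0].
  rewrite !jE !comb_cons !comb_nil /= !eqxx !(neqE ab) !(neqE a1) !(neqE a2) !(neqE a3).
  rewrite !(neqE b1) !(neqE b2) !(neqE b3) !(neqE c12) !(neqE c13) !(neqE c23).
  by split; rewrite /=; lra.
have ij z w : disc z -> disc w -> j z = j w -> z = w.
  move=> /disc_itv[z1 z2] /disc_itv[y1 y2] E.
  have [Ea E1 E2 _] := ev z; have [Fa F1 F2 _] := ev w; rewrite E in Ea E1 E2.
  have w2E : w2 z = w2 w.
    by case: (m12 z) => -[h1 [h2 h3]]; case: (m12 w) => -[h1' [h2' h3']]; lra.
  have w1E : w1 z = w1 w by lra.
  move: w1E w2E; rewrite /w1 /w2 !clsqE//.
  case: z {z1 z2 E Ea E1 E2} => [z1 z2]; case: w {y1 y2 Fa F1 F2} => [y1 y2] /= e2 e1; congr pair; lra.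
pose u (r : R) := cl01 r / 8.
have cu : continuous u by apply: contM; [exact: cl01_cont|exact: cont_cst].
pose s' := [:: (a, fun r => 2^-1 - u r / 2); (b, fun r => 2^-1 - u r / 2); (c3, u)].
have sK' r : geometric_realization K (comb s' r).
  apply: (comb_real complexK K3); last by rewrite !big_cons big_nil /=; lra.
  have := cl01_itv r => h1.
  by rewrite /= !inE !eqxx !orbT !implybT /u !andbT; apply/and3P; split; lra.
have cs' (i : 'I_n) : continuous (fun r => comb s' r 0 i).
  have cu2 : continuous (fun r => 2^-1 - u r / 2).
    apply: contB; first exact: cont_cst.
    by apply: contM => //; exact: cont_cst.
  by apply: comb_cont => p; rewrite !inE => /or3P[] /eqP-> //=.
have u0 : u 0 = 0 by rewrite /u cl01E ?mul0r// lexx ler01.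
have [||r r01 [z _ E]] := @disc_path j (fun r => pt (comb s' r)) cj ij.
- exact: pcont.
- congr pt; apply/rowP => i; rewrite !comb_cons !comb_nil /m1 /m2 /w1 /w2 /= clsq0 u0.
  by rewrite !mul0r oppr0 !maxxx !mul0r !addr0 !mul0r !subr0.
have [_ _ _] := ev z; rewrite E pco// !comb_cons !comb_nil /= !eqxx (negPf a3) (negPf b3).
by rewrite /u cl01E /=; lra.
Qed.

Lemma convex_near (s a b c e : R) : 0 <= s <= 1 -> `|a - c| < e -> `|b - c| < e ->
  `|(1 - s) * a + s * b - c| < e.
Proof.
move=> s01 a1 b1; have -> : (1 - s) * a + s * b - c = (1 - s) * (a - c) + s * (b - c) by ring.
apply: (le_lt_trans (ler_normD _ _)); rewrite !normrM (ger0_norm (x := s)) ?(ger0_norm (x := 1 - s)); try lra.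
have [->|s1] := eqVneq s 1; first by rewrite subrr mul0r add0r mul1r.
have s1' : 0 < 1 - s by rewrite subr_gt0 lt_neqAle s1; lra.
have : (1 - s) * `|a - c| < (1 - s) * e by rewrite ltr_pM2l.
have : s * `|b - c| <= s * e by apply: ler_wpM2l; lra.
lra.
Qed.

(** A punctured square is connected: two points are joined through a third point [p] that is
    collinear with neither of them and the centre, so that no segment meets the centre. *)
Lemma punctured_path (e : R) (c z z' : plane) (P : plane -> Prop) : 0 < e ->
  (forall w : plane, `|w.1 - c.1| < e -> `|w.2 - c.2| < e -> w <> c ->
     exists2 d : R, 0 < d & forall a b : plane,
       `|a.1 - w.1| < d -> `|a.2 - w.2| < d -> `|b.1 - w.1| < d -> `|b.2 - w.2| < d ->
       P a -> P b) ->
  `|z.1 - c.1| < e -> `|z.2 - c.2| < e -> `|z'.1 - c.1| < e -> `|z'.2 - c.2| < e ->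
  z <> c -> z' <> c -> P z -> P z'.
Proof.
move=> e0 locP z1 z2 z1' z2' zc zc'.
pose det (a b : plane) := (a.1 - c.1) * (b.2 - c.2) - (a.2 - c.2) * (b.1 - c.1).
have seg (a b : plane) : `|a.1 - c.1| < e -> `|a.2 - c.2| < e ->
    `|b.1 - c.1| < e -> `|b.2 - c.2| < e -> det a b != 0 -> P a -> P b.
  move=> a1 a2 b1 b2 dab Pa.
  pose g (t : R) : plane := ((1 - cl01 t) * a.1 + cl01 t * b.1, (1 - cl01 t) * a.2 + cl01 t * b.2).
  have cg : continuous g.
    by apply: pair_continuous; apply: contD; (apply: contM; last exact: cont_cst);
      try exact: cl01_cont; apply: contB; [exact: cont_cst|exact: cl01_cont|exact: cont_cst|exact: cl01_cont].
  have g1 t : `|(g t).1 - c.1| < e.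
    exact: convex_near (cl01_itv t) a1 b1.
  have g2 t : `|(g t).2 - c.2| < e.
    exact: convex_near (cl01_itv t) a2 b2.
  have gc t : g t <> c.
    move=> E; have E1 := congr1 fst E; have E2 := congr1 snd E; move: E1 E2; rewrite /g /=.
    set s := cl01 t => E1 E2.
    have h1 : s * det a b = 0 by rewrite /det; nra.
    have h2 : (1 - s) * det a b = 0 by rewrite /det; nra.
    have : det a b = 0 by lra.
    by apply/eqP.
  have := @locally_constant R (fun t => P (g t)) _ 0 1.
  have -> : g 0 = a by rewrite /g cl01E ?lexx ?ler01// subr0 !mul1r !mul0r !addr0 -surjective_pairing.
  have -> : g 1 = b by rewrite /g cl01E ?lexx ?ler01// subrr !mul1r !mul0r !add0r -surjective_pairing.
  apply=> // t; have [d d0 dP] := locP (g t) (g1 t) (g2 t) (gc t).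
  have : nbhs t (g @^-1` [set w | `|w.1 - (g t).1| < d /\ `|w.2 - (g t).2| < d]).
    by apply: cg; apply/nbhs_plane; exists d.
  move=> /nbhs_real[d' d0' d'g]; exists d' => // r r' /d'g[h1 h2] /d'g[h1' h2'].
  exact: dP.
have [p [p1 p2 pz pz']] : exists p : plane, [/\ `|p.1 - c.1| < e, `|p.2 - c.2| < e,
    det z p != 0 & det z' p != 0].
  have nz (a : plane) : a <> c -> (a.1 - c.1 != 0) || (a.2 - c.2 != 0).
    move=> ac; rewrite -negb_and; apply/negP => /andP[]; rewrite !subr_eq0 => /eqP h1 /eqP h2.
    by apply: ac; rewrite (surjective_pairing a) h1 h2 -surjective_pairing.
  have e2 : 0 < e / 2 by lra.
  (* Each of the two vectors [z - c] and [z' - c] rules out at most one of the directions $(0,1)$,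
     $(1,0)$, $(1,1)$, so one of the three is left. *)
  have tst (u v : R) : `|u| <= 1 -> `|v| <= 1 ->
      (z.1 - c.1) * v - (z.2 - c.2) * u != 0 -> (z'.1 - c.1) * v - (z'.2 - c.2) * u != 0 ->
      exists p : plane, [/\ `|p.1 - c.1| < e, `|p.2 - c.2| < e, det z p != 0 & det z' p != 0].
    move=> u1 v1 h1 h2; exists (c.1 + e / 2 * u, c.2 + e / 2 * v) => /=.
    rewrite !(addrC c.1) !(addrC c.2) !addrK !(normrM (e / 2)) !(gtr0_norm e2).
    have dE (a : plane) : det a (e / 2 * u + c.1, e / 2 * v + c.2) =
        e / 2 * ((a.1 - c.1) * v - (a.2 - c.2) * u) by rewrite /det /=; ring.
    have e2n : e / 2 != 0 := lt0r_neq0 e2.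
    by rewrite !dE; split; [nra|nra|exact: mulf_neq0|exact: mulf_neq0].
  have n0 : `|0 : R| <= 1 by rewrite normr0.
  have n1 : `|1 : R| <= 1 by rewrite normr1.
  have := nz _ zc; have := nz _ zc'.
  set u1 := z.1 - c.1; set u2 := z.2 - c.2; set v1 := z'.1 - c.1; set v2 := z'.2 - c.2.
  move=> hv hu.
  have [u10|u10] := eqVneq u1 0; last first.
    have [v10|v10] := eqVneq v1 0; last by apply: (tst 0 1) => //; rewrite -/u1 -/u2 -/v1 -/v2; lra.
    have v20 : v2 != 0 by move: hv; rewrite v10 eqxx.
    have [u20|u20] := eqVneq u2 0; last first.
      by apply: (tst 1 0) => //; rewrite -/u1 -/u2 -/v1 -/v2 ?mulr0 ?mulr1 ?sub0r ?oppr_eq0.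
    by apply: (tst 1 1) => //; rewrite -/u1 -/u2 -/v1 -/v2 ?u20 ?v10 ?mul0r ?mulr1 ?sub0r ?oppr_eq0 ?subr0.
  have u20 : u2 != 0 by move: hu; rewrite u10 eqxx.
  have [v20|v20] := eqVneq v2 0; last first.
    by apply: (tst 1 0) => //; rewrite -/u1 -/u2 -/v1 -/v2 ?mulr0 ?mulr1 ?sub0r ?oppr_eq0.
  have v10 : v1 != 0 by move: hv; rewrite v20 eqxx orbF.
  by apply: (tst 1 1) => //; rewrite -/u1 -/u2 -/v1 -/v2 ?u10 ?v20 ?mul0r ?mulr1 ?sub0r ?oppr_eq0 ?subr0.
move=> Pz; apply: (seg p z') => //; last exact: (seg z p).
have -> : det p z' = - det z' p by rewrite /det; ring.
by rewrite oppr_eq0.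
Qed.

(** A chart at the vertex [v] identifies a punctured neighbourhood with a punctured square. A point
    there is labelled by whether it lies in the star of some vertex other than [v] satisfying [B],
    and this label is locally constant. *)
Lemma link_connected (v : 'I_n) (B : pred 'I_n) :
  (forall c c', c != v -> c' != v -> [set v; c; c']%SET \in K -> B c -> B c') ->
  forall c c', c != v -> c' != v -> [set v; c]%SET \in K -> [set v; c']%SET \in K -> B c -> B c'.
Proof.
move=> Bcl c c' cv cv' cK cK' Bc.
have vK : [set v]%SET \in K.
  apply: (face_closed complexK cK); last by apply/set0Pn; exists v; rewrite inE.
  exact: finset.subsetUl.
pose y := pt (bary R [set v]%SET).
have yE i : co y 0 i = bary R [set v]%SET 0 i by rewrite pco//; exact: bary_real.
have yv : co y 0 v = 1 by rewrite yE baryE inE eqxx cards1 invr1.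
have [p [z0 [cp ip pz0 op]]] := chart eucl y.
have /nbhs_plane[e e0 ev] : nbhs z0 (p @^-1` [set y' | 0 < co y' 0 v]).
  apply: cp; rewrite pz0; apply: open_nbhs_nbhs; split; first exact: (star_open ch).
  by rewrite /= yv ltr01.
have on_edge d : d != v -> [set v; d]%SET \in K -> exists z : plane,
    [/\ `|z.1 - z0.1| < e, `|z.2 - z0.2| < e & 0 < co (p z) 0 d].
  move=> dv dK; pose s := [:: (v, fun r => 1 - cl01 r); (d, @cl01 R)].
  have sK r : geometric_realization K (comb s r).
    apply: (comb_real complexK dK); last by rewrite !big_cons big_nil /=; lra.
    have := cl01_itv r => h1.
    by rewrite /= !inE !eqxx !orbT !implybT !andbT; apply/andP; split; lra.
  have cs (i : 'I_n) : continuous (fun r => comb s r 0 i).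
    apply: comb_cont => q; rewrite !inE => /orP[] /eqP-> /=; last exact: cl01_cont.
    by apply: contB; [exact: cont_cst|exact: cl01_cont].
  have cq : continuous (fun r => pt (comb s r)) by exact: pcont.
  have q0 : pt (comb s 0) = y.
    congr pt; apply/rowP => i; rewrite !comb_cons comb_nil baryE /= cl01E ?lexx ?ler01//.
    by rewrite inE eq_sym cards1 invr1; case: eqP => _; rewrite /=; lra.
  have := op e e0; rewrite -q0 => /cq/nbhs_real[r r0 re].
  have [|z [h1 h2 h3]] := re (Num.min (r / 2) 1).
    rewrite subr0 ger0_norm; first by rewrite gt_min; apply/orP; left; lra.
    by rewrite le_min; apply/andP; split; lra.
  exists z; split=> //; rewrite h3 pco// !comb_cons comb_nil /= eqxx eq_sym (negPf dv) cl01E.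
    by rewrite mulr0 add0r mulr1 addr0 lt_min; lra.
  by rewrite le_min ge_min lexx orbT andbT; lra.
pose P (z : plane) := exists d, [/\ d != v, B d & 0 < co (p z) 0 d].
have excl z d d' : 0 < co (p z) 0 v -> d != v -> d' != v -> B d ->
    0 < co (p z) 0 d -> 0 < co (p z) 0 d' -> B d'.
  move=> zv dv dv' Bd zd zd'; apply: (Bcl d) => //.
  have -> : [set v; d; d']%SET = [set l in [:: v; d; d']].
    by apply/setP => l; rewrite !inE orbA.
  by apply: (@co_supp_in (p z)) => // l; rewrite !inE => /or3P[]/eqP->.
have posnear (w : plane) d : 0 < co (p w) 0 d -> exists2 r : R, 0 < r & forall a : plane,
    `|a.1 - w.1| < r -> `|a.2 - w.2| < r -> 0 < co (p a) 0 d.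
  move=> wd; apply/nbhs_plane.
  have : nbhs (p w) [set y' | 0 < co y' 0 d] by apply: open_nbhs_nbhs; split; [exact: (star_open ch)|].
  by move/cp.
have [z [z1 z2 zc]] := on_edge c cv cK; have [z' [z1' z2' zc']] := on_edge c' cv' cK'.
have ne w d : d != v -> 0 < co (p w) 0 d -> w <> z0.
  by move=> dv + E; rewrite E pz0 yE baryE inE (negPf dv) ltxx.
have : P z' -> B c'.
  by move=> [d [dv Bd zd]]; apply: (excl z' d) => //; exact: ev.
apply; apply: (punctured_path e0 (z := z) (c := z0)) => //; [|exact: ne zc|exact: ne zc'|by exists c].
move=> w w1 w2 wz0.
have [d [dv wd]] : exists d, d != v /\ 0 < co (p w) 0 d.
  apply: contrapT => nod; apply: wz0; apply: ip; rewrite pz0; apply: co_inj => i.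
  have zr d : d != v -> co (p w) 0 d = 0.
    move=> dv; apply/eqP/negPn/negP => wd; apply: nod; exists d; split=> //.
    by rewrite lt_neqAle eq_sym wd co_ge0.
  have [->|iv] := eqVneq i v; last by rewrite zr// yE baryE inE (negPf iv).
  have [_ + _] := co_real h (p w).
  by rewrite (bigD1 v)//= big1 ?addr0 ?yv//; exact: zr.
have [r r0 rP] := posnear w d wd; have [r' r0' rv] := posnear w v (ev w w1 w2).
exists (Num.min r r'); first by rewrite lt_min r0.
move=> a b; rewrite !lt_min => /andP[a1 a1'] /andP[a2 a2'] /andP[b1 b1'] /andP[b2 b2'].
move=> [f [fv Bf af]]; exists d; split=> //; last exact: rP.
by apply: (excl a f) => //; [exact: rv|exact: rP].
Qed.

Hypothesis connS : connected [set: S].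

Lemma vertices_connected (B : pred 'I_n) :
  (forall u v, [set u; v]%SET \in K -> B u -> B v) ->
  forall u v, [set u]%SET \in K -> [set v]%SET \in K -> B u -> B v.
Proof.
move=> Bcl u v uK vK Bu.
pose O (C : pred 'I_n) : set S := \bigcup_(i in [set i | C i]) [set y | 0 < co y 0 i].
have oO C : open (O C) by apply: bigcup_open => i _; exact: (star_open ch).
have vE w : [set w]%SET \in K -> forall i, co (pt (bary R [set w]%SET)) 0 i = (i == w)%:R.
  move=> wK i; rewrite pco; last exact: bary_real.
  by rewrite baryE inE cards1 invr1; case: eqP.
have excl y i i' : 0 < co y 0 i -> 0 < co y 0 i' -> B i -> B i'.
  move=> yi yi'; apply: Bcl.
  have -> : [set i; i']%SET = [set l in [:: i; i']] by apply/setP => l; rewrite !inE.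
  by apply: (@co_supp_in y) => //; exact: mem2.
have compl : ~` O B = O (predC B).
  apply/seteqP; split=> y.
    move=> nB; have [i yi] := star_cover h y; exists i => //=.
    by apply/negP => Bi; apply: nB; exists i.
  move=> [i /negP nBi yi] [i' Bi' yi']; apply: nBi; exact: excl yi' yi Bi'.
have : O B = [set: S].
  apply: connS; first by exists (pt (bary R [set u]%SET)); exists u => //; rewrite /= vE// eqxx ltr01.
    by exists (O B) => //; rewrite setTI.
  by exists (O B); rewrite ?setTI// -openC compl.
move=> /seteqP[_ /(_ (pt (bary R [set v]%SET)) I)[i Bi]].
by rewrite /= vE//; case: eqP => [<-|] //; rewrite ltxx.
Qed.

End surface.

(** * Normal forms of surface presentations *)

Local Close Scope ring_scope.
Local Close Scope classical_set_scope.
Local Open Scope group_scope.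

Section words.
Variable L : eqType.
Local Notation dart := (dart L).
Implicit Types (w A B C D E Z : seq dart) (d e x y : dart).

Definition lets w := map fst w.

Lemma lets_cat u w : lets (u ++ w) = lets u ++ lets w. Proof. exact: map_cat. Qed.
Lemma lets_cons d w : lets (d :: w) = d.1 :: lets w. Proof. by []. Qed.
Lemma lets_winv w : lets (winv w) = rev (lets w).
Proof. by rewrite /lets /winv map_rev -map_comp; congr rev; apply: eq_map. Qed.

Lemma lets_split l w : l \in lets w -> exists A d B, w = A ++ d :: B /\ d.1 = l.
Proof.
elim: w => // d w IH; rewrite lets_cons in_cons => /orP[/eqP->|/IH[A [e [B [-> el]]]]].
  by exists [::], d, w.
by exists (d :: A), e, B.
Qed.

Lemma split_two l w : count_mem l (lets w) = 2 -> exists A d B e C,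
  [/\ w = A ++ d :: B ++ e :: C, d.1 = l, e.1 = l & l \notin lets (A ++ B ++ C)].
Proof.
move=> c2; have lw : l \in lets w by rewrite -has_pred1 has_count c2.
have [A [d [B [Ew dl]]]] := lets_split lw; rewrite Ew lets_cat lets_cons count_cat /= dl eqxx in c2.
have : l \in lets A ++ lets B by rewrite -has_pred1 has_count count_cat; lia.
rewrite mem_cat => /orP[] /lets_split[A' [e [B' [EA el]]]].
  rewrite EA lets_cat lets_cons count_cat /= el eqxx in c2.
  exists A', e, B', d, B; rewrite Ew EA -catA; split=> //.
  by rewrite !lets_cat -has_pred1 has_count !count_cat; lia.
rewrite EA lets_cat lets_cons count_cat /= el eqxx in c2.
exists A, d, A', e, B'; rewrite Ew EA; split=> //.
by rewrite !lets_cat -has_pred1 has_count !count_cat; lia.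
Qed.

Section groups.
Variable H : groupType.
Implicit Type h : L -> H.

Definition upd h d (g : H) : L -> H :=
  fun l => if l == d.1 then (if d.2 then g^-1 else g) else h l.

Lemma evd_upd h d g : evd (upd h d g) d = g.
Proof. by rewrite /evd /upd eqxx; case: d.2; rewrite ?invgK. Qed.

Lemma eq_ev_in h k w : {in lets w, h =1 k} -> ev h w = ev k w.
Proof.
elim: w => //= d w IH hk; rewrite IH; last by move=> l lw; apply: hk; rewrite inE lw orbT.
by rewrite /evd hk// mem_head.
Qed.

Lemma ev_upd h d g w : d.1 \notin lets w -> ev (upd h d g) w = ev h w.
Proof.
move=> dw; apply: eq_ev_in => l lw; rewrite /upd ifN//.
by apply: contraNneq dw => <-.
Qed.

Lemma upd_in h d g l : l != d.1 -> upd h d g l = h l.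
Proof. by rewrite /upd => /negPf->. Qed.

Lemma upd_evd h d : upd h d (evd h d) =1 h.
Proof. by move=> l; rewrite /upd /evd; case: eqP => // ->; case: d.2; rewrite ?invgK. Qed.

Lemma upd_upd h d g g' : upd (upd h d g) d g' =1 upd h d g'.
Proof. by move=> l; rewrite /upd; case: eqP. Qed.

Lemma ev_subgroup (Q : H -> Prop) h w : is_subgroup Q ->
  (forall l, l \in lets w -> Q (h l)) -> Q (ev h w).
Proof.
move=> [Q1 QM QV]; elim: w => //= d w IH Qh; apply: QM.
  by rewrite /evd; case: d.2; [apply: QV|]; apply: Qh; rewrite mem_head.
by apply: IH => l lw; apply: Qh; rewrite inE lw orbT.
Qed.

End groups.

Lemma upd_hom (H H' : groupType) (f : H -> H') (h : L -> H) d g : is_hom f ->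
  f \o upd h d g =1 upd (f \o h) d (f g).
Proof. by move=> fM l; rewrite /upd /=; case: eqP => // _; case: d.2; rewrite ?homV. Qed.

Lemma evd_hom (H H' : groupType) (f : H -> H') (h : L -> H) d : is_hom f ->
  f (evd h d) = evd (f \o h) d.
Proof. by move=> fM; rewrite /evd /=; case: d.2; rewrite ?homV. Qed.

Section presentable.
Variable G : groupType.

(* [fs] is a list of relators; only the letters occurring in it generate. *)
Definition presF (fs : seq (seq dart)) (gen : L -> G) :=
  [/\ forall w, w \in fs -> ev gen w = 1,
      forall (H : groupType) (h : L -> H), (forall w, w \in fs -> ev h w = 1) ->
        exists f : G -> H, is_hom f /\ forall l, l \in lets (flatten fs) -> f (gen l) = h l &
      forall Q : G -> Prop, is_subgroup Q ->
        (forall l, l \in lets (flatten fs) -> Q (gen l)) -> forall a, Q a].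

Definition presentable fs := exists gen, presF fs gen.

Lemma presentable1 W gen : presF [:: W] gen <->
  [/\ ev gen W = 1,
      forall (H : groupType) (h : L -> H), ev h W = 1 ->
        exists f : G -> H, is_hom f /\ forall l, l \in lets W -> f (gen l) = h l &
      forall Q : G -> Prop, is_subgroup Q ->
        (forall l, l \in lets W -> Q (gen l)) -> forall a, Q a].
Proof.
rewrite /presF /= cats0; split=> -[g1 g2 g3]; split=> //.
- by apply: g1; rewrite mem_head.
- by move=> H h hW; apply: g2 => w; rewrite inE => /eqP->.
- by move=> w; rewrite inE => /eqP->.
- by move=> H h hW; apply: g2; apply: hW; rewrite mem_head.
Qed.

(* Nielsen transformation: the dart [d] is replaced by [u d v]. *)
Lemma presentable_move d u v W W' :
  d.1 \notin lets u -> d.1 \notin lets v -> d.1 \in lets W ->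
  {subset lets u <= lets W} -> {subset lets v <= lets W} -> lets W' =i lets W ->
  (forall (H : groupType) (h : L -> H),
     ev (upd h d (ev h u * evd h d * ev h v)) W' = ev h W) ->
  presentable [:: W] -> presentable [:: W'].
Proof.
move=> du dv dW uW vW WW' C [gen /presentable1[g1 g2 g3]].
pose T (H : groupType) (h : L -> H) := upd h d (ev h u * evd h d * ev h v).
pose T' (H : groupType) (h : L -> H) := upd h d ((ev h u)^-1 * evd h d * (ev h v)^-1).
have TT' (H : groupType) (h : L -> H) : T H (T' H h) =1 h.
  by move=> l; rewrite /T upd_upd !ev_upd// evd_upd !gnorm upd_evd.
have T'T (H : groupType) (h : L -> H) : T' H (T H h) =1 h.
  by move=> l; rewrite /T' upd_upd !ev_upd// evd_upd !gnorm upd_evd.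
exists (T G gen); apply/presentable1; split.
- by rewrite C.
- move=> H h hW'; have hW : ev (T' H h) W = 1 by rewrite -C (eq_ev (TT' H h)).
  have [f [fM fgen]] := g2 H (T' H h) hW.
  exists f; split=> // l lW'.
  have -> : f (T G gen l) = T H (f \o gen) l.
    by rewrite -[LHS]/((f \o T G gen) l) upd_hom// !fM !(ev_hom _ _ fM) evd_hom.
  rewrite -[RHS](TT' H h) /T.
  have Eu : ev (f \o gen) u = ev (T' H h) u by apply: eq_ev_in => k ku; apply/fgen/uW.
  have Ev : ev (f \o gen) v = ev (T' H h) v by apply: eq_ev_in => k kv; apply/fgen/vW.
  have Ed : evd (f \o gen) d = evd (T' H h) d by rewrite /evd /= fgen.
  by rewrite Eu Ev Ed /upd; case: eqP => // _; apply: fgen; rewrite -WW'.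
- move=> Q Qs Qgen; apply: g3 => // l lW; rewrite -(T'T G gen).
  have [Q1 QM QV] := Qs; have QT k : k \in lets W -> Q (T G gen k) by rewrite -WW'; exact: Qgen.
  have Qu : Q (ev (T G gen) u) by apply: ev_subgroup => // k ku; apply/QT/uW.
  have Qv : Q (ev (T G gen) v) by apply: ev_subgroup => // k kv; apply/QT/vW.
  have Qd : Q (evd (T G gen) d) by rewrite /evd; case: d.2; [apply: QV|]; exact: QT.
  rewrite /T' /upd; case: eqP => _; last exact: QT.
  have Qx : Q ((ev (T G gen) u)^-1 * evd (T G gen) d * (ev (T G gen) v)^-1).
    by apply: (QM); [apply: (QM) => //; exact: QV|exact: QV].
  by case: d.2 => //; exact: QV.
Qed.

Lemma presentable_moveE d u v W W' :
  d.1 \notin lets u -> d.1 \notin lets v -> d.1 \in lets W ->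
  {subset lets u <= lets W} -> {subset lets v <= lets W} -> lets W' =i lets W ->
  (forall (H : groupType) (h : L -> H),
     ev (upd h d (ev h u * evd h d * ev h v)) W' = ev h W) ->
  presentable [:: W] <-> presentable [:: W'].
Proof.
move=> du dv dW uW vW WW' C; split; first exact: (presentable_move du dv).
apply: (@presentable_move d (winv u) (winv v)).
- by rewrite lets_winv mem_rev.
- by rewrite lets_winv mem_rev.
- by rewrite WW'.
- by move=> l; rewrite lets_winv mem_rev WW' => /uW.
- by move=> l; rewrite lets_winv mem_rev WW' => /vW.
- by move=> l; rewrite WW'.
move=> H h; rewrite -C; apply: eq_ev => l; rewrite upd_upd !ev_upd// evd_upd !ev_winv.
by rewrite !gnorm upd_evd.
Qed.

Lemma presentable_rot A B : presentable [:: A ++ B] <-> presentable [:: B ++ A].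
Proof.
wlog suff : A B / presentable [:: A ++ B] -> presentable [:: B ++ A].
  by move=> S; split; exact: S.
move=> [gen /presentable1[g1 g2 g3]]; exists gen; apply/presentable1.
have rotE (H : groupType) (h : L -> H) : ev h (A ++ B) = 1 <-> ev h (B ++ A) = 1.
  by rewrite !ev_cat; split=> /mulg1_eq <-; rewrite ?mulgV ?mulVg.
have memE l : (l \in lets (B ++ A)) = (l \in lets (A ++ B)) by rewrite !lets_cat !mem_cat orbC.
split; first exact/rotE.
- by move=> H h /rotE/g2[f [fM fE]]; exists f; split=> // l; rewrite memE; exact: fE.
- by move=> Q Qs Ql; apply: g3 => // l; rewrite -memE; exact: Ql.
Qed.

End presentable.

Ltac cats := do 5 (rewrite /= -?catA).

Ltac clia := repeat match goal with
 | |- context [count_mem ?a ?b] => let c := fresh in set c := count_mem a b; clearbody c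
 | |- context [nat_of_bool ?b] => let c := fresh in set c := nat_of_bool b; clearbody c end; clear; lia.

Ltac nl := rewrite ?(lets_cat, lets_cons, lets_winv, mem_cat, inE, mem_rev, negb_or) -?andbA.

Ltac nletters := nl; repeat match goal with
 | |- context [?a \in lets ?b] => case: (a \in lets b) => //=
 | |- context [?a == ?b] => case: (a == b) => //= end; rewrite ?orbT ?andbT //.

Section moves.
Variable G : groupType.
Local Notation "W ~ W'" := (presentable G [:: W] <-> presentable G [:: W']) (at level 70).

(** The substitution $d \mapsto dB$ turns the right-hand word into the left-hand one. *)
Lemma crosscap A d B C : d.1 \notin lets (A ++ B ++ C) ->
  A ++ d :: B ++ d :: C ~ A ++ [:: d; d] ++ winv B ++ C.
Proof.
nl => /and3P[dA dB dC].
apply: (@presentable_moveE _ d [::] B) => //.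
- by nl; rewrite eqxx orbT.
- by move=> l lB; nl; rewrite lB !orbT.
- by move=> l; nletters.
move=> H h; rewrite !(ev_cat, ev_cons) ev_winv !ev_upd// !evd_upd /=.
by rewrite !gnorm.
Qed.

(** The substitution $d \mapsto AdA^{-1}$; for commutators, [slide_comm] does this to both letters
    in turn. *)
Lemma slide_sq A d C : d.1 \notin lets (A ++ C) ->
  A ++ [:: d; d] ++ C ~ [:: d; d] ++ A ++ C.
Proof.
nl => /andP[dA dC].
apply: (@presentable_moveE _ d A (winv A)) => //.
- by nl.
- by nl; rewrite eqxx orbT.
- by move=> l lA; nl; rewrite lA.
- by move=> l; rewrite lets_winv mem_rev => lA; nl; rewrite lA.
- by move=> l; nletters.
by move=> H h; rewrite !(ev_cat, ev_cons) ev_winv !ev_upd// !evd_upd /= !gnorm.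
Qed.

Definition comm x y := [:: x; y; dinv x; dinv y].

Lemma slide_comm A x y C : x.1 != y.1 -> x.1 \notin lets (A ++ C) -> y.1 \notin lets (A ++ C) ->
  A ++ comm x y ++ C ~ comm x y ++ A ++ C.
Proof.
move=> xy; nl => /andP[xA xC] /andP[yA yC].
have yx : y.1 != x.1 by rewrite eq_sym.
transitivity (presentable G [:: x :: A ++ y :: winv A ++ dinv x :: A ++ dinv y :: C]).
  apply: (@presentable_moveE _ x A (winv A)) => //.
  - by nl.
  - by nl; rewrite eqxx orbT.
  - by move=> l lA; nl; rewrite lA.
  - by move=> l; rewrite lets_winv mem_rev => lA; nl; rewrite lA.
  - by move=> l; nletters.
  move=> H h; rewrite !(ev_cat, ev_cons) !evd_inv !ev_winv !ev_upd// !evd_upd /= ?evd_inv.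
  have E z : z.1 != x.1 -> forall g, evd (upd h x g) z = evd h z.
    by move=> zx g; rewrite /evd upd_in.
  by rewrite !E// !gnorm.
apply: (@presentable_moveE _ y A (winv A)) => //.
- by nl.
- by nl; rewrite eqxx !orbT.
- by move=> l lA; nl; rewrite lA !orbT.
- by move=> l; rewrite lets_winv mem_rev => lA; nl; rewrite lA !orbT.
- by move=> l; nletters.
move=> H h; rewrite !(ev_cat, ev_cons) !evd_inv !ev_winv !ev_upd// !evd_upd /= ?evd_inv.
have E z : z.1 != y.1 -> forall g, evd (upd h y g) z = evd h z.
  by move=> zx g; rewrite /evd upd_in.
by rewrite !E// !gnorm.
Qed.

(** Two linked pairs of letters form a handle. The substitutions $x \mapsto xB$, $y \mapsto yCB$ and
    $x \mapsto (DCB)^{-1}x$ collect in front of it what lies between the four letters. *)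
Lemma handle A x B y C D E : x.1 != y.1 ->
  x.1 \notin lets (A ++ B ++ C ++ D ++ E) -> y.1 \notin lets (A ++ B ++ C ++ D ++ E) ->
  A ++ x :: B ++ y :: C ++ dinv x :: D ++ dinv y :: E ~ A ++ D ++ C ++ B ++ comm x y ++ E.
Proof.
move=> xy; nl => /and5P[xA xB xC xD xE] /and5P[yA yB yC yD yE].
have yx : y.1 != x.1 by rewrite eq_sym.
have Ex (H : groupType) (h : L -> H) g : evd (upd h x g) y = evd h y by rewrite /evd upd_in.
have Ey (H : groupType) (h : L -> H) g : evd (upd h y g) x = evd h x by rewrite /evd upd_in.
transitivity (presentable G [:: A ++ x :: y :: C ++ B ++ dinv x :: D ++ dinv y :: E]).
  apply: (@presentable_moveE _ x [::] B) => //.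
  - by nl; rewrite eqxx orbT.
  - by move=> l lA; nl; rewrite lA ?orbT.
  - by move=> l; nletters.
  move=> H h; rewrite !(ev_cat, ev_cons) !evd_inv !ev_upd// !evd_upd !Ex /=.
  by rewrite !gnorm.
transitivity (presentable G [:: A ++ x :: y :: dinv x :: D ++ C ++ B ++ dinv y :: E]).
  apply: (@presentable_moveE _ y [::] (C ++ B)) => //.
  - by nl; apply/andP.
  - by nl; rewrite eqxx !orbT.
  - by move=> l; nl => /orP[] ->; rewrite ?orbT.
  - by move=> l; nletters.
  move=> H h; rewrite !(ev_cat, ev_cons) !evd_inv !ev_upd// !evd_upd !Ey /= ?ev_cat.
  by rewrite !gnorm.
apply: (@presentable_moveE _ x (winv (D ++ C ++ B)) [::]) => //.
- by rewrite lets_winv mem_rev; nl; apply/and3P.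
- by nl; rewrite eqxx orbT.
- by move=> l; rewrite lets_winv mem_rev; nl => /or3P[] ->; rewrite ?orbT.
- by move=> l; nletters.
move=> H h; rewrite !(ev_cat, ev_cons) ev_winv !ev_cat !evd_inv !ev_upd// !evd_upd !Ex /= ?evd_inv.
by rewrite !gnorm.
Qed.

(** Dyck's theorem: a torus and a projective plane together are three projective planes. After $x
    \mapsto xa$ the letters [a] and [b] occur twice with the same sign, so [crosscap] applies to
    them. *)
Lemma squares3 A x a b Z : uniq [:: x.1; a.1; b.1] ->
  x.1 \notin lets (A ++ Z) -> a.1 \notin lets (A ++ Z) -> b.1 \notin lets (A ++ Z) ->
  A ++ [:: x; x] ++ comm a b ++ Z ~ A ++ [:: x; x; b; b; a; a] ++ Z.
Proof.
rewrite /= !inE negb_or andbT => /andP[/andP[xa xb] ab].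
nl => /andP[xA xZ] /andP[aA aZ] /andP[bA bZ].
have ax : a.1 != x.1 by rewrite eq_sym.
have bx : b.1 != x.1 by rewrite eq_sym.
have ba : b.1 != a.1 by rewrite eq_sym.
transitivity (presentable G [:: A ++ [:: x; dinv a; x; b; dinv a; dinv b] ++ Z]).
  apply: (@presentable_moveE _ x [::] [:: a]) => //.
  - by rewrite inE.
  - by nl; rewrite eqxx orbT.
  - by move=> l; nl => /eqP->; rewrite eqxx ?orbT.
  - by move=> l; nletters.
  move=> H h; rewrite !(ev_cat, ev_cons) !ev_upd// !evd_upd /=.
  have E z : z.1 != x.1 -> forall g, evd (upd h x g) z = evd h z.
    by move=> zx g; rewrite /evd upd_in.
  by rewrite !E// !evd_inv !gnorm.
have -> : A ++ [:: x; dinv a; x; b; dinv a; dinv b] ++ Z =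
    (A ++ [:: x]) ++ dinv a :: [:: x; b] ++ dinv a :: dinv b :: Z by rewrite -catA.
rewrite (@crosscap (A ++ [:: x]) (dinv a) [:: x; b] (dinv b :: Z)); last first.
  by nl; rewrite aA aZ /= ax ab.
have -> : (A ++ [:: x]) ++ [:: dinv a; dinv a] ++ winv [:: x; b] ++ dinv b :: Z =
    (A ++ [:: x; dinv a; dinv a]) ++ dinv b :: [:: dinv x] ++ dinv b :: Z by rewrite -!catA.
rewrite (@crosscap (A ++ [:: x; dinv a; dinv a]) (dinv b) [:: dinv x] Z); last first.
  by nl; rewrite /= bA bZ ba bx.
have -> : (A ++ [:: x; dinv a; dinv a]) ++ [:: dinv b; dinv b] ++ winv [:: dinv x] ++ Z =
    A ++ x :: [:: dinv a; dinv a; dinv b; dinv b] ++ x :: Z by rewrite -!catA /winv /= dinvK.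
rewrite crosscap; last by nl; rewrite /= xA xZ xa xb.
by rewrite /winv /rev /= !dinvK.
Qed.


Definition sqs (ds : seq dart) := flatten [seq [:: d; d] | d <- ds].
Definition cms (es : seq (dart * dart)) := flatten [seq comm p.1 p.2 | p <- es].

(** Colours the corners of a polygon: [k d] is the colour where the side [d] starts, [k (dinv d)]
    the colour where it ends, and consecutive sides have to agree at their common corner. *)
Fixpoint run (k : dart -> bool) p w q :=
  if w is d :: w' then (k d == p) && run k (k (dinv d)) w' q else p == q.

Lemma run_cat k p u w q : run k p (u ++ w) q <-> exists m, run k p u m /\ run k m w q.
Proof.
elim: u p => [|d u IH] p /=.
  by split=> [h|[m [/eqP-> //]]]; exists p.
split=> [/andP[-> /IH[m [? ?]]]|[m [/andP[-> ? ?]]]]; first by exists m.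
by apply/IH; exists m.
Qed.

Lemma run_winv k p w q : run k p w q -> run k q (winv w) p.
Proof.
elim: w p => [|d w IH] p /=; first by rewrite eq_sym.
move=> /andP[dp /IH h]; rewrite winv_cons; apply/run_cat; exists (k (dinv d)).
by split=> //=; rewrite eqxx dinvK.
Qed.

Lemma run_ext k k' p w q : (forall d, d.1 \in lets w -> k d = k' d) ->
  run k p w q -> run k' p w q.
Proof.
elim: w p => // d w IH p kk /= /andP[kd h]; rewrite -kk ?kd ?mem_head//= -kk ?mem_head//.
by apply: IH h => e ew; apply: kk; rewrite inE ew orbT.
Qed.

Lemma run_const k p w : (forall d, d.1 \in lets w -> k d = p) -> run k p w p.
Proof.
elim: w => //= d w IH kw; rewrite kw ?mem_head// kw ?mem_head// eqxx IH// => e ew.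
by apply: kw; rewrite inE ew orbT.
Qed.

(** The polygon [W] has a single vertex after gluing: every two-colouring of the corners that
    respects the gluing is constant. In this form the condition is carried through the moves by
    translating colourings, without equivalence classes of corners. *)
Definition univ W := forall k p, run k p W p -> forall d, d.1 \in lets W -> k d = p.

Lemma dart2 d e : d.1 = e.1 -> d = e \/ d = dinv e.
Proof. by case: d e => l b [l' b'] /= ->; rewrite /dinv /=; case: b b' => [] []; [left|right|right|left]. Qed.

Lemma run_sqs k p ds q : run k p (sqs ds) q ->
  q = p /\ forall d, d.1 \in lets (sqs ds) -> k d = p.
Proof.
elim: ds => [|e ds IH] /=; first by move=> /eqP.
move=> /and3P[/eqP e1 /eqP e2]; rewrite -e2 e1 => /IH[-> h]; split=> // d.
rewrite !inE orbA orbb => /orP[/eqP/dart2[->|->]|/h//]; first exact: e1.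
by rewrite -e2.
Qed.

Lemma run_comm k p x y w q : run k p (comm x y ++ w) q ->
  (forall d, d.1 \in lets (comm x y) -> k d = p) /\ run k p w q.
Proof.
rewrite /= !dinvK => /and5P[/eqP x1 /eqP y1 /eqP x2 /eqP y2 h].
have y3 : k y = p by rewrite y1 x2 y2.
have x3 : k (dinv x) = p by rewrite -y1.
rewrite y3 in h; split=> // d; rewrite !inE.
have y4 : k (dinv y) = p by rewrite y2.
by move=> /or4P[] /eqP/dart2[] ->.
Qed.

Lemma run_cms k p es q : run k p (cms es) q ->
  q = p /\ forall d, d.1 \in lets (cms es) -> k d = p.
Proof.
elim: es => [|[x y] es IH]; first by move=> /eqP.
rewrite /cms /= -/(cms es) => /(@run_comm k p x y)[c /IH[-> h]]; split=> // d.
rewrite -[[:: x.1, y.1, x.1, y.1 & _]]/(lets (comm x y) ++ lets (cms es)) mem_cat => /orP[/c|/h] //.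
Qed.

Definition quad W := forall l, l \in lets W -> count_mem l (lets W) = 2.

Lemma quad_count W W' : (forall l, count_mem l (lets W') = count_mem l (lets W)) ->
  quad W -> quad W'.
Proof. by move=> E qW l lW; rewrite E; apply: qW; rewrite -has_pred1 has_count -E -has_count has_pred1. Qed.

Lemma count_blocks ds es l : l \in lets (sqs ds ++ cms es) ->
  (2 <= count_mem l (lets (sqs ds ++ cms es)))%N.
Proof.
rewrite lets_cat mem_cat count_cat => /orP[].
  elim: ds => // d ds IH; rewrite /sqs /= -/(sqs ds) !inE orbA orbb => /orP[/eqP->|/IH]; first by rewrite !eqxx; lia.
  lia.
elim: es => // -[x y] es IH; rewrite /cms /= -/(cms es) !inE.
by case: eqVneq => [->|_] /=; [|case: eqVneq => [->|_] /=; [|move=> /IH]]; rewrite ?eqxx; lia.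
Qed.

(** Between [d] and [dinv d], look at the letter following [d]. Its partner has the same sign, or
    lies outside and gives a linked pair, or lies inside and gives a pair at smaller distance; the
    induction is on this distance. *)
Lemma quad_find Z : Z != [::] -> quad Z ->
  [\/ exists A d B C, Z = A ++ d :: B ++ d :: C,
      exists A x B y C D E, Z = A ++ x :: B ++ y :: C ++ dinv x :: D ++ dinv y :: E |
      exists A d C, Z = A ++ d :: dinv d :: C].
Proof.
move=> Z0 qZ.
have main k : forall A d B C, Z = A ++ d :: B ++ dinv d :: C -> (size B <= k)%N ->
  [\/ exists A d B C, Z = A ++ d :: B ++ d :: C,
      exists A x B y C D E, Z = A ++ x :: B ++ y :: C ++ dinv x :: D ++ dinv y :: E |
      exists A d C, Z = A ++ d :: dinv d :: C].
  elim: k => [|k IH] A d B C EZ.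
    by case: B EZ => // EZ _; constructor 3; exists A, d, C.
  case: B EZ => [EZ|y B EZ]; first by move=> _; constructor 3; exists A, d, C.
  rewrite ltnS => sB.
  have yZ : y.1 \in lets Z by rewrite EZ !(lets_cat, lets_cons, mem_cat, inE) eqxx !orbT.
  have c2 := qZ _ yZ.
  rewrite EZ !(lets_cat, lets_cons, count_cat) /= !(lets_cat, lets_cons, count_cat) /= eqxx in c2.
  have [yd|yd] := eqVneq y.1 d.1; first by rewrite yd eqxx in c2; lia.
  have : y.1 \in lets A ++ (lets B ++ lets C).
    rewrite -has_pred1 has_count !count_cat; move: c2; rewrite eq_sym (negPf yd); lia.
  rewrite !mem_cat => /or3P[] /lets_split[A1 [e [A2 [EA /dart2 ey]]]].
  - case: ey => ey; rewrite ey in EA; rewrite EA in EZ.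
      by constructor 1; exists A1, y, (A2 ++ [:: d]), (B ++ dinv d :: C); rewrite EZ; cats.
    by constructor 2; exists A1, (dinv y), A2, d, [::], B, C; rewrite EZ /= ?dinvK; cats.
  - case: ey => ey; rewrite ey in EA; rewrite EA in EZ sB.
      by constructor 1; exists (A ++ [:: d]), y, A1, (A2 ++ dinv d :: C); rewrite EZ; cats.
    apply: (IH (A ++ [:: d]) y A1 (A2 ++ dinv d :: C)); first by rewrite EZ; cats.
    by move: sB; rewrite -/(size (A1 ++ dinv y :: A2)) size_cat; lia.
  - case: ey => ey; rewrite ey in EA; rewrite EA in EZ.
      by constructor 1; exists (A ++ [:: d]), y, (B ++ dinv d :: A1), A2; rewrite EZ; cats.
    by constructor 2; exists A, d, [::], y, B, A1, A2; rewrite EZ.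
case: Z Z0 qZ main => // z Z _ qZ main.
have [A [d [B [e [C [EZ dz ez _]]]]]] := split_two (qZ z.1 (mem_head _ _)).
have /dart2[Ee|Ee] : e.1 = d.1 by rewrite dz.
  by constructor 1; exists A, d, B, C; rewrite EZ Ee.
by apply: (main (size B) A d B C) => //; rewrite EZ Ee.
Qed.

Ltac cnt := do 5 (rewrite ?(lets_cat, lets_cons, lets_winv, count_cat, count_rev) /=).

Lemma quad_notin W A d B e C : quad W -> W = A ++ d :: B ++ e :: C -> e.1 = d.1 ->
  d.1 \notin lets (A ++ B ++ C).
Proof.
move=> qW EW ed; have : d.1 \in lets W by rewrite EW; nl; rewrite eqxx orbT.
move=> /qW; rewrite EW; cnt; rewrite ed eqxx -has_pred1 has_count; cnt; lia.
Qed.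

(** Each step extracts a square or a commutator from the unsorted rest [Z]. To keep the one-vertex
    condition, a colouring [k] of the new word is translated into a colouring [k'] of the old
    one. *)
Lemma blocks_form m : forall ds es Z, (size Z <= m)%N ->
  let W := sqs ds ++ cms es ++ Z in
  quad W -> univ W -> presentable G [:: W] ->
  exists ds' es', let W' := sqs ds' ++ cms es' in
  [/\ quad W', presentable G [:: W'] & size W' = size W].
Proof.
elim: m => [|m IH] ds es Z sZ W qW uW pW.
  by case: Z sZ @W qW uW pW => // _; rewrite !cats0; exists ds, es.
have [Z0|Z0] := eqVneq Z [::].
  by move: @W qW uW pW; rewrite Z0 cats0 => W qW uW pW; exists ds, es.
(* The letters of the sorted blocks already occur twice there, so none of them is left for [Z]. *)
have qZ : quad Z.
  move=> l lZ; have := qW l; rewrite /W catA [in lets _]lets_cat mem_cat lZ orbT => /(_ isT).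
  have := @count_blocks ds es l; rewrite -has_pred1 has_count !lets_cat !count_cat; 
  move: lZ; rewrite -has_pred1 has_count; case: (_ + _)%N => [|c]; lia.
case: (quad_find Z0 qZ) => [[A [d [B [C EZ]]]]|[A [x [B [y [C [D [E EZ]]]]]]]|[A [d [C EZ]]]].
- have EW : W = (sqs ds ++ cms es ++ A) ++ d :: B ++ d :: C by rewrite /W EZ -!catA.
  have dW := quad_notin qW EW erefl.
  pose Z' := A ++ winv B ++ C; pose W' := sqs (d :: ds) ++ cms es ++ Z'.
  have pW' : presentable G [:: W'].
    have := crosscap dW; rewrite -EW => -[/(_ pW) p _].
    move: p; rewrite (@slide_sq (sqs ds ++ cms es ++ A) d (winv B ++ C)).
      by rewrite /W' /Z' /sqs /= -!catA.
    by move: dW; nl.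
  have cW l : count_mem l (lets W') = count_mem l (lets W).
    by rewrite EW /W' /Z' /sqs /= -/(sqs ds); cnt; clia.
  have sW : size W' = size W.
    have : perm_eq (lets W') (lets W) by apply/allP => l _; apply/eqP; exact: cW.
    by move=> /perm_size; rewrite !size_map.
  have [||ds' [es' [q p s]]] := IH (d :: ds) es Z' _ (quad_count cW qW) _ pW'.
  + move: sZ; rewrite EZ /Z' !size_cat /= !size_cat /= size_rev size_map; lia.
  + move=> k p; rewrite /W' /Z' /sqs /= -/(sqs ds) => /and3P[/eqP k1 /eqP k2].
    rewrite -k2 k1 => /run_cat[m1 [/run_sqs[-> ps] /run_cat[m2 [/run_cms[-> pc]]]]].
    move=> /run_cat[a [rA /run_cat[b [/run_winv rB rC]]]]; rewrite winvK in rB.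
    (* In the old word both occurrences of [d] lead from the corner at the end of [A] to the corner
       at the start of [C]. *)
    pose k' e := if e == d then a else if e == dinv d then b else k e.
    have k'E e : e.1 != d.1 -> k' e = k e.
      move=> ed; rewrite /k' !ifN//; first by apply: contraNneq ed => ->.
      by apply: contraNneq ed => ->.
    have k'd : k' d = a by rewrite /k' eqxx.
    have k'd' : k' (dinv d) = b.
      rewrite /k' eqxx ifN//; apply/eqP => /(congr1 snd) /=; by case: d.2.
    have ext w u v : d.1 \notin lets w -> run k u w v -> run k' u w v.
      move=> dw; apply: run_ext => e ew; rewrite k'E//; apply: contraNneq dw => <-; exact: ew.
    move: (dW); nl => /and5P[d1 d2 d3 d4 d5].
    have rW : run k' p W p.
      rewrite EW; apply/run_cat; exists a; split.
        apply/run_cat; exists p; split; first by apply: ext => //; exact: run_const.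
        apply/run_cat; exists p; split; first by apply: ext => //; exact: run_const.
        exact: ext.
      rewrite /= k'd eqxx k'd' /=; apply/run_cat; exists a; split; first exact: ext.
      by rewrite /= k'd eqxx k'd' /=; exact: ext.
    have uk := uW _ _ rW => e eW'.
    have eW : e.1 \in lets W.
      rewrite -has_pred1 has_count -cW -has_count has_pred1.
      by move: eW'; rewrite /W' /Z' /sqs /= -/(sqs ds); nl.
    have [ed|ed] := eqVneq e.1 d.1; last by rewrite -k'E// uk.
    by case: (dart2 ed) => ->; rewrite -?k2.
  by exists ds', es'; split=> //; rewrite s.
- have EW : W = (sqs ds ++ cms es ++ A) ++ x :: B ++ y :: C ++ dinv x :: D ++ dinv y :: E.
    by rewrite /W EZ -!catA.
  have EWx : W = (sqs ds ++ cms es ++ A) ++ x :: (B ++ y :: C) ++ dinv x :: (D ++ dinv y :: E).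
    by rewrite EW; cats.
  have EWy : W = (sqs ds ++ cms es ++ A ++ x :: B) ++ y :: (C ++ dinv x :: D) ++ dinv y :: E.
    by rewrite EW; cats.
  have xW := quad_notin qW EWx erefl; have yW := quad_notin qW EWy erefl.
  pose Z' := A ++ D ++ C ++ B ++ E; pose W' := sqs ds ++ cms ((x, y) :: es) ++ Z'.
  move: (xW); nl => /and5P[x1 x2 x3 x4 /and5P[xy x5 x6 _ x7]].
  move: (yW); nl => /and5P[y1 y2 y3 yx /and5P[y4 y5 _ y6 y7]].
  have pW' : presentable G [:: W'].
    have := @handle (sqs ds ++ cms es ++ A) x B y C D E; rewrite -EW => -[||| /(_ pW) p _].
    + by [].
    + by nl; rewrite x1 x2 x3 x4 x5 x6 x7.
    + by nl; rewrite y1 y2 y3 y4 y5 y6 y7.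
    move: p; have -> : (sqs ds ++ cms es ++ A) ++ D ++ C ++ B ++ comm x y ++ E =
        (sqs ds ++ cms es ++ A ++ D ++ C ++ B) ++ comm x y ++ E by rewrite -!catA.
    rewrite slide_comm//.
    + have -> : W' = sqs ds ++ comm x y ++ (cms es ++ Z') by rewrite /W' /cms /= -?catA.
      rewrite slide_comm//.
      * by rewrite /Z' -!catA.
      * by rewrite /Z'; nl; rewrite x1 x2 x3 x4 x5 x6 x7.
      * by rewrite /Z'; nl; rewrite y1 y2 y3 y4 y5 y6 y7.
    + by nl; rewrite x1 x2 x3 x4 x5 x6 x7.
    + by nl; rewrite y1 y2 y3 y4 y5 y6 y7.
  have cW l : count_mem l (lets W') = count_mem l (lets W).
    by rewrite EW /W' /Z' /cms /= -/(cms es); cnt; clia.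
  have sW : size W' = size W.
    have : perm_eq (lets W') (lets W) by apply/allP => l _; apply/eqP; exact: cW.
    by move=> /perm_size; rewrite !size_map.
  have [||ds' [es' [q p s]]] := IH ds ((x, y) :: es) Z' _ (quad_count cW qW) _ pW'.
  + move: sZ; rewrite EZ /Z' !size_cat /= !size_cat /= !size_cat /= !size_cat /=; clear; lia.
  + rewrite -/W' => k p; have -> : W' = sqs ds ++ comm x y ++ (cms es ++ Z') by rewrite /W' /cms /= -?catA.
    move=> /run_cat[m1 [/run_sqs[-> ps] /run_comm[pxy /run_cat[m2 [/run_cms[-> pc]]]]]].
    move=> /run_cat[a [rA /run_cat[d [rD /run_cat[c [rC /run_cat[b [rB rE]]]]]]]].
    pose k' e := if e == x then a else if e == dinv x then c else
      if e == y then b else if e == dinv y then d else k e.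
    have neqd (u v : dart) : u.1 != v.1 -> u != v by apply: contraNneq => ->.
    have inv (u : dart) : dinv u != u by apply/eqP => /(congr1 snd) /=; case: u.2.
    have yx' : y.1 != x.1 by rewrite eq_sym.
    have k'E e : e.1 != x.1 -> e.1 != y.1 -> k' e = k e.
      by move=> ex ey; rewrite /k' !ifN//; exact: neqd.
    have k1 : k' x = a by rewrite /k' eqxx.
    have k2 : k' (dinv x) = c by rewrite /k' eqxx (negPf (inv x)).
    have k3 : k' y = b by rewrite /k' eqxx !ifN//; exact: neqd.
    have k4 : k' (dinv y) = d by rewrite /k' eqxx (negPf (inv y)) !ifN//; exact: neqd.
    have ext w u v : x.1 \notin lets w -> y.1 \notin lets w -> run k u w v -> run k' u w v.
      move=> xw yw; apply: run_ext => e ew; rewrite k'E//; first by apply: contraNneq xw => <-.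
      by apply: contraNneq yw => <-.
    have rW : run k' p W p.
      rewrite EW; apply/run_cat; exists a; split.
        apply/run_cat; exists p; split; first by apply: ext => //; exact: run_const.
        apply/run_cat; exists p; split; first by apply: ext => //; exact: run_const.
        exact: ext.
      rewrite /= k1 eqxx k2; apply/run_cat; exists b; split; first exact: ext.
      rewrite /= k3 eqxx k4; apply/run_cat; exists c; split; first exact: ext.
      rewrite /= k2 eqxx dinvK k1; apply/run_cat; exists d; split; first exact: ext.
      by rewrite /= k4 eqxx dinvK k3; exact: ext.
    have uk := uW _ _ rW => e eW'.
    have eW : e.1 \in lets W.
      by rewrite -has_pred1 has_count -cW -has_count has_pred1 /W' /cms /= -?catA; exact: eW'.
    have [ex|ex] := eqVneq e.1 x.1; first by apply: pxy; rewrite !inE ex eqxx.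
    have [ey|ey] := eqVneq e.1 y.1; first by apply: pxy; rewrite !inE ey eqxx orbT.
    by rewrite -k'E// uk.
  by exists ds', es'; split=> //; rewrite s.
(* A subword [d], [dinv d] encloses a vertex of its own, and the colouring that singles out this tip
   contradicts [univ]. *)
- exfalso.
  have EW : W = (sqs ds ++ cms es ++ A) ++ d :: [::] ++ dinv d :: C by rewrite /W EZ -!catA.
  have dW := quad_notin qW EW erefl.
  have inv : dinv d != d by apply/eqP => /(congr1 snd) /=; case: d.2.
  pose k e := e == dinv d.
  have kd : k d = false by rewrite /k eq_sym (negPf inv).
  have kd' : k (dinv d) = true by rewrite /k eqxx.
  have kE w : d.1 \notin lets w -> run k false w false.
    move=> dw; apply: run_const => e ew; rewrite /k; apply: contraNF dw => /eqP E.
    by rewrite E in ew.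
  have rW : run k false W false.
    move: dW; nl => /and4P[d1 d2 d3 d4]; rewrite EW; apply/run_cat; exists false; split.
      by apply: kE; nl; rewrite d1 d2.
    by rewrite /= kd kd' dinvK kd; apply: kE; case/andP: d4.
  have : k (dinv d) = false by apply: (uW _ _ rW); rewrite EW; nl; rewrite eqxx orbT.
  by rewrite kd'.
Qed.

End moves.
End words.

(** * Merging the faces of a complex into one polygon *)

Section faces.
Variables (L : eqType) (G : groupType).
Local Notation dart := (dart L).
Implicit Types (w A B C D E Z : seq dart) (d e x y : dart) (fs : seq (seq dart)).

(** The colour [c] is common to all faces, so this expresses that the glued complex has one vertex
    and is connected. *)
Definition univF fs := forall k : dart -> bool,
  (forall w, w \in fs -> exists p, run k p w p) ->
  exists c, forall d, d.1 \in lets (flatten fs) -> k d = c.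

Lemma has_let w : w != [::] -> exists d : dart, d.1 \in lets w.
Proof. by case: w => // d w _; exists d; rewrite mem_head. Qed.

Lemma lets_flatten l fs : l \in lets (flatten fs) <-> exists2 w, w \in fs & l \in lets w.
Proof.
elim: fs => [|w fs IH]; first by split=> // -[].
rewrite /= lets_cat mem_cat; split=> [/orP[lw|/IH[v vf lv]]|[v]].
- by exists w => //; rewrite mem_head.
- by exists v => //; rewrite inE vf orbT.
- by rewrite inE => /orP[/eqP-> ->//|vf lv]; apply/orP; right; apply/IH; exists v.
Qed.

Lemma perm_presF fs fs' gen : perm_eq fs fs' -> @presF L G fs gen -> presF fs' gen.
Proof.
move=> ff; have mE := perm_mem ff.
have lE l : l \in lets (flatten fs) <-> l \in lets (flatten fs').
  by split=> /lets_flatten[w wf lw]; apply/lets_flatten; exists w; rewrite ?mE// -?mE.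
move=> [g1 g2 g3]; split.
- by move=> w; rewrite -mE; exact: g1.
- move=> H h hf; have [w|f [fM fE]] := g2 H h; first by rewrite mE; exact: hf.
  by exists f; split=> // l /lE; exact: fE.
- by move=> Q Qs Ql; apply: g3 => // l /lE; exact: Ql.
Qed.

Lemma perm_univF fs fs' : perm_eq fs fs' -> univF fs -> univF fs'.
Proof.
move=> ff; have mE := perm_mem ff => u k kf.
have [w|c cE] := u k; first by rewrite mE; exact: kf.
exists c => d /lets_flatten[w wf dw]; apply: cE; apply/lets_flatten; exists w => //.
by rewrite mE.
Qed.

Lemma count_flatten l fs :
  count_mem l (lets (flatten fs)) = sumn [seq count_mem l (lets w) | w <- fs].
Proof. by elim: fs => //= w fs IH; rewrite lets_cat count_cat IH. Qed.

Lemma perm_count l fs fs' : perm_eq fs fs' ->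
  count_mem l (lets (flatten fs)) = count_mem l (lets (flatten fs')).
Proof. by move=> ff; rewrite !count_flatten; apply: perm_sumn; exact: perm_map. Qed.

Lemma size_flatten_perm fs fs' : perm_eq fs fs' -> size (flatten fs) = size (flatten fs').
Proof. by move=> ff; rewrite !size_flatten; apply: perm_sumn; exact: perm_map. Qed.

(** The second relator is solved for the common letter [d], which is then eliminated; geometrically,
    two faces are glued along a common side. *)
Lemma merge_two A1 d A2 B1 B2 rest f2 gen :
  f2 = B1 ++ dinv d :: B2 \/ winv f2 = B1 ++ dinv d :: B2 ->
  d.1 \notin lets (A1 ++ A2 ++ B1 ++ B2 ++ flatten rest) ->
  let fs := (A1 ++ d :: A2) :: f2 :: rest in
  let fs' := (A1 ++ B2 ++ B1 ++ A2) :: rest in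
  univF fs -> @presF L G fs gen -> univF fs' /\ presF fs' gen.
Proof.
move=> Ef2 dn fs fs' uf [g1 g2 g3].
move: dn; rewrite !(lets_cat, mem_cat) !negb_or => /and5P[dA1 dA2 dB1 dB2 dr].
have f2E (H : groupType) (h : L -> H) : ev h f2 = 1 <-> ev h B1 * (evd h d)^-1 * ev h B2 = 1.
  case: Ef2 => E; first by rewrite E ev_cat /= evd_inv mulgA.
  have : ev h (winv f2) = ev h B1 * (evd h d)^-1 * ev h B2.
    by rewrite E ev_cat /= evd_inv mulgA.
  by rewrite ev_winv => <-; split=> [->|/eqP]; rewrite ?invg1// invg_eq1 => /eqP.
have dE (H : groupType) (h : L -> H) : ev h f2 = 1 <-> evd h d = ev h B2 * ev h B1.
  rewrite f2E; split=> [E|->]; last by rewrite !gnorm.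
  by rewrite -(mulg1_eq E) !gnorm.
have lf2 l : l \in lets f2 -> l = d.1 \/ l \in lets B1 ++ lets B2.
  have : (l \in lets f2) = (l \in lets (B1 ++ dinv d :: B2)).
    by case: Ef2 => <- //; rewrite lets_winv mem_rev.
  move=> ->; rewrite lets_cat lets_cons !mem_cat inE.
  by move=> /or3P[->|/eqP|->]; [right|left|right; rewrite orbT].
have lfs l : l \in lets (flatten fs) -> l = d.1 \/ l \in lets (flatten fs').
  rewrite /= !(lets_cat, lets_cons, mem_cat, inE) => /orP[/or3P[h|/eqP|h]|/orP[/lf2[]|h]].
  - by right; rewrite h.
  - by left.
  - by right; rewrite h !orbT.
  - by left.
  - by rewrite mem_cat => /orP[] h; right; rewrite h !orbT.
  - by right; rewrite h !orbT.
have lfs' l : l \in lets (flatten fs') -> l \in lets (flatten fs) /\ l != d.1.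
  move=> h; split; last first.
    apply: contraTneq h => ->; rewrite /= !(lets_cat, mem_cat) !negb_or.
    by rewrite dA1 dA2 dB1 dB2 dr.
  move: h; rewrite /= !(lets_cat, lets_cons, mem_cat, inE).
  have BB : (l \in lets B1) || (l \in lets B2) -> l \in lets f2.
    have -> : (l \in lets f2) = (l \in lets (B1 ++ dinv d :: B2)).
      by case: Ef2 => <- //; rewrite lets_winv mem_rev.
    by rewrite lets_cat lets_cons mem_cat inE => /orP[] ->; rewrite ?orbT.
  move=> /orP[/or4P[]|] h; rewrite ?h ?orbT//; by rewrite BB ?h ?orbT.
split.
  move=> k kf.
  have [p /run_cat[m1 [r1 /run_cat[m2 [r2 /run_cat[m3 [r3 r4]]]]]]] := kf _ (mem_head _ _).
  pose k' e := if e == d then m1 else if e == dinv d then m3 else k e.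
  have inv : dinv d != d by apply/eqP => /(congr1 snd) /=; case: d.2.
  have k1 : k' d = m1 by rewrite /k' eqxx.
  have k2 : k' (dinv d) = m3 by rewrite /k' eqxx (negPf inv).
  have k'E e : e.1 != d.1 -> k' e = k e.
    move=> ed; rewrite /k' !ifN//; first by apply: contraNneq ed => ->.
    by apply: contraNneq ed => ->.
  have ext w u v : d.1 \notin lets w -> run k u w v -> run k' u w v.
    by move=> dw; apply: run_ext => e ew; rewrite k'E//; apply: contraNneq dw => <-.
  have [w|c cE] := uf k'.
    rewrite !inE => /or3P[/eqP->|/eqP->|wr].
    - exists p; apply/run_cat; exists m1; split; first exact: ext.
      by rewrite /= k1 eqxx k2; exact: ext.
    - have rB : run k' m2 (B1 ++ dinv d :: B2) m2.
        apply/run_cat; exists m3; split; first exact: ext.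
        by rewrite /= k2 eqxx dinvK k1; exact: ext.
      exists m2; case: Ef2 => E; first by rewrite E.
      by rewrite -[f2]winvK; apply: run_winv; rewrite E.
    - have [q rq] := kf w (introT orP (or_intror wr)).
      exists q; apply: ext rq; apply: contra dr => dw; apply/lets_flatten; by exists w.
  exists c => e /lfs'[ef ed]; rewrite -k'E//; exact: cE.
split.
- move=> w; rewrite inE => /orP[/eqP->|wr]; last by apply: g1; rewrite !inE wr !orbT.
  have E1 : ev gen (A1 ++ d :: A2) = 1 by apply: g1; rewrite mem_head.
  have /dE E2 : ev gen f2 = 1 by apply: g1; rewrite !inE eqxx orbT.
  by move: E1; rewrite !ev_cat /= E2 !mulgA.
- move=> H h hf; pose h1 := upd h d (ev h B2 * ev h B1).
  have [w|f [fM fE]] := g2 H h1.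
    rewrite !inE => /or3P[/eqP->|/eqP->|wr].
    - rewrite ev_cat /= !ev_upd// evd_upd.
      by have := hf _ (mem_head _ _); rewrite !ev_cat !mulgA.
    - by apply/dE; rewrite evd_upd !ev_upd.
    - rewrite ev_upd; last by apply: contra dr => dw; apply/lets_flatten; exists w.
      by apply: hf; rewrite inE wr orbT.
  by exists f; split=> // l /lfs'[/fE-> ld]; rewrite /h1 upd_in.
- move=> Q Qs Ql; apply: g3 => // l /lfs[->|]; last exact: Ql.
  have /dE E2 : ev gen f2 = 1 by apply: g1; rewrite !inE eqxx orbT.
  have [Q1 QM QV] := Qs.
  have : Q (evd gen d).
    rewrite E2; apply: (QM); apply: ev_subgroup => // l' h; apply: Ql;
      by rewrite /= !(lets_cat, mem_cat) h !orbT.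
  by rewrite /evd; case: d.2 => // /QV; rewrite invgK.
Qed.

(** If the first face shared no letter with the others, giving its corners a colour of their own
    would contradict [univF]. Each merger shortens the total length by two, from $2(n+N)$ down to
    $2n$. *)
Lemma merge_faces n N : forall fs gen, (0 < n)%N -> size fs = N.+1 ->
  (forall w, w \in fs -> w != [::]) -> quad (flatten fs) -> univF fs -> presF (G := G) fs gen ->
  size (flatten fs) = (2 * (n + N))%N ->
  exists W : seq dart, [/\ quad W, univ W, presentable G [:: W] & size W = (2 * n)%N].
Proof.
elim: N => [|N IH] fs gen n0 sf nf qf uf pf sz.
  case: fs sf nf qf uf pf sz => // W [] // _ nW qW uW pW sz; exists W.
  have W0 : W != [::] by apply: nW; rewrite mem_head.
  rewrite /= cats0 in qW sz; split=> //; [|by exists gen|by rewrite sz addn0].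
  move=> k p rp; have [w|c cE] := uW k; first by rewrite inE => /eqP->; exists p.
  rewrite /= cats0 in cE; move: rp W0; case: (W) cE => // e W' cE /= /andP[/eqP ep _] _ d dW.
  by rewrite cE// -ep cE// mem_head.
case: fs sf nf qf uf pf sz => // f1 rest [sr] nf qf uf pf sz.
have [l lf1 lr] : exists2 l, l \in lets f1 & l \in lets (flatten rest).
  apply: contrapT => nol; have f10 : f1 != [::] by apply: nf; rewrite mem_head.
  pose k d := d.1 \in lets f1.
  have kr w d : w \in rest -> d.1 \in lets w -> k d = false.
    move=> wr dw; apply/negP => kd; apply: nol; exists d.1 => //.
    by apply/lets_flatten; exists w.
  have [w|c cE] := uf k.
    rewrite inE => /orP[/eqP->|wr]; first by exists true; apply: run_const.
    by exists false; apply: run_const => d; exact: kr wr.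
  have [w wr] : exists w, w \in rest by case: (rest) sr => // w r _; exists w; rewrite mem_head.
  have w0 : w != [::] by apply: nf; rewrite inE wr orbT.
  have [d dw] := has_let w0; have [e ef] := has_let f10.
  have : k d = k e.
    rewrite !cE//; apply/lets_flatten; first by exists f1; rewrite ?mem_head.
    by exists w => //; rewrite inE wr orbT.
  by rewrite (kr w)// /k ef.
move/lets_flatten: lr => [f2 f2r lf2].
have [A1 [d [A2 [Ef1 dl]]]] := lets_split lf1.
have [B1 [B2 [Ef2 cB]]] : exists B1 B2, (f2 = B1 ++ dinv d :: B2 \/ winv f2 = B1 ++ dinv d :: B2) /\
    forall l', count_mem l' (lets f2) = (count_mem l' (lets B1) + (d.1 == l') + count_mem l' (lets B2))%N.
  have [B1 [e [B2 [Ef2 el]]]] := lets_split lf2.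
  have /dart2[ed|ed] : e.1 = d.1 by rewrite dl.
    exists (winv B2), (winv B1); rewrite Ef2 ed winv_cat winv_cons -catA; split; first by right.
    by move=> l'; rewrite !(lets_cat, lets_cons, lets_winv, count_cat, count_rev) /=; lia.
  exists B1, B2; rewrite Ef2 ed; split; first by left.
  by move=> l'; rewrite !(lets_cat, lets_cons, count_cat) /=; lia.
pose rest' := rem f2 rest.
have pfs : perm_eq (f1 :: rest) (f1 :: f2 :: rest') by rewrite perm_cons perm_to_rem.
have cfs l' : count_mem l' (lets (flatten (f1 :: rest))) =
    (count_mem l' (lets (A1 ++ A2 ++ B1 ++ B2 ++ flatten rest')) + (d.1 == l') + (d.1 == l'))%N.
  rewrite (perm_count _ pfs) /= !(lets_cat, count_cat) cB Ef1 lets_cat lets_cons count_cat /=.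
  by move: (count_mem _ _) (count_mem _ _) (count_mem _ _) (count_mem _ _) (count_mem _ _) => *; lia.
have dn : d.1 \notin lets (A1 ++ A2 ++ B1 ++ B2 ++ flatten rest').
  have dm : d.1 \in lets (flatten (f1 :: rest)) by rewrite /= lets_cat mem_cat dl lf1.
  by move: (qf _ dm); rewrite cfs eqxx -has_pred1 has_count; case: count => // c; rewrite !addnS.
pose f' := A1 ++ B2 ++ B1 ++ A2.
have cf' l' : count_mem l' (lets (flatten (f' :: rest'))) =
    count_mem l' (lets (A1 ++ A2 ++ B1 ++ B2 ++ flatten rest')).
  rewrite /= /f' !(lets_cat, count_cat).
  by move: (count_mem _ _) (count_mem _ _) (count_mem _ _) (count_mem _ _) (count_mem _ _) => *; lia.
have [uf' pf'] : univF (f' :: rest') /\ presF (G := G) (f' :: rest') gen.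
  apply: (merge_two (d := d) (f2 := f2)) => //.
    by rewrite -Ef1; exact: perm_univF uf.
  by rewrite -Ef1; exact: perm_presF pf.
have sB : size f2 = (size B1 + size B2).+1.
  case: Ef2 => E; first by rewrite E size_cat /= addnS.
  by have := congr1 size E; rewrite /winv size_rev size_map size_cat /= addnS.
have sE : size (flatten (f' :: rest')) = (2 * (n + N))%N.
  move: sz; rewrite (size_flatten_perm pfs) /= !size_cat sB Ef1 size_cat /=.
  move: (size _) (size _) (size _) (size _) (size _) => *; lia.
apply: (IH (f' :: rest') gen) => //.
- have := size_rem f2r; rewrite -/rest' sr /= => ->.
  by [].
- move=> w; rewrite inE => /orP[/eqP->|wr]; last by apply: nf; rewrite inE (mem_rem wr) orbT.
  (* An empty result would mean that both faces consist of the single side [d]. The remaining faces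
     are not empty, by their length, so colouring [d] differently from them contradicts [univF]. *)
  apply/negP => /eqP f'0; have [E1 [E2 [E3 E4]]] : A1 = [::] /\ A2 = [::] /\ B1 = [::] /\ B2 = [::].
    by move: f'0; rewrite /f'; case: (A1) => //; case: (B2) => //; case: (B1) => //; case: (A2).
  have r0 : flatten rest' != [::].
    move: sE; rewrite /= f'0 /=; case: flatten => //=; lia.
  have [e er] := has_let r0.
  pose k (e : dart) := e.1 == d.1.
  have ned e' : e'.1 \in lets (flatten rest') -> k e' = false.
    move=> h; apply/negP => /eqP ed; move: dn; rewrite !lets_cat !mem_cat -ed h !orbT //.
  have [w'|c cE] := perm_univF pfs uf (k := k).
    rewrite !inE => /or3P[/eqP->|/eqP->|wr'].
    - exists true; apply: run_const => e'; rewrite Ef1 E1 E2 /= !inE /k => ->//.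
    - exists true; apply: run_const => e' e'f; rewrite /k.
      by have := cB e'.1; rewrite E3 E4 /= addn0 add0n eq_sym; case: eqP => // _ /eqP;
        rewrite -leqn0 leqNgt -has_count has_pred1 e'f.
    - exists false; apply: run_const => e' e'w; apply: ned; apply/lets_flatten; by exists w'.
  have : k d = k e by rewrite !cE// /= !lets_cat !mem_cat ?er ?orbT// Ef1 E1 /= inE eqxx.
  by rewrite (ned e er) /k eqxx.
- move=> l' l'f; rewrite cf'; have l'd : l' != d.1.
    apply: contraNneq dn => <-; by rewrite -has_pred1 has_count -cf' -has_count has_pred1.
  have := qf l'; rewrite cfs eq_sym (negPf l'd) !addn0; apply.
  by rewrite -has_pred1 has_count cfs !ltn_addr// -cf' -has_count has_pred1.
Qed.

End faces.

(** * The normal form with a leading commutator *)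

Section normal.
Variables (L : eqType) (G : groupType).
Local Notation dart := (dart L).
Implicit Types (ds : seq dart) (es : seq (dart * dart)).

Lemma sqs_cat ds ds' : sqs (ds ++ ds') = sqs ds ++ sqs ds'.
Proof. by rewrite /sqs map_cat flatten_cat. Qed.

Lemma count_sqs l ds : count_mem l (lets (sqs ds)) = (2 * count_mem l (lets ds))%N.
Proof. by elim: ds => //= d ds; rewrite -/(sqs ds) => ->; lia. Qed.

(** A single square suffices to turn all commutators into squares, one after the other, by
    [squares3]. *)
Lemma to_squares es : forall ds, ds != [::] -> quad (sqs ds ++ cms es) ->
  presentable G [:: sqs ds ++ cms es] ->
  exists ds', [/\ quad (sqs ds'), presentable G [:: sqs ds'] & size (sqs ds') = size (sqs ds ++ cms es)].
Proof.
elim: es => [|[a b] es IH] [//|x ds] _.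
  by rewrite cats0 => q p; exists (x :: ds).
set W := _ ++ _ => qW pW.
have EW : W = [:: x; x] ++ sqs ds ++ comm a b ++ cms es by rewrite /W /cms /sqs /= -?catA.
pose W' := sqs (ds ++ [:: x; b; a]) ++ cms es.
have cW l : count_mem l (lets W') = count_mem l (lets W).
  rewrite EW /W' sqs_cat !(lets_cat, count_cat) !count_sqs /=.
  by move: (count_mem _ _) (count_mem _ _) => *; lia.
have two l : (2 <= count_mem l (lets W))%N -> count_mem l (lets W) = 2.
  by move=> h; apply: qW; rewrite -has_pred1 has_count; lia.
have cE l : count_mem l (lets W) = (2 * ((x.1 == l) + (a.1 == l) + (b.1 == l) + count_mem l (lets ds)) + count_mem l (lets (cms es)))%N.
  rewrite EW !(lets_cat, count_cat) !count_sqs /=.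
  by move: (count_mem _ _) (count_mem _ _) => *; lia.
have cx := two x.1; have ca := two a.1; have cb := two b.1.
rewrite !cE !eqxx in cx ca cb.
have nm c : count_mem c (lets ds) = 0 -> count_mem c (lets (cms es)) = 0 ->
    c \notin lets (sqs ds ++ cms es).
  by move=> h1 h2; rewrite -has_pred1 has_count lets_cat count_cat count_sqs h1 h2.
have u3 : uniq [:: x.1; a.1; b.1].
  rewrite /= !inE negb_or andbT -andbA; apply/and3P; split; apply/negP => /eqP E; rewrite -?E ?eqxx in cx ca cb; lia.
have hx : x.1 \notin lets (sqs ds ++ cms es) by apply: nm; lia.
have ha : a.1 \notin lets (sqs ds ++ cms es) by apply: nm; lia.
have hb : b.1 \notin lets (sqs ds ++ cms es) by apply: nm; lia.
have pW' : presentable G [:: W'].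
  have -> : W' = sqs ds ++ [:: x; x; b; b; a; a] ++ cms es by rewrite /W' sqs_cat -catA.
  apply/(squares3 G u3 hx ha hb).
  apply/(slide_sq G (A := sqs ds) (d := x) (C := comm a b ++ cms es)); last by rewrite -EW.
  move: u3 hx; rewrite /= !(lets_cat, mem_cat, inE) !negb_or => /andP[/andP[h1 h2] _] /andP[-> ->].
  by rewrite h1 h2.
have [|ds' [q p s]] := IH (ds ++ [:: x; b; a]) _ (quad_count cW qW) pW'.
  by case: (ds).
exists ds'; split=> //; rewrite s.
have : perm_eq (lets W') (lets W) by apply/allP => l _; apply/eqP; exact: cW.
by move=> /perm_size; rewrite !size_map.
Qed.

Definition kw (k : bool) (x y : dart) := if k then comm x y else [:: x; x; y; y].
Definition nw k (es : seq (dart * dart)) :=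
  if es is e :: es' then comm e.1 e.2 ++ flatten [seq kw k p.1 p.2 | p <- es'] else [::].

Lemma sqs_pair d ds : size ds = (2 * d)%N ->
  exists es, size es = d /\ sqs ds = flatten [seq kw false p.1 p.2 | p <- es].
Proof.
elim: d ds => [|d IH] ds; first by case: ds => // _; exists [::].
case: ds => [|x [|y ds]]; [by move=> /= h; exfalso; lia|by move=> /= h; exfalso; lia|].
move=> /= s; have [|es [se E]] := IH ds; first lia.
by exists ((x, y) :: es); rewrite /= se /sqs /= -/(sqs ds) E.
Qed.

(** In the non-orientable case there are $2d+2$ squares. Three of them are traded for a commutator
    and a square, the commutator is rotated to the front, and the $2d$ squares that remain are
    grouped in pairs. *)
Lemma normal_word ds es d : (0 < d)%N -> size (sqs ds ++ cms es) = (2 * (2 * d + 2))%N ->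
  quad (sqs ds ++ cms es) -> presentable G [:: sqs ds ++ cms es] ->
  exists k es', [/\ size es' = d.+1, quad (nw k es') & presentable G [:: nw k es']].
Proof.
move=> dpos; case: ds => [|d0 ds] s q p.
  exists true, es; have ss : size (cms es) = (4 * size es)%N.
    by elim: (es) => // e es' IH; rewrite /cms /= -/(cms es') IH; lia.
  have nE : nw true es = cms es by case: (es).
  by rewrite /= in s q p; rewrite nE; split=> //; rewrite s in ss; lia.
have [//|ds' [q' p' s']] := to_squares _ q p.
rewrite s in s'; have ss : size (sqs ds') = (2 * size ds')%N.
  by elim: (ds') => //= e es' IH; rewrite -/(sqs es') IH; lia.
rewrite ss in s'; case: ds' q' p' s' ss => [|x [|y [|z ds']]] q' p' s' _ /=; rewrite /= in s'; try (exfalso; lia).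
have [|es' [se E]] := @sqs_pair d (ds' ++ [:: x]); first by rewrite size_cat /=; lia.
exists false, ((z, y) :: es').
have -> : nw false ((z, y) :: es') = comm z y ++ (sqs ds' ++ sqs [:: x]).
  by rewrite -sqs_cat E.
split; first by rewrite /= se.
  apply: quad_count q' => l; rewrite !(lets_cat, count_cat) !count_sqs /=.
  by move: (count_mem _ _) => *; lia.
rewrite catA; apply/presentable_rot.
have cnt2 c : count_mem c (lets (x :: y :: z :: ds')) = 1%N <-> c \in lets (x :: y :: z :: ds').
  split=> [h|]; first by rewrite -has_pred1 has_count h.
  move=> h; have := q' c; rewrite count_sqs -has_pred1 has_count count_sqs.
  by rewrite -has_pred1 has_count in h; lia.
have cx := (cnt2 x.1).2; have cy := (cnt2 y.1).2; have cz := (cnt2 z.1).2.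
rewrite /= !inE !eqxx ?orbT in cx cy cz.
have {}cx := cx isT; have {}cy := cy isT; have {}cz := cz isT.
have nm c : count_mem c (lets ds') = 0 -> c \notin lets ([::] ++ sqs ds').
  by move=> h1; rewrite -has_pred1 has_count count_sqs h1.
apply/(squares3 G (A := [::]) (x := x) (a := z) (b := y) (Z := sqs ds')) => //.
- rewrite /= !inE negb_or andbT -andbA; apply/and3P; split; apply/negP => /eqP E'; rewrite -?E' ?eqxx in cx cy cz; lia.
- by apply: nm; lia.
- by apply: nm; lia.
- by apply: nm; lia.
Qed.

End normal.

Definition kap (G : groupType) (k : bool) (u v : G) :=
  if k then u * v * u^-1 * v^-1 else u * u * v * v.

Definition srel (G : groupType) k d (a b : G) (u v : nat -> G) :=
  a * b * a^-1 * b^-1 * \prod_(0 <= i < d) kap k (u i) (v i).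

Definition surface_presented k d (G : groupType) := exists (a b : G) (u v : nat -> G),
  [/\ srel k d a b u v = 1,
      forall (H : groupType) (a' b' : H) (u' v' : nat -> H), srel k d a' b' u' v' = 1 ->
        exists f : G -> H, [/\ is_hom f, f a = a', f b = b' &
          forall i, (i < d)%N -> f (u i) = u' i /\ f (v i) = v' i] &
      forall Q : G -> Prop, is_subgroup Q -> Q a -> Q b ->
        (forall i, (i < d)%N -> Q (u i) /\ Q (v i)) -> forall g, Q g].

Section surface.
Variables (L : eqType) (G : groupType).
Local Notation dart := (dart L).
Implicit Types (es : seq (dart * dart)).

Definition pairs es := flatten [seq [:: p.1; p.2] | p <- es].

Lemma count_nw k es l : count_mem l (lets (nw k es)) = (2 * count_mem l (lets (pairs es)))%N.
Proof.
have E es' : count_mem l (lets (flatten [seq kw k p.1 p.2 | p <- es'])) = (2 * count_mem l (lets (pairs es')))%N.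
  elim: es' => //= p es' IH; rewrite lets_cat count_cat IH /pairs /= -/(pairs es').
  by case: k {IH} => /=; lia.
by case: es => // e es; rewrite /= E /pairs /= -/(pairs es); lia.
Qed.

Lemma assign (H : groupType) es : forall (h0 : L -> H) (u v : nat -> H) e0, uniq (lets (pairs es)) ->
  exists h : L -> H, (forall i, (i < size es)%N ->
    evd h (nth e0 es i).1 = u i /\ evd h (nth e0 es i).2 = v i).
Proof.
elim: es => [|[x y] es IH] h0 u v e0 /=; first by exists h0.
rewrite inE negb_or -andbA => /and4P[xy xe ye ue].
have [h hE] := IH h0 (u \o succn) (v \o succn) e0 ue.
exists (upd (upd h x (u 0%N)) y (v 0%N)).
have xy' : x.1 != y.1 by [].
move=> [_|i]; first by rewrite /= evd_upd; split=> //; rewrite /evd upd_in// -/(evd _ x) evd_upd.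
rewrite ltnS /= => ie; have [h1 h2] := hE i ie.
have nb z : z.1 \in lets (pairs es) -> evd (upd (upd h x (u 0%N)) y (v 0%N)) z = evd h z.
  by move=> zi; rewrite /evd !upd_in//; [apply: contraNneq xe => <-|apply: contraNneq ye => <-].
have inn : (nth e0 es i).1.1 \in lets (pairs es) /\ (nth e0 es i).2.1 \in lets (pairs es).
  have := mem_nth e0 ie; move: (nth _ _ _) => p; elim: (es) => // q es' IH'.
  rewrite inE /pairs /= -/(pairs es') !inE => /orP[/eqP->|/IH'[-> ->]]; rewrite ?eqxx ?orbT//.
by rewrite !nb; [|case: inn|case: inn].
Qed.

Lemma ev_nw (H : groupType) (h : L -> H) k e0 es : ev h (nw k (e0 :: es)) =
  srel k (size es) (evd h e0.1) (evd h e0.2) (fun i => evd h (nth e0 es i).1) (fun i => evd h (nth e0 es i).2).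
Proof.
rewrite /srel /= !evd_inv !mulgA; congr (_ * _).
transitivity (\prod_(p <- es) kap k (evd h p.1) (evd h p.2)).
  elim: es => [|p es IH]; first by rewrite big_nil.
  rewrite big_cons /= ev_cat IH; congr (_ * _).
  by rewrite /kw /kap; case: k {IH} => /=; rewrite ?evd_inv ?mulg1 !mulgA.
by rewrite (big_nth e0).
Qed.

Theorem surface_of_word k es d : size es = d.+1 -> quad (nw k es) -> presentable G [:: nw k es] ->
  surface_presented k d G.
Proof.
case: es => // e0 es [se] q [gen /presentable1[g1 g2 g3]].
have un : uniq (lets (pairs (e0 :: es))).
  apply: count_mem_uniq => l; have := q l; have := count_nw k (e0 :: es) l.
  rewrite -has_pred1 has_count -[l \in _]has_pred1 has_count => ->.
  by case: count => // c /(_ isT); lia.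
have memE l : (l \in lets (nw k (e0 :: es))) = (l \in lets (pairs (e0 :: es))).
  by rewrite -!has_pred1 !has_count count_nw; case: count.
have in0 : e0.1.1 \in lets (nw k (e0 :: es)) /\ e0.2.1 \in lets (nw k (e0 :: es)).
  by rewrite !memE /= !inE !eqxx ?orbT.
have ini i : (i < d)%N -> (nth e0 es i).1.1 \in lets (nw k (e0 :: es)) /\ (nth e0 es i).2.1 \in lets (nw k (e0 :: es)).
  rewrite -se => id; rewrite !memE; have := mem_nth e0 id; move: (nth _ _ _) => p.
  rewrite /pairs /= -/(pairs es) !inE => pe.
  suff [-> ->] : p.1.1 \in lets (pairs es) /\ p.2.1 \in lets (pairs es) by rewrite !orbT.
  elim: (es) pe => // r es' IH'.
  rewrite inE /pairs /= -/(pairs es') !inE => /orP[/eqP->|/IH'[-> ->]]; rewrite ?eqxx ?orbT//.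
exists (evd gen e0.1), (evd gen e0.2), (fun i => evd gen (nth e0 es i).1), (fun i => evd gen (nth e0 es i).2).
split.
- by rewrite -se -ev_nw.
- move=> H a' b' u' v' rel.
  have [h hE] := assign (fun=> 1 : H) (fun i => if i is j.+1 then u' j else a')
    (fun i => if i is j.+1 then v' j else b') e0 un.
  have h0 := hE 0%N isT; have hS i : (i < d)%N -> _ := fun id => hE i.+1 (eqbRL (congr1 (leq i.+2) (congr1 succn se)) id).
  have hW : ev h (nw k (e0 :: es)) = 1.
    rewrite ev_nw se -rel /srel /= h0.1 h0.2; congr (_ * _).
    by apply: eq_big_nat => i /hS[/= -> ->].
  have [f [fM fE]] := g2 H h hW; exists f.
  have fd x : x.1 \in lets (nw k (e0 :: es)) -> f (evd gen x) = evd h x.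
    by move=> xi; rewrite evd_hom// /evd /= fE.
  split=> // [||i id]; rewrite ?fd; try by case: in0.
  + by case: h0.
  + by case: h0.
  + by case: (hS i id).
  + by case: (ini i id).
  + by case: (ini i id).
- move=> Q Qs Qa Qb Quv; have [Q1 QM QV] := Qs; apply: g3 => // l; rewrite memE => lp.
  suff [x [xl Qx]] : exists x : dart, x.1 = l /\ Q (evd gen x).
    by move: Qx; rewrite /evd xl; case: x.2 => // /QV; rewrite invgK.
  move: lp; rewrite /pairs /= -/(pairs es) !inE => /or3P[/eqP->|/eqP->|lp].
  + by exists e0.1.
  + by exists e0.2.
  have [p pe pl] : exists2 p, p \in es & l = p.1.1 \/ l = p.2.1.
    elim: (es) lp => // r es' IH'; rewrite /pairs /= -/(pairs es') !inE.
    move=> /or3P[/eqP->|/eqP->|/IH'[p pe pl]]; [exists r; rewrite ?mem_head//; by left|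
      exists r; rewrite ?mem_head//; by right|by exists p; rewrite // inE pe orbT].
  have pi : (index p es < d)%N by rewrite -se index_mem.
  have [Q1' Q2'] := Quv _ pi; rewrite !nth_index// in Q1' Q2'.
  by case: pl => ->; [exists p.1|exists p.2].
Qed.

End surface.

Theorem classification (L : eqType) (G : groupType) (fs : seq (seq (dart L))) gen d :
  (forall w, w \in fs -> w != [::]) -> quad (flatten fs) -> univF fs -> presF (G := G) fs gen ->
  (0 < d)%N -> (0 < size fs)%N -> size (flatten fs) = (2 * (2 * d + 2 + (size fs).-1))%N ->
  exists k, surface_presented k d G.
Proof.
move=> nf qf uf pf d0 sf sz.
have [||W [qW uW pW sW]] := @merge_faces L G (2 * d + 2) (size fs).-1 fs gen _ _ nf qf uf pf sz.
- by rewrite addn2.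
- by rewrite prednK.
have [ds [es [q p s]]] := @blocks_form L G (size W) [::] [::] W (leqnn _) qW uW pW.
have [|k [es' [se q' p']]] := normal_word (d := d) d0 _ q p; first by rewrite s.
by exists k; exact: surface_of_word q' p'.
Qed.

(** * The presentation of a triangulated surface *)

Section combinatorial_surface.
Variables (n : nat) (K : {set {set 'I_n}}) (r : 'I_n).
Hypothesis complexK : simplicial_complex K.
Implicit Types (u v : 'I_n) (T : {set 'I_n}).

Definition vtx v := [set v]%SET \in K.
Definition edg u v := (u != v) && ([set u; v]%SET \in K).
Definition tri T := (T \in K) && (#|T| == 3).

Hypothesis dimK : forall A, A \in K -> (#|A| <= 3)%N.
Hypothesis edge2 : forall a b, edg a b -> exists c1 c2, c1 != c2 /\
  forall c, (c != a) && (c != b) && ([set a; b; c]%SET \in K) = (c == c1) || (c == c2).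
Hypothesis linkK : forall v (B : pred 'I_n),
  (forall c c', c != v -> c' != v -> [set v; c; c']%SET \in K -> B c -> B c') ->
  forall c c', c != v -> c' != v -> [set v; c]%SET \in K -> [set v; c']%SET \in K -> B c -> B c'.
Hypothesis connK : forall B : pred 'I_n,
  (forall u v, [set u; v]%SET \in K -> B u -> B v) ->
  forall u v, vtx u -> vtx v -> B u -> B v.
Hypothesis rK : vtx r.
Hypothesis rT : exists2 T, tri T & r \in T.

Lemma edgC u v : edg u v = edg v u.
Proof. by rewrite /edg eq_sym finset.setUC. Qed.

Lemma sub_vtx A v : A \in K -> v \in A -> vtx v.
Proof.
move=> AK vA; apply: (face_closed complexK AK); first by rewrite finset.sub1set.
by apply/set0Pn; exists v; rewrite inE.
Qed.

Lemma sub_edg A u v : A \in K -> u \in A -> v \in A -> u != v -> edg u v.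
Proof.
move=> AK uA vA uv; rewrite /edg uv; apply: (face_closed complexK AK).
  by apply/fintype.subsetP => i; rewrite !inE => /orP[]/eqP->.
by apply/set0Pn; exists u; rewrite !inE eqxx.
Qed.

Lemma edg_vtx u v : edg u v -> vtx u /\ vtx v.
Proof. by move=> /andP[_ uvK]; split; apply: sub_vtx uvK _; rewrite !inE eqxx ?orbT. Qed.

Lemma card3 (a b c : 'I_n) : a != b -> a != c -> b != c -> #|[set a; b; c]%SET| = 3.
Proof.
move=> ab ac bc; rewrite finset.setUC cardsU1 cards2 ab !inE negb_or.
by rewrite eq_sym ac eq_sym bc.
Qed.

Lemma tri_eq T a b c : tri T -> a \in T -> b \in T -> c \in T ->
  a != b -> a != c -> b != c -> T = [set a; b; c]%SET.
Proof.
move=> /andP[_ /eqP T3] aT bT cT ab ac bc; apply/esym/eqP; rewrite eqEcard T3 card3// leqnn andbT.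
by apply/fintype.subsetP => i; rewrite !inE => /orP[/orP[]|]/eqP->.
Qed.

Lemma edge_tris u v : edg u v -> exists T1 T2, T1 != T2 /\
  forall T, (tri T && (u \in T) && (v \in T)) = (T == T1) || (T == T2).
Proof.
move=> uv; have /andP[uv' uvK] := uv; have [c1 [c2 [c12 cE]]] := edge2 uv.
exists [set u; v; c1]%SET, [set u; v; c2]%SET.
have /andP[/andP[h1 h1'] k1] : (c1 != u) && (c1 != v) && ([set u; v; c1]%SET \in K) by rewrite cE eqxx.
have /andP[/andP[h2 h2'] k2] : (c2 != u) && (c2 != v) && ([set u; v; c2]%SET \in K) by rewrite cE eqxx orbT.
split.
  apply/eqP => /setP/(_ c1); rewrite !inE eqxx orbT (negPf h1) (negPf h1') (negPf c12).
  by [].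
move=> T; apply/idP/idP => [/andP[/andP[tT uT] vT]|].
  have /set0Pn[c] : T :\: [set u; v] != finset.set0.
    have /andP[_ /eqP T3] := tT; rewrite -cards_eq0 cardsD.
    have : (#|T :&: [set u; v]| <= #|[set u; v]%SET|)%N by apply: subset_leq_card; exact: finset.subsetIr.
    by rewrite T3 cards2 uv' => le2; rewrite -lt0n subn_gt0; exact: leq_ltn_trans le2 _.
  rewrite !inE negb_or => /andP[/andP[cu cv] cT].
  have TE : T = [set u; v; c]%SET by apply: tri_eq => //; rewrite eq_sym.
  have : (c == c1) || (c == c2) by rewrite -cE cu cv -TE; case/andP: tT.
  by move=> /orP[]/eqP cc; rewrite TE cc eqxx ?orbT.
rewrite /tri; move=> /orP[]/eqP->; rewrite !inE !eqxx ?orbT !andbT ?k1 ?k2 /= card3//; by rewrite eq_sym.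
Qed.

(** The tree grows one vertex at a time from the root; [rk] records the step at which a vertex was
    added, so it decreases towards the root. *)
Lemma spanning_tree : exists (rk : 'I_n -> nat) (par : 'I_n -> 'I_n),
  forall v, vtx v -> v != r -> edg v (par v) && (rk (par v) < rk v)%N.
Proof.
pose V := [set v | vtx v]%SET.
have grow m : (m < #|V|)%N -> exists (B : {set 'I_n}) (rk : 'I_n -> nat) (par : 'I_n -> 'I_n),
    [/\ B \subset V, r \in B, #|B| = m.+1, forall v, v \in B -> (rk v <= m)%N &
     forall v, v \in B -> v != r -> [/\ par v \in B, edg v (par v) & (rk (par v) < rk v)%N]].
  elim: m => [|m IH] mV.
    exists [set r]%SET, (fun=> 0%N), id; split; rewrite ?cards1 ?inE//.
    - by rewrite finset.sub1set inE.
    - by move=> v; rewrite inE => ->.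
  have [B [rk [par [BV rB Bm rkm parB]]]] := IH (ltnW mV).
  have [u [v [uB vB uv]]] : exists u v, [/\ u \in B, v \notin B & [set u; v]%SET \in K].
    apply: contrapT => nouv.
    have cl u v : [set u; v]%SET \in K -> u \in B -> v \in B.
      by move=> uvK uB; apply/negPn/negP => vB; apply: nouv; exists u, v.
    have : V \subset B.
      by apply/fintype.subsetP => v; rewrite inE => vV; apply: (connK (B := mem B) cl rK vV rB).
    by move/subset_leq_card; rewrite Bm; lia.
  have vu : v != u by apply: contraNneq vB => ->.
  exists (v |: B), (fun i => if i == v then m.+1 else rk i), (fun i => if i == v then u else par i).
  split.
  - rewrite finset.subUset BV finset.sub1set inE andbT; apply: sub_vtx uv _.
    by rewrite !inE eqxx orbT.
  - by rewrite !inE rB orbT.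
  - by rewrite cardsU1 vB Bm.
  - by move=> i; rewrite !inE; case: eqVneq => //= _ /rkm/leqW.
  - move=> i; rewrite !inE; case: eqVneq => /= [-> _ _|iv iB ir].
      have uv' : (u == v) = false by rewrite eq_sym (negPf vu).
      by rewrite uv' uB /edg vu finset.setUC uv ltnS rkm.
    have [pB e1 e2] := parB i iB ir.
    have pv : (par i == v) = false by apply: contraNF vB => /eqP <-.
    by rewrite pv pB.
have V0 : (#|V|.-1 < #|V|)%N by rewrite prednK//; apply/card_gt0P; exists r; rewrite inE.
have [B [rk [par [BV _ Bm _ parB]]]] := grow _ V0.
rewrite prednK in Bm; last by apply/card_gt0P; exists r; rewrite inE.
exists rk, par => v vK vr; have [|_ -> ->//] := parB v _ vr.
suff -> : B = V by rewrite inE.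
by apply/eqP; rewrite eqEcard BV Bm leqnn.
Qed.

Section tree.
Variables (rk : 'I_n -> nat) (par : 'I_n -> 'I_n).
Hypothesis parP : forall v, vtx v -> v != r -> edg v (par v) && (rk (par v) < rk v)%N.

Definition tree u v := ((u != r) && (par u == v)) || ((v != r) && (par v == u)).

Lemma treeC u v : tree u v = tree v u. Proof. by rewrite /tree orbC. Qed.

Definition tword a b c : seq (dart ('I_n * 'I_n)%type) :=
  [:: ((a, b), false); ((b, c), false); ((a, c), true)].

Definition erase (w : seq (dart ('I_n * 'I_n)%type)) := [seq d <- w | ~~ tree d.1.1 d.1.2].

(** [enum] lists the vertices in increasing order, so each edge is named by one pair only. Tree
    edges are dropped because their generators will be trivial. *)
Definition face T := let s := enum T in
  erase (tword (nth r s 0) (nth r s 1) (nth r s 2)).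

Definition faces := [seq face T | T <- enum [set T | tri T]%SET].

Lemma tri_sorted T : tri T -> exists a b c : 'I_n,
  [/\ (a < b)%N, (b < c)%N, face T = erase (tword a b c) & T = [set a; b; c]%SET].
Proof.
move=> tT; have /andP[_ /eqP T3] := tT.
have so : sorted ltn (map val (enum T)).
  have -> : enum T = [seq x <- enum 'I_n | x \in T] by rewrite enumT /enum_mem.
  have : subseq (map val [seq x <- enum 'I_n | x \in T]) (map val (enum 'I_n)).
    by apply: map_subseq; exact: filter_subseq.
  rewrite val_enum_ord => h; apply: (subseq_sorted ltn_trans h); exact: iota_ltn_sorted.
have mT a : (a \in T) = (a \in enum T) by rewrite mem_enum.
have sz : size (enum T) = 3 by rewrite -cardE.
rewrite /face; case: (enum T) so mT sz => [|a [|b [|c []]]]//= /and3P[ab bc _] mT _.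
exists a, b, c; split=> //; apply: tri_eq => //; rewrite ?mT ?inE ?eqxx ?orbT// -val_eqE /= neq_ltn.
- by rewrite ab.
- by rewrite (ltn_trans ab bc).
- by rewrite bc.
Qed.

Lemma lets_erase w : lets (erase w) = [seq x <- lets w | ~~ tree x.1 x.2].
Proof. by rewrite /lets /erase filter_map. Qed.

Lemma count_face T (x : 'I_n * 'I_n) : tri T -> count_mem x (lets (face T)) =
  [&& ~~ tree x.1 x.2, (x.1 < x.2)%N, x.1 \in T & x.2 \in T].
Proof.
move=> /tri_sorted[a [b [c [ab bc -> ->]]]]; rewrite lets_erase count_filter.
have ac := ltn_trans ab bc.
have -> : count (predI (pred1 x) (fun y => ~~ tree y.1 y.2)) (lets (tword a b c)) =
    (~~ tree x.1 x.2 * count_mem x (lets (tword a b c)))%N.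
  rewrite -[in RHS]sum1_count -sum1_count big_distrr /= big_mkcond [RHS]big_mkcond /=.
  by apply: eq_bigr => y _; rewrite /=; case: eqVneq => //= ->; case: (tree _ _).
case: (tree x.1 x.2) => //=; rewrite mul1n !inE.
case: x => u v /=; rewrite !xpair_eqE.
have n1 : (a == b) = false by apply/negP => /eqP E; rewrite E ltnn in ab.
have n2 : (b == c) = false by apply/negP => /eqP E; rewrite E ltnn in bc.
have n3 : (a == c) = false by apply/negP => /eqP E; rewrite E ltnn in ac.
rewrite ![_ == u]eq_sym ![_ == v]eq_sym.
case: (eqVneq u a) => [->|ua]; [|case: (eqVneq u b) => [->|ub]; [|case: (eqVneq u c) => [->|uc]]];
  (case: (eqVneq v a) => [->|va]; [|case: (eqVneq v b) => [->|vb]; [|case: (eqVneq v c) => [->|vc]]]);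
  rewrite /= ?eqxx ?[b == a]eq_sym ?[c == a]eq_sym ?[c == b]eq_sym ?n1 ?n2 ?n3 /= ?ab ?bc ?ac ?ltnn ?andbF //;
  by rewrite ltnNge ltnW.
Qed.

Definition ltri := enum [set T | tri T]%SET.

Lemma mem_ltri T : (T \in ltri) = tri T.
Proof. by rewrite mem_enum inE. Qed.

Lemma count_faces (x : 'I_n * 'I_n) : count_mem x (lets (flatten faces)) =
  if [&& ~~ tree x.1 x.2, (x.1 < x.2)%N & edg x.1 x.2] then 2 else 0.
Proof.
rewrite count_flatten /faces -map_comp sumnE big_map big_enum_cond /=.
under eq_bigl do rewrite inE andbT.
under eq_bigr => T tT do rewrite /= count_face//.
have [tx|_] /= := boolP (tree x.1 x.2); first by rewrite big1.
have [x12|_] /= := boolP (x.1 < x.2)%N; last by rewrite big1.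
have [ex|nex] := boolP (edg x.1 x.2); last first.
  rewrite big1// => T tT; apply/eqP; rewrite eqb0; apply: contra nex => /andP[xT xT'].
  have /andP[TK _] := tT; apply: (sub_edg TK xT xT').
  by apply: contraTneq x12 => ->; rewrite ltnn.
have [T1 [T2 [T12 TE]]] := edge_tris ex.
transitivity (#|[set T1; T2]%SET|); last by rewrite cards2 T12.
rewrite -sum1_card big_mkcond [RHS]big_mkcond /=; apply: eq_bigr => T _.
by rewrite !inE -TE; case: (tri T); case: (_ \in T); case: (_ \in T).
Qed.

Lemma mem_faces (x : 'I_n * 'I_n) : (x \in lets (flatten faces)) =
  [&& ~~ tree x.1 x.2, (x.1 < x.2)%N & edg x.1 x.2].
Proof. by rewrite -has_pred1 has_count count_faces; case: ifP. Qed.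

Lemma quad_faces : quad (flatten faces).
Proof. by move=> x; rewrite mem_faces count_faces => ->. Qed.

(** A triangle with all three sides in the tree would be a cycle, which the strict decrease of [rk]
    towards the root excludes. *)
Lemma faces_neq0 w : w \in faces -> w != [::].
Proof.
move=> /mapP[T]; rewrite mem_ltri => tT ->; have /andP[TK _] := tT.
have [a [b [c [ab bc -> TE]]]] := tri_sorted tT.
have ac := ltn_trans ab bc.
have [aT bT cT] : [/\ a \in T, b \in T & c \in T] by rewrite TE !inE !eqxx ?orbT.
apply/negP => /eqP; rewrite /erase /=.
case: ifP => //= /negbFE t1; case: ifP => //= /negbFE t2; case: ifP => //= /negbFE t3 _.
have n1 : a != b by apply/negP => /eqP E; rewrite E ltnn in ab.
have n2 : b != c by apply/negP => /eqP E; rewrite E ltnn in bc.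
have n3 : a != c by apply/negP => /eqP E; rewrite E ltnn in ac.
have pr u v : u \in T -> u != r -> par u == v -> (rk v < rk u)%N.
  by move=> uT ur /eqP <-; have /andP[] := parP (sub_vtx TK uT) ur.
have main u v w' : u \in T -> v \in T -> w' \in T -> u != v -> u != w' -> v != w' ->
    tree u v -> tree u w' -> tree v w' -> u != r -> par u == v -> False.
  move=> uT vT wT uv uw vw _ t2' t3' ur puv; have h1 := pr _ _ uT ur puv.
  case/orP: t2' => /andP[hr hp]; first by move: vw; rewrite -(eqP puv) (eqP hp) eqxx.
  have h2 := pr _ _ wT hr hp.
  case/orP: t3' => /andP[hr' hp']; last by move: uv; rewrite -(eqP hp) (eqP hp') eqxx.
  by have := ltn_trans (ltn_trans (pr _ _ vT hr' hp') h1) h2; rewrite ltnn.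
case/orP: (t1) => /andP[hr hp].
  exact: (main a b c aT bT cT n1 n3 n2 t1 t3 t2 hr hp).
apply: (main b a c bT aT cT _ n2 n3 _ t2 t3 hr hp); first by rewrite eq_sym.
by rewrite treeC.
Qed.

Lemma size_count (T : finType) (s : seq T) : size s = (\sum_(x : T) count_mem x s)%N.
Proof.
elim: s => [|y s IH]; first by rewrite big1.
rewrite /= big_split /= -IH (bigD1 y)//= eqxx big1 ?addn0 ?add1n//.
by move=> x; rewrite eq_sym => /negPf->.
Qed.

Lemma card_edges : #|[set x : 'I_n * 'I_n | (x.1 < x.2)%N && edg x.1 x.2]%SET| =
  #|[set A in K | #|A| == 2]%SET|.
Proof.
rewrite -(card_in_imset (f := fun x : 'I_n * 'I_n => [set x.1; x.2]%SET)).
  congr #|pred_of_set _|; apply/setP => A; apply/imsetP/idP => [[x]|].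
    by rewrite !inE => /andP[_ /andP[x12 xK]] ->; rewrite xK cards2 x12.
  rewrite inE => /andP[AK /cards2P[a [b [ab AE]]]].
  have [h|h|h] := ltngtP a b; last by rewrite (val_inj h) eqxx in ab.
    by exists (a, b) => //; rewrite inE /= h /edg ab -AE.
  exists (b, a); last by rewrite AE finset.setUC.
  by rewrite inE /= h /edg eq_sym ab finset.setUC -AE.
move=> [a b] [a' b'] /=; rewrite !inE /= => /andP[ab _] /andP[ab' _] /setP E.
have /orP h1 : (a == a') || (a == b') by have := E a; rewrite !inE eqxx /= => <-.
have /orP h2 : (b == a') || (b == b') by have := E b; rewrite !inE eqxx orbT => <-.
case: h1 => /eqP ea; case: h2 => /eqP eb.
- by rewrite ea eb ltnn in ab.
- by rewrite ea eb.
- by rewrite -ea -eb in ab'; have := ltn_trans ab ab'; rewrite ltnn.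
- by rewrite ea eb ltnn in ab.
Qed.

Lemma card_tree : #|[set x : 'I_n * 'I_n | [&& tree x.1 x.2, (x.1 < x.2)%N & edg x.1 x.2]]%SET| =
  #|[set v | vtx v]%SET|.-1.
Proof.
have rV : r \in [set v | vtx v]%SET by rewrite inE.
rewrite (cardsD1 r) rV add1n /=.
pose f v : 'I_n * 'I_n := if (v < par v)%N then (v, par v) else (par v, v).
rewrite -(card_in_imset (f := f)).
  congr #|pred_of_set _|; apply/setP => x; rewrite inE; apply/idP/imsetP => [/and3P[tx x12 ex]|[v]].
    have [v1 v2] := edg_vtx ex.
    case/orP: tx => /andP[hr /eqP hp]; [exists x.1|exists x.2]; rewrite ?inE ?hr ?v1 ?v2// /f hp.
      by rewrite x12 -surjective_pairing.
    by rewrite ltnNge (ltnW x12) /= -surjective_pairing.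
  rewrite !inE => /andP[vr vK] ->; have /andP[e1 e2] := parP vK vr.
  have vp : v != par v by apply: contraTneq e2 => {2}->; rewrite ltnn.
  rewrite /f; case: ltngtP => [h|h|h] /=; rewrite /tree ?vr ?eqxx ?orbT ?h ?e1 ?(edgC (par v))//.
  by move/val_inj: h vp => <-; rewrite eqxx.
move=> u v; rewrite !inE => /andP[ur uK] /andP[vr vK].
have /andP[_ eu] := parP uK ur; have /andP[_ ev] := parP vK vr.
rewrite /f; case: ifP => _; case: ifP => _ [] h1 h2 //; exfalso.
  move: eu; rewrite h2 => eu; move: ev; rewrite -h1 => ev.
  by have := ltn_trans eu ev; rewrite ltnn.
move: eu; rewrite h1 => eu; move: ev; rewrite -h2 => ev.
by have := ltn_trans eu ev; rewrite ltnn.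
Qed.

(** The $E-(V-1)$ edges outside the tree are counted twice each. *)
Lemma size_faces : (size (flatten faces) + 2 * #|[set v | vtx v]%SET| =
  2 * #|[set A in K | #|A| == 2]%SET| + 2)%N.
Proof.
pose NT := [set x : 'I_n * 'I_n | [&& ~~ tree x.1 x.2, (x.1 < x.2)%N & edg x.1 x.2]]%SET.
have szE : size (flatten faces) = (#|NT| * 2)%N.
  rewrite -(size_map fst) -/(lets _) size_count.
  under eq_bigr do rewrite count_faces.
  rewrite -big_mkcond /= sum_nat_const; congr (_ * _)%N; apply: eq_card => x; rewrite inE //.
have V0 : (0 < #|[set v | vtx v]%SET|)%N by apply/card_gt0P; exists r; rewrite inE.
rewrite szE -card_edges.
pose E := [set x : 'I_n * 'I_n | (x.1 < x.2)%N && edg x.1 x.2]%SET.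
have := cardsID [set x : 'I_n * 'I_n | tree x.1 x.2]%SET E.
have -> : E :&: [set x | tree x.1 x.2]%SET =
    [set x : 'I_n * 'I_n | [&& tree x.1 x.2, (x.1 < x.2)%N & edg x.1 x.2]]%SET.
  by apply/setP => x; rewrite !inE andbC.
have -> : E :\: [set x | tree x.1 x.2]%SET = NT by apply/setP => x; rewrite !inE.
rewrite card_tree -/E => <-.
by move: V0; move: #|[set v | vtx v]%SET| #|NT| => a b; clear; lia.
Qed.

Section labelling.
Variable k : dart ('I_n * 'I_n)%type -> bool.
Hypothesis kface : forall w, w \in faces -> exists p, run k p w p.

(** The run along the erased face colours the three corners of the triangle; an erased side
    transmits the colour unchanged from one end to the other. *)
Lemma corner T : tri T -> exists l : 'I_n -> bool, forall u v, u \in T -> v \in T -> (u < v)%N ->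
  if tree u v then l u = l v else l u = k ((u, v), false) /\ l v = k ((u, v), true).
Proof.
move=> tT; have [p] : exists p, run k p (face T) p.
  by apply: kface; apply/mapP; exists T; rewrite ?mem_ltri.
have [a [b [c [ab bc -> TE]]]] := tri_sorted tT; have ac := ltn_trans ab bc.
rewrite /erase /= => rp.
pose lb := if tree a b then p else k ((a, b), true).
pose lc := if tree b c then lb else k ((b, c), true).
have n1 : (b == a) = false by apply/negP => /eqP E; rewrite E ltnn in ab.
have n2 : (c == b) = false by apply/negP => /eqP E; rewrite E ltnn in bc.
have n3 : (c == a) = false by apply/negP => /eqP E; rewrite E ltnn in ac.
exists (fun i => if i == a then p else if i == b then lb else lc) => u v.
have H : [/\ if tree a b then p = lb else p = k ((a, b), false) /\ lb = k ((a, b), true),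
    if tree b c then lb = lc else lb = k ((b, c), false) /\ lc = k ((b, c), true) &
    if tree a c then p = lc else p = k ((a, c), false) /\ lc = k ((a, c), true)].
  move: rp; rewrite /lc /lb; case: (tree a b); case: (tree b c); case: (tree a c);
    rewrite /= /dinv /= => h; repeat (case/andP: h => /eqP ? h); move/eqP: h => ?; split=> //; by subst.
rewrite TE !inE => /orP[/orP[]|]/eqP-> /orP[/orP[]|]/eqP->; rewrite ?ltnn// ?eqxx ?n1 ?n2 ?n3 => h; try by case: H.
all: by move: h; rewrite ltnNge ?(ltnW ab) ?(ltnW ac) ?(ltnW bc).
Qed.

(** The colour [lam T v] of a corner has to be independent of the triangle [T]. Across an edge
    outside the tree this is the compatibility of [k]. Across tree edges it is proved from the
    leaves to the root by a parity argument. Connectedness of the links then makes the colour depend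
    on the vertex only, and the tree makes it constant. *)
Lemma labelling_const : exists c, forall d, d.1 \in lets (flatten faces) -> k d = c.
Proof.
have [lam lamP] : exists lam : {set 'I_n} -> 'I_n -> bool, forall T, tri T ->
    forall u v, u \in T -> v \in T -> (u < v)%N ->
    if tree u v then lam T u = lam T v else lam T u = k ((u, v), false) /\ lam T v = k ((u, v), true).
  have ex T : exists l : 'I_n -> bool, tri T -> forall u v, u \in T -> v \in T -> (u < v)%N ->
      if tree u v then l u = l v else l u = k ((u, v), false) /\ l v = k ((u, v), true).
    have [tT|nT] := boolP (tri T); first by have [l lP] := corner tT; exists l.
    by exists (fun=> false).
  by exists (fun T => projT1 (cid (ex T))) => T; exact: (projT2 (cid (ex T))).
have lamtree T u v : tri T -> u \in T -> v \in T -> u != v -> tree u v -> lam T u = lam T v.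
  move=> tT uT vT uv tuv; have [h|h|h] := ltngtP u v; last by rewrite (val_inj h) eqxx in uv.
    by have := lamP T tT u v uT vT h; rewrite tuv.
  by have := lamP T tT v u vT uT h; rewrite treeC tuv.
pose sat v w := forall T1 T2, tri T1 -> tri T2 -> v \in T1 -> w \in T1 -> v \in T2 -> w \in T2 ->
  lam T1 v = lam T2 v.
have satN v w : edg v w -> ~~ tree v w -> sat v w.
  move=> /andP[vw _] nt T1 T2 t1 t2 v1 w1 v2 w2.
  have [h|h|h] := ltngtP v w; last by rewrite (val_inj h) eqxx in vw.
    have := lamP T1 t1 v w v1 w1 h; have := lamP T2 t2 v w v2 w2 h; rewrite (negPf nt).
    by move=> [-> _] [-> _].
  have := lamP T1 t1 w v w1 v1 h; have := lamP T2 t2 w v w2 v2 h; rewrite treeC (negPf nt).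
  by move=> [_ ->] [_ ->].
pose N v w := (\sum_(T | tri T && (v \in T) && (w \in T)) lam T v)%N.
have N2 v w T1 T2 : T1 != T2 -> (forall T, tri T && (v \in T) && (w \in T) = (T == T1) || (T == T2)) ->
    N v w = (lam T1 v + lam T2 v)%N.
  move=> T12 TE; rewrite /N (eq_bigl _ _ TE) (bigD1 T1) ?eqxx//= (big_pred1 T2)// => T.
  by case: eqVneq => [->|_] /=; rewrite ?(negPf T12) ?andbT.
(* Every triangle at [v] is counted by two of the edges at [v], so the sum of [N v w] over all [w]
   is even. All terms but one are even by assumption, hence so is the last one, and its two corners
   agree. *)
have parity v p : edg v p -> (forall w, edg v w -> w != p -> sat v w) -> sat v p.
  move=> vp sv; have [T1 [T2 [T12 TE]]] := edge_tris vp.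
  have tot : (2 %| \sum_(w | w != v) N v w)%N.
    rewrite (exchange_big_dep (fun T => tri T && (v \in T))) /=; last by move=> w T _ /andP[].
    apply: dvdn_sum => T /andP[tT vT].
    rewrite (eq_bigl (fun w => w \in T :\ v)); last by move=> w; rewrite !inE tT vT.
    rewrite sum_nat_const; have /andP[_ /eqP T3] := tT.
    have -> : #|T :\ v| = 2%N by move: T3; rewrite (cardsD1 v) vT add1n => -[].
    by rewrite dvdn_mulr.
  have pv : p != v by case/andP: vp; rewrite eq_sym.
  rewrite (bigD1 p)//= dvdn_addl in tot; last first.
    apply: dvdn_sum => w /andP[wv wp].
    have [e|ne] := boolP (edg v w); last first.
      rewrite /N big1// => T /andP[/andP[tT vT] wT]; exfalso; case/negP: ne.
      by case/andP: tT => TK _; apply: (sub_edg TK) => //; rewrite eq_sym.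
    have [U1 [U2 [U12 UE]]] := edge_tris e.
    rewrite (N2 _ _ _ _ U12 UE).
    have := UE U1; rewrite eqxx => /andP[/andP[a1 a2] a3].
    have := UE U2; rewrite eqxx orbT => /andP[/andP[b1 b2] b3].
    by rewrite (sv w e wp U1 U2)// addnn -muln2 dvdn_mull.
  rewrite (N2 _ _ _ _ T12 TE) in tot => U1 U2 t1 t2 v1 p1 v2 p2.
  have l12 : lam T1 v = lam T2 v by move: tot; case: (lam T1 v); case: (lam T2 v).
  have := TE U1; rewrite t1 v1 p1 => /esym/orP[]/eqP->; have := TE U2; rewrite t2 v2 p2 => /esym/orP[]/eqP->;
  by rewrite ?l12.
(* Induction from large rank to small. An edge to a child is settled at the child, since the ends of
   a tree edge have equal colours in each triangle; the edge to the parent is the last one, left to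
   [parity]. *)
have allsat m : forall v, vtx v -> ((\max_(i : 'I_n) rk i) - rk v < m)%N -> forall w, edg v w -> sat v w.
  elim: m => [//|m IH] v vK vm w vw.
  have child w' : edg v w' -> ~~ ((v != r) && (par v == w')) -> sat v w'.
    move=> vw' np; have [t|t] := boolP (tree v w'); last exact: satN.
    have /andP[wr /eqP pw] : (w' != r) && (par w' == v) by move: t; rewrite /tree (negPf np).
    have [_ wK] := edg_vtx vw'; have /andP[_ rkw] := parP wK wr; rewrite pw in rkw.
    have mx : (rk w' <= \max_(i : 'I_n) rk i)%N by exact: leq_bigmax.
    have sw : sat w' v.
      apply: IH; rewrite ?(edgC w')//.
      by move: mx rkw vm; move: (rk w') (rk v) (\max_(i : 'I_n) rk i)%N => x y z; clear; lia.
    move=> T1 T2 t1 t2 v1 w1 v2 w2; have vw0 : v != w' by case/andP: vw'.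
    rewrite (lamtree T1 v w' t1 v1 w1 vw0 t) (lamtree T2 v w' t2 v2 w2 vw0 t).
    exact: sw.
  have [/andP[vr /eqP pv]|np] := boolP ((v != r) && (par v == w)); last exact: child.
  by apply: parity => // w' vw' ww'; apply: child => //; rewrite vr pv eq_sym.
have const v : vtx v -> forall T1 T2, tri T1 -> tri T2 -> v \in T1 -> v \in T2 -> lam T1 v = lam T2 v.
  move=> vK; have sv := allsat _ v vK (ltnSn _).
  have imp T1 T2 : tri T1 -> tri T2 -> v \in T1 -> v \in T2 -> lam T1 v -> lam T2 v.
    move=> t1 t2 v1 v2 l1.
    have other T : tri T -> v \in T -> exists2 c, c \in T & c != v.
      move=> /andP[_ /eqP T3] vT; have : (0 < #|T :\ v|)%N.
        by move: T3; rewrite (cardsD1 v) vT add1n => -[->].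
      by move=> /card_gt0P[c]; rewrite !inE => /andP[cv cT]; exists c.
    have [c1 c1T c1v] := other _ t1 v1; have [c2 c2T c2v] := other _ t2 v2.
    have T1K : T1 \in K by case/andP: t1.
    have T2K : T2 \in K by case/andP: t2.
    have e1 : edg v c1 by apply: (sub_edg T1K) => //; rewrite eq_sym.
    have e2 : edg v c2 by apply: (sub_edg T2K) => //; rewrite eq_sym.
    pose B c := [exists T, [&& tri T, v \in T, c \in T & lam T v]].
    have : B c2.
      apply: (@linkK v B _ c1 c2) => //; [|by case/andP: e1|by case/andP: e2|].
        move=> c c' cv c'v cK /existsP[T /and4P[tT vT cT lT]].
        have [->|cc'] := eqVneq c' c; first by apply/existsP; exists T; rewrite tT vT cT.
        pose T0 := [set v; c; c']%SET.
        have t0 : tri T0 by rewrite /tri cK card3// eq_sym.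
        have v0 : v \in T0 by rewrite !inE eqxx.
        have c0 : c \in T0 by rewrite !inE eqxx orbT.
        apply/existsP; exists T0; rewrite t0 v0 !inE eqxx orbT /=.
        have TK : T \in K by case/andP: tT.
        have ec : edg v c by apply: (sub_edg TK) => //; rewrite eq_sym.
        by rewrite (sv c ec T0 T).
      by apply/existsP; exists T1; rewrite t1 v1 c1T.
    by move=> /existsP[T /and4P[tT vT cT lT]]; rewrite (sv c2 e2 T2 T).
  by move=> T1 T2 t1 t2 v1 v2; apply/idP/idP; exact: imp.
have [T0 t0 r0] := rT.
have all m : forall v, vtx v -> (rk v < m)%N -> forall T, tri T -> v \in T -> lam T v = lam T0 r.
  elim: m => [//|m IH] v vK vm T tT vT.
  have [vr|vr] := eqVneq v r; first by rewrite vr; apply: const => //; rewrite -vr.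
  have /andP[e1 e2] := parP vK vr.
  have [T1 [T2 [_ TE]]] := edge_tris e1.
  have := TE T1; rewrite eqxx => /andP[/andP[t1 v1] p1].
  rewrite (const v vK T T1)// (lamtree T1 v (par v))//.
  - apply: IH => //; first by have [] := edg_vtx e1.
    exact: leq_trans e2 _.
  - by case/andP: e1.
  - by rewrite /tree vr eqxx.
exists (lam T0 r) => -[[u v] b]; rewrite mem_faces /= => /and3P[nt uv e].
have [T1 [T2 [_ TE]]] := edge_tris e.
have := TE T1; rewrite eqxx => /andP[/andP[t1 u1] v1].
have [uK vK] := edg_vtx e.
have := lamP T1 t1 u v u1 v1 uv; rewrite (negPf nt) => -[h1 h2].
by case: b; rewrite -?h1 -?h2; apply: all (ltnSn _) _ _ _.
Qed.

End labelling.

Lemma univ_faces : univF faces.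
Proof. by move=> k; exact: labelling_const. Qed.

Section group.
Variables (G : groupType) (g : 'I_n -> 'I_n -> G).
Hypothesis g1 : forall u v w, [set u; v; w]%SET \in K -> g u v * g v w = g u w.
Hypothesis g2 : forall (H : groupType) (lam : 'I_n -> 'I_n -> H),
  (forall u v w, [set u; v; w]%SET \in K -> lam u v * lam v w = lam u w) ->
  exists (f : G -> H) (t : 'I_n -> H), is_hom f /\
    forall u v, [set u; v]%SET \in K -> f (g u v) = t u * lam u v * (t v)^-1.
Hypothesis g3 : forall (Q : G -> Prop) (s : 'I_n -> G), is_subgroup Q ->
  (forall u v, [set u; v]%SET \in K -> Q (s u * g u v * (s v)^-1)) -> forall a, Q a.

Lemma g_refl v : vtx v -> g v v = 1.
Proof.
move=> vK; apply: (mulgI (g v v)); rewrite g1 ?mulg1//.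
by rewrite !finset.setUid.
Qed.

Lemma g_inv u v : [set u; v]%SET \in K -> g v u = (g u v)^-1.
Proof.
move=> uvK; apply/esym/mulg1_eq; rewrite g1; last by rewrite finset.setUAC finset.setUid.
by apply: g_refl; apply: sub_vtx uvK _; rewrite !inE eqxx.
Qed.

Lemma tree_section : exists s : 'I_n -> G,
  s r = 1 /\ forall v, vtx v -> v != r -> s v = s (par v) * g (par v) v.
Proof.
pose sN := fix sN k v : G := if k is k'.+1 then
  (if v == r then 1 else sN k' (par v) * g (par v) v) else 1.
have st k : forall v, vtx v -> (rk v < k)%N -> sN k v = sN k.+1 v.
  elim: k => // k IH v vK vk; rewrite [LHS]/= [RHS]/= -/sN; case: eqVneq => // vr.
  have /andP[e1 e2] := parP vK vr; have [_ pK] := edg_vtx e1.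
  by rewrite IH//; lia.
pose M := (\max_(i : 'I_n) rk i).+1.
exists (sN M); split=> [|v vK vr]; first by rewrite /M /= eqxx.
have /andP[e1 e2] := parP vK vr; have [_ pK] := edg_vtx e1.
have vM : (rk v < M)%N by rewrite ltnS; exact: leq_bigmax.
by rewrite [in LHS]/M /= (negPf vr) (st _ _ pK (leq_trans e2 vM)).
Qed.

(** The section [s] multiplies up along the tree from the root, so the corrected generators of tree
    edges become trivial; conversely [l] extends values on the remaining edges to a cocycle. *)
Lemma pres_faces : exists gen, presF (G := G) faces gen.
Proof.
have [s [sr sE]] := tree_section.
pose gen (x : 'I_n * 'I_n) := s x.1 * g x.1 x.2 * (s x.2)^-1.
have gen_tree u v : edg u v -> tree u v -> gen (u, v) = 1.
  move=> e; have [uK vK] := edg_vtx e; have /andP[_ uvK] := e; rewrite /gen /=.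
  have vuK : [set v; u]%SET \in K by rewrite finset.setUC.
  move=> /orP[]/andP[hr /eqP hp].
    by rewrite (sE u)// hp -mulgA -mulgA (mulgA (g v u)) g1 ?g_refl// ?mul1g ?mulgV// finset.setUAC finset.setUid.
  by rewrite (sE v)// hp mulgV.
have evT (H : groupType) (h : 'I_n * 'I_n -> H) (h' : 'I_n * 'I_n -> H) a b c :
    (forall x, x \in lets (tword a b c) -> h' x = if tree x.1 x.2 then 1 else h x) ->
    ev h (erase (tword a b c)) = h' (a, b) * h' (b, c) * (h' (a, c))^-1.
  move=> hh; rewrite !hh ?inE ?eqxx ?orbT// /erase /=.
  case: (tree a b); case: (tree b c); case: (tree a c); by rewrite /= /evd /= ?mulg1 ?mul1g ?invg1 ?mulg1 ?mulgA.
exists gen; split.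
- move=> w /mapP[T]; rewrite mem_ltri => tT ->; have /andP[TK _] := tT.
  have [a [b [c [ab bc -> TE]]]] := tri_sorted tT.
  rewrite (evT _ gen gen).
    by rewrite /gen /= !gnorm -(g1 (u := a) (v := b) (w := c)) ?gnorm// -TE.
  have ac := ltn_trans ab bc.
  have [aT bT cT] : [/\ a \in T, b \in T & c \in T] by rewrite TE !inE !eqxx ?orbT.
  have nl u v : (u < v)%N -> u != v by move=> h; apply: contraTneq h => ->; rewrite ltnn.
  move=> x; rewrite !inE => /or3P[]/eqP-> /=; case: ifP => // t; apply: gen_tree t; apply: (sub_edg TK) => //; exact: nl.
- move=> H h hf.
  pose l u v := if u == v then 1 else if tree u v then 1 else if (u < v)%N then h (u, v) else (h (v, u))^-1.
  have lV u v : l v u = (l u v)^-1.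
    rewrite /l eq_sym; case: eqVneq => [|uv]; first by rewrite invg1.
    rewrite treeC; case: ifP => _; first by rewrite invg1.
    by case: ltngtP => [_|_|/val_inj E]; rewrite ?invgK//; rewrite E eqxx in uv.
  have sw1 u v w : l u v * l v w = l u w -> l v u * l u w = l v w.
    by move=> <-; rewrite (lV u v) mulKg.
  have sw2 u v w : l u v * l v w = l u w -> l u w * l w v = l u v.
    by move=> <-; rewrite (lV v w) mulgK.
  have lM u v w : [set u; v; w]%SET \in K -> l u v * l v w = l u w.
    move=> uvwK; have lid i : l i i = 1 by rewrite /l eqxx.
    have [->|uv] := eqVneq u v; first by rewrite lid mul1g.
    have [->|vw] := eqVneq v w; first by rewrite lid mulg1.
    have [<-|uw] := eqVneq u w; first by rewrite (lV u v) mulgV lid.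
    have tT : tri [set u; v; w]%SET by rewrite /tri uvwK card3.
    have [a [b [c [ab bc fE TE]]]] := tri_sorted tT.
    have ac := ltn_trans ab bc.
    have nl (i j : 'I_n) : (i < j)%N -> (i == j) = false by move=> h'; apply/negP => /eqP E; rewrite E ltnn in h'.
    have lE (i j : 'I_n) : (i < j)%N -> l i j = if tree i j then 1 else h (i, j).
      by move=> ij; rewrite /l (nl _ _ ij) ij.
    have base : l a b * l b c = l a c.
      apply: divg1_eq; rewrite -[1](hf (face [set u; v; w]%SET)).
        rewrite fE (evT _ h (fun x => l x.1 x.2)) //= => x.
        by rewrite !inE => /or3P[]/eqP-> /=; rewrite lE.
      by apply/mapP; exists [set u; v; w]%SET; rewrite ?mem_ltri.
    have p1 := sw1 _ _ _ base; have p2 := sw2 _ _ _ base.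
    have p3 := sw1 _ _ _ p2; have p4 := sw2 _ _ _ p1; have p5 := sw2 _ _ _ p3.
    have : u \in [set a; b; c]%SET by rewrite -TE !inE eqxx.
    have : v \in [set a; b; c]%SET by rewrite -TE !inE eqxx orbT.
    have : w \in [set a; b; c]%SET by rewrite -TE !inE eqxx orbT.
    rewrite !inE => /orP[/orP[]|]/eqP Ew /orP[/orP[]|]/eqP Ev /orP[/orP[]|]/eqP Eu; rewrite Eu Ev Ew // in uv vw uw *;
      by rewrite eqxx in uv vw uw.
  have [f [t [fM fE]]] := g2 lM.
  pose f' x := (t r)^-1 * f x * t r.
  have fM' : is_hom f' by move=> x y; rewrite /f' fM !gnorm.
  have lt u v : tree u v -> l u v = 1 by move=> tuv; rewrite /l tuv; case: ifP.
  have fs m : forall v, vtx v -> (rk v < m)%N -> f (s v) = t r * (t v)^-1.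
    elim: m => [//|m IH] v vK vm.
    have [->|vr] := eqVneq v r; first by rewrite sr hom1// mulgV.
    have /andP[e1 e2] := parP vK vr; have [_ pK] := edg_vtx e1.
    have pvK : [set par v; v]%SET \in K by rewrite finset.setUC; case/andP: e1.
    rewrite (sE v)// fM IH//; last exact: leq_trans e2 _.
    by rewrite fE// lt ?/tree ?vr ?eqxx ?orbT// !gnorm.
  exists f'; split=> // -[u v]; rewrite mem_faces /= => /and3P[nt uv e].
  have [uK vK] := edg_vtx e; have /andP[uv' uvK] := e.
  rewrite /f' /gen /= !fM homV// (fs (rk u).+1)// (fs (rk v).+1)// fE// /l (negPf uv') (negPf nt) uv.
  by rewrite !gnorm.
- move=> Q Qs Ql; apply: (g3 (s := s)) => // u v uvK; have [Q1 QM QV] := Qs.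
  have [E|uv] := eqVneq u v.
    by rewrite -E g_refl ?mulg1 ?mulgV//; apply: sub_vtx uvK _; rewrite !inE eqxx.
  have e : edg u v by rewrite /edg uv.
  have [tuv|nt] := boolP (tree u v); first by rewrite -[_ * _]/(gen (u, v)) gen_tree.
  have [h|h|h] := ltngtP u v; last by rewrite (val_inj h) eqxx in uv.
    by apply: (Ql (u, v)); rewrite mem_faces /= nt h.
  have -> : s u * g u v * (s v)^-1 = (gen (v, u))^-1.
    by rewrite /gen /= (g_inv uvK) !gnorm.
  by apply/QV/(Ql (v, u)); rewrite mem_faces /= treeC nt h edgC.
Qed.

Variable d : nat.
Hypothesis d0 : (0 < d)%N.
Hypothesis chi : simplicial_euler_characteristic K = (- (d * 2)%N%:Z)%R.

Lemma euler_count :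
  (#|[set v | vtx v]%SET| + #|[set T | tri T]%SET| + 2 * d = #|[set A in K | #|A| == 2]%SET|)%N.
Proof.
have card1 : #|[set A in K | #|A| == 1%N]%SET| = #|[set v | vtx v]%SET|.
  rewrite -(card_imset _ (f := fun v => [set v]%SET)); last exact: finset.set1_inj.
  congr #|pred_of_set _|; apply/setP => A; rewrite inE; apply/andP/imsetP => [[AK /cards1P[v E]]|[v]].
    by exists v => //; rewrite inE /vtx -E.
  by rewrite inE => vK ->; rewrite cards1.
have P (p : pred {set 'I_n}) : (#|[set A in K | p A]%SET|%:Z = \sum_(A in K) (p A : nat)%:Z)%R.
  have -> : #|[set A in K | p A]%SET| = (\sum_(A in K) p A)%N.
    rewrite -sum1_card big_mkcond [RHS]big_mkcond /=; apply: eq_bigr => A _.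
    by rewrite inE; case: (A \in K); case: (p A).
  exact: (big_morph Posz PoszD).
have sumE : simplicial_euler_characteristic K =
    (#|[set A in K | #|A| == 1%N]%SET|%:Z - #|[set A in K | #|A| == 2]%SET|%:Z + #|[set T | tri T]%SET|%:Z)%R.
  rewrite !P -sumrB -big_split /=; apply: eq_bigr => A AK.
  have A3 := dimK AK; have := K_neq0 complexK AK; rewrite -card_gt0.
  by move: A3; case: #|A| => [|[|[|[|]]]].
rewrite card1 chi in sumE; move: sumE.
by move: #|[set v | vtx v]%SET| #|[set T | tri T]%SET| #|[set A in K | #|A| == 2]%SET| => a b c; clear; lia.
Qed.

End group.
End tree.

Theorem surface_of_complex (G : groupType) (g : 'I_n -> 'I_n -> G) d :
  (forall u v w, [set u; v; w]%SET \in K -> g u v * g v w = g u w) ->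
  (forall (H : groupType) (lam : 'I_n -> 'I_n -> H),
    (forall u v w, [set u; v; w]%SET \in K -> lam u v * lam v w = lam u w) ->
    exists (f : G -> H) (t : 'I_n -> H), is_hom f /\
      forall u v, [set u; v]%SET \in K -> f (g u v) = t u * lam u v * (t v)^-1) ->
  (forall (Q : G -> Prop) (s : 'I_n -> G), is_subgroup Q ->
    (forall u v, [set u; v]%SET \in K -> Q (s u * g u v * (s v)^-1)) -> forall a, Q a) ->
  (0 < d)%N -> simplicial_euler_characteristic K = (- (d * 2)%N%:Z)%R ->
  exists k, surface_presented k d G.
Proof.
move=> g1 g2 g3 d0 chi; have [rk [par parP]] := spanning_tree.
have [gen gP] := pres_faces parP g1 g2 g3.
have sf : size (faces par) = #|[set T | tri T]%SET| by rewrite size_map -cardE.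
have F0 : (0 < #|[set T | tri T]%SET|)%N.
  by have [T tT _] := rT; apply/card_gt0P; exists T; rewrite inE.
apply: (classification (fs := faces par) (gen := gen)) => //.
- exact: faces_neq0 parP.
- exact: quad_faces.
- exact: univ_faces parP.
- by rewrite sf.
rewrite sf; have := size_faces parP; have := euler_count chi.
have V0 : (0 < #|[set v | vtx v]%SET|)%N by apply/card_gt0P; exists r; rewrite inE.
move: F0 V0; move: #|[set v | vtx v]%SET| #|[set T | tri T]%SET| #|[set A in K | #|A| == 2]%SET| (size _) => a b c e; clear; lia.
Qed.

End combinatorial_surface.

Local Close Scope group_scope.

Theorem surface_group (R : realType) (S : topologicalType) (x : S) (chi : int) :
  closed_surface R S -> has_euler_characteristic R S chi -> (2 %| chi)%Z -> (chi <= -2)%R ->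
  exists k d, (0 < d)%N /\ surface_presented k d (fundamental_group R x).
Proof.
move=> [_ _ conn eucl] [n [K [[cK [h [k [ch ck hk kh]]]] chiE]]] even le2.
have [d dE] : exists d : nat, chi = (- (d * 2)%N%:Z)%R.
  have /dvdzP[q qE] := even; exists `|q|%N; lia.
have d0 : (0 < d)%N by lia.
have tri3 := triangle_above cK ch ck hk kh x eucl.
have [r rK] : exists r, [set r]%SET \in K.
  have [v vx] := star_cover h x; exists v.
  have [_ _ xK] := co_real h x; apply: (face_closed cK xK); first by rewrite finset.sub1set; exact: star_supp.
  by apply/set0Pn; exists v; rewrite inE.
have [g [g1 g2 g3]] := triangulated_group cK ch ck hk kh x conn.
suff [e eP] : exists e, surface_presented e d (fundamental_group R x) by exists e, d.
apply: (@surface_of_complex n K r cK _ _ _ _ rK _ _ g d) => //.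
- exact: (dim_le2 cK ck kh x eucl).
- move=> a b /andP[ab abK].
  have [c1 [c1a c1b k1]] := edge_third cK ch ck hk kh x eucl ab abK.
  have [c2 [c2a c2b c21 k2]] := edge_two cK ch hk kh x eucl ab c1a c1b k1.
  exists c1, c2; split; first by rewrite eq_sym.
  move=> c; apply/idP/idP => [/andP[/andP[ca cb] k3]|/orP[]/eqP->]; last 2 first.
  + by rewrite c1a c1b k1.
  + by rewrite c2a c2b k2.
  rewrite -[_ || _]negbK negb_or; apply/negP => /andP[cc1 cc2].
  apply: (edge_not_three cK ck kh x eucl _ k1 k2 k3).
  by rewrite /= !inE !negb_or ab !(eq_sym a) !(eq_sym b) c1a c2a ca c1b c2b cb !(eq_sym c1) c21 cc1 eq_sym cc2.
- exact: (link_connected cK ch ck hk kh x eucl).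
- exact: (vertices_connected cK ch kh x conn).
- have [T TK /andP[rT T3]] := tri3 _ rK; exists T; first by rewrite /tri TK.
  by move: rT; rewrite finset.sub1set.
- by rewrite chiE dE.
Qed.

(** * Diagram groups *)

Local Open Scope group_scope.

Section diagrams.
Variable P : semigroup_presentation.
Local Notation word := (seq P).
Local Notation path := (seq (squier_edge P)).
Implicit Types (w u v a b c : word) (p q : path) (e : squier_edge P).

Definition ext_edge a b e := SquierEdge (a ++ edge_left e) (edge_src e) (edge_tgt e) (edge_right e ++ b).
Definition ext a b p := map (ext_edge a b) p.

Lemma ext_start a b e : edge_start (ext_edge a b e) = a ++ edge_start e ++ b.
Proof. by rewrite /edge_start /= -!catA. Qed.

Lemma ext_end a b e : edge_end (ext_edge a b e) = a ++ edge_end e ++ b.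
Proof. by rewrite /edge_end /= -!catA. Qed.

Lemma ext_path a b u p v : is_edge_path u p v -> is_edge_path (a ++ u ++ b) (ext a b p) (a ++ v ++ b).
Proof.
elim: p u => [|e p IH] u /=; first by move->.
by move=> [e1 -> /IH h]; rewrite ext_end ext_start; split.
Qed.

Lemma ext_cat a b p q : ext a b (p ++ q) = ext a b p ++ ext a b q.
Proof. exact: map_cat. Qed.

Lemma ext_inv a b p : ext a b (path_inv p) = path_inv (ext a b p).
Proof. by rewrite /ext /path_inv map_rev -!map_comp; congr rev; apply: eq_map. Qed.

Lemma ext_elementary a b p q : elementary_homotopy p q -> elementary_homotopy (ext a b p) (ext a b q).
Proof.
case=> [p' e q'|p' x u v y s t z q']; rewrite !ext_cat.
  have := Backtrack (ext a b p') (ext_edge a b e) (ext a b q').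
  by [].
have := Square (ext a b p') (a ++ x) u v y s t (z ++ b) (ext a b q').
by rewrite /ext /ext_edge /= -!catA.
Qed.

Lemma ext_homotopic a b u v p q : edge_homotopic u v p q ->
  edge_homotopic (a ++ u ++ b) (a ++ v ++ b) (ext a b p) (ext a b q).
Proof.
elim=> {p q} [p q [h1 h2 h3]|p|p q _ IH|p q r _ IH _ IH'].
- by apply: rst_step; split; [exact: ext_path|exact: ext_path|exact: ext_elementary].
- exact: rst_refl.
- exact: rst_sym.
- exact: rst_trans IH IH'.
Qed.

Lemma homotopic_catl x w y l p q : is_edge_path x l w -> edge_homotopic w y p q ->
  edge_homotopic x y (l ++ p) (l ++ q).
Proof. by move=> xl h; have := edge_homotopic_ctx xl (erefl : is_edge_path y [::] y) h; rewrite !cats0. Qed.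

Lemma homotopic_catr x w y r p q : is_edge_path w r y -> edge_homotopic x w p q ->
  edge_homotopic x y (p ++ r) (q ++ r).
Proof. by move=> wr h; exact: (edge_homotopic_ctx (erefl : is_edge_path x [::] x) wr h). Qed.

(** Edges of [p] and of [q] rewrite disjoint subwords and are exchanged by squares: one edge with
    one edge, then one edge with all of [q], then all of [p]. *)
Lemma disjoint_commute a u u' b v v' c p q : is_edge_path u p u' -> is_edge_path v q v' ->
  edge_homotopic (a ++ u ++ b ++ v ++ c) (a ++ u' ++ b ++ v' ++ c)
    (ext a (b ++ v ++ c) p ++ ext (a ++ u' ++ b) c q)
    (ext (a ++ u ++ b) c q ++ ext a (b ++ v' ++ c) p).
Proof.
have one e f : is_squier_edge e -> is_squier_edge f ->
    edge_homotopic (a ++ edge_start e ++ b ++ edge_start f ++ c) (a ++ edge_end e ++ b ++ edge_end f ++ c)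
      [:: ext_edge a (b ++ edge_start f ++ c) e; ext_edge (a ++ edge_end e ++ b) c f]
      [:: ext_edge (a ++ edge_start e ++ b) c f; ext_edge a (b ++ edge_end f ++ c) e].
  move=> he hf; apply: rst_step; split.
  - rewrite /= ext_start; split; [exact: he|by rewrite -!catA|].
    by split; [exact: hf|rewrite ext_end ext_start -!catA|rewrite ext_end -!catA].
  - rewrite /= ext_start; split; [exact: hf|by rewrite -!catA|].
    by split; [exact: he|rewrite ext_end ext_start -!catA|rewrite ext_end -!catA].
  have := Square [::] (a ++ edge_left e) (edge_src e) (edge_tgt e) (edge_right e ++ b ++ edge_left f)
    (edge_src f) (edge_tgt f) (edge_right f ++ c) [::].
  by rewrite /ext_edge /edge_start /edge_end /= -!catA.
have right e : is_squier_edge e -> forall q v v', is_edge_path v q v' ->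
    edge_homotopic (a ++ edge_start e ++ b ++ v ++ c) (a ++ edge_end e ++ b ++ v' ++ c)
      (ext_edge a (b ++ v ++ c) e :: ext (a ++ edge_end e ++ b) c q)
      (ext (a ++ edge_start e ++ b) c q ++ [:: ext_edge a (b ++ v' ++ c) e]).
  move=> he {}q; elim: q => [|f q IH] {}v {}v' /=; first by move->; exact: rst_refl.
  move=> [hf -> vq].
  have pth : is_edge_path (a ++ edge_end e ++ b ++ edge_end f ++ c) (ext (a ++ edge_end e ++ b) c q)
      (a ++ edge_end e ++ b ++ v' ++ c).
    by have := ext_path (a ++ edge_end e ++ b) c vq; rewrite -!catA.
  apply: rst_trans (homotopic_catr pth (one e f he hf)) _.
  have := @homotopic_catl (a ++ edge_start e ++ b ++ edge_start f ++ c) _ _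
    [:: ext_edge (a ++ edge_start e ++ b) c f] _ _ _ (IH _ _ vq).
  by apply; rewrite /= ext_start ext_end -!catA.
move=> + vq; elim: p u => [|e p IH] u /=; first by move->; rewrite /= cats0; exact: rst_refl.
move=> [he -> up].
have pth : is_edge_path (a ++ edge_start e ++ b ++ v ++ c) [:: ext_edge a (b ++ v ++ c) e]
    (a ++ edge_end e ++ b ++ v ++ c).
  by rewrite /= ext_start ext_end -!catA.
apply: rst_trans (homotopic_catl pth (IH _ up)) _.
have pth' : is_edge_path (a ++ edge_end e ++ b ++ v' ++ c) (ext a (b ++ v' ++ c) p)
    (a ++ u' ++ b ++ v' ++ c) by exact: ext_path.
have := homotopic_catr pth' (right e he _ _ _ vq).
by rewrite -!catA /=.
Qed.

Definition reach w z := exists p, is_edge_path w p z.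

Section based.
Variable w : word.

Definition dloop p : edge_loop w :=
  if pselect (is_edge_path w p w) is left h then exist _ p h else edge_loop_one w.
Definition dcl p : diagram_group_of w := class_of (dloop p : sg_elt (edge_loop_group w)).

Lemma dloopE p : is_edge_path w p w -> projT1 (dloop p) = p.
Proof. by move=> wp; rewrite /dloop; case: pselect. Qed.

Lemma sg_eqE (x y : edge_loop w) :
  @sg_eq (edge_loop_group w) x y = edge_homotopic w w (projT1 x) (projT1 y).
Proof. by []. Qed.

Lemma edge_loop_mulE (x y : edge_loop w) :
  projT1 (@sg_mul (edge_loop_group w) x y : edge_loop w) = projT1 x ++ projT1 y.
Proof. by []. Qed.

Lemma dcl_eq p q : is_edge_path w p w -> is_edge_path w q w ->
  dcl p = dcl q <-> edge_homotopic w w p q.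
Proof.
move=> wp wq; rewrite /dcl; split=> [/class_ofP|h]; last apply/class_ofP; by rewrite sg_eqE !dloopE.
Qed.

Lemma dclM p q : is_edge_path w p w -> is_edge_path w q w -> dcl (p ++ q) = dcl p * dcl q.
Proof.
move=> wp wq; rewrite /dcl [RHS]class_mulE; apply/class_ofP.
rewrite sg_eqE dloopE; last by apply/is_edge_path_cat; exists w.
rewrite (edge_loop_mulE (dloop p)) !dloopE//; exact: rst_refl.
Qed.

Lemma dcl1 : dcl [::] = 1.
Proof.
by apply/class_ofP; rewrite sg_eqE dloopE//=; exact: rst_refl.
Qed.

Lemma dclV p : is_edge_path w p w -> dcl (path_inv p) = (dcl p)^-1.
Proof.
move=> wp; have wq := is_edge_path_inv wp; apply/esym/mulg1_eq.
rewrite -dclM// -dcl1; apply/dcl_eq => //; first by apply/is_edge_path_cat; exists w.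
exact: edge_homotopic_mulrV wp.
Qed.

Lemma dcl_surj (g : diagram_group_of w) : exists2 p, is_edge_path w p w & g = dcl p.
Proof.
pose l : edge_loop w := repr g; have wp := projT2 l; exists (projT1 l) => //.
by rewrite -[g]class_of_repr; apply/class_ofP; rewrite sg_eqE dloopE//; exact: rst_refl.
Qed.

Section labelling.
Variables (H : groupType) (lab : squier_edge P -> H).

Definition plab p := \prod_(e <- p) lab e.

Lemma plab_cat p q : plab (p ++ q) = plab p * plab q. Proof. exact: big_cat. Qed.

Hypothesis labV : forall e, is_squier_edge e -> reach w (edge_start e) ->
  lab (edge_inv e) = (lab e)^-1.
Hypothesis labC : forall a u v b s t c, is_squier_edge (SquierEdge a u v (b ++ s ++ c)) ->
  is_squier_edge (SquierEdge (a ++ u ++ b) s t c) -> reach w (a ++ u ++ b ++ s ++ c) ->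
  lab (SquierEdge a u v (b ++ s ++ c)) * lab (SquierEdge (a ++ v ++ b) s t c) =
  lab (SquierEdge (a ++ u ++ b) s t c) * lab (SquierEdge a u v (b ++ t ++ c)).

Lemma plab_elementary z p q : is_edge_path w p z -> elementary_homotopy p q -> plab p = plab q.
Proof.
move=> wp h; case: h wp => [p' e q'|p' a u v b s t c q'].
  move=> /is_edge_path_cat[y p1 [e1 ye _]].
  rewrite !plab_cat; congr (_ * _); rewrite /plab !big_cons big_nil labV//.
    by rewrite mulg1 mulgV mul1g.
  by exists p'; rewrite -ye.
move=> /is_edge_path_cat[y p1 [e1 ye [e2 _ _]]].
rewrite !plab_cat; congr (_ * (_ * _)); rewrite /plab !big_cons !big_nil !mulg1.
by apply: labC => //; exists p'; move: p1; rewrite ye /edge_start /= -?catA.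
Qed.

Lemma plab_homotopic z p q : edge_homotopic w z p q -> plab p = plab q.
Proof.
elim=> {p q} [p q [h1 h2 h3]|p|p q _ IH|p q r _ IH _ IH'] //.
- exact: plab_elementary h1 h3.
- by rewrite IH.
Qed.

(** Labels need to be compatible only in the component of [w]; hence a labelling may rely on
    properties of the words reachable from [w]. *)
Lemma label_hom : exists f : diagram_group_of w -> H, is_hom f /\
  forall p, is_edge_path w p w -> f (dcl p) = plab p.
Proof.
pose f (g : diagram_group_of w) := plab (projT1 (repr g : edge_loop w)).
have fE p : is_edge_path w p w -> f (dcl p) = plab p.
  move=> wp; apply: (@plab_homotopic w).
  have := sg_eq_repr (dloop p : sg_elt (edge_loop_group w)).
  by rewrite sg_eqE dloopE.
exists f; split=> // x y; have [p wp ->] := dcl_surj x; have [q wq ->] := dcl_surj y.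
by rewrite -dclM// !fE// ?plab_cat//; apply/is_edge_path_cat; exists w.
Qed.

End labelling.
End based.
End diagrams.

(** * Embedding surface groups into a diagram group *)

Lemma kap_hom (G H : groupType) (f : G -> H) k x y : is_hom f ->
  f (kap k x y) = kap k (f x) (f y).
Proof. by move=> fM; rewrite /kap; case: k; rewrite !fM ?(homV fM). Qed.

(* The cyclic cover of degree [d] of the torus half of the surface of [Q]. *)
Theorem surface_cover k d (G Q : groupType) : (0 < d)%N -> surface_presented k d G ->
  surface_presented k 1 Q -> exists f : G -> Q, is_hom f /\ injective f.
Proof.
move=> d0 [a [b [u [v [grel gmap ggen]]]]] [al [be [ga' [de' [qrel qmap qgen]]]]].
pose ga := ga' 0%N; pose de := de' 0%N.
rewrite /srel big_nat1 -/ga -/de in qrel.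
pose cj (i : nat) x := al ^+ i * x * (al ^+ i)^-1.
have cjM i : is_hom (cj i) by move=> x y; rewrite /cj !gnorm.
have kapE i x y : kap k (cj i x) (cj i y) = cj i (kap k x y).
  by rewrite (kap_hom k x y (cjM i)).
(* By the relation of [Q], [kap k ga de] is $\beta\alpha\beta^{-1}\alpha^{-1}$, so its conjugates by
   the powers of $\alpha$ telescope. *)
have pE n : \prod_(0 <= i < n) cj i (kap k ga de) = be * al ^+ n * be^-1 * (al ^+ n)^-1.
  elim: n => [|n IH]; first by rewrite big_nil expg0 !gnorm.
  have E : kap k ga de = be * al * be^-1 * al^-1.
    by apply: (mulgI (al * be * al^-1 * be^-1)); rewrite qrel !gnorm.
  by rewrite big_nat_recr//= IH E /cj expgSr !gnorm.
have frel : srel k d (al ^+ d) be (fun i => cj i ga) (fun i => cj i de) = 1.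
  rewrite /srel (eq_bigr (fun i => cj i (kap k ga de))) => [|i _]; last exact: kapE.
  by rewrite pE !gnorm.
have [f [fM fa fb fuv]] := gmap Q _ _ _ _ frel; exists f; split=> //.
(* For injectivity, [Q] acts on [d] sheets, each a copy of [G], as in an induced representation:
   [al] permutes the sheets cyclically with a twist by [a] on the way round, and on sheet [i] the
   relation forces [be] to act as [bb i]. Points beyond the first [d] sheets are fixed. *)
pose c i := kap k (u i) (v i).
pose bb i := (\prod_(0 <= j < i) c j)^-1 * b.
pose T := (nat * G)%type.
pose A (t : T) : T := if (t.1 < d)%N then (if t.1 is i.+1 then (i, t.2) else (d.-1, a * t.2)) else t.
pose A' (t : T) : T := if (t.1 < d)%N then
  (if (t.1.+1 < d)%N then (t.1.+1, t.2) else (0%N, a^-1 * t.2)) else t.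
have AK : cancel A A'.
  move=> [[|i] g]; rewrite /A /A' /=.
    by rewrite d0 /= prednK// leqnn ltnn mulKg.
  have [id|di] := ltnP i.+1 d; first by rewrite /= (ltnW id) id.
  by rewrite /= ltnNge di.
have A'K : cancel A' A.
  move=> [i g]; rewrite /A /A' /=.
  have [id|di] := ltnP i d; last by rewrite /= ltnNge di.
  have [id'|di] := ltnP i.+1 d; first by rewrite /= id'.
  rewrite /= d0 mulVKg; congr pair; apply/eqP; rewrite -eqSS prednK// eqn_leq di.
  by rewrite id.
pose S (h : nat -> G) (t : T) : T := if (t.1 < d)%N then (t.1, h t.1 * t.2) else t.
pose S' (h : nat -> G) (t : T) : T := if (t.1 < d)%N then (t.1, (h t.1)^-1 * t.2) else t.
have SK h : cancel (S h) (S' h).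
  by move=> [i g]; rewrite /S /S' /=; have [id|id] := boolP (i < d)%N; rewrite /= ?id ?(negPf id) ?mulKg.
have S'K h : cancel (S' h) (S h).
  by move=> [i g]; rewrite /S /S' /=; have [id|id] := boolP (i < d)%N; rewrite /= ?id ?(negPf id) ?mulVKg.
pose rA := Bij AK A'K; pose rS h := Bij (SK h) (S'K h).
have rS_kap x y i g : (i < d)%N -> (kap k (rS x) (rS y)) (i, g) = (i, kap k (x i) (y i) * g).
  move=> id; have E h g' : rS h (i, g') = (i, h i * g') by rewrite /= /S /= id.
  have EV h g' : (rS h)^-1 (i, g') = (i, (h i)^-1 * g') by rewrite /= /S' /= id.
  by rewrite /kap; case: (k); rewrite !bijM ?EV ?E ?EV ?E !mulgA.
have rS_out x t : (d <= t.1)%N -> rS x t = t by move=> dt; rewrite /= /S ltnNge dt.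
have rSV_out x t : (d <= t.1)%N -> (rS x)^-1 t = t by move=> dt; rewrite /= /S' ltnNge dt.
have rA_out t : (d <= t.1)%N -> rA t = t by move=> dt; rewrite /= /A ltnNge dt.
have rAV_out t : (d <= t.1)%N -> rA^-1 t = t by move=> dt; rewrite /= /A' ltnNge dt.
have rrel : srel k 1 rA (rS bb) (fun=> rS u) (fun=> rS v) = 1.
  rewrite /srel big_nat1; apply: bij_eq => -[i g]; rewrite bij1.
  have [id|di] := ltnP i d; last first.
    have kout : (kap k (rS u) (rS v)) (i, g) = (i, g).
      by rewrite /kap; case: (k); rewrite !bijM ?rSV_out// ?rS_out// ?rSV_out// ?rS_out.
    by rewrite bijM kout !bijM rSV_out// rAV_out// rS_out// rA_out.
  rewrite bijM rS_kap// -/(c i) !bijM.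
  have -> : (rS bb)^-1 (i, c i * g) = (i, (bb i)^-1 * (c i * g)) by rewrite /= /S' /= id.
  have [id'|di] := ltnP i.+1 d.
    have -> : rA^-1 (i, (bb i)^-1 * (c i * g)) = (i.+1, (bb i)^-1 * (c i * g)) by rewrite /= /A' /= id id'.
    have -> : rS bb (i.+1, (bb i)^-1 * (c i * g)) = (i.+1, bb i.+1 * ((bb i)^-1 * (c i * g))) by rewrite /= /S /= id'.
    rewrite /= /A /= id'; congr pair; rewrite /bb big_nat_recr//= -/(c i); by rewrite !gnorm.
  have di' : i.+1 = d by apply/eqP; rewrite eqn_leq id di.
  have -> : rA^-1 (i, (bb i)^-1 * (c i * g)) = (0%N, a^-1 * ((bb i)^-1 * (c i * g))).
    by rewrite /= /A' /= id ltnNge di.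
  set g' := _ * (_ * _).
  have -> : rS bb (0%N, g') = (0%N, bb 0%N * g') by rewrite /= /S /= d0.
  rewrite /= /A /= d0 -di' /=; congr pair.
  have cE : \prod_(0 <= j < i) c j = b * a * b^-1 * a^-1 * (c i)^-1.
    have := grel; rewrite /srel -di' big_nat_recr//= -/(c i) => /(congr1 (fun x => b * a * b^-1 * a^-1 * x * (c i)^-1)).
    by rewrite !gnorm.
  by rewrite /g' /bb big_nil cE !gnorm.
have [r [rM ra rb ruv]] := qmap _ _ _ _ _ rrel.
have [rga rde] := ruv 0%N isT.
have rAn n g : (n < d)%N -> (rA ^+ n)^-1 (0%N, g) = (n, g).
  elim: n => [|n IH] nd; first by rewrite expg0 invg1.
  rewrite expgSr invgM bijM IH ?(ltnW nd)//; by rewrite /= /A' /= (ltnW nd) nd.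
have rAd g : (rA ^+ d) (0%N, g) = (0%N, a * g).
  have d1 : (d.-1 < d)%N by rewrite prednK.
  rewrite -(prednK d0) expgSr bijM.
  have -> : rA (0%N, g) = (d.-1, a * g) by rewrite /= /A /= d0.
  by rewrite -(rAn _ _ d1) bijKV.
(* On sheet 0 the image of [x] is left multiplication by [x], which recovers [x]. *)
have main x : forall g, r (f x) (0%N, g) = (0%N, x * g).
  pose W y := forall g, r (f y) (0%N, g) = (0%N, y * g).
  have rcj i y h : (i < d)%N -> r y = rS h -> forall g, r (cj i y) (0%N, g) = (0%N, h i * g).
    move=> id rx g; rewrite /cj !rM (homV rM) (homX rM) ra rx !bijM rAn//.
    by rewrite /= /S /= id -(rAn _ _ id) bijKV.
  apply: (ggen W).
  - split=> [g|y z hy hz g|y hy g]; first by rewrite hom1// hom1// mul1g.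
      by rewrite fM rM bijM hz hy mulgA.
    have := hy (y^-1 * g); rewrite mulVKg => <-.
    by rewrite homV// homV// bijVK.
  - by move=> g; rewrite fa homX// ra rAd.
  - by move=> g; rewrite fb rb /= /S /= d0 /bb big_nil invg1 mul1g.
  - move=> i id; have [fu fv] := fuv i id; split=> g.
      by rewrite fu (rcj i _ u).
    by rewrite fv (rcj i _ v).
apply: hom_inj => // x fx; have := main x 1.
by rewrite fx hom1// bij1 mulg1 => -[].
Qed.

(** * Actions on reduced words and doubled groups *)

Section reduced_words.
Variable X : eqType.
Local Notation dart := (dart X).
Implicit Types (d : dart) (w : seq dart).

Definition reduced w := sorted (fun d e => e != dinv d) w.

(** Left multiplication by a letter in the free group over [X], on reduced words. *)
Definition rcons_ d w := if w is e :: w' then (if e == dinv d then w' else d :: w) else [:: d].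

Lemma reduced_rcons d w : reduced w -> reduced (rcons_ d w).
Proof.
case: w => //= e w; case: eqVneq => [_|ed]; first by case: w => //= f w /andP[].
by rewrite /= ed.
Qed.

Lemma rconsK d w : reduced w -> rcons_ (dinv d) (rcons_ d w) = w.
Proof.
case: w => [|e w] /=; first by rewrite dinvK eqxx.
case: (eqVneq e (dinv d)) => [->|ed] /=; last by rewrite dinvK eqxx.
by case: w => //= f w /andP[/negPf]; rewrite dinvK => ->.
Qed.

Definition rword := {w : seq dart | reduced w}.

Lemma rword_eq (u v : rword) : sval u = sval v -> u = v.
Proof. exact: val_inj. Qed.

Definition push_ d (u : rword) : rword := exist _ (rcons_ d (sval u)) (reduced_rcons d (valP u)).

Lemma push_K d : cancel (push_ d) (push_ (dinv d)).
Proof. by move=> u; apply: rword_eq; rewrite /= rconsK//; exact: (valP u). Qed.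

Lemma push_VK d : cancel (push_ (dinv d)) (push_ d).
Proof. by move=> u; have := push_K (dinv d) u; rewrite dinvK. Qed.

Definition push d : bij rword := Bij (push_K d) (push_VK d).

Lemma pushVE d u : sval ((push d)^-1 u) = rcons_ (dinv d) (sval u). Proof. by []. Qed.

Section relabel.
Variable s : bij X.

Definition dmap (d : dart) : dart := (s d.1, d.2).

Lemma dmap_inv d : dmap (dinv d) = dinv (dmap d). Proof. by []. Qed.

Lemma dmap_inj : injective dmap.
Proof. by move=> [x b] [y c] [/(can_inj (bfunK s)) -> ->]. Qed.

Lemma reduced_map w : reduced w -> reduced (map dmap w).
Proof.
case: w => //= d w; elim: w d => //= e w IH d /andP[ed /IH ->]; rewrite andbT.
by rewrite -dmap_inv (inj_eq dmap_inj).
Qed.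

Lemma rcons_map d w : map dmap (rcons_ d w) = rcons_ (dmap d) (map dmap w).
Proof.
case: w => //= e w; rewrite -dmap_inv (inj_eq dmap_inj).
by case: ifP.
Qed.

Definition relabel_ (u : rword) : rword := exist _ (map dmap (sval u)) (reduced_map (valP u)).
End relabel.

Lemma relabel_K (s : bij X) : cancel (relabel_ s) (relabel_ s^-1).
Proof.
move=> u; apply: rword_eq; rewrite /= -map_comp -[RHS]map_id; apply: eq_map => -[x b].
by congr pair; exact: bfunK.
Qed.

Lemma relabel_VK (s : bij X) : cancel (relabel_ s^-1) (relabel_ s).
Proof.
move=> u; apply: rword_eq; rewrite /= -map_comp -[RHS]map_id; apply: eq_map => -[x b].
by congr pair; exact: bifunK.
Qed.

Definition relabel (s : bij X) : bij rword := Bij (relabel_K s) (relabel_VK s).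

Lemma relabel_hom : is_hom relabel.
Proof.
by move=> s t; apply: bij_eq => u; apply: rword_eq; rewrite /= -map_comp.
Qed.

(** The relation of a semidirect product: bijections of [X] act on the free group over [X] by
    permuting its generators. *)
Lemma relabel_push (s : bij X) d : relabel s * push d = push (dmap s d) * relabel s.
Proof. by apply: bij_eq => u; apply: rword_eq; rewrite !bijM /= rcons_map. Qed.

Lemma relabel_fix (s : bij X) d : s d.1 = d.1 -> relabel s * push d = push d * relabel s.
Proof. by move=> sd; rewrite relabel_push /dmap sd -surjective_pairing. Qed.

Lemma relabel_inj (s : bij X) : relabel s = 1 -> s = 1.
Proof.
move=> E; apply: bij_eq => x.
have := congr1 (fun b : bij rword => sval (b (exist _ [:: (x, false)] isT))) E.
by rewrite /= /dmap /= => -[].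
Qed.

End reduced_words.

(* [Q] is generated by two copies [i1 F] and [i2 F], glued along the subgroups
   [C i] by means of the elements [t i]. *)
Section doubling.
Variables (I : Type) (F Q : groupType) (X : eqType).
Variables (act : F -> bij X) (o : I -> X) (C : I -> F -> Prop).
Hypotheses (actM : is_hom act) (act_inj : forall f, act f = 1 -> f = 1).
Hypothesis stab : forall i j f, act f (o j) = o i -> i = j /\ C i f.
Variables (i1 i2 : F -> Q) (t : I -> Q).
Hypotheses (i1M : is_hom i1) (i2M : is_hom i2).
Hypothesis glue : forall i c, C i c -> t i * i2 c * (t i)^-1 = i1 c.

Definition mid i v j := t i * i2 v * (t j)^-1.

Hypothesis genQ : forall S : Q -> Prop, is_subgroup S -> (forall f, S (i1 f)) ->
  (forall i v j, S (mid i v j)) -> forall g, S g.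
Variable rho : Q -> bij (rword X).
Hypotheses (rhoM : is_hom rho) (rho1 : forall f, rho (i1 f) = relabel (act f)).
Hypothesis rho2 : forall i v j, rho (mid i v j) =
  push (o i, false) * relabel (act v) * (push (o j, false))^-1.

Definition syl : Type := (I * F * I * F)%type.

Fixpoint val_ (l : seq syl) : Q :=
  if l is (i, v, j, b) :: l' then mid i v j * i1 b * val_ l' else 1.

(** Alternation as in an amalgam, or in a graph of groups with two vertices and edges [I]: going to
    the other copy and coming back along the same edge must not happen within the glued subgroup of
    that edge. *)
Fixpoint nf (l : seq syl) : Prop :=
  if l is (i, v, j, b) :: l' then
    [/\ (i = j -> ~ C i v),
        (if l' is (i', _, _, _) :: _ then j = i' -> ~ C j b else True) & nf l']
  else True.

Definition NF (g : Q) := exists b l, nf l /\ g = i1 b * val_ l.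

Lemma NF_i1 f g : NF g -> NF (i1 f * g).
Proof. by move=> [b [l [nl ->]]]; exists (f * b), l; rewrite i1M mulgA. Qed.

Lemma NF_mid i v j g : NF g -> NF (mid i v j * g).
Proof.
move=> [b [l [nl gE]]].
have [[Cb [i' [v' [j' [b' [l' [lE ji]]]]]]]|nM] := pselect (C j b /\ exists i' v' j' b' l',
    l = (i', v', j', b') :: l' /\ j = i').
  have mE : mid i v j * g = mid i (v * b * v') j' * (i1 b' * val_ l').
    rewrite gE lE /= -(glue Cb) -ji /mid !i2M; by rewrite !gnorm.
  move: nl; rewrite lE /= => -[n1 n2 n3]; rewrite mE.
  have [[<- Cv]|nC] := pselect (i = j' /\ C i (v * b * v')).
    by rewrite [mid _ _ _]glue//; apply: NF_i1; exists b', l'.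
  exists 1, ((i, v * b * v', j', b') :: l'); rewrite (hom1 i1M) mul1g /= !mulgA; split=> //.
  by split=> // ij Cv; apply: nC.
have [[<- Cv]|nC] := pselect (i = j /\ C i v).
  by rewrite /mid glue// gE; apply: NF_i1; exists b, l.
exists 1, ((i, v, j, b) :: l); rewrite (hom1 i1M) mul1g /= gE !mulgA; split=> //.
split=> //; first by move=> ij Cv; apply: nC.
case: l nl gE nM => // -[[[i' v'] j'] b'] l nl gE nM ji Cb; apply: nM; split=> //.
by exists i', v', j', b', l.
Qed.

Lemma all_NF g : NF g.
Proof.
have H x : (forall y, NF y -> NF (x * y)) /\ (forall y, NF y -> NF (x^-1 * y)).
  apply: (genQ (S := fun x => (forall y, NF y -> NF (x * y)) /\ (forall y, NF y -> NF (x^-1 * y)))).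
  - split; first by split=> y; rewrite ?invg1 mul1g.
      move=> a b [a1 a2] [b1 b2]; split=> y hy; rewrite ?invgM -mulgA; first exact/a1/b1.
      exact/b2/a2.
    by move=> a [a1 a2]; split=> y; rewrite ?invgK; [exact: a2|exact: a1].
  - by move=> f; split=> y hy; rewrite -?(homV i1M); exact: NF_i1.
  - move=> i v j; split=> y hy; first exact: NF_mid.
    have -> : (mid i v j)^-1 = mid j v^-1 i by rewrite /mid !gnorm (homV i2M).
    exact: NF_mid.
have [h _] := H g; rewrite -[g]mulg1; apply: h.
by exists 1, [::]; rewrite (hom1 i1M) mulg1.
Qed.

Definition nil_word : rword X := exist _ [::] isT.

(** Applied to the empty word, a normal form leaves its first syllable visible. A cancellation
    between neighbouring pushes would put an intermediate element into a stabiliser, hence by [stab]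
    into a glued subgroup, contrary to [nf]. *)
Lemma rho_val l : nf l -> forall b, if l is (i, v, j, _) :: _ then
  exists w, sval (rho (i1 b * val_ l) nil_word) = (act b (o i), false) :: (act (b * v) (o j), true) :: w
  else sval (rho (i1 b * val_ l) nil_word) = [::].
Proof.
elim: l => [|[[[i v] j] b'] l IH] /=; first by move=> _ b; rewrite mulg1 rho1.
move=> [n1 n2 nl] b.
have stepE : rho (i1 b * (mid i v j * i1 b' * val_ l)) nil_word =
    relabel (act b) (push (o i, false) (relabel (act v) ((push (o j, false))^-1 (rho (i1 b' * val_ l) nil_word)))).
  by rewrite rhoM -[mid i v j * i1 b' * val_ l]mulgA (rhoM (mid i v j)) rho1 rho2 !bijM.
have pE : exists w, sval ((push (o j, false))^-1 (rho (i1 b' * val_ l) nil_word)) = (o j, true) :: w.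
  move: (IH nl b') n2; case: (l) => [E _|[[[i' v'] j'] b''] l' [w E] n2].
    by rewrite pushVE E /=; exists [::].
  rewrite pushVE E /= ifN; first by eexists.
  apply/eqP; rewrite /dinv /= => -[h].
  by have [h1 h2] := stab h; apply: n2.
case: pE => w pE; exists (map (dmap (act b)) (map (dmap (act v)) w)).
rewrite stepE; move: ((push (o j, false))^-1 _) pE => z pE.
rewrite /= pE /= ifN; first by rewrite /dmap /= actM bijM.
apply/eqP; rewrite /dinv /dmap /= => -[h].
by have [h1 h2] := stab h; apply: n1.
Qed.

Theorem doubling_injective : injective rho.
Proof.
apply: hom_inj => // g; have [b [l [nl ->]]] := all_NF g => r1.
case: l nl r1 => [|[[[i v] j] b'] l] nl r1.
  by move: r1; rewrite /= mulg1 rho1 => /relabel_inj/act_inj ->; rewrite (hom1 i1M).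
by have [w] := rho_val nl b; rewrite r1.
Qed.

End doubling.

(** * A diagram group generated by overlapping loops *)

Section overlapping_loops.
Local Notation p := (pair 0%N : nat -> nat * nat).
Local Notation q := (pair 1%N : nat -> nat * nat).
Local Notation r := (pair 2%N : nat -> nat * nat).

Definition chain_rel (u v : seq (nat * nat)) := exists i,
  [\/ u = [:: p i; p i.+1] /\ v = [:: q i], u = [:: q i] /\ v = [:: r i] |
      u = [:: r i] /\ v = [:: p i; p i.+1]].

Lemma chain_rel_lhs u v : chain_rel u v -> u <> [::].
Proof. by move=> [i [] [-> _]]. Qed.

Lemma chain_rel_rhs u v : chain_rel u v -> v <> [::].
Proof. by move=> [i [] [_ ->]]. Qed.

Lemma chain_rel_asym u v : chain_rel u v -> ~ chain_rel v u.
Proof. by move=> [i [] [-> ->]] [j [] [] // []]. Qed.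

(* The loop [p_i p_(i+1) -> q_i -> r_i -> p_i p_(i+1)] for each [i]; the loops
   [i] and [j] are disjoint, hence commute, as soon as [i + 1 < j]. *)
Definition chain_presentation :=
  SemigroupPresentation chain_rel_lhs chain_rel_rhs chain_rel_asym.
Local Notation P := chain_presentation.
Local Notation edge := (squier_edge P).

Definition chain_word (m n : nat) : seq P := [seq p i | i <- iota m n].
Definition cloop i : seq edge := [:: @SquierEdge P [::] [:: p i; p i.+1] [:: q i] [::];
  @SquierEdge P [::] [:: q i] [:: r i] [::]; @SquierEdge P [::] [:: r i] [:: p i; p i.+1] [::]].

Lemma cloop_path i : is_edge_path (chain_word i 2) (cloop i) (chain_word i 2).
Proof.
rewrite /cloop /=; split=> //; first by left; exists i; constructor 1.
split=> //; first by left; exists i; constructor 2.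
by split=> //; left; exists i; constructor 3.
Qed.

Lemma seg_cat m n k : chain_word m (n + k) = chain_word m n ++ chain_word (m + n) k.
Proof. by rewrite /chain_word iotaD map_cat. Qed.

Variable N : nat.
Local Notation w := (chain_word 0 N).

Definition cgen i : diagram_group_of w := dcl w (ext (chain_word 0 i) (chain_word i.+2 (N - i.+2)) (cloop i)).

Lemma seg_split i : (i.+1 < N)%N -> w = chain_word 0 i ++ chain_word i 2 ++ chain_word i.+2 (N - i.+2).
Proof.
move=> iN; rewrite -{1}(subnKC iN) -addn2 seg_cat seg_cat -catA !add0n addn2 //.
Qed.

Lemma cgen_path i : (i.+1 < N)%N ->
  is_edge_path w (ext (chain_word 0 i) (chain_word i.+2 (N - i.+2)) (cloop i)) w.
Proof.
move=> iN; rewrite {1}(seg_split iN) [X in is_edge_path _ _ X](seg_split iN).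
by apply: ext_path; exact: cloop_path.
Qed.

Lemma cgenC i j : (i.+1 < j)%N -> (j.+1 < N)%N -> cgen i * cgen j = cgen j * cgen i.
Proof.
move=> ij jN; have iN : (i.+1 < N)%N by lia.
have [k jE] : exists k, j = (i.+2 + k)%N by exists (j - i.+2)%N; lia.
have := disjoint_commute (chain_word 0 i) (chain_word i.+2 k) (chain_word j.+2 (N - j.+2)) (cloop_path i) (cloop_path j).
have E1 : chain_word i.+2 k ++ chain_word j 2 ++ chain_word j.+2 (N - j.+2) = chain_word i.+2 (N - i.+2).
  rewrite jE catA -seg_cat; have -> : (i.+2 + k).+2 = (i.+2 + (k + 2))%N by lia.
  by rewrite -seg_cat; congr chain_word; lia.
have E2 : chain_word 0 i ++ chain_word i 2 ++ chain_word i.+2 k = chain_word 0 j.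
  by rewrite jE -[in chain_word i.+2 _](addn2 i) -seg_cat -{2}[i]add0n -seg_cat; congr chain_word; lia.
rewrite E1 E2 -(seg_split iN) => h.
by rewrite -!dclM; try (exact: cgen_path); apply/dcl_eq => //; apply/is_edge_path_cat; exists w; exact: cgen_path.
Qed.

Section universal.
Variables (H : groupType) (h : nat -> H).
Hypothesis hC : forall i j, (i.+1 < j)%N -> (j.+1 < N)%N -> h i * h j = h j * h i.

(** Only the third edge of the loop [i] is counted; the other two edges have trivial label, so
    [cgen i] goes to [h i]. *)
Definition clab (e : edge) : H := match edge_src e, edge_tgt e with
  | [:: (2%N, i)], [:: _; _] => h i
  | [:: _; _], [:: (2%N, i)] => (h i)^-1
  | _, _ => 1 end.

(** Replacing [q i] and [r i] by the indices of the two letters they come from gives an invariant of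
    connected words, here the list $0,\dots,N-1$. So disjoint edges of the loops [i] and [j], in
    this order, satisfy $i+1<j$, and only such labels have to commute. *)
Definition expand (u : seq P) : seq nat :=
  flatten [seq (if l.1 == 0%N then [:: l.2] else [:: l.2; l.2.+1]) | l <- u].

Lemma expand_cat u v : expand (u ++ v) = expand u ++ expand v.
Proof. by rewrite /expand map_cat flatten_cat. Qed.

Lemma expand_edge (e : edge) : is_squier_edge e -> expand (edge_start e) = expand (edge_end e).
Proof.
rewrite /edge_start /edge_end !expand_cat => he; congr (_ ++ (_ ++ _)).
by case: he => -[i [] [-> ->]].
Qed.

Lemma expand_reach z : reach w z -> expand z = iota 0 N.
Proof.
move=> [l]; have : expand w = iota 0 N by rewrite /w /chain_word /expand -map_comp; elim: iota => //= i s ->.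
elim: l w => [|e l IH] y /= yE; first by move=> <-.
by move=> [he ye]; apply: IH; rewrite -expand_edge// -ye.
Qed.

Lemma clab_inv (e : edge) : is_squier_edge e -> clab (edge_inv e) = (clab e)^-1.
Proof. by rewrite /clab /= => -[] [i [] [-> ->]]; rewrite ?invg1 ?invgK. Qed.

Lemma clab_cases (e : edge) : is_squier_edge e ->
  clab e = 1 \/ exists i, expand (edge_src e) = [:: i; i.+1] /\ (clab e = h i \/ clab e = (h i)^-1).
Proof.
rewrite /clab => -[] [i [] [E1 E2]]; rewrite E1 ?E2 /=; try (by left); right; exists i; split=> //;
  by [left|right].
Qed.

Lemma cgen_hom : exists f : diagram_group_of w -> H, is_hom f /\
  forall i, (i.+1 < N)%N -> f (cgen i) = h i.
Proof.
have [||f [fM fE]] := @label_hom P w H clab.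
- by move=> e he _; exact: clab_inv.
- move=> a u v b s t c h1 h2 /expand_reach.
  set e1 := SquierEdge _ _ _ _ in h1 *; set e2 := SquierEdge _ _ _ _ in h2 *.
  have -> : clab (SquierEdge (a ++ v ++ b) s t c) = clab e2 by [].
  have -> : clab (SquierEdge a u v (b ++ t ++ c)) = clab e1 by [].
  case: (clab_cases h1) => [->|[i [Ei ci]]]; first by rewrite mul1g mulg1.
  case: (clab_cases h2) => [->|[j [Ej cj]]]; first by rewrite mul1g mulg1.
  rewrite !expand_cat Ei Ej => E.
  have so : sorted ltn (iota 0 N) := iota_ltn_sorted 0 N.
  have /= ij : (i.+1 < j)%N.
    move: so; rewrite -E => /(subseq_sorted ltn_trans) so.
    have := so [:: i.+1; j]; rewrite /= andbT; apply.
    apply: (@subseq_trans _ ([:: i.+1] ++ expand b ++ [:: j])).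
      by rewrite /= eqxx -[[:: j]]cat0s; apply: cat_subseq => //; exact: sub0seq.
    apply: subseq_trans (suffix_subseq (expand a) _).
    apply: subseq_trans (subseq_cons _ i); rewrite /= eqxx.
    by apply: cat_subseq; rewrite //= eqxx; case: (expand c).
  have jN : (j.+1 < N)%N.
    have : j.+1 \in iota 0 N by rewrite -E !(mem_cat, inE) eqxx !orbT.
    by rewrite mem_iota.
  have hij : commute (h i) (h j) by exact: hC.
  have main : commute (clab e1) (clab e2).
    have hVj : commute (h i)^-1 (h j) by apply/commute_sym/commuteV/commute_sym.
    by case: ci => ->; case: cj => ->; [|exact: commuteV| |exact: commuteV].
  exact: main.
exists f; split=> // i iN; rewrite /cgen fE; last exact: cgen_path.
by rewrite /plab !big_cons big_nil /clab /= !mulg1 !mul1g.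
Qed.

End universal.
End overlapping_loops.

(** A word of eight letters has seven pairs of neighbours, which give the generators
    $x_0,\dots,x_6$. *)
Lemma chain_group : exists (D : groupType) (x : nat -> D), [/\ is_diagram_group D,
  forall i j, (i.+1 < j)%N -> (j < 7)%N -> x i * x j = x j * x i &
  forall (H : groupType) (h : nat -> H),
    (forall i j, (i.+1 < j)%N -> (j < 7)%N -> h i * h j = h j * h i) ->
    exists f : D -> H, is_hom f /\ forall i, (i < 7)%N -> f (x i) = h i].
Proof.
exists (diagram_group_of (chain_word 0 8)), (@cgen 8); split.
- exists chain_presentation, (chain_word 0 8); split=> //; exists id; split; last by exists id.
  by split.
- by move=> i j ij j7; exact: cgenC.
- move=> H h hC; have [|f [fM fE]] := @cgen_hom 8 H h; first by move=> i j ij jN; exact: hC.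
  by exists f; split=> // i i7; exact: fE.
Qed.

Local Close Scope group_scope.
Local Open Scope classical_set_scope.
Local Open Scope group_scope.

(** * The free group of rank two and subsets of groups *)

Definition F2 : groupType := pres ([::] : seq (dart bool)).
Definition fA : F2 := pgen [::] false.
Definition fB : F2 := pgen [::] true.

Lemma F2_map (H : groupType) (x y : H) : exists f : F2 -> H, [/\ is_hom f, f fA = x & f fB = y].
Proof.
have [_ h _] := pres_presents ([::] : seq (dart bool)).
have [f [fM fE]] := h H (fun b => if b then y else x) erefl.
by exists f; split=> //; [exact: (fE false)|exact: (fE true)].
Qed.

Lemma F2_word (g : F2) : exists u, g = ev (@pgen bool [::]) u.
Proof. exact: pword_surj. Qed.

Lemma F2_ind (S : F2 -> Prop) : is_subgroup S -> S fA -> S fB -> forall g, S g.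
Proof.
move=> Ss SA SB g; have [u ->] := F2_word g; apply: ev_subgroup => // -[] _ //.
Qed.

Lemma hom_subgroup (G H : groupType) (f f' : G -> H) : is_hom f -> is_hom f' ->
  is_subgroup (fun g => f g = f' g).
Proof.
move=> fM fM'; split; first by rewrite !hom1.
  by move=> x y E E'; rewrite fM fM' E E'.
by move=> x E; rewrite !homV// E.
Qed.

Lemma F2_eq (H : groupType) (f f' : F2 -> H) : is_hom f -> is_hom f' ->
  f fA = f' fA -> f fB = f' fB -> f =1 f'.
Proof. by move=> fM fM' EA EB g; exact: (F2_ind (hom_subgroup fM fM')). Qed.

Section translations.
Variable G : groupType.

(** Cosets are handled as subsets, with translation as the action; the stabiliser of a subgroup is
    then the subgroup itself, and no quotient has to be formed. *)
Definition shift_ (g : G) (S : set G) : set G := [set x | S (g^-1 * x)].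

Lemma shift_K g : cancel (shift_ g) (shift_ g^-1).
Proof. by move=> S; apply/funext => x; rewrite /shift_ /= invgK mulKg. Qed.

Lemma shift_VK g : cancel (shift_ g^-1) (shift_ g).
Proof. by move=> S; apply/funext => x; rewrite /shift_ /= invgK mulVKg. Qed.

Definition shift g : bij (set G) := Bij (shift_K g) (shift_VK g).

Lemma shiftE g S x : shift g S x = S (g^-1 * x). Proof. by []. Qed.

Lemma shift_hom : is_hom shift.
Proof.
move=> g h; apply: bij_eq => S; apply/funext => x.
by rewrite bijM !shiftE invgM mulgA.
Qed.

Lemma shift_fix g (S : set G) : is_subgroup S -> S g -> shift g S = S.
Proof.
move=> [S1 SM SV] Sg; apply/funext => x; rewrite shiftE; apply/propext; split=> h.
  by rewrite -(mulVKg g x); exact: SM.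
by apply: (SM) => //; exact: SV.
Qed.

Lemma shift_stab g (S : set G) : is_subgroup S -> shift g S = S -> S g.
Proof.
move=> [S1 SM SV] E; have : shift g S g by rewrite shiftE mulVg.
by rewrite E.
Qed.

Lemma shift_inj g : shift g = 1 -> g = 1.
Proof.
move=> E; have : shift g [set 1] g by rewrite shiftE mulVg.
by rewrite E.
Qed.

Definition gen1 (g : G) : set G := [set x | forall S : set G, is_subgroup S -> S g -> S x].

Lemma gen1_subgroup g : is_subgroup (gen1 g).
Proof.
split=> [S [] //|x y hx hy S Ss Sg|x hx S Ss Sg]; have [S1 SM SV] := Ss.
  by apply: SM; [exact: hx|exact: hy].
by apply: SV; exact: hx.
Qed.

Lemma gen1_mem g : gen1 g g. Proof. by move=> S. Qed.

End translations.

Section bijections.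
Variables Y Z : Type.

Definition bl_ (b : bij Y) (t : Y * Z) := (b t.1, t.2).
Lemma bl_K b : cancel (bl_ b) (bl_ b^-1).
Proof. by move=> [y z]; rewrite /bl_ /= bfunK. Qed.
Lemma bl_VK b : cancel (bl_ b^-1) (bl_ b).
Proof. by move=> [y z]; rewrite /bl_ /= bifunK. Qed.
Definition bl (b : bij Y) : bij (Y * Z) := Bij (bl_K b) (bl_VK b).

Definition br_ (b : bij Z) (t : Y * Z) := (t.1, b t.2).
Lemma br_K b : cancel (br_ b) (br_ b^-1).
Proof. by move=> [y z]; rewrite /br_ /= bfunK. Qed.
Lemma br_VK b : cancel (br_ b^-1) (br_ b).
Proof. by move=> [y z]; rewrite /br_ /= bifunK. Qed.
Definition br (b : bij Z) : bij (Y * Z) := Bij (br_K b) (br_VK b).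

Lemma bl_hom : is_hom bl. Proof. by move=> b c; exact: bij_eq. Qed.
Lemma br_hom : is_hom br. Proof. by move=> b c; exact: bij_eq. Qed.
Lemma blr b c : bl b * br c = br c * bl b. Proof. exact: bij_eq. Qed.

End bijections.

Section fibre.
Variable Z : Type.
Definition bf_ (c : bool) (b : bij Z) (t : bool * Z) := (t.1, if t.1 == c then b t.2 else t.2).
Lemma bf_K c b : cancel (bf_ c b) (bf_ c b^-1).
Proof. by move=> [y z]; rewrite /bf_ /=; case: eqP => //= _; rewrite bfunK. Qed.
Lemma bf_VK c b : cancel (bf_ c b^-1) (bf_ c b).
Proof. by move=> [y z]; rewrite /bf_ /=; case: eqP => //= _; rewrite bifunK. Qed.
Definition bf c (b : bij Z) : bij (bool * Z) := Bij (bf_K c b) (bf_VK c b).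
Lemma bf_hom c : is_hom (bf c).
Proof. by move=> b b'; apply: bij_eq => -[y z]; rewrite !bijM /= /bf_ /=; case: eqP. Qed.
Lemma bfC c b b' : bf c b * bf (~~ c) b' = bf (~~ c) b' * bf c b.
Proof. by apply: bij_eq => -[y z]; rewrite !bijM /= /bf_ /=; case: y; case: c. Qed.
End fibre.

Section transposition.
Variables (Y : eqType) (a b : Y).
Definition swp_ (t : Y) := if t == a then b else if t == b then a else t.
Lemma swp_K : cancel swp_ swp_.
Proof.
move=> t; rewrite /swp_; have [->|ta] := eqVneq t a.
  by rewrite eqxx; case: eqP.
have [->|tb] := eqVneq t b; first by rewrite eqxx.
by rewrite (negPf ta) (negPf tb).
Qed.
Definition swp : bij Y := Bij swp_K swp_K.
Lemma swp2 : swp * swp = 1.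
Proof. by apply: bij_eq => t; rewrite bijM /= swp_K. Qed.
Lemma swpL : swp a = b. Proof. by rewrite /= /swp_ eqxx. Qed.
Lemma swpC (s : bij Y) : s a = a -> s b = b -> swp * s = s * swp.
Proof.
move=> sa sb; apply: bij_eq => t; rewrite !bijM /= /swp_.
have E c : s c = c -> (s t == c) = (t == c).
  by move=> sc; rewrite -{1}sc (inj_eq (can_inj (bfunK s))).
by rewrite !E//; case: eqP => [_|_]; [rewrite sb|case: eqP => // _; rewrite sa].
Qed.
End transposition.

(* The automaton with two states in which the letter [l] loops, and the other
   letter leads from [false] to [true]. *)
Section automaton.
Variable l : bool.
Local Notation dart := (dart bool).

Fixpoint rd (s : bool) (u : seq dart) : option bool :=
  if u is d :: u' then
    (if d.1 == l then rd s u' else if s == d.2 then rd (~~ s) u' else None)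
  else Some s.

Lemma rd_cat s u v : rd s (u ++ v) = if rd s u is Some t then rd t v else None.
Proof. by elim: u s => //= d u IH s; case: ifP => // _; case: ifP. Qed.

Lemma rd_winv s u t : rd s u = Some t -> rd t (winv u) = Some s.
Proof.
elim: u s => [|d u IH] s /=; first by case=> ->.
rewrite winv_cons rd_cat; case: (boolP (d.1 == l)) => dl; first by move=> /IH ->; rewrite /= dl.
case: eqP => // sd /IH ->; rewrite /= (negPf dl) sd eqxx.
by case: (d.2).
Qed.

Lemma rd_rcons s d u t : rd s (d :: u) = Some t -> rd s (rcons_ d u) = Some t.
Proof.
case: u => // e u; rewrite /rcons_; case: eqP => // -> /=.
by case: (d.1 == l) => //; case: (d.2); case: s.
Qed.

Definition reduce (u : seq dart) := foldr (@rcons_ bool) [::] u.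

Lemma rd_reduce s u t : rd s u = Some t -> rd s (reduce u) = Some t.
Proof.
elim: u s => // d u IH s h; apply: rd_rcons; move: h => /=.
by case: ifP => _; [exact: IH|case: ifP => // _; exact: IH].
Qed.

(** The fundamental group of the graph of the automaton at the state [false], that is, the subgroup
    generated by the letter [l] and its conjugate by the other letter. *)
Definition accepted : set F2 := [set g | exists2 u, g = ev (@pgen bool [::]) u & rd false u = Some false].

Lemma accepted_subgroup : is_subgroup accepted.
Proof.
split; first by exists [::].
  by move=> _ _ [u -> hu] [v -> hv]; exists (u ++ v); rewrite ?ev_cat// rd_cat hu.
by move=> _ [u -> hu]; exists (winv u); [rewrite ev_winv|exact: rd_winv].
Qed.

Definition loopg : F2 := if l then fB else fA.
Definition moveg : F2 := if l then fA else fB.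

Lemma accepted_loop : accepted loopg.
Proof. by exists [:: (l, false)]; rewrite ?ev1 /= ?eqxx// /loopg; case: l. Qed.

Lemma accepted_conj : accepted (moveg * loopg * moveg^-1).
Proof.
exists [:: (~~ l, false); (l, false); (~~ l, true)].
  by rewrite !ev_cons /= /evd /= mulg1 mulgA /moveg /loopg; case: l.
by rewrite /= !eqxx; case: l.
Qed.

End automaton.

Lemma reduced_reduce u : reduced (reduce u).
Proof. by elim: u => // d u IH; exact: reduced_rcons. Qed.

Lemma ev_reduce (H : groupType) (h : bool -> H) u : ev h (reduce u) = ev h u.
Proof.
elim: u => //= d u <-; case: (reduce u) => // e v; rewrite /rcons_; case: eqP => // ->.
by rewrite /= evd_inv mulVKg.
Qed.

(** Uniqueness of reduced words: the reduced form is the image of the empty word under the action of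
    the group element. *)
Lemma reduce_eq u v : ev (@pgen bool [::]) u = ev (@pgen bool [::]) v -> reduce u = reduce v.
Proof.
pose h (b : bool) := push (b, false).
have hE w : sval (ev h w (nil_word bool)) = reduce w.
  elim: w => // -[b c] w IH; rewrite /reduce /= -/(reduce w) -IH.
  by case: c; rewrite /evd /= -?IH.
move=> E; rewrite -!hE; have [f [fM fA' fB']] := F2_map (h false) (h true).
have fE w : f (ev (@pgen bool [::]) w) = ev h w by rewrite ev_hom//; apply: eq_ev => -[].
by rewrite -!fE E.
Qed.

(** One automaton forces the occurrences of [fB] and its inverse to alternate, the other one those
    of [fA]. A reduced word obeying both falls into blocks of four letters, each block being the
    commutator or its inverse; the blocks are stripped one by one. *)
Lemma accepted_both g : accepted false g -> accepted true g -> gen1 (fA * fB * fA^-1 * fB^-1) g.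
Proof.
move=> [u -> hu] [v Ev hv]; rewrite -ev_reduce.
have := rd_reduce hu; have := rd_reduce hv; rewrite -(reduce_eq Ev).
have := reduced_reduce u; move: (reduce u) => {u v Ev hu hv} w.
move: {2}(size w) (leqnn (size w)) => m; elim: m w => [|m IH] w.
  by case: w => // _ _ _ _ S [].
have [S1 SM SV] := gen1_subgroup (fA * fB * fA^-1 * fB^-1).
have cA (b : bool) : gen1 (fA * fB * fA^-1 * fB^-1) (if b then fB * fA * fB^-1 * fA^-1 else fA * fB * fA^-1 * fB^-1).
  case: b; last exact: gen1_mem.
  have -> : fB * fA * fB^-1 * fA^-1 = (fA * fB * fA^-1 * fB^-1)^-1 by rewrite !gnorm.
  by apply: SV; exact: gen1_mem.
case: w => [|[[] []] [|[[] []] [|[[] []] [|[[] []] w]]]] //= sw.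
all: try by move=> *; exact: S1.
all: rewrite /evd /= ?andbT => rw r1 r2; try discriminate.
all: have {}rw : reduced w by case: (w) rw => //= ? ?; do ?case/andP => ? //; move=> *; repeat match goal with H : is_true (_ && _) |- _ => case/andP: H => * end.
all: have {}IH := IH w _ rw r1 r2.
- have -> : fB * (fA * (fB^-1 * (fA^-1 * ev (@pgen bool [::]) w))) = (fB * fA * fB^-1 * fA^-1) * ev (@pgen bool [::]) w by rewrite !mulgA.
  by apply: SM; [exact: (cA true)|apply: IH; exact: ltnW (ltnW (ltnW sw))].
- have -> : fA * (fB * (fA^-1 * (fB^-1 * ev (@pgen bool [::]) w))) = (fA * fB * fA^-1 * fB^-1) * ev (@pgen bool [::]) w by rewrite !mulgA.
  by apply: SM; [exact: (cA false)|apply: IH; exact: ltnW (ltnW (ltnW sw))].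
Qed.

Lemma commuteVl (D : groupType) (x y : D) : commute x y -> commute x^-1 y.
Proof. by move=> h; apply/commute_sym/commuteV/commute_sym. Qed.

Lemma commuteMl (D : groupType) (x y z : D) : commute x z -> commute y z -> commute (x * y) z.
Proof. by move=> hx hy; apply/commute_sym/commuteM; exact: commute_sym. Qed.

Lemma commute_commutator (D : groupType) (x y p m : D) :
  commute p m -> commute p x -> commute y x -> commute y m ->
  x * p * (m * y) * (x * p)^-1 * (m * y)^-1 = (x * m * x^-1 * m^-1) * (p * y * p^-1 * y^-1).
Proof.
move=> pm px yx ym.
have h1 : commute x^-1 (p * y * p^-1).
  apply: commuteVl; apply: commuteM; first by apply: commuteM; exact: commute_sym.
  by apply/commuteV/commute_sym.
have h2 : commute (p * y * p^-1 * y^-1) m^-1.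
  apply: commuteV; apply: commuteMl; last exact: commuteVl.
  by apply: commuteMl; [exact: commuteMl|exact: commuteVl].
have -> : x * p * (m * y) * (x * p)^-1 * (m * y)^-1 = x * (p * m) * (y * p^-1 * x^-1 * y^-1 * m^-1).
  by rewrite !gnorm.
rewrite pm.
have -> : x * (m * p) * (y * p^-1 * x^-1 * y^-1 * m^-1) = x * m * ((p * y * p^-1) * x^-1) * y^-1 * m^-1.
  by rewrite !gnorm.
rewrite -h1.
have -> : x * m * (x^-1 * (p * y * p^-1)) * y^-1 * m^-1 = x * m * x^-1 * (p * y * p^-1 * y^-1 * m^-1).
  by rewrite !gnorm.
by rewrite h2 !mulgA.
Qed.

Lemma commutator_right (D : groupType) (x y p : D) : commute p x ->
  x * (y * p) * x^-1 * (y * p)^-1 = x * y * x^-1 * y^-1.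
Proof.
move=> px; have : commute p x^-1 by exact: commuteV.
rewrite invgM => h.
have -> : x * (y * p) * x^-1 * (p^-1 * y^-1) = x * y * (p * x^-1) * p^-1 * y^-1 by rewrite !mulgA.
by rewrite h !gnorm.
Qed.

Lemma commutator_left (D : groupType) (x y p : D) : commute p y ->
  x * p * y * (x * p)^-1 * y^-1 = x * y * x^-1 * y^-1.
Proof.
move=> py; have -> : x * p * y * (x * p)^-1 * y^-1 = x * (p * y) * p^-1 * x^-1 * y^-1 by rewrite !gnorm.
by rewrite py !gnorm.
Qed.

(** * The orientable case *)

Section orientable.
Variable Q : groupType.
Hypothesis presQ : surface_presented true 1 Q.
Local Notation Y := (set F2).
Local Notation X := (Y * Y)%type.

Let SL := accepted false.
Let SR := accepted true.
Let tauL : bij Y := swp SL (shift fB^-1 SL).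
Let tauR : bij Y := swp SR (shift fA^-1 SR).
Let rl (b : bij Y) : bij (rword X) := relabel (bl Y b).
Let rr (b : bij Y) : bij (rword X) := relabel (br Y b).

(** The outer generators act on the two factors of [X] separately. To commute with the push, [x 1]
    must fix [SL]: the transposition [tauL] sends [SL] to its translate and [fB] brings it back.
    Multiplying by [x 2] removes [tauL] again, and similarly on the right. What remains is the
    diagonal action of [F2], where the stabiliser of [(SL, SR)] is generated by the commutator
    ([accepted_both]). *)
Definition or_rep (i : nat) : bij (rword X) := nth 1
  [:: rl (shift fA); rl (shift fB * tauL); rl tauL; push ((SL, SR), false);
      rr tauR; rr (shift fA * tauR); rr (shift fB)] i.

Let rl_hom : is_hom rl. Proof. exact: hom_comp (@bl_hom Y Y) (@relabel_hom X). Qed.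
Let rr_hom : is_hom rr. Proof. exact: hom_comp (@br_hom Y Y) (@relabel_hom X). Qed.

Let rlr b c : commute (rl b) (rr c).
Proof. by rewrite /commute /rl /rr -!(@relabel_hom X) blr. Qed.

Let AL : shift fA SL = SL.
Proof. apply: shift_fix; [exact: accepted_subgroup|exact: (accepted_loop false)]. Qed.
Let BR : shift fB SR = SR.
Proof. apply: shift_fix; [exact: accepted_subgroup|exact: (accepted_loop true)]. Qed.

Let shiftM (g h : F2) (S : Y) : shift g (shift h S) = shift (g * h) S.
Proof. by rewrite shift_hom bijM. Qed.

Let AL' : shift fA (shift fB^-1 SL) = shift fB^-1 SL.
Proof.
rewrite shiftM; have -> : fA * fB^-1 = fB^-1 * (fB * fA * fB^-1) by rewrite !gnorm.
rewrite -shiftM; congr (shift _ _).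
by apply: shift_fix; [exact: accepted_subgroup|exact: (accepted_conj false)].
Qed.
Let BR' : shift fB (shift fA^-1 SR) = shift fA^-1 SR.
Proof.
rewrite shiftM; have -> : fB * fA^-1 = fA^-1 * (fA * fB * fA^-1) by rewrite !gnorm.
rewrite -shiftM; congr (shift _ _).
by apply: shift_fix; [exact: accepted_subgroup|exact: (accepted_conj true)].
Qed.

Let tauLA : commute tauL (shift fA). Proof. exact: (swpC AL AL'). Qed.
Let tauRB : commute tauR (shift fB). Proof. exact: (swpC BR BR'). Qed.

Lemma or_repC i j : (i.+1 < j)%N -> (j < 7)%N -> or_rep i * or_rep j = or_rep j * or_rep i.
Proof.
have pl (b : bij Y) : b SL = SL -> commute (rl b) (push ((SL, SR), false)).
  by move=> bS; apply: relabel_fix; rewrite /= /bl_ /= bS.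
have pr (b : bij Y) : b SR = SR -> commute (rr b) (push ((SL, SR), false)).
  by move=> bS; apply: relabel_fix; rewrite /= /br_ /= bS.
have BtL : (shift fB * tauL) SL = SL.
  by rewrite bijM swpL shiftM mulgV (hom1 (@shift_hom F2)).
have AtR : (shift fA * tauR) SR = SR.
  by rewrite bijM swpL shiftM mulgV (hom1 (@shift_hom F2)).
have ll (b c : bij Y) : commute b c -> commute (rl b) (rl c) by move=> h; rewrite /commute -!rl_hom h.
have rr' (b c : bij Y) : commute b c -> commute (rr b) (rr c) by move=> h; rewrite /commute -!rr_hom h.
case: i => [|[|[|[|[|[|[|i]]]]]]]; case: j => [|[|[|[|[|[|[|j]]]]]]] //= _ _; rewrite /or_rep /=;
  try exact: rlr.
- by apply: ll; exact: commute_sym.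
- exact: pl.
- exact: pl.
- by apply/commute_sym/pr.
- by apply/commute_sym/pr.
- exact: rr'.
Qed.

Theorem orientable_embeds (D : groupType) (x : nat -> D) :
  (forall i j, (i.+1 < j)%N -> (j < 7)%N -> x i * x j = x j * x i) ->
  (forall (H : groupType) (h : nat -> H),
    (forall i j, (i.+1 < j)%N -> (j < 7)%N -> h i * h j = h j * h i) ->
    exists f : D -> H, is_hom f /\ forall i, (i < 7)%N -> f (x i) = h i) ->
  group_embeds Q D.
Proof.
move=> xC xU; have [al [be [ga' [de' [rel qmap qgen]]]]] := presQ.
pose ga := ga' 0%N; pose de := de' 0%N.
rewrite /srel big_nat1 -/ga -/de /kap in rel.
(* The commutator of [a] and [b] is that of [x 0] and [x 1] times that of [x 5] and [x 6], so it
   commutes with [z]. The factors [x 4] in [a] and [x 2] in [b] drop out of it; they stand for the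
   neighbours of [z], with which [z] does not commute. *)
pose a := x 0%N * (x 5 * x 4); pose b := x 1%N * x 2 * x 6; pose z := x 3.
have abE : a * b * a^-1 * b^-1 = (x 0%N * x 1%N * (x 0%N)^-1 * (x 1%N)^-1) * (x 5 * x 6 * (x 5)^-1 * (x 6)^-1).
  rewrite commute_commutator; [|by do !apply: commuteM; apply: commuteMl; apply: commute_sym; exact: xC|
    by apply: commuteMl; apply: commute_sym; exact: xC|by apply: commute_sym; exact: xC|
    by apply: commuteM; apply: commute_sym; exact: xC].
  congr (_ * _); first by apply: commutator_right; apply: commute_sym; exact: xC.
  by apply: commutator_left; exact: xC.
have zab : commute z (a * b * a^-1 * b^-1).
  rewrite abE; do !apply: commuteM; do ?apply: commuteV; first [by apply: commute_sym; exact: xC|by exact: xC].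
have drel : srel true 1 a b (fun=> z * b * z^-1) (fun=> z * a * z^-1) = 1.
  rewrite /srel big_nat1 /kap.
  have -> : z * b * z^-1 * (z * a * z^-1) * (z * b * z^-1)^-1 * (z * a * z^-1)^-1 =
      z * (a * b * a^-1 * b^-1)^-1 * z^-1 by rewrite !gnorm.
  by rewrite (commuteV zab) !gnorm.
have [th [thM tha thb thuv]] := qmap _ _ _ _ _ drel; exists th; split; first by split=> //; exact: hom1.
have [tga tde] := thuv 0%N isT.
have [rep [repM repE]] := xU _ or_rep or_repC.
suff inj : injective (rep \o th) by move=> u v E; apply: inj; rewrite /= E.
(* The second copy sends [fA] to [de] and [fB] to [ga], in this order, so that by the relation both
   copies of the commutator coincide. *)
have [i1 [i1M i1A i1B]] := F2_map al be; have [i2 [i2M i2A i2B]] := F2_map de ga.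
pose act (f : F2) : bij X := bl Y (shift f) * br Y (shift f).
have actM : is_hom act.
  move=> f g; rewrite /act !shift_hom bl_hom br_hom !mulgA; congr (_ * _).
  by rewrite -!mulgA; congr (_ * _); rewrite blr.
have rt2 (u : bij Y) t : t * t = 1 -> u * t * t = u by move=> tt; rewrite -mulgA tt mulg1.
have repa : rep a = relabel (act fA).
  rewrite /a !repM !repE// /or_rep /= /act (@relabel_hom X); congr (_ * _).
  by rewrite -/(rr _) -rr_hom rt2// swp2.
have repb : rep b = relabel (act fB).
  rewrite /b !repM !repE// /or_rep /= /act (@relabel_hom X); congr (_ * _).
  by rewrite -/(rl _) -rl_hom rt2// swp2.
have repz : rep z = push ((SL, SR), false) by rewrite /z repE.
have rconj u : rep (z * u * z^-1) = rep z * rep u * (rep z)^-1 by rewrite 2!repM (homV repM).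
have rho1 f : (rep \o th) (i1 f) = relabel (act f).
  have := @F2_eq _ ((rep \o th) \o i1) (@relabel X \o act); apply.
  - by do 2?apply: hom_comp.
  - by apply: hom_comp => //; exact: relabel_hom.
  - by rewrite /= i1A tha repa.
  - by rewrite /= i1B thb repb.
have rho2 f : (rep \o th) (i2 f) = rep z * relabel (act f) * (rep z)^-1.
  have := @F2_eq _ ((rep \o th) \o i2) (fun f => rep z * relabel (act f) * (rep z)^-1); apply.
  - by do 2?apply: hom_comp.
  - by move=> g h; rewrite actM (@relabel_hom X) !gnorm.
  - by rewrite /= i2A tde rconj repa.
  - by rewrite /= i2B tga rconj repb.
pose C (_ : unit) (f : F2) := gen1 (fA * fB * fA^-1 * fB^-1) f.
apply: (@doubling_injective unit F2 Q X act (fun=> (SL, SR)) C actM _ _ i1 i2 (fun=> 1) i1M i2M).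
- move=> f E; apply: shift_inj; apply: bij_eq => S.
  by have := congr1 (fun s : bij X => (s (S, S)).1) E.
- move=> [] [] f /= [h1 h2]; split=> //.
  by apply: accepted_both; apply: shift_stab => //; exact: accepted_subgroup.
- move=> [] c Cc; rewrite mul1g invg1 mulg1.
  apply: (Cc (fun c => i2 c = i1 c)); first exact: hom_subgroup.
  rewrite !i1M !i2M !(homV i1M) !(homV i2M) i1A i1B i2A i2B.
  by rewrite -[LHS]mul1g -[X in X * _]rel !gnorm.
- move=> S Ss S1 S2; apply: qgen => //.
  + by rewrite -i1A.
  + by rewrite -i1B.
  + move=> [|//] _; rewrite -/ga -/de -i2A -i2B.
    have E v : i2 v = mid i2 (fun=> 1) tt v tt by rewrite /mid mul1g invg1 mulg1.
    by rewrite !E.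
- exact: hom_comp.
- exact: rho1.
- by move=> [] v []; rewrite /mid mul1g invg1 mulg1 rho2 repz.
Qed.

End orientable.

(** * The non-orientable case *)

Section nonorientable.
Variable Q : groupType.
Hypothesis presQ : surface_presented false 1 Q.
Local Notation Y := (set F2).
Local Notation X := (bool * Y)%type.

Let cb (i : bool) : F2 := if i then fA * fB * fB else fA.
Let o (i : bool) : X := (i, gen1 (cb i)).
Let rf (c : bool) (g : F2) : bij (rword X) := relabel (bf c (shift g)).

(** One fibre for each of the two glued cyclic subgroups, generated by $A$ over [false] and by
    $AB^2$ over [true]; the points [o i] are these subgroups. The list has six entries, so [x 6]
    acts trivially. *)
Definition nor_rep (i : nat) : bij (rword X) := nth 1
  [:: rf false fA; rf false fB; push (o false, false); push (o true, false);
      rf true fB; rf true (fA * fB * fB)] i.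

Let rf_hom c : is_hom (rf c).
Proof. exact: hom_comp (hom_comp (@shift_hom F2) (@bf_hom Y c)) (@relabel_hom X). Qed.

Lemma nor_repC i j : (i.+1 < j)%N -> (j < 7)%N -> nor_rep i * nor_rep j = nor_rep j * nor_rep i.
Proof.
have pl c g : gen1 (cb c) g -> commute (rf c g) (push (o c, false)).
  move=> h; apply: relabel_fix; rewrite /= /bf_ /= eqxx; congr pair; exact: (shift_fix (gen1_subgroup _) h).
have pr c g : commute (rf (~~ c) g) (push (o c, false)).
  by apply: relabel_fix; rewrite /= /bf_ /=; case: (c).
have rr g h : commute (rf false g) (rf true h).
  by rewrite /commute /rf -!(@relabel_hom X) (bfC false).
case: i => [|[|[|[|[|[|[|i]]]]]]]; case: j => [|[|[|[|[|[|[|j]]]]]]] //= _ _; rewrite /nor_rep /=;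
  rewrite ?mulg1 ?mul1g //; try exact: rr.
- by apply: (pl false); exact: gen1_mem.
- exact: (pr true).
- exact: (pr true).
- by apply/commute_sym/(pr false).
- by apply/commute_sym/(pr false).
- by apply/commute_sym/(pl true); exact: gen1_mem.
Qed.

Theorem nonorientable_embeds (D : groupType) (x : nat -> D) :
  (forall i j, (i.+1 < j)%N -> (j < 7)%N -> x i * x j = x j * x i) ->
  (forall (H : groupType) (h : nat -> H),
    (forall i j, (i.+1 < j)%N -> (j < 7)%N -> h i * h j = h j * h i) ->
    exists f : D -> H, is_hom f /\ forall i, (i < 7)%N -> f (x i) = h i) ->
  group_embeds Q D.
Proof.
move=> xC xU; have [al [be [ga' [de' [rel qmap qgen]]]]] := presQ.
pose ga := ga' 0%N; pose de := de' 0%N.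
rewrite /srel big_nat1 -/ga -/de /kap in rel.
(* Over [true], $AB^2 \cdot B^{-2}$ is $A$ again, so [e] acts as [fA] on both fibres, and [a] as
   [fB]. That [z1] commutes with [e] and [z2] with $ea^2$ yields the two glueings. *)
pose e := x 0%N * x 5 * ((x 4)^-1 * (x 4)^-1); pose a := x 1%N * x 4.
pose z1 := x 2; pose z2 := x 3.
have z1e : commute z1 e.
  by rewrite /e; do !apply: commuteM; do ?apply: commuteV; first [by apply: commute_sym; exact: xC|exact: xC].
have c14 : commute (x 1%N) (x 4) by exact: xC.
have eaa : e * a * a = x 0%N * x 5 * (x 1%N * x 1%N).
  rewrite /e /a; move: (x 0%N * x 5) (x 1%N) (x 4) c14 => p q r h.
  have -> : p * (r^-1 * r^-1) * (q * r) * (q * r) = p * (r^-1 * (r^-1 * (q * r)) * (q * r)) by rewrite !mulgA.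
  by rewrite h mulKg -mulgA (mulgA q) h -mulgA mulKg.
have z2eaa : commute z2 (e * a * a).
  by rewrite eaa; do !apply: commuteM; do ?apply: commuteV; first [by apply: commute_sym; exact: xC|exact: xC].
(* This makes $a^{-2}b = z_2z_1^{-1}$ the element [tau] that glues along the second subgroup; [g] is
   the inverse of $z_1az_1^{-1}$, conjugated so that the relation of the surface holds. *)
pose b := a * a * z2 * z1^-1.
pose g := (b * e) * z1 * a^-1 * z1^-1 * (b * e)^-1.
have drel : srel false 1 e b (fun=> g) (fun=> a) = 1.
  rewrite /srel big_nat1 /kap.
  rewrite /g /b; move: z2eaa z1e; clearbody e a z1 z2; clear => z2eaa z1e.
  have z1e' : commute z1^-1 e^-1 by apply: commuteVl; exact: commuteV.
  set b := a * a * z2 * z1^-1; set g := b * e * z1 * a^-1 * z1^-1 * (b * e)^-1.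
  have -> : e * b * e^-1 * b^-1 * (g * g * a * a) = e * b * z1 * a^-1 * a^-1 * (z1^-1 * e^-1) * b^-1 * a * a.
    by rewrite /g; clearbody b; rewrite !gnorm.
  rewrite z1e' /b.
  have -> : e * (a * a * z2 * z1^-1) * z1 * a^-1 * a^-1 * (e^-1 * z1^-1) * (a * a * z2 * z1^-1)^-1 * a * a =
    e * a * a * z2 * (e * a * a)^-1 * z2^-1 by rewrite !gnorm.
  by rewrite -z2eaa !gnorm.
have [th [thM the thb thuv]] := qmap _ _ _ _ _ drel; exists th; split; first by split=> //; exact: hom1.
have [tga tde] := thuv 0%N isT.
have [rep [repM repE]] := xU _ nor_rep nor_repC.
suff inj : injective (rep \o th) by move=> u v E; apply: inj; rewrite /= E.
pose ab := (be * al)^-1 * ga^-1 * (be * al); pose tau := de^-1 * de^-1 * be.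
have [i1 [i1M i1A i1B]] := F2_map al de; have [i2 [i2M i2A i2B]] := F2_map al ab.
pose act (f : F2) : bij X := bf false (shift f) * bf true (shift f).
have actM : is_hom act.
  move=> f h; rewrite /act !shift_hom !bf_hom !mulgA; congr (_ * _).
  by rewrite -!mulgA; congr (_ * _); rewrite (bfC false).
have reprf f : relabel (act f) = rf false f * rf true f by rewrite /act (@relabel_hom X).
have repe : rep e = relabel (act fA).
  rewrite reprf /e !repM !(homV repM) !repE// /nor_rep /= -!mulgA; congr (_ * _).
  by rewrite -!(homV (rf_hom true)) -!rf_hom !gnorm.
have repa : rep a = relabel (act fB) by rewrite /a repM !repE// /nor_rep /= reprf.
have repz1 : rep z1 = push (o false, false) by rewrite /z1 repE.
have repz2 : rep z2 = push (o true, false) by rewrite /z2 repE.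
have tab : th ab = z1 * a * z1^-1.
  by rewrite /ab !thM !(homV thM) !thM the thb tga /g !gnorm.
have ttau : th tau = z2 * z1^-1 by rewrite /tau !thM !(homV thM) tde thb /b !gnorm.
have rho1 f : (rep \o th) (i1 f) = relabel (act f).
  have := @F2_eq _ ((rep \o th) \o i1) (@relabel X \o act); apply.
  - by do 2?apply: hom_comp.
  - by apply: hom_comp => //; exact: relabel_hom.
  - by rewrite /= i1A the repe.
  - by rewrite /= i1B tde repa.
have rho2 f : (rep \o th) (i2 f) = rep z1 * relabel (act f) * (rep z1)^-1.
  have := @F2_eq _ ((rep \o th) \o i2) (fun f => rep z1 * relabel (act f) * (rep z1)^-1); apply.
  - by do 2?apply: hom_comp.
  - by move=> u v; rewrite actM (@relabel_hom X) !gnorm.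
  - by rewrite /= i2A the -repe -(homV repM) -!repM z1e !gnorm.
  - by rewrite /= i2B tab 2!repM (homV repM) repa.
pose C (i : bool) (f : F2) := gen1 (cb i) f.
pose t (i : bool) := if i then tau else 1.
apply: (@doubling_injective bool F2 Q X act o C actM _ _ i1 i2 t i1M i2M).
- move=> f E; apply: shift_inj; apply: bij_eq => S.
  by have := congr1 (fun s : bij X => (s (false, S)).2) E.
- move=> i j f; rewrite /= /bf_ /=; case: i; case: j => //= -[h]; split=> //;
    by apply: shift_stab => //; exact: gen1_subgroup.
- move=> i c Cc; apply: (Cc (fun c => t i * i2 c * (t i)^-1 = i1 c)).
    by apply: hom_subgroup => // u v; rewrite i2M !gnorm.
  case: i Cc => Cc; rewrite /cb /= ?i1M ?i2M i1A i2A ?i1B ?i2B; last by rewrite !gnorm.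
  have E : be * al^-1 * be^-1 * ga * ga * de * de = al^-1 by rewrite -[RHS]mulg1 -rel !gnorm.
  have E2 : be * al * be^-1 = ga * ga * de * de * al.
    by rewrite -[al in RHS]invgK -E !gnorm.
  rewrite /tau /ab.
  have -> : de^-1 * de^-1 * be * (al * ((be * al)^-1 * ga^-1 * (be * al)) * ((be * al)^-1 * ga^-1 * (be * al))) *
      (de^-1 * de^-1 * be)^-1 = de^-1 * de^-1 * ga^-1 * ga^-1 * (be * al * be^-1) * de * de by rewrite !gnorm.
  by rewrite E2 !gnorm.
- move=> S Ss S1 S2; have [S1' SM SV] := Ss.
  have Sal : S al by rewrite -i1A.
  have Sde : S de by rewrite -i1B.
  have Sab : S ab.
    by have := S2 false fB false; rewrite /mid /t i2B mul1g invg1 mulg1.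
  have Stau : S tau.
    by have := S2 true 1 false; rewrite /mid /t (hom1 i2M) invg1 !mulg1.
  have Sbe : S be.
    have -> : be = de * de * tau by rewrite /tau !gnorm.
    by apply: (SM) => //; exact: (SM).
  apply: qgen => // -[|//] _; rewrite -/ga -/de; split=> //.
  have -> : ga = ((be * al) * ab * (be * al)^-1)^-1 by rewrite /ab !gnorm.
  have Sba : S (be * al) by exact: (SM).
  by apply: (SV); apply: (SM); [exact: (SM)|exact: (SV)].
- exact: hom_comp.
- exact: rho1.
- move=> i v j; rewrite /mid.
  have hM : is_hom (rep \o th) by exact: hom_comp.
  rewrite !hM (homV hM) rho2.
  have tE k : (rep \o th) (t k) * rep z1 = push (o k, false).
    case: k; rewrite /t /= ?ttau; last by rewrite (hom1 thM) (hom1 repM) mul1g repz1.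
    by rewrite repM (homV repM) -mulgA mulVg mulg1 repz2.
  by rewrite -!tE !gnorm.
Qed.

End nonorientable.

Definition surface_word (k : bool) : seq (dart (bool * bool)) :=
  comm ((false, false), false) ((false, true), false) ++ kw k ((true, false), false) ((true, true), false).

Lemma surface_word_presented k : surface_presented k 1 (pres (surface_word k)).
Proof.
set W := surface_word k; have [g1 g2 g3] := pres_presents W.
have srelE (H : groupType) (h : bool * bool -> H) : ev h W =
    srel k 1 (h (false, false)) (h (false, true)) (fun=> h (true, false)) (fun=> h (true, true)).
  by rewrite /srel big_nat1 /W /surface_word /kap /kw; case: (k); rewrite /= /evd /= !mulg1 !mulgA.
exists (pgen W (false, false)), (pgen W (false, true)), (fun=> pgen W (true, false)), (fun=> pgen W (true, true)).
split; first by rewrite -srelE.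
  move=> H a b u v rel; pose h (l : bool * bool) := match l with
    | (false, false) => a | (false, true) => b | (true, false) => u 0%N | (true, true) => v 0%N end.
  have [|f [fM fE]] := g2 H h; first by rewrite srelE /srel big_nat1; move: rel; rewrite /srel big_nat1.
  exists f; split=> //; [exact: (fE (false, false))|exact: (fE (false, true))|].
  by move=> [|//] _; split; [exact: (fE (true, false))|exact: (fE (true, true))].
move=> S Ss Sa Sb Suv g; have [w ->] := g3 g; apply: ev_subgroup => // -[[] []] _ //;
  by have [] := Suv 0%N isT.
Qed.

Theorem surface_embeds k d (G : groupType) : (0 < d)%N -> surface_presented k d G ->
  exists D : groupType, is_diagram_group D /\ group_embeds G D.
Proof.
move=> d0 presG; have [D [x [Dd xC xU]]] := chain_group; exists D; split=> //.
have presQ := surface_word_presented k; move: (pres _) presQ => Q presQ.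
have [f [fM fi]] := surface_cover d0 presG presQ.
have [th [thM thi]] : group_embeds Q D.
  case: k presG presQ => presG presQ; first exact: (orientable_embeds presQ xC xU).
  exact: (nonorientable_embeds presQ xC xU).
exists (th \o f); split; last exact: inj_comp.
have thM' : is_hom th by move=> u v; case: thM => _; exact.
split; first by rewrite /= (hom1 fM) (hom1 thM').
exact: hom_comp.
Qed.

(** * Wires in diagrams *)

Section wire.
Implicit Types (b : bij nat) (i j k m n t : nat) (x : nat * nat).

(* Every letter of a word carries infinitely many wires, numbered by nat; the
   position [i] and the number [t] form the point [(i, t)]. Through the encodings
   [(k, t) |-> t * n.+1 + k] and [(l, t) |-> t * m.+1 + l], the bijection [b] joins
   the wires of a block of [n.+1] letters to those of a block of [m.+1]. *)
Definition wire_ b j m n x : nat * nat :=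
  if (x.1 < j)%N then x else
  if (x.1 < j + n.+1)%N then
    let y := b (x.2 * n.+1 + (x.1 - j))%N in ((j + y %% m.+1)%N, (y %/ m.+1)%N)
  else ((x.1 - n.+1 + m.+1)%N, x.2).

Lemma wire_in_ b j m n k t : (k < n.+1)%N -> wire_ b j m n ((j + k)%N, t) =
  ((j + b (t * n.+1 + k)%N %% m.+1)%N, (b (t * n.+1 + k)%N %/ m.+1)%N).
Proof. by move=> kn; rewrite /wire_ /= ltnNge leq_addr /= ltn_add2l kn addKn. Qed.

Lemma wire_ge_ b j m n i t : wire_ b j m n ((j + (n.+1 + i))%N, t) = ((j + (m.+1 + i))%N, t).
Proof.
rewrite /wire_ /= ltnNge leq_addr /= ltn_add2l ltnNge leq_addr /=.
by congr pair; clear; lia.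
Qed.

Lemma wire_lt_ b j m n i t : (i < j)%N -> wire_ b j m n (i, t) = (i, t).
Proof. by move=> h; rewrite /wire_ /= h. Qed.

Lemma block_cases j n i : [\/ (i < j)%N, (exists2 k, (k < n.+1)%N & i = (j + k)%N) |
  exists k, i = (j + (n.+1 + k))%N].
Proof.
case: (ltnP i j) => ji; [by constructor 1|rewrite -(subnKC ji); move: (i - j)%N => k].
by case: (ltnP k n.+1) => nk; [constructor 2; exists k|constructor 3; exists (k - n.+1)%N; rewrite subnKC].
Qed.

Lemma wire_K b j m n : cancel (wire_ b j m n) (wire_ b^-1 j n m).
Proof.
move=> [i t]; case: (block_cases j n i) => [h|[k h ->]|[k ->]].
- by rewrite !wire_lt_.
- rewrite wire_in_// wire_in_ ?ltn_pmod// -divn_eq bijVK.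
  by rewrite modnMDl modn_small// divnMDl// divn_small// addn0.
- by rewrite !wire_ge_.
Qed.

Lemma wire_VK b j m n : cancel (wire_ b^-1 j n m) (wire_ b j m n).
Proof. by have := wire_K b^-1 j n m; rewrite invgK. Qed.

Definition wire b j m n : bij (nat * nat) := Bij (@wire_K b j m n) (@wire_VK b j m n).

Lemma wire_in b j m n k t : (k < n.+1)%N -> wire b j m n ((j + k)%N, t) =
  ((j + b (t * n.+1 + k)%N %% m.+1)%N, (b (t * n.+1 + k)%N %/ m.+1)%N).
Proof. exact: wire_in_. Qed.

Lemma wire_ge b j m n i t : wire b j m n ((j + (n.+1 + i))%N, t) = ((j + (m.+1 + i))%N, t).
Proof. exact: wire_ge_. Qed.

Lemma wire_lt b j m n i t : (i < j)%N -> wire b j m n (i, t) = (i, t).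
Proof. exact: wire_lt_. Qed.

Lemma wire_exit b j m n k l t t' : (k < n.+1)%N -> (l < m.+1)%N ->
  b (t' * n.+1 + k)%N = (t * m.+1 + l)%N -> wire b j m n ((j + k)%N, t') = ((j + l)%N, t).
Proof.
move=> kn lm E; rewrite wire_in// E modnMDl modn_small// divnMDl// divn_small// addn0//.
Qed.

Lemma wireV b j m n : wire b^-1 j n m = (wire b j m n)^-1.
Proof. by apply: bij_eq. Qed.

Lemma wire_shift b i j m n x : wire b (i + j) m n ((i + x.1)%N, x.2) =
  ((i + (wire b j m n x).1)%N, (wire b j m n x).2).
Proof.
case: x => k t /=; case: (block_cases j n k) => [h|[l h ->]|[l ->]].
- by rewrite !wire_lt_ ?ltn_add2l.
- by rewrite addnA !wire_in_//= addnA.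
- by rewrite (addnA i j) !wire_ge_ /= -addnA.
Qed.

(** The square relation needed for [lab]. The right-hand cell has different offsets on the two sides
    because the block to its left changes its length. *)
Lemma wireC b1 b2 i j m n p q : wire b1 j m n * wire b2 (j + n.+1 + i) p q =
  wire b2 (j + m.+1 + i) p q * wire b1 j m n.
Proof.
apply: bij_eq => -[k t]; rewrite !bijM; case: (block_cases j n k) => [h|[l h ->]|[l ->]].
- by rewrite !wire_lt//; move: h; clear; lia.
- rewrite wire_lt ?wire_in ?wire_lt//.
    by have := ltn_pmod (b1 (t * n.+1 + l)%N) (ltn0Sn m); clear; lia.
  by move: h; clear; lia.
- rewrite wire_ge !addnA -!(addnA j).
  case: (block_cases i q l) => [h|[r h ->]|[r ->]].
  + rewrite wire_lt; last by move: h; clear; lia.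
    by rewrite wire_ge wire_lt//; move: h; clear; lia.
  + rewrite !addnA !wire_in// -!addnA wire_ge//.
  + by rewrite !addnA -(addnA _ q.+1) -[in RHS](addnA _ q.+1) !wire_ge -!addnA wire_ge.
Qed.

End wire.

Lemma cat_split (T : Type) (l x a y : seq T) : l ++ x = a ++ y -> (size a <= size l)%N ->
  exists2 m, l = a ++ m & y = m ++ x.
Proof.
elim: a l => [|c a IH] [|d l] //=; [by move=> <-; exists [::]|by move=> <-; exists (d :: l)|].
by move=> [-> /IH h] /h[m -> ->]; exists m.
Qed.

Section wires.
Variable P : semigroup_presentation.
Local Notation word := (seq P).
Local Notation path := (seq (squier_edge P)).
Implicit Types (a b l r u v w z : word) (p q : path) (e f : squier_edge P).

(** The connection depends on the relation but not on the context of the edge, and is inverted with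
    the relation; thus one wiring gives actions of all diagram groups of [P] at once. *)
Definition wiring := {s : word -> word -> bij nat | forall u v, s v u = (s u v)^-1}.

(** Points of the target word are sent to points of the source word, so a product along a path leads
    from its end back to its start. *)
Definition lab (s : wiring) e := wire (sval s (edge_src e) (edge_tgt e)) (size (edge_left e))
  (size (edge_src e)).-1 (size (edge_tgt e)).-1.

Local Notation pl s := (plab (lab s)).

Lemma src_size e : is_squier_edge e -> (size (edge_src e)).-1.+1 = size (edge_src e).
Proof.
case: e => l u v r [] /=; rewrite /is_squier_edge /= => h.
  by have := relation_lhs h; case: (u).
by have := relation_rhs h; case: (u).
Qed.

Lemma tgt_size e : is_squier_edge e -> (size (edge_tgt e)).-1.+1 = size (edge_tgt e).
Proof. by move=> he; rewrite -(src_size (is_squier_edge_inv he)). Qed.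

Lemma lab_hom s w : exists f : diagram_group_of w -> bij (nat * nat), is_hom f /\
  forall p, is_edge_path w p w -> f (dcl w p) = pl s p.
Proof.
apply: label_hom => [e he _|a u v b x y c he hf _].
  by rewrite /lab /= (svalP s) wireV.
have := src_size he; have := tgt_size he; rewrite /lab /= !size_cat => h1 h2.
have := wireC (sval s u v) (sval s x y) (size b) (size a) (size u).-1 (size v).-1 (size x).-1 (size y).-1.
by rewrite h1 h2 !addnA.
Qed.

Lemma plab1 s x : pl s [::] x = x. Proof. by rewrite /plab big_nil. Qed.
Lemma plab_cons s e p x : pl s (e :: p) x = lab s e (pl s p x).
Proof. by rewrite /plab big_cons bijM. Qed.

Lemma plab_extr s b p : pl s (ext [::] b p) = pl s p.
Proof. by apply: bij_eq; elim: p => // e p IH x; rewrite !plab_cons IH. Qed.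

Lemma plab_extl s a p x : pl s (ext a [::] p) ((size a + x.1)%N, x.2) =
  ((size a + (pl s p x).1)%N, (pl s p x).2).
Proof.
elim: p => [|e p IH]; first by rewrite !plab1.
by rewrite !plab_cons IH -wire_shift /lab /= size_cat.
Qed.

Lemma plab_extl_lt s a p i t : (i < size a)%N -> pl s (ext a [::] p) (i, t) = (i, t).
Proof.
move=> ia; elim: p => [|e p IH]; first by rewrite !plab1.
by rewrite plab_cons IH /lab wire_lt//= size_cat ltn_addr.
Qed.

Lemma plab_ge s w p z i t : is_edge_path w p z ->
  pl s p ((size z + i)%N, t) = ((size w + i)%N, t).
Proof.
elim: p w => [|e p IH] w /=; first by move=> ->; rewrite plab1.
move=> [he -> /IH h]; rewrite plab_cons h /edge_start /edge_end /lab !size_cat.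
rewrite -(src_size he) -(tgt_size he) /= -!addnA.
by have := wire_ge (sval s (edge_src e) (edge_tgt e)) (size (edge_left e)) (size (edge_src e)).-1 (size (edge_tgt e)).-1 (size (edge_right e) + i) t.
Qed.

Record passage := Passage { pin : word; pout : word; kin : nat; kout : nat }.

(** A wire entering [p] at the letter [i] of its first word; [c] lists the cells it crosses, with
    the letters where it enters and where it is chosen to leave. *)
Fixpoint follows p (i : nat) (c : seq passage) : Prop :=
  if p is e :: p' then
    if (i < size (edge_left e))%N then follows p' i c
    else if (i < size (edge_left e) + size (edge_src e))%N then
      exists k c', [/\ (k < size (edge_tgt e))%N,
        c = Passage (edge_src e) (edge_tgt e) (i - size (edge_left e)) k :: c' &
        follows p' (size (edge_left e) + k) c']
    else follows p' (i - size (edge_src e) + size (edge_tgt e)) c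
  else c = [::].

(** The wire never turns straight back through the inverse of the cell just crossed, entering at the
    letter where it came out. This makes the requirements on a wiring consistent. *)
Fixpoint unfolded u v (k : nat) (c : seq passage) : Prop :=
  if c is x :: c' then
    ~ [/\ pin x = v, pout x = u & kin x = k] /\ unfolded (pin x) (pout x) (kout x) c'
  else True.

(** Being shortest in the homotopy class plays the role of having no dipoles; such paths exist
    without any theory of normal forms. *)
Definition tight w p z := is_edge_path w p z /\
  forall q, edge_homotopic w z p q -> (size p <= size q)%N.

Lemma tight_cons w e p z : tight w (e :: p) z -> tight (edge_end e) p z.
Proof.
move=> [[he -> ep] h]; split=> // q pq.
have := h (e :: q); rewrite ltnS; apply.
by apply: (homotopic_catl (l := [:: e]) _ pq); split.
Qed.

Lemma tight_eq w p q z : tight w p z -> edge_homotopic w z p q -> is_edge_path w q z ->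
  size q = size p -> tight w q z.
Proof.
move=> [_ h] pq wq E; split=> // q' qq; rewrite E; apply: h; exact: rst_trans pq qq.
Qed.

(* If every wire leaving the cell [e] went straight back into an inverse of it,
   then [e] could be moved along [q] until it cancels. *)
Lemma wire_exits q e z : tight (edge_start e) (e :: q) z ->
  exists k c, [/\ (k < size (edge_tgt e))%N, follows q (size (edge_left e) + k) c &
    unfolded (edge_src e) (edge_tgt e) k c].
Proof.
elim: q e => [|f q IH] e te.
  have [[he _ _] _] := te.
  by exists 0%N, [::]; rewrite -(tgt_size he).
have [[he _ [hf ef qz]] tmin] := te.
have tf := tight_cons te; rewrite ef in tf.
case: e he ef te tmin => l u v r he; case: f hf qz tf => lf uf vf rf hf qz tf.
rewrite /edge_end /edge_start /= => E te tmin.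
(* If [f] lies to the left of the block made by [e], a square exchanges the two cells and the
   induction applies to [e] placed after [f]; the next case is the mirror image. *)
have [h1|h1] := leqP (size lf + size uf) (size l).
  have [m lE rE] : exists2 m, l = (lf ++ uf) ++ m & rf = m ++ (v ++ r).
    by apply: cat_split; rewrite ?size_cat// E catA.
  rewrite -catA in lE.
  have sq := @Square P [::] lf uf vf m u v r q.
  have p2 : is_edge_path (l ++ u ++ r) ([:: SquierEdge lf uf vf (m ++ u ++ r); SquierEdge (lf ++ vf ++ m) u v r] ++ q) z.
    rewrite lE /=; split=> //; first by rewrite /edge_start /= -!catA.
    split=> //; first by rewrite /edge_end /edge_start /= -!catA.
    by move: qz; rewrite rE /edge_end /= -!catA.
  have p1 : is_edge_path (l ++ u ++ r) ([:: SquierEdge l u v r; SquierEdge lf uf vf rf] ++ q) z.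
    by have [] := te.
  have hom : edge_homotopic (l ++ u ++ r) z (SquierEdge l u v r :: SquierEdge lf uf vf rf :: q)
    (SquierEdge lf uf vf (m ++ u ++ r) :: SquierEdge (lf ++ vf ++ m) u v r :: q).
    by apply: rst_sym; apply: rst_step; split=> //; move: sq; rewrite lE rE.
  have t2 := tight_cons (tight_eq te hom p2 erefl).
  have [|k [c [kv fc rc]]] := IH (SquierEdge (lf ++ vf ++ m) u v r).
    by move: t2; rewrite /edge_end /edge_start /= -!catA.
  exists k, c; split=> //; move: fc; rewrite lE !size_cat /=.
  have -> : (size lf + (size uf + size m) + k < size lf)%N = false by clear; lia.
  have -> : (size lf + (size uf + size m) + k < size lf + size uf)%N = false by clear; lia.
  by congr follows; clear; lia.
have [h2|h2] := leqP (size l + size v) (size lf).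
  have [m lE rE] : exists2 m, lf = (l ++ v) ++ m & r = m ++ (uf ++ rf).
    by apply: cat_split; rewrite ?size_cat// -E catA.
  rewrite -catA in lE.
  have sq := @Square P [::] l u v m uf vf rf q.
  have p2 : is_edge_path (l ++ u ++ r) ([:: SquierEdge (l ++ u ++ m) uf vf rf; SquierEdge l u v (m ++ vf ++ rf)] ++ q) z.
    rewrite rE /=; split=> //; first by rewrite /edge_start /= -!catA.
    split=> //; first by rewrite /edge_end /edge_start /= -!catA.
    by move: qz; rewrite lE /edge_end /= -!catA.
  have hom : edge_homotopic (l ++ u ++ r) z (SquierEdge l u v r :: SquierEdge lf uf vf rf :: q)
    (SquierEdge (l ++ u ++ m) uf vf rf :: SquierEdge l u v (m ++ vf ++ rf) :: q).
    have p1 := te.1; apply: rst_step; split; [exact: p1|exact: p2|].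
    by move: sq; rewrite lE rE.
  have t2 := tight_cons (tight_eq te hom p2 erefl).
  have [|k [c [kv fc rc]]] := IH (SquierEdge l u v (m ++ vf ++ rf)).
    by move: t2; rewrite /edge_end /edge_start /= -!catA.
  exists k, c; split=> //=; rewrite ifT//; move: kv h2 => /=; clear; lia.
(* The cells overlap: the wire leaves [e] at the first letter shared with [f] and continues as found
   for [f]. The truncated differences are the offsets of that letter. If this were a turn straight
   back, [f] would be the inverse of [e], contradicting minimal length. *)
have [k2 [c [kv fc rc]]] := IH _ tf.
have su := src_size hf; have sv := tgt_size he; rewrite /= in su sv fc rc kv.
exists (size lf - size l)%N, (Passage uf vf (size l - size lf) k2 :: c); split=> /=.
- by move: h2 sv; clear; lia.
- rewrite ifF; last by clear; lia.
  rewrite ifT; last by move: h1 su; clear; lia.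
  exists k2, c; split=> //; congr (Passage _ _ _ _ :: _); clear; lia.
- split=> // -[uv vu kE].
  have lE : l = lf.
    have sE : size l = size lf by move: kE; clear; lia.
    by have := congr1 (take (size l)) E; rewrite take_size_cat// sE take_size_cat.
  have rE : r = rf.
    by move: E; rewrite lE uv => /(congr1 (drop (size lf))); rewrite !drop_size_cat// => /(congr1 (drop (size v))); rewrite !drop_size_cat.
  have := tmin q; rewrite /= ltnNge leqnSn => /(_ _)/negP; apply=> //.
  apply: rst_step; split; first by have [] := te.
    by move: qz; rewrite /edge_end /= -vu -lE -rE vu.
  by have := @Backtrack P [::] (SquierEdge l u v r) q; rewrite /edge_inv /= uv vu lE rE.
Qed.

Definition enc u (k t : nat) := (t * (size u).-1.+1 + k)%N.

Lemma enc_inj u k k' t t' : (k < size u)%N -> (k' < size u)%N -> enc u k t = enc u k' t' ->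
  k = k' /\ t = t'.
Proof.
rewrite /enc; case: (size u) => // m /= h h' E; split.
  by have := congr1 (modn^~ m.+1) E; rewrite /= !modnMDl !modn_small.
by have := congr1 (divn^~ m.+1) E; rewrite /= !divnMDl// !divn_small// !addn0.
Qed.

(** The number of the wire grows by one at each cell, so that the requirements made by different
    cells concern different points. *)
Fixpoint obeys (s : wiring) (t : nat) (c : seq passage) : Prop :=
  if c is x :: c' then
    sval s (pin x) (pout x) (enc (pout x) (kout x) t.+1) = enc (pin x) (kin x) t /\ obeys s t.+1 c'
  else True.

Fixpoint valid_passages (c : seq passage) : Prop :=
  if c is x :: c' then
    [/\ pin x <> pout x, (kin x < size (pin x))%N, (kout x < size (pout x))%N & valid_passages c']
  else True.

Lemma follows_valid w p z i c : is_edge_path w p z -> follows p i c -> valid_passages c.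
Proof.
elim: p w i c => [|e p IH] w i c /=; first by move=> _ ->.
move=> [he _ /IH {}IH]; case: ifP => h1; first exact: IH.
case: ifP => h2; last exact: IH.
move=> [k [c' [kv -> /IH h]]] /=; split=> //.
  by move=> E; case: he; rewrite E => r; have := relation_asym r.
by move: h1 h2; clear; lia.
Qed.

(* The transposition forces the value [y] at [x] and keeps the values prescribed
   at other points. *)
Definition rewire (s : wiring) u v (x y : nat) u' v' : bij nat :=
  if `[< u' = u /\ v' = v >] then swp (sval s u v x) y * sval s u v
  else if `[< u' = v /\ v' = u >] then (swp (sval s u v x) y * sval s u v)^-1
  else sval s u' v'.

Lemma rewireV s u v x y : u <> v -> forall u' v', rewire s u v x y v' u' = (rewire s u v x y u' v')^-1.
Proof.
move=> uv u' v'; rewrite /rewire; case: asboolP => [[vu uv']|h1]; case: asboolP => [[uu vv]|h2].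
- by case: uv; rewrite -vu vv.
- by case: asboolP => [_|[]//]; rewrite invgK.
- by case: asboolP => // -[].
- case: asboolP => [[? ?]|_]; first by case: h2.
  case: asboolP => [[? ?]|_]; first by case: h1.
  exact: (svalP s).
Qed.

(** The requirements are imposed from the last cell backwards. The new one, at level [t], can clash
    only with that of the next cell, and only if the next cell is the inverse entered at the same
    letter; [unfolded] excludes this. *)
Lemma realize t u v k c : valid_passages c -> unfolded u v k c -> (k < size v)%N ->
  exists s, obeys s t c.
Proof.
elim: c t u v k => [|[u v ki ko] c IH] t u0 v0 k0 /=.
  by move=> _ _ _; exists (exist (fun s : word -> word -> bij nat => forall u v, s v u = (s u v)^-1) (fun _ _ => 1)
    (fun _ _ => esym (@invg1 (bij nat)))).
move=> [uv kiu kov vc] [_ nf] _; have [s sc] := IH t.+1 _ _ _ vc nf kov.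
pose x := enc v ko t.+1; pose y := enc u ki t.
exists (exist _ (rewire s u v x y) (@rewireV s u v x y uv)) => /=; split.
  by rewrite /rewire; case: asboolP => [_|[]//]; rewrite bijM swpL.
have keep u' v' x' y' : (u' = u /\ v' = v -> x' <> x /\ y' <> y) ->
    (u' = v /\ v' = u -> y' <> x /\ x' <> y) ->
    sval s u' v' x' = y' -> rewire s u v x y u' v' x' = y'.
  move=> h1 h2 E; rewrite /rewire; case: asboolP => [uv'|_].
    have [xx yy] := h1 uv'; case: uv' => ? ?; subst u' v'.
    rewrite bijM /= /swp_ E; case: eqP => [E'|_]; last by case: eqP.
    by case: xx; apply: (can_inj (bfunK (sval s u v))); rewrite E.
  case: asboolP => [uv'|_] //; have [xx yy] := h2 uv'; case: uv' => ? ?; subst u' v'.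
  suff E3 : (swp (sval s u v x) y * sval s u v) y' = x' by rewrite -E3 bijVK.
  rewrite bijM; have E' : sval s u v y' = x' by rewrite -E (svalP s v u) bijKV.
  rewrite /= /swp_ E'; case: eqP => [E2|_]; last by case: eqP.
  by case: xx; apply: (can_inj (bfunK (sval s u v))); rewrite E'.
have late t' c' : (t < t')%N -> valid_passages c' ->
    (forall z : passage, c' = z :: behead c' -> t' = t.+1 -> ~ [/\ pin z = v, pout z = u & kin z = ko]) ->
    obeys s t' c' -> obeys (exist _ (rewire s u v x y) (@rewireV s u v x y uv)) t' c'.
  elim: c' t' => //= -[u' v' ki' ko'] c' IHc t' tt' /= [uv' ki'u ko'v vc'] hd [E oc]; split.
    apply: keep => // -[? ?]; subst u' v'; split.
    - by move=> /(enc_inj ko'v kov)[_]; move: tt'; clear; lia.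
    - by move=> /(enc_inj ki'u kiu)[_]; move: tt'; clear; lia.
    - move=> /(enc_inj ki'u kov)[kk tE]; apply: (hd _ erefl tE); split=> //.
    - by move=> /(enc_inj ko'v kiu)[_]; move: tt'; clear; lia.
  apply: IHc => //; first exact: ltnW.
  by move=> z' _ [E']; move: tt'; rewrite E' ltnn.
by apply: late => // z; case: (c) nf => //= z' c' [h _] [<-].
Qed.

Lemma plab_follows s w p z i t c : is_edge_path w p z -> follows p i c -> obeys s t c ->
  exists j, pl s p (j, (t + size c)%N) = (i, t).
Proof.
elim: p w i t c => [|e p IH] w i t c /=.
  by move=> _ -> _; exists i; rewrite plab1 addn0.
move=> [he _ ep]; have su := src_size he; have sv := tgt_size he.
case: ltnP => h1 => [fc oc|].
  have [j jE] := IH _ _ _ _ ep fc oc.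
  by exists j; rewrite plab_cons jE /lab wire_lt.
case: ltnP => h2.
  move=> [k [c' [kv -> fc]]] /= [oE oc]; have [j jE] := IH _ _ _ _ ep fc oc.
  exists j; rewrite plab_cons addnS -addSn jE /lab.
  rewrite (@wire_exit _ _ _ _ k (i - size (edge_left e))%N t t.+1) ?sv ?su ?subnKC//.
    by rewrite ltn_subLR.
  by move: oE; rewrite /enc /= sv su.
move=> fc oc; have [j jE] := IH _ _ _ _ ep fc oc; exists j; rewrite plab_cons jE /lab.
have [i' iE] : exists i', i = (size (edge_left e) + ((size (edge_src e)).-1.+1 + i'))%N.
  by exists (i - (size (edge_left e) + size (edge_src e)))%N; rewrite su addnA subnKC.
have -> : (i - size (edge_src e) + size (edge_tgt e))%N = (size (edge_left e) + ((size (edge_tgt e)).-1.+1 + i'))%N.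
  by rewrite iE su sv; clear; lia.
by rewrite wire_ge -iE.
Qed.

Lemma tight_exists w p z : is_edge_path w p z -> exists2 q, edge_homotopic w z p q & tight w q z.
Proof.
move: {2}(size p) (leqnn (size p)) => n; elim: n p => [|n IH] p pn wp.
  exists p; first exact: rst_refl.
  by split=> // q _; apply: leq_trans pn _.
case: (pselect (tight w p z)) => [tp|ntp]; first by exists p => //; exact: rst_refl.
have [q pq qp] : exists2 q, edge_homotopic w z p q & (size q < size p)%N.
  apply: contrapT => h; apply: ntp; split=> // q pq; rewrite leqNgt; apply/negP => qp.
  by apply: h; exists q.
have wq : is_edge_path w q z.
  have : is_edge_path w p z <-> is_edge_path w q z.
    elim: pq {IH pn wp ntp qp} => {p q} [p q [h1 h2 _]|p|p q _ ->|p q r _ -> _ ->] //.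
  by move=> [h _]; exact: h.
have [|q' qq' tq] := IH q _ wq; first by rewrite -ltnS; exact: leq_trans qp pn.
by exists q' => //; exact: rst_trans pq qq'.
Qed.

(** The wire has level 0 at one end and positive level at the other. This is stronger than acting
    non-trivially: a diagram next to the block leaves the levels of its wires alone, which separates
    the two factors in [split_faithful]. *)
Theorem faithful_wiring w p : is_edge_path w p w -> ~ edge_homotopic w w p [::] ->
  exists s i j t, [/\ (i < size w)%N, (0 < t)%N & pl s p (j, t) = (i, 0%N)].
Proof.
move=> wp np; have [q pq tq] := tight_exists wp.
have [wq _] := tq.
case: q pq tq wq => [/np //|e q] pq te wq; have [he wE eq] := wq.
rewrite {1}wE in te; have [k [c [kv fc rc]]] := wire_exits te.
have vc := follows_valid eq fc.
have vc' : valid_passages (Passage (edge_src e) (edge_tgt e) 0 k :: c).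
  by split=> //=; [move=> E; case: he; rewrite E => r; have := relation_asym r|rewrite -(src_size he)].
have so : exists s, obeys s 0 (Passage (edge_src e) (edge_tgt e) 0 k :: c).
  apply: (@realize 0 (edge_tgt e) (edge_tgt e) 0%N) => //=; last by rewrite -(tgt_size he).
  by split=> // -[E _ _]; case: he; rewrite E => r; have := relation_asym r.
have fol : follows (e :: q) (size (edge_left e)) (Passage (edge_src e) (edge_tgt e) 0 k :: c).
  rewrite /= ltnn -[X in (X < _)%N]addn0 ltn_add2l -(src_size he) /=.
  by exists k, c; rewrite subnn.
have [s so'] := so; have [j jE] := @plab_follows s _ _ _ _ 0%N _ wq fol so'.
exists s, (size (edge_left e)), j, (size c).+1; split=> //.
  by rewrite wE /edge_start !size_cat -(src_size he); clear; lia.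
have [f [_ fE]] := lab_hom s w.
by rewrite -fE// (_ : dcl w p = dcl w (e :: q)) ?fE//; apply/dcl_eq.
Qed.

Lemma split_faithful a b p q : is_edge_path a p a -> is_edge_path b q b ->
  edge_homotopic (a ++ b) (a ++ b) (ext [::] b p ++ ext a [::] q) [::] ->
  edge_homotopic a a p [::] /\ edge_homotopic b b q [::].
Proof.
move=> ap bq pq.
have pqE s : pl s (ext [::] b p) * pl s (ext a [::] q) = 1.
  have [f [fM fE]] := lab_hom s (a ++ b); rewrite -plab_cat -fE.
    rewrite -(hom1 fM); congr f; rewrite -(dcl1 (a ++ b)); apply/dcl_eq => //.
    apply/is_edge_path_cat; exists (a ++ b); first exact: (ext_path [::] b ap).
    by have := ext_path a [::] bq; rewrite !cats0.
  apply/is_edge_path_cat; exists (a ++ b); first exact: (ext_path [::] b ap).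
  by have := ext_path a [::] bq; rewrite !cats0.
split; apply: contrapT => /faithful_wiring.
  move=> /(_ ap)[s [i [j [t [ia t0 E]]]]].
  have E' : pl s p (i, 0%N) = (i, 0%N).
    have := congr1 (fun x : bij (nat * nat) => x (i, 0%N)) (pqE s).
    by rewrite bijM plab_extl_lt// plab_extr.
  have [_ t0'] := can_inj (bfunK (pl s p)) (etrans E (esym E')).
  by rewrite t0' in t0.
move=> /(_ bq)[s [i [j [t [ib t0 E]]]]].
have := congr1 (fun x : bij (nat * nat) => x ((size a + j)%N, t)) (pqE s).
rewrite bijM plab_extr (plab_extl s a q (j, t)) E /= (plab_ge s i 0 ap) => -[_ t0'].
by rewrite -t0' in t0.
Qed.

End wires.

(** * Lifting homomorphisms from a diagram group *)

Section null_loops.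
Variable P : semigroup_presentation.
Local Notation word := (seq P).
Local Notation path := (seq (squier_edge P)).
Implicit Types (a b l r u v w y z : word) (p q n : path) (e f : squier_edge P).

Lemma reach_refl w : reach w w. Proof. by exists [::]. Qed.
Lemma reach_trans w y z : reach w y -> reach y z -> reach w z.
Proof. by move=> [p wp] [q yq]; exists (p ++ q); apply/is_edge_path_cat; exists y. Qed.
Lemma reach_sym w y : reach w y -> reach y w.
Proof. by move=> [p wp]; exists (path_inv p); exact: is_edge_path_inv. Qed.
Lemma reach_ext a b w y : reach w y -> reach (a ++ w ++ b) (a ++ y ++ b).
Proof. by move=> [p wp]; exists (ext a b p); exact: ext_path. Qed.
Lemma reach_edge e : is_squier_edge e -> reach (edge_start e) (edge_end e).
Proof. by move=> he; exists [:: e]. Qed.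

Definition simply_connected a := forall p, is_edge_path a p a -> edge_homotopic a a p [::].
Local Notation trivial := simply_connected.

Lemma homotopic_mulV w p z : is_edge_path w p z -> edge_homotopic z z (path_inv p ++ p) [::].
Proof.
by move=> wp; have := edge_homotopic_mulrV (is_edge_path_inv wp); rewrite path_invK.
Qed.

Lemma trivial_reach w y : reach w y -> trivial w -> trivial y.
Proof.
move=> [r wr] tw p yp; have rw := is_edge_path_inv wr.
have h : edge_homotopic w w (r ++ p ++ path_inv r) [::].
  by apply: tw; apply/is_edge_path_cat; exists y => //; apply/is_edge_path_cat; exists y.
have h1 := homotopic_mulV wr.
have h2 : edge_homotopic y y (p ++ path_inv r ++ r) p.
  by have := homotopic_catl yp h1; rewrite cats0.
have yprr : is_edge_path y (p ++ path_inv r ++ r) y.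
  by apply/is_edge_path_cat; exists y => //; apply/is_edge_path_cat; exists w.
apply: (@rst_trans _ _ _ (path_inv r ++ (r ++ p ++ path_inv r) ++ r)).
  apply: rst_sym; have := rst_trans _ _ _ _ _ (homotopic_catr yprr h1) h2.
  by rewrite -!catA.
apply: rst_trans h1; apply: (homotopic_catl rw).
by have := homotopic_catr wr h; rewrite cat0s.
Qed.

(** $D(P,a)$ embeds into $D(P,ab)$, by [split_faithful] with the trivial path on [b]. *)
Lemma trivial_prefix a b : trivial (a ++ b) -> trivial a.
Proof.
move=> tab p ap; have [] // := @split_faithful P a b p [::] ap erefl.
by rewrite cats0; apply: tab; exact: (ext_path [::] b ap).
Qed.

Lemma trivial_nil : trivial [::].
Proof.
case=> [_|e p [he E _]]; first exact: rst_refl.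
have := src_size he; move: E; rewrite /edge_start.
by case: (edge_left e) => //; case: (edge_src e).
Qed.

(** The critical letter is the first one at which the diagram group of the prefix becomes
    non-trivial; by [trivial_prefix] there is only one such place. *)
Lemma critical_letter y : ~ trivial y ->
  exists X c Z, [/\ y = X ++ c :: Z, trivial X & ~ trivial (X ++ [:: c])].
Proof.
elim/last_ind: y => [|y c IH]; first by move=> []; exact: trivial_nil.
case: (pselect (trivial y)) => [ty|/IH[X [d [Z [-> tX tXd]]]] _].
  by rewrite -cats1 => ty'; exists y, c, [::].
by exists X, d, (rcons Z c); rewrite rcons_cat.
Qed.

Lemma trivial_size a b y z : a ++ y = b ++ z -> trivial b -> ~ trivial a -> (size b < size a)%N.
Proof.
move=> E tb ta; rewrite ltnNge; apply/negP => ab.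
by have [m bE _] := cat_split (esym E) ab; apply: ta; apply: (@trivial_prefix _ m); rewrite -bE.
Qed.

(* An edge is critical when it rewrites the critical letter of the word at which
   it starts. *)
Definition crit e := trivial (edge_left e) /\ ~ trivial (edge_left e ++ edge_src e).

Lemma crit_inv e : is_squier_edge e -> crit e -> crit (edge_inv e).
Proof.
move=> he [h1 h2]; split=> //= h; apply: h2; apply: trivial_reach h.
apply: reach_sym; have := @reach_edge (SquierEdge (edge_left e) (edge_src e) (edge_tgt e) [::]) he.
by rewrite /edge_start /edge_end /= !cats0.
Qed.

Fixpoint calm p := if p is e :: p' then ~ crit e /\ calm p' else True.

Lemma calm_cat p q : calm (p ++ q) <-> calm p /\ calm q.
Proof. by elim: p => [|e p IH] /=; [split=> // -[]|rewrite IH; tauto]. Qed.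

Lemma calm_inv w p z : is_edge_path w p z -> calm p -> calm (path_inv p).
Proof.
elim: p w => // e p IH w [he _ ep] [h1 h2]; rewrite /path_inv /= rev_cons -cats1.
apply/calm_cat; split; first exact: IH ep h2.
by split=> // /(crit_inv (is_squier_edge_inv he)); rewrite edge_invK.
Qed.

(** A calm path never rewrites the critical letter [c]: each edge lies entirely in [X] or entirely
    in [Z], and edges on the two sides commute. *)
Lemma calm_split n X c Z y1 : is_edge_path (X ++ c :: Z) n y1 -> calm n ->
  trivial X -> ~ trivial (X ++ [:: c]) ->
  exists X1 Z1 p q, [/\ is_edge_path X p X1, is_edge_path Z q Z1, y1 = X1 ++ c :: Z1,
    edge_homotopic (X ++ c :: Z) y1 n (ext [::] (c :: Z) p ++ ext (X1 ++ [:: c]) [::] q) &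
    ~ trivial (X1 ++ [:: c])].
Proof.
elim: n X Z => [|e n IH] X Z /=.
  by move=> <- _ tX tXc; exists X, Z, [::], [::]; split=> //; exact: rst_refl.
move=> [he yE en] [nce cn] tX tXc; case: e he yE en nce => l u v r he.
rewrite /edge_start /edge_end /crit /= => yE en nce.
case: (pselect (trivial (l ++ u))) => [tlu|ntlu].
  have [m XE rE] : exists2 m, X = (l ++ u) ++ m & r = m ++ c :: Z.
    apply: cat_split; first by rewrite yE catA.
    have := @trivial_size (X ++ [:: c]) (l ++ u) Z r; rewrite -!catA yE => /(_ erefl tlu tXc).
    by rewrite !size_cat /= addn1 ltnS.
  rewrite -catA in XE; pose f := SquierEdge l u v m.
  have Xf : is_edge_path X [:: f] (l ++ v ++ m) by rewrite XE.
  have rX : reach X (l ++ v ++ m) by exists [:: f].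
  have eE : SquierEdge l u v r = ext_edge [::] (c :: Z) f by rewrite /ext_edge /= rE.
  have [||X1 [Z1 [p [q [Xp Zq y1E h nt]]]]] := IH (l ++ v ++ m) Z _ cn (trivial_reach rX tX) _.
  - by rewrite rE in en; rewrite -!catA.
  - move=> h; apply: tXc; apply: trivial_reach h; apply: reach_sym.
    exact: (reach_ext [::] [:: c] rX).
  exists X1, Z1, (f :: p), q; split=> //.
  rewrite /= -eE; apply: (homotopic_catl (l := [:: SquierEdge l u v r]) _ h).
  by rewrite /= /edge_start /edge_end /= rE -!catA XE -!catA.
have ntl : ~ trivial l by move=> tl; apply: nce.
have [m lE ZE] : exists2 m, l = (X ++ [:: c]) ++ m & Z = m ++ u ++ r.
  apply: cat_split; first by rewrite -yE -catA.
  by have := @trivial_size l X _ _ (esym yE) tX ntl; rewrite size_cat addn1.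
pose f := SquierEdge m u v r.
have Zf : is_edge_path Z [:: f] (m ++ v ++ r) by rewrite ZE.
have eE : SquierEdge l u v r = ext_edge (X ++ [:: c]) [::] f by rewrite /ext_edge /= lE cats0.
have [|X1 [Z1 [p [q [Xp Zq y1E h nt]]]]] := IH X (m ++ v ++ r) _ cn tX tXc.
  by rewrite lE in en; rewrite -!catA in en.
exists X1, Z1, p, (f :: q); split=> //.
have e1 : is_edge_path (X ++ c :: Z) [:: SquierEdge l u v r] (X ++ c :: m ++ v ++ r).
  by rewrite /= /edge_start /edge_end /= lE ZE -!catA.
apply: (rst_trans _ _ _ _ _ (homotopic_catl e1 h)); rewrite y1E.
have q1 : is_edge_path (X1 ++ c :: m ++ v ++ r) (ext (X1 ++ [:: c]) [::] q) (X1 ++ c :: Z1).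
  by have := ext_path (X1 ++ [:: c]) [::] Zq; rewrite !cats0 -!catA.
have := @disjoint_commute P [::] X X1 [:: c] Z (m ++ v ++ r) [::] p [:: f] Xp Zf.
rewrite !cats0 /= -eE => dc; apply: rst_sym.
by have := homotopic_catr q1 dc; rewrite -!catA.
Qed.

(** By [calm_split] the path is a product of loops at [X] and at [Z]. The first is null because [X]
    has trivial diagram group; the second because [X ++ [:: c]] has not, so the splitting hypothesis
    applies to [Z]. Sizes show that the critical letter returns to its place. *)
Lemma calm_loop y n : (forall a b, y = a ++ b -> trivial a \/ trivial b) -> ~ trivial y ->
  is_edge_path y n y -> calm n -> edge_homotopic y y n [::].
Proof.
move=> ysp nty; have [X [c [Z [yE tX tXc]]]] := critical_letter nty.
rewrite {1 2}yE => yn cn; have [X1 [Z1 [p [q [Xp Zq y1E h nt]]]]] := calm_split yn cn tX tXc.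
have tX1 : trivial X1 by apply: trivial_reach tX; exists p.
have s1 : (size X < size (X1 ++ [:: c]))%N.
  by apply: (@trivial_size _ _ Z1 (c :: Z)) => //; rewrite -catA -y1E.
have s2 : (size X1 < size (X ++ [:: c]))%N.
  by apply: (@trivial_size _ _ Z (c :: Z1)) => //; rewrite -catA -y1E.
rewrite !size_cat !addn1 !ltnS in s1 s2.
have [m XE] := cat_split (esym y1E) s1; have m0 : m = [::].
  by apply: size0nil; move: s2; rewrite XE size_cat; clear; lia.
rewrite m0 cats0 in XE; rewrite m0 => -[ZE]; subst X1 Z1.
have tZ : trivial Z by case: (ysp (X ++ [:: c]) Z) => //; rewrite -catA.
rewrite {1 2}yE; apply: (rst_trans _ _ _ _ _ h).
have hp := ext_homotopic [::] (c :: Z) (tX p Xp); have hq := ext_homotopic (X ++ [:: c]) [::] (tZ q Zq).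
rewrite !cats0 -!catA /= in hq hp.
have q1 : is_edge_path (X ++ c :: Z) (ext (X ++ [:: c]) [::] q) (X ++ c :: Z).
  by have := ext_path (X ++ [:: c]) [::] Zq; rewrite !cats0 -!catA.
exact: (rst_trans _ _ _ _ _ (homotopic_catr q1 hp)).
Qed.

End null_loops.

Section lifting.
Variables (P : semigroup_presentation) (w : seq P).
Local Notation word := (seq P).
Local Notation path := (seq (squier_edge P)).
Implicit Types (a b l r u v y z : word) (p q n : path) (e f : squier_edge P).
Local Notation trivial := (@simply_connected P).

Hypothesis splitH : forall a b, reach w (a ++ b) -> trivial a \/ trivial b.
Hypothesis wN : ~ trivial w.

Let calm_null y n : reach w y -> is_edge_path y n y -> calm n -> edge_homotopic y y n [::].
Proof.
move=> wy; apply: calm_loop => [a b yE|ty]; first by apply: splitH; rewrite -yE.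
by apply: wN; exact: trivial_reach (reach_sym wy) ty.
Qed.

Definition near_ y z := exists2 n, is_edge_path y n z & calm n.

Lemma near_refl y : near_ y y. Proof. by exists [::]. Qed.

Lemma near_trans y z t : near_ y z -> near_ z t -> near_ y t.
Proof.
move=> [n yn cn] [m zm cm]; exists (n ++ m); first by apply/is_edge_path_cat; exists z.
exact/calm_cat.
Qed.

Lemma near_sym y z : near_ y z -> near_ z y.
Proof.
by move=> [n yn cn]; exists (path_inv n); [exact: is_edge_path_inv|exact: calm_inv yn cn].
Qed.

(** The representative is chosen from the predicate [near_ y] rather than from [y], so that words
    joined by calm paths receive the same one ([base_eq]). *)
Definition base y : word := projT1 (cid (ex_intro (near_ y) y (near_refl y))).

Lemma base_near y : near_ y (base y).
Proof. exact: (projT2 (cid (ex_intro (near_ y) y (near_refl y)))). Qed.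

Lemma base_eq y z : near_ y z -> base y = base z.
Proof.
move=> yz; have E : near_ y = near_ z.
  apply/funext => t; apply/propext; split=> h; first exact: near_trans (near_sym yz) h.
  exact: near_trans yz h.
have aux (Q Q' : word -> Prop) (h : exists x, Q x) (h' : exists x, Q' x) : Q = Q' ->
    projT1 (cid h) = projT1 (cid h').
  by move=> QQ; subst Q'; rewrite (Prop_irrelevance h h').
exact: aux.
Qed.

Definition road y : path := if pselect (reach w y) is left h then projT1 (cid h) else [::].

Lemma roadP y : reach w y -> is_edge_path w (road y) y.
Proof. by move=> h; rewrite /road; case: pselect => // h'; exact: (projT2 (cid h')). Qed.

Definition lane y : path := projT1 (cid2 (near_sym (base_near y))).

Lemma laneP y : is_edge_path (base y) (lane y) y.
Proof. by rewrite /lane; case: cid2. Qed.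

Lemma lane_calm y : calm (lane y).
Proof. by rewrite /lane; case: cid2. Qed.

Lemma base_reach y : reach w y -> reach w (base y).
Proof. by move=> wy; apply: reach_trans wy _; have [n yn _] := base_near y; exists n. Qed.

(** The first part depends only on the class of [y] under calm paths and the second part is calm;
    hence closing up a calm path gives a conjugate of a calm loop, which is null. *)
Definition tether y := road (base y) ++ lane y.

Lemma tetherP y : reach w y -> is_edge_path w (tether y) y.
Proof.
move=> wy; apply/is_edge_path_cat; exists (base y); last exact: laneP.
exact/roadP/base_reach.
Qed.

Variables (E H : groupType) (pi : E -> H) (th : diagram_group_of w -> H).
Hypotheses (HC : forall x y : H, commute x y) (piM : is_hom pi) (piS : forall h, exists x : E, pi x = h).
Hypothesis thM : is_hom th.

Definition hol y p z := th (dcl w (tether y ++ p ++ path_inv (tether z))).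

Let hol_path y p z : reach w y -> is_edge_path y p z ->
  is_edge_path w (tether y ++ p ++ path_inv (tether z)) w.
Proof.
move=> wy yp; have wz : reach w z by apply: reach_trans wy _; exists p.
apply/is_edge_path_cat; exists y; first exact: tetherP.
by apply/is_edge_path_cat; exists z => //; apply: is_edge_path_inv; exact: tetherP.
Qed.

Lemma hol_eq y p q z : reach w y -> is_edge_path y p z -> is_edge_path y q z ->
  edge_homotopic y z p q -> hol y p z = hol y q z.
Proof.
move=> wy yp yq pq; congr th; apply/dcl_eq; [exact: hol_path|exact: hol_path|].
apply: edge_homotopic_ctx pq; first exact: tetherP.
by apply: is_edge_path_inv; apply: tetherP; apply: reach_trans wy _; exists p.
Qed.

Lemma holM y p z q t : reach w y -> is_edge_path y p z -> is_edge_path z q t ->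
  hol y (p ++ q) t = hol y p z * hol z q t.
Proof.
move=> wy yp zq; have wz : reach w z by apply: reach_trans wy _; exists p.
have ypq : is_edge_path y (p ++ q) t by apply/is_edge_path_cat; exists z.
have h1 := hol_path wy yp; have h2 := hol_path wz zq.
rewrite /hol -thM -dclM//; congr th; apply/dcl_eq; first exact: hol_path.
  by apply/is_edge_path_cat; exists w.
have gz := tetherP wz; have wt : reach w t by apply: reach_trans wz _; exists q.
have wgp : is_edge_path w (tether y ++ p) z by apply/is_edge_path_cat; exists y => //; exact: tetherP.
have zqt : is_edge_path z (q ++ path_inv (tether t)) w.
  by apply/is_edge_path_cat; exists t => //; apply: is_edge_path_inv; exact: tetherP.
have := edge_homotopic_ctx wgp zqt (homotopic_mulV gz).
by rewrite -!catA => h; apply: rst_sym.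
Qed.

Lemma hol_calm y p z : reach w y -> is_edge_path y p z -> calm p -> hol y p z = 1.
Proof.
move=> wy yp cp; rewrite -(hom1 thM) -(dcl1 w); congr th; apply/dcl_eq => //; first exact: hol_path.
have bE : base z = base y by apply/esym/base_eq; exists p.
rewrite /tether bE /path_inv map_cat rev_cat -/(path_inv (lane z)) -/(path_inv (road (base y))) -!catA.
have wr := roadP (base_reach wy); have lz := is_edge_path_inv (laneP z); rewrite bE in lz.
have loop : is_edge_path (base y) (lane y ++ p ++ path_inv (lane z)) (base y).
  apply/is_edge_path_cat; exists y; first exact: laneP.
  by apply/is_edge_path_cat; exists z.
have cl : calm (lane y ++ p ++ path_inv (lane z)).
  apply/calm_cat; split; first exact: lane_calm.
  by apply/calm_cat; split=> //; apply: calm_inv (laneP z) (lane_calm z).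
have := edge_homotopic_ctx wr (is_edge_path_inv wr) (calm_null (base_reach wy) loop cl).
rewrite -!catA /= => h; exact: (rst_trans _ _ _ _ _ h (edge_homotopic_mulrV wr)).
Qed.

(** Closing up conjugates by the loop [tether w], which is invisible in the commutative group
    [H]. *)
Lemma hol_loop p : is_edge_path w p w -> hol w p w = th (dcl w p).
Proof.
move=> wp; have gw := tetherP (reach_refl w); have gw' := is_edge_path_inv gw.
rewrite /hol dclM//; last by apply/is_edge_path_cat; exists w.
rewrite (dclM wp gw') dclV//.
by rewrite !thM (homV thM) HC -mulgA mulVg mulg1.
Qed.

Let sec h := projT1 (cid (piS h)).
Let piK h : pi (sec h) = h. Proof. exact: (projT2 (cid (piS h))). Qed.

Let hol1 e := hol (edge_start e) [:: e] (edge_end e).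

Let hol1V e : is_squier_edge e -> reach w (edge_start e) -> hol1 (edge_inv e) = (hol1 e)^-1.
Proof.
move=> he we; apply/esym/mulg1_eq; rewrite /hol1.
have hi := is_squier_edge_inv he; have eE : edge_end (edge_inv e) = edge_start e by [].
rewrite eE -[LHS](@holM (edge_start e) [:: e] (edge_end e) [:: edge_inv e] (edge_start e))//.
rewrite (@hol_eq _ _ [::])//; last by apply: (@edge_homotopic_backtrack P _ e [::]).
exact: hol_calm.
Qed.

(* The holonomy of a critical edge is not affected by the edges disjoint from it,
   hence any lift of it to [E] that only depends on the holonomy is consistent. *)
Definition psi e : E := if `[< crit e >] then
  if `[< relation_of (edge_src e) (edge_tgt e) >] then sec (hol1 e) else (sec (hol1 (edge_inv e)))^-1 else 1.

Lemma psiV e : is_squier_edge e -> reach w (edge_start e) -> psi (edge_inv e) = (psi e)^-1.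
Proof.
move=> he _; have hi := is_squier_edge_inv he; rewrite /psi edge_invK.
case: asboolP => [ci|nci].
  have ce : crit e by rewrite -(edge_invK e); exact: crit_inv.
  case: (asboolP (crit e)) => // _.
  case: asboolP => r1; case: asboolP => r2; rewrite ?invgK//.
    by have := relation_asym r1.
  by case: he.
by rewrite asboolF ?invg1// => ce; apply: nci; exact: crit_inv.
Qed.

Lemma psi_pi e : is_squier_edge e -> reach w (edge_start e) -> pi (psi e) = hol1 e.
Proof.
move=> he we; rewrite /psi; case: asboolP => [ce|nce].
  by case: asboolP => _; rewrite ?(homV piM) piK// hol1V// invgK.
by rewrite (hom1 piM) /hol1 hol_calm.
Qed.

Lemma psiC a u v b s t c : is_squier_edge (SquierEdge a u v (b ++ s ++ c)) ->
  is_squier_edge (SquierEdge (a ++ u ++ b) s t c) -> reach w (a ++ u ++ b ++ s ++ c) ->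
  psi (SquierEdge a u v (b ++ s ++ c)) * psi (SquierEdge (a ++ v ++ b) s t c) =
  psi (SquierEdge (a ++ u ++ b) s t c) * psi (SquierEdge a u v (b ++ t ++ c)).
Proof.
set e := SquierEdge a u v (b ++ s ++ c); set f' := SquierEdge (a ++ v ++ b) s t c.
set f := SquierEdge (a ++ u ++ b) s t c; set e' := SquierEdge a u v (b ++ t ++ c).
move=> he hf wy; have he' : is_squier_edge e' by []; have hf' : is_squier_edge f' by [].
have eS : edge_start e = a ++ u ++ b ++ s ++ c by [].
have fS : edge_start f = a ++ u ++ b ++ s ++ c by rewrite /edge_start /= -!catA.
have ef : edge_end e = edge_start f' by rewrite /edge_start /edge_end /= -!catA.
have fe : edge_end f = edge_start e' by rewrite /edge_start /edge_end /= -!catA.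
have ee : edge_end f' = edge_end e' by rewrite /edge_end /= -!catA.
have we : reach w (edge_start e) by rewrite eS.
have wf : reach w (edge_start f) by rewrite fS.
have wf' : reach w (edge_start f') by rewrite -ef; exact: reach_trans we (reach_edge he).
have we' : reach w (edge_start e') by rewrite -fe; exact: reach_trans wf (reach_edge hf).
have ruv x : reach (a ++ u ++ x) (a ++ v ++ x) by exists [:: SquierEdge a u v x].
have cee : crit e <-> crit e' by [].
have cff : crit f <-> crit f'.
  rewrite /crit /= -!catA; split=> -[h1 h2]; split.
  - exact: trivial_reach (ruv b) h1.
  - by move=> h; apply: h2; exact: trivial_reach (reach_sym (ruv _)) h.
  - exact: trivial_reach (reach_sym (ruv b)) h1.
  - by move=> h; apply: h2; exact: trivial_reach (ruv _) h.
(* To the right of a critical edge, the prefix already has a non-trivial diagram group. So at most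
   one edge of each pair in a square is critical, and no two chosen lifts ever have to commute. *)
have cef : crit e -> ~ crit f.
  move=> [_ h] [h1 _]; apply: h; apply: (@trivial_prefix _ _ b); rewrite -catA; exact: h1.
have holE : hol1 e * hol1 f' = hol1 f * hol1 e'.
  rewrite /hol1 -ef -[LHS](@holM (edge_start e) [:: e] (edge_end e) [:: f'] (edge_end f'))//.
  rewrite -fe -[RHS](@holM (edge_start f) [:: f] (edge_end f) [:: e'] (edge_end e'))//.
  rewrite eS fS ee; apply: hol_eq => //.
  apply: rst_step; split; [by []|by split|exact: (@Square P [::] a u v b s t c [::])].
case: (pselect (crit e)) => [ce|nce].
  have nf : ~ crit f by exact: cef.
  have nf' : ~ crit f' by move=> /cff.
  have psif : psi f = 1 by rewrite /psi asboolF.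
  have psif' : psi f' = 1 by rewrite /psi asboolF.
  have hE : hol1 e = hol1 e'.
    move: holE; rewrite [hol1 f](hol_calm (p := [:: f]))// [hol1 f'](hol_calm (p := [:: f']))//.
    by rewrite mulg1 mul1g.
  rewrite psif psif' mulg1 mul1g /psi !hol1V// hE; congr (if _ then _ else _).
have nce' : ~ crit e' by move=> /cee.
have psie : psi e = 1 by rewrite /psi asboolF.
have psie' : psi e' = 1 by rewrite /psi asboolF.
rewrite psie psie' mulg1 mul1g.
have hE : hol1 f' = hol1 f.
  move: holE; rewrite [hol1 e](hol_calm (p := [:: e]))// [hol1 e'](hol_calm (p := [:: e']))//.
  by rewrite mulg1 mul1g.
have cE : `[< crit f' >] = `[< crit f >] by apply: asbool_equiv_eq; tauto.
by rewrite /psi !hol1V// hE cE.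
Qed.

Lemma nontrivial_lift : exists f : diagram_group_of w -> E, is_hom f /\ forall g, pi (f g) = th g.
Proof.
have [f [fM fE]] := label_hom psiV psiC; exists f; split=> // g.
have [p wp ->] := dcl_surj g; rewrite fE// -hol_loop//.
have : forall y, reach w y -> forall z, is_edge_path y p z -> pi (plab psi p) = hol y p z.
  elim: p {wp} => [|e p IH] y wy z.
    by move=> /= <-; rewrite /plab big_nil (hom1 piM) hol_calm.
  move=> [he yE ep]; subst y; rewrite /plab big_cons piM psi_pi//.
  rewrite -cat1s (@holM _ _ (edge_end e))//; congr (_ * _); apply: IH => //.
  exact: reach_trans wy (reach_edge he).
by apply=> //; exact: reach_refl.
Qed.

End lifting.

Theorem diagram_group_lift (P : semigroup_presentation) (w : seq P) (E H : groupType)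
    (pi : E -> H) (th : diagram_group_of w -> H) :
  (forall a b : seq P, reach w (a ++ b) -> simply_connected a \/ simply_connected b) ->
  (forall x y : H, commute x y) -> is_hom pi -> (forall h, exists x : E, pi x = h) -> is_hom th ->
  exists f : diagram_group_of w -> E, is_hom f /\ forall g, pi (f g) = th g.
Proof.
move=> splitH HC piM piS thM; case: (pselect (simply_connected w)) => [tw|nw].
  exists (fun=> 1); split=> [x y|g]; first by rewrite mulg1.
  have [p wp ->] := dcl_surj g; rewrite (hom1 piM) -(hom1 thM) -(dcl1 w); congr th.
  by apply/esym/dcl_eq => //; exact: tw.
exact: nontrivial_lift.
Qed.

(** * Lifting homomorphisms from infinite index subgroups *)

Lemma ultra_constant (I : Type) (E : eqType) (F : set_system I) (f : I -> E) (V : seq E) :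
  UltraFilter F -> F [set i | f i \in V] -> exists v, F [set i | f i = v].
Proof.
move=> FU; elim: V => [|v V IH] FV.
  by have [i] := filter_ex FV.
have [Fv|Fv] := @in_ultra_setVsetC _ F [set i | f i = v] FU; first by exists v.
apply: IH; apply: filterS (filterI FV Fv) => i [/=].
by rewrite inE => /orP[/eqP|].
Qed.

Section translates.
Variable Q : groupType.
Implicit Types (s t : set Q) (g h : Q).

Definition tr g t : set Q := shift g t.
Arguments tr : simpl never.

Lemma trM g h t : tr g (tr h t) = tr (g * h) t.
Proof. by rewrite /tr shift_hom bijM. Qed.
Lemma tr1 t : tr 1 t = t.
Proof. by rewrite /tr (hom1 (@shift_hom Q)). Qed.
Lemma tr_inj g : injective (tr g).
Proof. exact: (can_inj (bfunK (shift g))). Qed.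
Lemma tr_fix t g : is_subgroup t -> t g -> tr g t = t.
Proof. exact: shift_fix. Qed.
Lemma tr_stab t g : is_subgroup t -> tr g t = t -> t g.
Proof. exact: shift_stab. Qed.

End translates.
Arguments tr : simpl never.

Section cover.
Variables (L : eqType) (W : seq (dart L)) (Q : groupType) (x : L -> Q).
Hypothesis presQ : presents W x.
Variables (E H : groupType) (pi : E -> H).
Hypotheses (HC : forall g h : H, commute g h) (piM : is_hom pi)
  (piS : forall h, exists e : E, pi e = h).
Hypothesis kerC : forall z, pi z = 1 -> forall e, commute z e.
Variable M : seq E.
Hypothesis kerF : forall z, pi z = 1 -> z \in M.
Variables (A : set Q) (phi : Q -> H).
Hypothesis As : is_subgroup A.
Hypothesis phiM : forall a b, A a -> A b -> phi (a * b) = phi a * phi b.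

Local Notation T := (set Q).
Implicit Types (t s : T) (g q : Q) (l : L) (d : dart L) (u : seq (dart L)) (eta : T -> L -> E).

Definition orb t := exists q, t = tr q A.

Let orb_tr g t : orb t -> orb (tr g t).
Proof. by move=> [q ->]; exists (g * q); rewrite trM. Qed.
Let orbV g t : orb (tr g t) -> orb t.
Proof. by move=> /(orb_tr g^-1); rewrite trM mulVg tr1. Qed.

Definition rep t : Q := if pselect (orb t) is left h then projT1 (cid h) else 1.

Lemma repP t : orb t -> t = tr (rep t) A.
Proof. by move=> h; rewrite /rep; case: pselect => // h'; exact: (projT2 (cid h')). Qed.

Let rep_mem q : A ((rep (tr q A))^-1 * q).
Proof.
apply: (tr_stab As); rewrite -trM; have qA : orb (tr q A) by exists q.
transitivity (tr (rep (tr q A))^-1 (tr (rep (tr q A)) A)); first by rewrite -(repP qA).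
by rewrite trM mulVg tr1.
Qed.

(** Extends [phi] from [A] to [Q] by coset representatives; it is multiplicative only for right
    factors in [A] ([PhiM]). *)
Definition Phi q := phi ((rep (tr q A))^-1 * q).

Lemma PhiM q a : A a -> Phi (q * a) = Phi q * phi a.
Proof.
by move=> Aa; rewrite /Phi -trM (tr_fix As Aa) -phiM ?mulgA//; exact: rep_mem.
Qed.

(** The cocycle of [phi] on the graph of cosets, as in Shapiro's lemma: by [tauE] any representative
    of the coset may be used. *)
Definition tau t g := Phi (g * rep t) * (Phi (rep t))^-1.

Lemma tauE q g : tau (tr q A) g = Phi (g * q) * (Phi q)^-1.
Proof.
rewrite /tau; set r := rep _; have Aq : A (r^-1 * q) := rep_mem q.
have -> : Phi (g * q) = Phi (g * r) * phi (r^-1 * q) by rewrite -PhiM// -mulgA mulVKg.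
have -> : Phi q = Phi r * phi (r^-1 * q) by rewrite -PhiM// mulVKg.
by rewrite !gnorm.
Qed.

Definition admissible eta := (forall t, orb t -> forall l, pi (eta t l) = tau t (x l)) /\
  (forall t, ~ orb t -> forall l, eta t l = 1).

(** The coset at which the edge traversed by [d] starts when read in its positive direction; [eta]
    is indexed by this end. *)
Definition foot d t : T := if d.2 then tr (x d.1)^-1 t else t.
Definition footq d q : Q := if d.2 then (x d.1)^-1 * q else q.

Lemma footE d q t : foot d (tr q t) = tr (footq d q) t.
Proof. by rewrite /foot /footq; case: (d.2); rewrite ?trM. Qed.

Definition cocd eta d t := let e := eta (foot d t) d.1 in if d.2 then e^-1 else e.
(* [coc eta u t] lifts the path [u] starting at [t] to the covering with fibre [E]
   which [eta] defines over the Schreier graph. *)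
Fixpoint coc eta u t := if u is d :: u' then cocd eta d (tr (ev x u') t) * coc eta u' t else 1.

Lemma coc_cat eta u v t : coc eta (u ++ v) t = coc eta u (tr (ev x v) t) * coc eta v t.
Proof.
by elim: u => [|d u IH] /=; [rewrite mul1g|rewrite IH ev_cat trM mulgA].
Qed.

Lemma pi_coc eta u q : admissible eta -> pi (coc eta u (tr q A)) = Phi (ev x u * q) * (Phi q)^-1.
Proof.
move=> [h _]; elim: u => [|d u IH] /=; first by rewrite (hom1 piM) mul1g mulgV.
rewrite piM IH trM -mulgA; set q' := ev x u * q; rewrite /cocd footE /evd.
have o : orb (tr (footq d q') A) by exists (footq d q').
rewrite /footq in o *; case: (d.2) o => o.
  by rewrite (homV piM) h// tauE mulVKg !gnorm.
by rewrite h// tauE !gnorm.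
Qed.

Lemma coc_off eta u t : admissible eta -> ~ orb t -> coc eta u t = 1.
Proof.
move=> [_ h] nt; elim: u => //= d u ->; rewrite mulg1 /cocd h; first by case: (d.2); rewrite ?invg1.
by rewrite footE => /orbV.
Qed.

Definition bump eta s l z := fun t k => if (t == s) && (k == l) then eta t k * z else eta t k.

Lemma coc_bump_other eta s l z u t : all (fun d => d.1 != l) u ->
  coc (bump eta s l z) u t = coc eta u t.
Proof.
elim: u => //= d u IH /andP[dl /IH ->]; congr (_ * _).
by rewrite /cocd /bump (negPf dl) andbF.
Qed.

(** The face at a coset [t] is the closed path [W] from [t]. Its second occurrence of [l] uses the
    same edge as the first occurrence of [l] in the face at [tr g t]; so [g] is the step across an
    edge labelled [l] in the dual graph. *)
Definition dual l g := exists u1 d u2 d' u3, [/\ W = u1 ++ d :: u2 ++ d' :: u3,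
  (d.1 = l) /\ (d'.1 = l), all (fun e => e.1 != l) (u1 ++ u2 ++ u3) &
  g = (footq d (ev x (u2 ++ d' :: u3)))^-1 * footq d' (ev x u3)].

Variable delta : L -> Q.
Hypothesis dualH : forall l, dual l (delta l).
Hypothesis dual_gen : forall S : Q -> Prop, is_subgroup S -> (forall l, S (delta l)) -> forall g, S g.
Hypothesis infA : forall S : seq T, exists g, tr g A \notin S.

(** A finite set closed under the dual generators is also closed under their inverses, hence under
    all of [Q]; it would contain the whole infinite orbit of [A]. *)
Lemma boundary (S : seq T) t0 : t0 \in S -> orb t0 -> exists t l, t \in S /\ tr (delta l) t \notin S.
Proof.
move=> S0 [q qE]; apply: contrapT => nex.
have cl t l : t \in S -> tr (delta l) t \in S.
  by move=> St; apply: contrapT => n; apply: nex; exists t, l; split=> //; exact/negP.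
have [g] := infA S; suff -> : tr g A \in S by [].
have : forall g, forall t, (t \in S) = (tr g t \in S).
  apply: dual_gen; first split=> [t|g1 g2 h1 h2 t|g1 h1 t].
  - by rewrite tr1.
  - by rewrite -trM -h1 h2.
  - by rewrite [RHS]h1 trM mulgV tr1.
  move=> l t; apply/idP/idP; first exact: cl.
  pose f s := tr (delta l) s; have fi : injective f by move=> a b /tr_inj.
  have us := undup_uniq S; have uf : uniq (map f (undup S)) by rewrite map_inj_uniq.
  have sub : {subset map f (undup S) <= undup S}.
    by move=> _ /mapP[s + ->]; rewrite !mem_undup; exact: cl.
  have [_ SE] := uniq_min_size uf sub (eq_leq (esym (size_map f (undup S)))).
  by rewrite -(mem_undup S (tr _ t)) -SE => /mapP[s + /tr_inj ->]; rewrite mem_undup.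
by move=> /(_ (g * q^-1) t0); rewrite S0 qE trM -mulgA mulVg mulg1 => <-.
Qed.

(* A face on the boundary of [S] has an edge which no other face of [S] uses, and
   this edge can absorb its defect. *)
Lemma finite_solution (S : seq T) : exists eta, admissible eta /\ forall t, t \in S -> orb t -> coc eta W t = 1.
Proof.
wlog So : S / forall t, t \in S -> orb t => [th|].
  have [|eta [ea h]] := th [seq t <- S | `[< orb t >]].
    by move=> t; rewrite mem_filter => /andP[/asboolP].
  exists eta; split=> // t St ot; apply: h => //.
  by rewrite mem_filter St andbT; apply/asboolP.
move: {2}(size S) (leqnn (size S)) => n; elim: n S So => [|n IH] S So Sn.
  have tl t l : exists e : E, (orb t -> pi e = tau t (x l)) /\ (~ orb t -> e = 1).
    case: (pselect (orb t)) => [ot|ot]; last by exists 1.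
    by have [e eE] := piS (tau t (x l)); exists e.
  exists (fun t l => projT1 (cid (tl t l))); split.
    by split=> t o l; have [h1 h2] := projT2 (cid (tl t l)); [exact: h1|exact: h2].
  by move=> t; rewrite (size0nil (eqP _) : S = [::]) ?in_nil//; move: Sn; rewrite leqn0.
case: (boolP (S == [::])) => [/eqP S0|Sne].
  by apply: (IH S So); rewrite S0.
have [t0 S0] : exists t0, t0 \in S by case: (S) Sne => // t s; exists t; rewrite mem_head.
have [t [l [St nS]]] := boundary S0 (So _ S0).
have [||eta [ea h]] := IH [seq s <- S | s != t].
- by move=> s; rewrite mem_filter => /andP[_]; exact: So.
- rewrite size_filter -ltnS; apply: leq_trans Sn; rewrite -(count_predC (predC1 t) S) -addn1 leq_add2l.
  by rewrite -has_count; apply/hasP; exists t => //=; rewrite negbK.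
have [q qE] := So _ St; have [W1 _ _] := presQ.
have c1 : pi (coc eta W t) = 1 by rewrite qE pi_coc// W1 mul1g mulgV.
have [u1 [d [u2 [d' [u3 [WE [dl d'l] nl dE]]]]]] := dualH l.
move: nl; rewrite !all_cat => /and3P[n1 n2 n3].
(* [s] is the foot of the free edge. The sign of the letter there decides whether the defect [c] or
   its inverse has to be multiplied onto the edge; the kernel is central, so the place within the
   product is irrelevant. *)
pose s := tr (footq d' (ev x u3)) t; pose c := coc eta W t; pose z := if d'.2 then c else c^-1.
have zk : pi z = 1 by rewrite /z; case: (d'.2); rewrite ?(homV piM) c1 ?invg1.
exists (bump eta s l z); split.
  have os : orb s by apply: orb_tr; exact: So.
  split=> t1 o k; rewrite /bump; case: eqP => [E1|_] /=.
  - by case: eqP => _; rewrite ?piM ?zk ?mulg1; exact: ea.1.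
  - exact: ea.1.
  - by case: o; rewrite E1.
  - exact: ea.2.
have key t1 : tr (footq d (ev x (u2 ++ d' :: u3))) t1 <> s ->
    coc (bump eta s l z) W t1 = coc eta W t1 * (if tr (footq d' (ev x u3)) t1 == s then
      (if d'.2 then z^-1 else z) else 1).
  move=> ds; rewrite WE !(coc_cat, cat_cons) /= !coc_cat /= !coc_bump_other//.
  have -> : cocd (bump eta s l z) d (tr (ev x (u2 ++ d' :: u3)) t1) = cocd eta d (tr (ev x (u2 ++ d' :: u3)) t1).
    by rewrite /cocd /bump footE; case: eqP.
  set k := if _ == s then _ else _.
  have kk : pi k = 1 by rewrite /k; do 2?case: ifP => _; rewrite ?(homV piM) ?zk ?invg1 ?(hom1 piM).
  have -> : cocd (bump eta s l z) d' (tr (ev x u3) t1) = k * cocd eta d' (tr (ev x u3) t1).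
    rewrite /cocd /bump footE d'l eqxx andbT /k; case: eqP => _; last by rewrite mul1g.
    by case: (d'.2); rewrite ?invgM// (kerC zk).
  have kc e : e * k = k * e by rewrite (kerC kk).
  by rewrite -!mulgA -!(kc (_ * _)) -!mulgA kc !mulgA.
move=> t1 S1 o1; have dz (r : T) : tr (footq d (ev x (u2 ++ d' :: u3))) r = s -> r = tr (delta l) t.
  by rewrite /s dE -trM => <-; rewrite trM mulVg tr1.
rewrite key; last by move=> /dz E1; rewrite -E1 S1 in nS.
case: (eqVneq t1 t) => [->|t1t].
  rewrite eqxx /z -/c; case: (d'.2); exact: mulgV.
rewrite ifF ?mulg1; first by apply: h => //; rewrite mem_filter t1t.
by apply/eqP => /tr_inj; move/eqP: t1t.
Qed.

(** Compactness: two admissible choices differ by an element of the finite kernel, so each [eta t l]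
    has finitely many possible values, and an ultrafilter on the finite sets of faces, containing
    all cones under inclusion, selects one of them. *)
Lemma solution : exists eta, admissible eta /\ forall t, coc eta W t = 1.
Proof.
have [etaS etaP] : exists etaS : seq T -> T -> L -> E, forall S, admissible (etaS S) /\
    forall t, t \in S -> orb t -> coc (etaS S) W t = 1.
  by exists (fun S => projT1 (cid (finite_solution S))) => S; exact: (projT2 (cid (finite_solution S))).
pose F : set_system (seq T) := filter_from [set: seq T] (fun R => [set S : seq T | {subset R <= S}]).
have FP : ProperFilter F.
  apply: filter_from_proper; last by move=> R _; exists R.
  apply: filter_from_filter; first by exists [::].
  move=> R1 R2 _ _; exists (R1 ++ R2) => // S h; split=> t Rt; apply: h; rewrite mem_cat Rt ?orbT//.
have [G [GU FG]] := ultraFilterLemma FP.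
have vals t l : exists v, G [set S | etaS S t l = v].
  apply: (@ultra_constant _ _ _ _ (etaS [::] t l :: [seq etaS [::] t l * z | z <- M]) GU).
  apply: filterS filterT => S _ /=.
  have [[a1 b1] _] := etaP [::]; have [[a2 b2] _] := etaP S.
  case: (pselect (orb t)) => o; last by rewrite b1// b2// mem_head.
  rewrite inE; apply/orP; right; apply/mapP; exists ((etaS [::] t l)^-1 * etaS S t l); last by rewrite mulVKg.
  by rewrite kerF// piM (homV piM) a1// a2// mulVg.
pose eta t l := projT1 (cid (vals t l)).
have etaG t l : G [set S | etaS S t l = eta t l] := projT2 (cid (vals t l)).
exists eta; split.
  split=> t o l; have [S <-] := filter_ex (etaG t l); have [[a b] _] := etaP S; [exact: a|exact: b].
move=> t; have cocG u : G [set S | coc (etaS S) u t = coc eta u t].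
  elim: u => [|d u IH]; first by apply: filterS filterT.
  apply: filterS (filterI IH (etaG (foot d (tr (ev x u) t)) d.1)) => S [/= -> e2].
  by rewrite /cocd e2.
have St : G [set S : seq T | t \in S].
  by apply: FG; exists [:: t] => // S /=; apply; rewrite inE.
have [S [/= <- tS]] := filter_ex (filterI (cocG W) St).
have [a b] := etaP S; case: (pselect (orb t)) => o; [exact: b|exact: coc_off].
Qed.

(** Since [eta] closes up around every face, it makes [Q] act on pairs of a subset and an element of
    [E], a bundle over the coset graph. Elements of [A] fix the base coset, and their action on its
    fibre is the lift. *)
Theorem cover_lift : exists psi : Q -> E, (forall g h, A g -> A h -> psi (g * h) = psi g * psi h) /\
  forall g, A g -> pi (psi g) = phi g.
Proof.
have [eta [ea eW]] := solution; have [W1 Qmap Qgen] := presQ.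
pose f_ l (p : T * E) : T * E := (tr (x l) p.1, eta p.1 l * p.2).
pose g_ l (p : T * E) : T * E := (tr (x l)^-1 p.1, (eta (tr (x l)^-1 p.1) l)^-1 * p.2).
have fK l : cancel (f_ l) (g_ l) by move=> [t e]; rewrite /f_ /g_ /= trM mulVg tr1 mulKg.
have gK l : cancel (g_ l) (f_ l) by move=> [t e]; rewrite /f_ /g_ /= trM mulgV tr1 mulVKg.
pose a l : bij (T * E) := Bij (fK l) (gK l).
have evE u t e : ev a u (t, e) = (tr (ev x u) t, coc eta u t * e).
  elim: u t e => [|d u IH] t e; first by rewrite tr1 mul1g.
  rewrite ev_cons bijM IH [in RHS]ev_cons /= /cocd /foot /evd -mulgA; case: (d.2) => /=.
    by rewrite /g_ /= !trM.
  by rewrite /f_ /= trM.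
have [f [fM fE]] : exists f : Q -> bij (T * E), is_hom f /\ forall l, f (x l) = a l.
  apply: Qmap; apply: bij_eq => -[t e]; rewrite evE W1 tr1 eW mul1g//.
have fev g : exists2 u, g = ev x u & f g = ev a u.
  have [u ->] := Qgen g; exists u => //.
  by rewrite ev_hom//; apply: eq_ev.
pose psi g := (f g (A, 1)).2; exists psi.
have AE g : A g -> forall e, f g (A, e) = (A, psi g * e).
  move=> Ag e; have [u gE fg] := fev g; rewrite /psi fg !evE -gE (tr_fix As Ag) /= mulg1//.
split=> [g h Ag Ah|g Ag].
  by rewrite {1}/psi fM bijM (AE h)// (AE g)//= mulg1.
have [u gE fg] := fev g; rewrite /psi fg evE /= mulg1 -{1}(tr1 A) pi_coc//.
by rewrite mulg1 -gE -{1}[g]mul1g PhiM// HC mulKg.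
Qed.

End cover.

Lemma dual_gens (G : groupType) (S : G -> Prop) k (a b c d : G) : is_subgroup S ->
  let K := if k then c * d * c^-1 * d^-1 else c * c * d * d in
  S (K^-1 * b * a * b^-1 * a^-1 * b^-1 * K) -> S (K^-1 * b * a * b^-1 * K) ->
  S (if k then d * c * d^-1 * c^-1 * d^-1 else d^-1 * d^-1 * c^-1 * d * d) ->
  S (if k then d * c * d^-1 else d^-1) -> [/\ S a, S b, S c & S d].
Proof.
move=> Ss; have [S1 SM SV] := Ss; move=> /= ha hb hc hd.
have Sd : S d.
  case: (k) hd hc => hd hc; last by rewrite -[d]invgK; exact: SV.
  have h1 : S (d * c).
    have -> : d * c = (d * c * d^-1 * c^-1 * d^-1)^-1 * (d * c * d^-1) by rewrite !gnorm.
    by apply: (SM) => //; exact: SV.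
  have -> : d = (d * c * d^-1)^-1 * (d * c) by rewrite !gnorm.
  by apply: (SM) => //; exact: SV.
have Sc : S c.
  case: (k) hd hc => hd hc.
    have -> : c = d^-1 * (d * c * d^-1) * d by rewrite !gnorm.
    by apply: (SM) => //; apply: (SM) => //; exact: SV.
  have -> : c = (d * d * (d^-1 * d^-1 * c^-1 * d * d) * d^-1 * d^-1)^-1 by rewrite !gnorm.
  by apply: (SV); do !apply: (SM) => //; exact: SV.
set K := if k then _ else _ in ha hb.
have SK : S K by rewrite /K; case: (k); do !apply: (SM) => //; exact: SV.
have h1 : S (b * a * b^-1).
  have -> : b * a * b^-1 = K * (K^-1 * b * a * b^-1 * K) * K^-1 by rewrite !gnorm.
  by apply: (SM); [exact: SM|exact: SV].
have h2 : S (b * a).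
  have -> : b * a = (K * (K^-1 * b * a * b^-1 * a^-1 * b^-1 * K) * K^-1)^-1 * (b * a * b^-1) by rewrite !gnorm.
  by apply: (SM) => //; apply: (SV); apply: (SM); [exact: SM|exact: SV].
have Sb : S b.
  have -> : b = (b * a * b^-1)^-1 * (b * a) by rewrite !gnorm.
  by apply: (SM) => //; exact: SV.
have Sa : S a.
  have -> : a = b^-1 * (b * a) by rewrite !gnorm.
  by apply: (SM) => //; exact: SV.
by [].
Qed.

(** * Abelian subgroups of the surface group with Euler characteristic $-2$ *)

Section surface_lift.
Variable k : bool.
Local Notation Q := (pres (surface_word k)).
Local Notation x := (@pgen (bool * bool) (surface_word k)).
Local Notation la := ((false, false) : bool * bool).
Local Notation lb := ((false, true) : bool * bool).
Local Notation lc := ((true, false) : bool * bool).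
Local Notation ld := ((true, true) : bool * bool).

Definition surface_dual (l : bool * bool) : Q :=
  let a := x la in let b := x lb in let c := x lc in let d := x ld in
  let K := if k then c * d * c^-1 * d^-1 else c * c * d * d in
  match l with
  | (false, false) => K^-1 * b * a * b^-1 * a^-1 * b^-1 * K
  | (false, true) => K^-1 * b * a * b^-1 * K
  | (true, false) => if k then d * c * d^-1 * c^-1 * d^-1 else d^-1 * d^-1 * c^-1 * d * d
  | (true, true) => if k then d * c * d^-1 else d^-1
  end.

Lemma surface_dualP l : dual (surface_word k) x l (surface_dual l).
Proof.
rewrite /surface_dual /surface_word; case: k l => -[[] []] /=; rewrite /dual.
- exists [:: (la, false); (lb, false); (la, true); (lb, true); (lc, false)], (ld, false), [:: (lc, true)],
    (ld, true), [::]; split=> //; by rewrite /footq /= /evd /= !gnorm.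
- exists [:: (la, false); (lb, false); (la, true); (lb, true)], (lc, false), [:: (ld, false)],
    (lc, true), [:: (ld, true)]; split=> //; by rewrite /footq /= /evd /= !gnorm.
- exists [:: (la, false)], (lb, false), [:: (la, true)],
    (lb, true), [:: (lc, false); (ld, false); (lc, true); (ld, true)]; split=> //.
  by rewrite /footq /= /evd /= !gnorm.
- exists [::], (la, false), [:: (lb, false)],
    (la, true), [:: (lb, true); (lc, false); (ld, false); (lc, true); (ld, true)]; split=> //.
  by rewrite /footq /= /evd /= !gnorm.
- exists [:: (la, false); (lb, false); (la, true); (lb, true); (lc, false); (lc, false)], (ld, false), [::],
    (ld, false), [::]; split=> //; by rewrite /footq /= /evd /= !gnorm.
- exists [:: (la, false); (lb, false); (la, true); (lb, true)], (lc, false), [::],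
    (lc, false), [:: (ld, false); (ld, false)]; split=> //; by rewrite /footq /= /evd /= !gnorm.
- exists [:: (la, false)], (lb, false), [:: (la, true)],
    (lb, true), [:: (lc, false); (lc, false); (ld, false); (ld, false)]; split=> //.
  by rewrite /footq /= /evd /= !gnorm.
- exists [::], (la, false), [:: (lb, false)],
    (la, true), [:: (lb, true); (lc, false); (lc, false); (ld, false); (ld, false)]; split=> //.
  by rewrite /footq /= /evd /= !gnorm.
Qed.

Lemma surface_dual_gen (S : Q -> Prop) : is_subgroup S -> (forall l, S (surface_dual l)) -> forall g, S g.
Proof.
move=> Ss hS; have [S1 SM SV] := Ss.
have [Sa Sb Sc Sd] := dual_gens Ss (hS la) (hS lb) (hS lc) (hS ld).
move=> g; have [_ _ gen] := pres_presents (surface_word k); have [w ->] := gen g.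
by apply: ev_subgroup => // -[[] []] _.
Qed.

(** Affine maps of the rationals; comparing the two orders at 0 would give $2^n m = m$. *)
Lemma doubling_translation : exists X Y : bij rat,
  forall n m, (0 < n)%N -> (0 < m)%N -> ~ commute (X ^+ n) (Y ^+ m).
Proof.
have dK : cancel (fun t : rat => (2 * t)%R) (fun t : rat => (2^-1 * t)%R) by move=> t; lra.
have hK : cancel (fun t : rat => (2^-1 * t)%R) (fun t : rat => (2 * t)%R) by move=> t; lra.
have pK : cancel (fun t : rat => (t + 1)%R) (fun t : rat => (t - 1)%R) by move=> t; lra.
have mK : cancel (fun t : rat => (t - 1)%R) (fun t : rat => (t + 1)%R) by move=> t; lra.
pose X := Bij dK hK; pose Y := Bij pK mK; exists X, Y => n m n0 m0.
have XE i t : (X ^+ i) t = (2 ^+ i * t)%R.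
  by elim: i => [|i IH]; rewrite ?mul1r// expgS bijM IH /= exprS mulrA.
have YE i t : (Y ^+ i) t = (t + i%:R)%R.
  by elim: i => [|i IH]; rewrite ?addr0// expgS bijM IH /= -addrA -natr1.
move=> /(congr1 (fun s : bij rat => s 0%R)); rewrite !bijM XE !YE XE mulr0 !add0r.
move=> /eqP; rewrite -natrX -natrM eqr_nat => /eqP h.
have : (1 < 2 ^ n)%N by case: (n) n0 => // i _; rewrite expnS; have := expn_gt0 2 i; lia.
by move: h m0; case: (m) => // i; clear; nia.
Qed.

(** With finitely many cosets, the pigeonhole principle puts a positive power of each element into
    [A]. But two generators map to a doubling and a translation, no positive powers of which
    commute. *)
Lemma abelian_infinite_index (A : set Q) : is_subgroup A -> (forall g h, A g -> A h -> commute g h) ->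
  forall S : seq (set Q), exists g, tr g A \notin S.
Proof.
move=> As AC S; apply: contrapT => nex.
have cl g : tr g A \in S by apply: contrapT => n; apply: nex; exists g; exact/negP.
have root g : exists2 n, (0 < n)%N & A (g ^+ n).
  have : ~~ uniq [seq tr (g ^+ i) A | i <- iota 0 (size S).+1].
    apply/negP => us; have sub : {subset [seq tr (g ^+ i) A | i <- iota 0 (size S).+1] <= S}.
      by move=> _ /mapP[i _ ->].
    by have := uniq_leq_size us sub; rewrite size_map size_iota ltnn.
  move=> /(uniqPn (set0 : set Q))[i [j [ij]]]; rewrite size_map size_iota => js.
  have iS := ltn_trans ij js.
  rewrite !(nth_map 0%N) ?size_iota// !nth_iota// !add0n => E.
  exists (j - i)%N; first by rewrite subn_gt0.
  apply: (tr_stab As); apply: (@tr_inj _ (g ^+ i)).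
  by rewrite trM -expgnDr subnKC// ltnW.
have [al [be [ga [de [_ qmap _]]]]] := surface_word_presented k.
have [X [Y XY]] := doubling_translation.
have [|f [fM fa _ fuv]] := qmap _ X 1 (fun=> Y) (fun=> if k then 1 else Y^-1).
  by rewrite /srel big_nat1 /kap; case: k; rewrite !gnorm.
have [fg _] := fuv 0%N isT.
have [n n0 An] := root al; have [m m0 Am] := root (ga 0%N).
apply: (XY n m n0 m0); rewrite -fa -fg -!(homX fM).
by rewrite /commute -!fM (AC _ _ An Am).
Qed.

Theorem surface_cover_lift (E H : groupType) (pi : E -> H) (M : seq E) (A : set Q) (phi : Q -> H) :
  (forall g h : H, commute g h) -> is_hom pi -> (forall h, exists e : E, pi e = h) ->
  (forall z, pi z = 1 -> forall e, commute z e) -> (forall z, pi z = 1 -> z \in M) ->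
  is_subgroup A -> (forall g h, A g -> A h -> commute g h) ->
  (forall a b, A a -> A b -> phi (a * b) = phi a * phi b) ->
  exists psi : Q -> E, (forall g h, A g -> A h -> psi (g * h) = psi g * psi h) /\
    forall g, A g -> pi (psi g) = phi g.
Proof.
move=> HC piM piS kerC kerF As AC phiM.
apply: (@cover_lift _ _ _ _ (pres_presents (surface_word k)) _ _ _ HC piM piS kerC _ kerF _ _ As phiM
  _ surface_dualP surface_dual_gen).
exact: abelian_infinite_index.
Qed.

End surface_lift.

(** * Cyclic subgroups and the finite groups used as obstructions *)

Section cyclic.
Variable G : groupType.

Lemma gen1_expg (a g : G) : gen1 a g -> exists m n, g = a ^+ m * a ^- n.
Proof.
have aC (m n : nat) : commute (a ^+ m) (a ^- n) by apply: commuteV; rewrite /commute -!expgnDr addnC.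
move=> ga; apply: (ga (fun g => exists m n, g = a ^+ m * a ^- n)); last by exists 1%N, 0%N; rewrite invg1 mulg1.
split; first by exists 0%N, 0%N; rewrite invg1 mulg1.
  move=> _ _ [m [n ->]] [m' [n' ->]]; exists (m + m')%N, (n' + n)%N.
  by rewrite !expgnDr invgM !mulgA -(mulgA (a ^+ m)) -(aC m' n) -!mulgA -!invgM -!expgnDr addnC.
by move=> _ [m [n ->]]; exists n, m; rewrite invgM invgK.
Qed.

Lemma gen1_commute (a b g h : G) : commute a b -> gen1 a g -> gen1 b h -> commute g h.
Proof.
have cent (c : G) : is_subgroup (commute c).
  by split; [exact: commute1|move=> *; exact: commuteM|move=> *; exact: commuteV].
move=> ab ga hb; apply: hb; first exact: cent.
by apply/commute_sym; apply: ga; [exact: cent|exact: commute_sym].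
Qed.

(** In an infinite cyclic group the exponent, written here as a difference of two natural numbers,
    is well defined, and so is its parity. *)
Lemma parity_hom (a : G) : (forall n, (0 < n)%N -> a ^+ n <> 1) -> exists chi : G -> bool,
  (forall g h, gen1 a g -> gen1 a h -> chi (g * h) = chi g (+) chi h) /\ chi a = true.
Proof.
move=> inf; pose chi g := `[< exists m n, g = a ^+ m * a ^- n /\ odd (m + n) >].
have aC (m n : nat) : commute (a ^+ m) (a ^- n) by apply: commuteV; rewrite /commute -!expgnDr addnC.
have ainj m n : a ^+ m = a ^+ n -> m = n.
  wlog mn : m n / (m <= n)%N => [th E|E].
    by case: (leqP m n) => h; [exact: th|apply/esym/th; [exact: ltnW|]].
  apply/eqP; rewrite eqn_leq mn leqNgt -subn_gt0; apply/negP => /inf; apply.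
  by rewrite expgnFr// E mulgV.
have chiE m n : chi (a ^+ m * a ^- n) = odd (m + n).
  apply/asboolP/idP => [[m' [n' [E]]]|h]; last by exists m, n.
  have : a ^+ (m + n') = a ^+ (m' + n).
    have E' : a ^+ m = a ^+ m' * a ^- n' * a ^+ n by rewrite -E !gnorm.
    rewrite !expgnDr E' -!mulgA; congr (_ * _).
    by rewrite -[a ^+ n * _]expgnDr addnC expgnDr mulKg.
  by move=> /ainj; clear; lia.
exists chi; split; last by rewrite -[X in chi X](mulg1 a) -[X in _ * X]invg1 (chiE 1%N 0%N).
move=> g h /gen1_expg[m [n ->]] /gen1_expg[m' [n' ->]].
have -> : a ^+ m * a ^- n * (a ^+ m' * a ^- n') = a ^+ (m + m') * a ^- (n' + n).
  by rewrite !expgnDr invgM !mulgA -(mulgA (a ^+ m)) -(aC m' n) -!mulgA -!invgM -!expgnDr addnC.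
by rewrite !chiE -oddD; congr odd; clear; lia.
Qed.

Lemma gen1_hom (H : groupType) (f : G -> H) (a : G) y : is_hom f -> gen1 (f a) y ->
  exists2 g, gen1 a g & y = f g.
Proof.
move=> fM gy; apply: (gy (fun y => exists2 g, gen1 a g & y = f g)); last by exists a => //; exact: gen1_mem.
have [S1 SM SV] := gen1_subgroup a; split.
- by exists 1; rewrite ?(hom1 fM).
- by move=> _ _ [g ag ->] [h ah ->]; exists (g * h); [exact: SM|rewrite fM].
- by move=> _ [g ag ->]; exists g^-1; [exact: SV|rewrite (homV fM)].
Qed.

End cyclic.

Definition klein : Type := (bool * bool)%type.
HB.instance Definition _ := Choice.copy klein (bool * bool)%type.
Definition klein_mul (g h : klein) : klein := (g.1 (+) h.1, g.2 (+) h.2).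
Definition klein_one : klein := (false, false).
Definition klein_inv (g : klein) : klein := g.
Lemma klein_mulA : associative klein_mul. Proof. by do 3!case=> [[] []]. Qed.
Lemma klein_mul1 : left_id klein_one klein_mul. Proof. by do !case=> [[] []]. Qed.
Lemma klein_mulr1 : right_id klein_one klein_mul. Proof. by do !case=> [[] []]. Qed.
Lemma klein_mulV : left_inverse klein_one klein_inv klein_mul. Proof. by do !case=> [[] []]. Qed.
Lemma klein_mulrV : right_inverse klein_one klein_inv klein_mul. Proof. by do !case=> [[] []]. Qed.
HB.instance Definition _ := isGroup.Build klein klein_mulA klein_mul1 klein_mulr1 klein_mulV klein_mulrV.

(* The Heisenberg group over the field with two elements. *)
Definition heis : Type := (bool * bool * bool)%type.
HB.instance Definition _ := Choice.copy heis (bool * bool * bool)%type.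
Definition heis_mul (g h : heis) : heis :=
  (g.1.1 (+) h.1.1, g.1.2 (+) h.1.2, g.2 (+) h.2 (+) (g.1.1 && h.1.2)).
Definition heis_one : heis := (false, false, false).
Definition heis_inv (g : heis) : heis := (g.1.1, g.1.2, g.2 (+) (g.1.1 && g.1.2)).
Lemma heis_mulA : associative heis_mul. Proof. by do 3!case=> [[[] []] []]. Qed.
Lemma heis_mul1 : left_id heis_one heis_mul. Proof. by do !case=> [[[] []] []]. Qed.
Lemma heis_mulr1 : right_id heis_one heis_mul. Proof. by do !case=> [[[] []] []]. Qed.
Lemma heis_mulV : left_inverse heis_one heis_inv heis_mul. Proof. by do !case=> [[[] []] []]. Qed.
Lemma heis_mulrV : right_inverse heis_one heis_inv heis_mul. Proof. by do !case=> [[[] []] []]. Qed.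
HB.instance Definition _ := isGroup.Build heis heis_mulA heis_mul1 heis_mulr1 heis_mulV heis_mulrV.

Definition heis_klein (g : heis) : klein := g.1.

Lemma heis_klein_hom : is_hom heis_klein. Proof. by []. Qed.
Lemma klein_commute (g h : klein) : commute g h.
Proof. by case: g => [[] []]; case: h => [[] []]. Qed.
Lemma heis_klein_surj (h : klein) : exists g : heis, heis_klein g = h.
Proof. by exists (h, false). Qed.
Lemma heis_klein_ker (z : heis) : heis_klein z = 1 -> (forall g, commute z g) /\
  z \in [:: heis_one; ((false, false), true) : heis].
Proof.
case: z => [[[] []] z] // _; split; first by case=> [[[] []] []]; case: z.
by case: z.
Qed.

Section no_torsion.
Variable k : bool.
Local Notation Q := (pres (surface_word k)).

(** Let [N] be the order of [a]. The isomorphism from the powers of [a] to the integers modulo $N$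
    would lift to the integers modulo $N^2$. There the image of [a] is killed by $N$, hence
    divisible by $N$, so it reduces to 0 and not to 1. *)
Theorem surface_torsion_free (a : Q) n : (0 < n)%N -> a ^+ n = 1 -> a = 1.
Proof.
move=> n0 an; apply: contrapT => a1.
have ex : exists n, (0 < n)%N && `[< a ^+ n = 1 >] by exists n; rewrite n0; apply/asboolP.
have [] := ex_minnP ex => {n n0 an} -[|m] // /asboolP am mmin.
pose N := m.+1; pose A : set Q := gen1 a.
have redN i : a ^+ i = a ^+ (i %% N).
  by rewrite {1}(divn_eq i N) expgnDr mulnC expgnA am expg1n mul1g.
have inj i j : a ^+ i = a ^+ j -> i = j %[mod N].
  rewrite redN (redN j); move: (ltn_pmod i (ltn0Sn m)) (ltn_pmod j (ltn0Sn m)).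
  rewrite -/N; move: (i %% N)%N (j %% N)%N => {}i {}j.
  wlog ij : i j / (i <= j)%N => [th iN jN E|iN jN E].
    by case: (leqP i j) => h; [exact: th|apply/esym/th => //; exact: ltnW].
  apply/eqP; rewrite eqn_leq ij leqNgt -subn_gt0; apply/negP => d.
  have /mmin : (0 < j - i)%N && `[< a ^+ (j - i) = 1 >].
    by rewrite d; apply/asboolP; rewrite expgnFr// E mulgV.
  by rewrite leqNgt (leq_ltn_trans (leq_subr _ _) jN).
have Apow g : A g -> exists i, g = a ^+ i.
  move=> Ag; apply: (Ag (fun g => exists i, g = a ^+ i)); last by exists 1%N.
  split; first by exists 0%N.
    by move=> _ _ [i ->] [j ->]; exists (i + j)%N; rewrite expgnDr.
  move=> _ [i ->]; exists (i * m)%N; apply: mulg1_eq.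
  by rewrite -expgnDr -mulnS mulnC expgnA am expg1n.
have powA i : A (a ^+ i).
  have [S1 SM _] := gen1_subgroup a; elim: i => // i IH; rewrite expgS; apply: SM => //; exact: gen1_mem.
pose phi (g : Q) : 'I_N := if pselect (exists i, g = a ^+ i) is left h then inZp (projT1 (cid h)) else inZp 0.
have phiE i : phi (a ^+ i) = inZp i.
  rewrite /phi; case: pselect => [h|[]]; last by exists i.
  by apply: val_inj => /=; apply/esym/inj; exact: (projT2 (cid h)).
(* ['I_M.+1] is the additive cyclic group of order $N^2$. *)
pose M := (N * N).-1; have ME : M.+1 = (N * N)%N by [].
pose pi (e : 'I_M.+1) : 'I_N := inZp e.
have NM : (N %| M.+1)%N by rewrite ME dvdn_mulr.
have [||||||psi [psiM psiE]] := @surface_cover_lift k 'I_M.+1 'I_N pi (enum 'I_M.+1) A phi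
    _ _ _ _ _ (gen1_subgroup a) (fun g h => @gen1_commute Q a a g h erefl).
- by move=> g h; apply: val_inj; rewrite /= addnC.
- by move=> g h; apply: val_inj; rewrite /= modn_dvdm// modnDm.
- move=> h; exists (inZp h); apply: val_inj; rewrite /= modn_dvdm// modn_small//.
- by move=> z _ e; apply: val_inj; rewrite /= addnC.
- by move=> z _; rewrite mem_enum.
- by move=> _ _ /Apow[i ->] /Apow[j ->]; rewrite -expgnDr !phiE; apply: val_inj; rewrite /= modnDm.
have pow i : psi (a ^+ i) = psi a ^+ i.
  elim: i => [|i IH]; last by rewrite !expgS psiM// ?IH//; exact: gen1_mem.
  have E : psi 1 * psi 1 = psi 1 by rewrite -psiM ?mulg1//; exact: (powA 0%N).
  by rewrite expg0; apply: (mulgI (psi 1)); rewrite E mulg1.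
have vpow (e : 'I_M.+1) i : val (e ^+ i) = ((i * e) %% M.+1)%N.
  by elim: i => [|i IH]; rewrite ?expg0 ?mod0n// expgS /= IH modnDmr mulSn.
have Aa : A a by exact: gen1_mem.
have := congr1 val (psiE a Aa); rewrite -[a in RHS]expg1 phiE /=.
have := congr1 val (pow N); rewrite am vpow (pow 0%N : psi 1 = _) expg0 /= => /esym.
move: (nat_of_ord (psi a)) => v /eqP; rewrite -/(dvdn _ _) ME dvdn_pmul2l// => /eqP -> /eqP.
have m0 : m != 0%N by apply/eqP => m0; apply: a1; rewrite -am m0.
by rewrite modn_small// ltnS lt0n.
Qed.

(** The product of the two infinite cyclic groups is direct, so the parities of the exponents define
    a homomorphism to the Klein group. A lift to the Heisenberg group would send [a] and [b] to
    elements that do not commute. *)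
Theorem surface_no_rank2 (a b : Q) : commute a b -> a <> 1 -> b <> 1 ->
  ~ (forall g, gen1 a g -> gen1 b g -> g = 1).
Proof.
move=> ab a1 b1 disj.
have inf (c : Q) : c <> 1 -> forall n, (0 < n)%N -> c ^+ n <> 1.
  by move=> c1 n n0 /(surface_torsion_free n0).
have [ca [caM caa]] := parity_hom (inf a a1); have [cb [cbM cbb]] := parity_hom (inf b b1).
pose A : set Q := [set g | exists u v, [/\ gen1 a u, gen1 b v & g = u * v]].
have [A1 AM AV] := gen1_subgroup a; have [B1 BM BV] := gen1_subgroup b.
have uvC u v : gen1 a u -> gen1 b v -> commute u v by exact: gen1_commute.
have uniq2 u v u' v' : gen1 a u -> gen1 b v -> gen1 a u' -> gen1 b v' -> u * v = u' * v' -> u = u' /\ v = v'.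
  move=> au bv au' bv' E; have E2 : u'^-1 * u = v' * v^-1.
    by apply: (mulgI u'); rewrite mulVKg mulgA -E mulgK.
  have h : u'^-1 * u = 1 by apply: disj; [apply: AM => //; exact: AV|rewrite E2; apply: BM => //; exact: BV].
  split; first by rewrite -[u](mulVKg u') h mulg1.
  by apply: (mulIg v^-1); rewrite mulgV -E2 h.
have mulE u v u' v' : gen1 a u -> gen1 b v -> gen1 a u' -> gen1 b v' ->
    u * v * (u' * v') = (u * u') * (v * v').
  by move=> au bv au' bv'; rewrite -!mulgA (mulgA v) -(uvC u' v)// -!mulgA.
pose phi (g : Q) : klein := (`[< exists u v, [/\ gen1 a u, gen1 b v & g = u * v] /\ ca u >],
  `[< exists u v, [/\ gen1 a u, gen1 b v & g = u * v] /\ cb v >]).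
have phiE u v : gen1 a u -> gen1 b v -> phi (u * v) = (ca u, cb v).
  move=> au bv; congr pair; apply/asboolP/idP => [[u' [v' [[au' bv' E] h]]]|h].
  - by have [-> _] := uniq2 _ _ _ _ au bv au' bv' E.
  - by exists u, v.
  - by have [_ ->] := uniq2 _ _ _ _ au bv au' bv' E.
  - by exists u, v.
have As : is_subgroup A.
  split; first by exists 1, 1; rewrite mulg1.
    move=> _ _ [u [v [au bv ->]]] [u' [v' [au' bv' ->]]].
    by exists (u * u'), (v * v'); split; [exact: AM|exact: BM|exact: mulE].
  move=> _ [u [v [au bv ->]]]; exists u^-1, v^-1; split; [exact: AV|exact: BV|].
  by rewrite (uvC u v)// invgM.
have AC g h : A g -> A h -> commute g h.
  move=> [u [v [au bv ->]]] [u' [v' [au' bv' ->]]]; rewrite /commute (mulE _ _ _ _ au bv au' bv') (mulE _ _ _ _ au' bv' au bv).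
  by rewrite (gen1_commute (erefl : commute a a) au au') (gen1_commute (erefl : commute b b) bv bv').
have [|psi [psiM psiE]] := surface_cover_lift (pi := heis_klein) (phi := phi) klein_commute heis_klein_hom heis_klein_surj
  (fun z h => (heis_klein_ker h).1) (fun z h => (heis_klein_ker h).2) As AC.
  move=> _ _ [u [v [au bv ->]]] [u' [v' [au' bv' ->]]].
  by rewrite mulE// !phiE//; [rewrite caM// cbM|exact: AM|exact: BM].
have ga : gen1 a a by exact: gen1_mem.
have gb : gen1 b b by exact: gen1_mem.
have Aa : A a by exists a, 1; rewrite mulg1.
have Ab : A b by exists 1, b; rewrite mul1g.
have chi1 (c : Q) (f : Q -> bool) : (forall g h, gen1 c g -> gen1 c h -> f (g * h) = f g (+) f h) -> f 1 = false.
  by move=> fM; have [C1 _ _] := gen1_subgroup c; have := fM 1 1 C1 C1; rewrite mulg1; case: (f 1).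
have pa : heis_klein (psi a) = (true, false).
  by rewrite psiE// -{1}[a]mulg1 phiE// caa (chi1 b).
have pb : heis_klein (psi b) = (false, true).
  by rewrite psiE// -{1}[b]mul1g phiE// cbb (chi1 a).
have : psi a * psi b = psi b * psi a by rewrite -!psiM// ab.
move: pa pb; rewrite /heis_klein; case: (psi a) => [[? ?] p] /= [-> ->].
by case: (psi b) => [[? ?] q] /= [-> ->]; case: p; case: q.
Qed.

End no_torsion.

(** * Surface groups are not diagram groups *)

Section transport.
Variables (P : semigroup_presentation) (w y : seq P).

Lemma change_of_base : reach w y -> exists f : diagram_group_of y -> diagram_group_of w,
  is_hom f /\ injective f.
Proof.
move=> [r wr]; have yr := is_edge_path_inv wr.
pose f (g : diagram_group_of y) := dcl w (r ++ projT1 (repr g : edge_loop y) ++ path_inv r).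
have lp p : is_edge_path y p y -> is_edge_path w (r ++ p ++ path_inv r) w.
  move=> yp; apply/is_edge_path_cat; exists y => //; apply/is_edge_path_cat; exists y => //.
have fE p : is_edge_path y p y -> f (dcl y p) = dcl w (r ++ p ++ path_inv r).
  move=> yp; apply/dcl_eq; [exact/lp/(projT2 (repr _ : edge_loop y))|exact: lp|].
  apply: edge_homotopic_ctx wr yr _.
  have := sg_eq_repr (dloop y p : sg_elt (edge_loop_group y)).
  by rewrite sg_eqE dloopE.
have fM : is_hom f.
  move=> g h; have [p yp ->] := dcl_surj g; have [q yq ->] := dcl_surj h.
  have ypq : is_edge_path y (p ++ q) y by apply/is_edge_path_cat; exists y.
  rewrite -dclM// !fE// -dclM; [|exact: lp|exact: lp].
  apply/dcl_eq; [exact: lp|by apply/is_edge_path_cat; exists w; exact: lp|].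
  have rp : is_edge_path w (r ++ p) y by apply/is_edge_path_cat; exists y.
  have qr : is_edge_path y (q ++ path_inv r) w by apply/is_edge_path_cat; exists y.
  by have := edge_homotopic_ctx rp qr (homotopic_mulV wr); rewrite -!catA => h'; exact: rst_sym.
exists f; split=> //; apply: hom_inj => // g; have [p yp ->] := dcl_surj g.
rewrite fE// -(dcl1 w) => /dcl_eq h; rewrite -(dcl1 y); apply/dcl_eq => //.
have {}h := h (lp _ yp) (erefl : is_edge_path w [::] w).
have h1 := edge_homotopic_ctx yr wr h; have h2 := homotopic_mulV wr.
have h3 : edge_homotopic y y ((path_inv r ++ r) ++ (p ++ path_inv r ++ r)) (p ++ path_inv r ++ r).
  by apply: (homotopic_catr _ h2); apply/is_edge_path_cat; exists y => //; apply/is_edge_path_cat; exists w.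
have h4 := homotopic_catl yp h2; rewrite cats0 in h4.
rewrite -!catA in h3; rewrite -!catA /= in h1.
apply: (rst_trans _ _ _ _ _ (rst_sym _ _ _ _ h4)).
apply: (rst_trans _ _ _ _ _ (rst_sym _ _ _ _ h3)).
exact: (rst_trans _ _ _ _ _ h1 h2).
Qed.

End transport.

Section products.
Variables (P : semigroup_presentation) (a b : seq P).

(** Take non-null loops at [a] and at [b], extended by the identity on the other word;
    [split_faithful] shows that the cyclic groups they generate meet trivially. *)
Lemma factors_commute : ~ simply_connected a -> ~ simply_connected b ->
  exists g h : diagram_group_of (a ++ b), [/\ commute g h, g <> 1, h <> 1 &
    forall z, gen1 g z -> gen1 h z -> z = 1].
Proof.
have loop (c : seq P) : ~ simply_connected c -> exists2 p, is_edge_path c p c & ~ edge_homotopic c c p [::].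
  by move=> nc; apply: contrapT => h; apply: nc => p cp; apply: contrapT => np; apply: h; exists p.
move=> /loop[p ap np] /loop[q bq nq].
have lp p' : is_edge_path a p' a -> is_edge_path (a ++ b) (ext [::] b p') (a ++ b).
  by move=> h; exact: (ext_path [::] b h).
have lq q' : is_edge_path b q' b -> is_edge_path (a ++ b) (ext a [::] q') (a ++ b).
  by move=> h; have := ext_path a [::] h; rewrite !cats0.
pose J p' := dcl (a ++ b) (ext [::] b p'); pose K q' := dcl (a ++ b) (ext a [::] q').
have JK p' q' : is_edge_path a p' a -> is_edge_path b q' b -> J p' * K q' = 1 ->
    edge_homotopic a a p' [::] /\ edge_homotopic b b q' [::].
  move=> ap' bq'; rewrite -dclM; [|exact: lp|exact: lq]; rewrite -(dcl1 (a ++ b)) => /dcl_eq h.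
  apply: split_faithful => //; apply: h => //.
  by apply/is_edge_path_cat; exists (a ++ b); [exact: lp|exact: lq].
have J1 : J [::] = 1 by exact: dcl1.
have K1 : K [::] = 1 by exact: dcl1.
have gJ z : gen1 (J p) z -> exists2 p', is_edge_path a p' a & z = J p'.
  move=> gz; apply: (gz (fun z => exists2 p', is_edge_path a p' a & z = J p')); last by exists p.
  split; first by exists [::].
    move=> _ _ [u au ->] [v av ->]; exists (u ++ v); first by apply/is_edge_path_cat; exists a.
    by rewrite /J ext_cat dclM//; exact: lp.
  move=> _ [u au ->]; exists (path_inv u); first exact: is_edge_path_inv.
  by rewrite /J ext_inv dclV//; exact: lp.
have gK z : gen1 (K q) z -> exists2 q', is_edge_path b q' b & z = K q'.
  move=> gz; apply: (gz (fun z => exists2 q', is_edge_path b q' b & z = K q')); last by exists q.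
  split; first by exists [::].
    move=> _ _ [u bu ->] [v bv ->]; exists (u ++ v); first by apply/is_edge_path_cat; exists b.
    by rewrite /K ext_cat dclM//; exact: lq.
  move=> _ [u bu ->]; exists (path_inv u); first exact: is_edge_path_inv.
  by rewrite /K ext_inv dclV//; exact: lq.
exists (J p), (K q); split.
- rewrite /commute /J /K -!dclM; try (by exact: lp || exact: lq).
  apply/dcl_eq.
  + by apply/is_edge_path_cat; exists (a ++ b); [exact: lp|exact: lq].
  + by apply/is_edge_path_cat; exists (a ++ b); [exact: lq|exact: lp].
  + by have := @disjoint_commute P [::] a a [::] b b [::] p q ap bq; rewrite /= !cats0.
- by move=> Jp; apply: np; have [] := @JK p [::] ap erefl _; rewrite ?K1 ?mulg1.
- by move=> Kq; apply: nq; have [] := @JK [::] q erefl bq _; rewrite ?J1 ?mul1g.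
- move=> z /gJ[u au zJ] /gK[v bv zK].
  have [] := @JK u (path_inv v) au (is_edge_path_inv bv).
    by rewrite /K ext_inv dclV; [rewrite -/(K v) -zJ -zK mulgV|exact: lq].
  move=> u1 _; rewrite zJ -J1; apply/dcl_eq => //; first exact: lp.
  exact: (ext_homotopic [::] b u1).
Qed.

End products.

Theorem surface_not_diagram k d (G : groupType) : (0 < d)%N -> surface_presented k d G ->
  ~ is_diagram_group G.
Proof.
move=> d0 presG [P [w [_ [f [[f1 fM] [f' fK f'K]]]]]].
have f'M : is_hom f'.
  by move=> g h; apply: (can_inj fK); rewrite fM !f'K.
case: (pselect (forall a b : seq P, reach w (a ++ b) -> simply_connected a \/ simply_connected b)); last first.
  move=> /existsNP[a /existsNP[b /not_implyP[wab /not_orP[na nb]]]].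
  have [g [h [gh g1 h1 disj]]] := factors_commute na nb.
  have [e [eM ei]] := change_of_base wab.
  (* Torsion and commuting pairs were excluded for $d = 1$ only; the covering carries the pair
     there. *)
  have [c [cM ci]] := surface_cover d0 presG (surface_word_presented k).
  pose t := c \o f' \o e; have tM : is_hom t by apply: hom_comp => //; exact: hom_comp.
  have ti : injective t by do 2?apply: inj_comp => //; exact: can_inj f'K.
  apply: (@surface_no_rank2 k (t g) (t h)).
  - by rewrite /commute -!tM gh.
  - by rewrite -(hom1 tM) => /ti.
  - by rewrite -(hom1 tM) => /ti.
  - move=> z /(gen1_hom tM)[u gu zu] /(gen1_hom tM)[v hv zv].
    have uv : u = v by apply: ti; rewrite -zu.
    by rewrite zu (disj u gu) ?(hom1 tM)// uv.
move=> splitH; have [al [be [ga [de [rel qmap _]]]]] := presG.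
have [|q [qM qa qb quv]] := qmap klein (true, false) (false, true) (fun=> 1) (fun=> 1).
  rewrite /srel big1_seq ?mulg1// => i _.
  by rewrite /kap; case: (k).
have qfM : is_hom (q \o f') by exact: hom_comp.
have [psi [psiM psiE]] := diagram_group_lift splitH klein_commute heis_klein_hom heis_klein_surj qfM.
pose s := psi \o f; have sM : is_hom s by apply: hom_comp.
have sE g : heis_klein (s g) = q g by rewrite /s /= psiE /= fK.
have := congr1 s rel; rewrite (hom1 sM) /srel !sM !(homV sM).
(* Over the identity of the Klein group lie central elements with trivial square, so every block
   [kap] is sent to 1, whether it is a commutator or a product of squares. *)
have -> : s (\prod_(0 <= i < d) kap k (ga i) (de i)) = 1.
  rewrite big_nat; elim/big_ind: _ => [|g h sg sh|i /andP[_ id]]; first exact: hom1.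
    by rewrite sM sg sh mulg1.
  have [gq dq] := quv i id; rewrite (kap_hom k _ _ sM).
  have := sE (ga i); have := sE (de i); rewrite gq dq.
  by rewrite /kap /heis_klein; case: (s (de i)) => [[? ?] u] [-> ->]; case: (s (ga i)) => [[? ?] v] [-> ->]; case: (k); case: u; case: v.
have := sE al; have := sE be; rewrite qa qb /heis_klein.
by case: (s be) => [[? ?] u] [-> ->]; case: (s al) => [[? ?] v] [-> ->]; case: u; case: v.
Qed.

Local Close Scope group_scope.
Local Close Scope classical_set_scope.
Local Open Scope ring_scope.
Unset Implicit Arguments.

Theorem corollary1p15 (R : realType) (S : topologicalType) (x : S) (chi : int)
    (surface_S : closed_surface R S) (hyperbolic_S : hyperbolic R S)
    (chi_S : has_euler_characteristic R S chi)
    (chi_even : (2 %| chi)%Z) (chi_le : chi <= -2) :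
  (exists G : groupType,
      is_diagram_group G /\ group_embeds (fundamental_group R x) G) /\
  ~ is_diagram_group (fundamental_group R x).
Proof.
have [k [d [d0 presG]]] := surface_group x surface_S chi_S chi_even chi_le.
by split; [exact: surface_embeds d0 presG|exact: surface_not_diagram d0 presG].
Qed.
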